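(* Assume (A-1)–(A-6) (written out in the context). Then: (1) The eigenvalues of $\widehat H$ in $\sigma_e(\widehat H)\setminus\mathcal T_1$ are finite in number and have finite multiplicities. (2) There is no eigenvalue of $\widehat H$ in $\sigma_e(\widehat H)\setminus\mathcal T_1$, provided $\mathcal V_{int}$ has the unique continuation property.
   Context: Let $d\ge2$. All graphs are infinite, connected, simple (no self-loops, no multiple edges), with edge set symmetric and all vertex degrees finite; $v\sim w$ means adjacent. For a graph with vertex set $\mathcal V$, $\ell^2(\mathcal V)$ has inner product $\sum_{v}f(v)\overline{g(v)}\deg(v)$, and the Laplacian is $(\widehat\Delta f)(v)=\frac1{\deg(v)}\sum_{w\sim v}f(w)$. Periodic graph $\Gamma_0=\{\mathcal L_0,\mathcal V_0,\mathcal E_0\}$: $\mathcal L_0=\{\mathbf v(n)=\sum_{j=1}^dn_j\mathbf v_j: n\in\mathbf Z^d\}$ is a lattice of rank $d$ with basis $\mathbf v_j$; $\mathcal V_0=\bigcup_{j=1}^s(p_j+\mathcal L_0)$ with $p_i-p_j\notin\mathcal L_0$ for $i\ne j$; $\mathcal E_0$ is invariant under the translations $p_j+\mathbf v(n)\mapsto p_j+\mathbf v(n+m)$, $m\in\mathbf Z^d$. $\deg(p_j+\mathbf v(n))=:\deg_0(j)$. A function on $\mathcal V_0$ is written $\widehat u(n)=(\widehat u_1(n),\dots,\widehat u_s(n))$, $\widehat u_j(n)=\widehat u(p_j+\mathbf v(n))$. Put $\widehat H_0=-\widehat\Delta_{\Gamma_0}$. Let $\mathbf T^d=\mathbf R^d/(2\pi\mathbf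 Z)^d$, $\mathbf T^d_{\mathbf C}=\mathbf C^d/(2\pi\mathbf Z)^d$; the unitary $\mathcal U_{\mathcal L_0}:\ell^2(\mathcal V_0)\to L^2(\mathbf T^d)^s$, $(\mathcal U_{\mathcal L_0}\widehat f)_j=(2\pi)^{-d/2}\sqrt{\deg_0(j)}\sum_n\widehat f_j(n)e^{in\cdot x}$, transforms $\widehat H_0$ into multiplication by an $s\times s$ Hermitian matrix $H_0(x)$ with trigonometric polynomial entries; $\sigma(H_0)=\sigma(\widehat H_0)=\bigcup_x\sigma_p(H_0(x))$. Let $p(z,\lambda)=\det(H_0(z)-\lambda)$, $M_\lambda=\{x\in\mathbf T^d:p(x,\lambda)=0\}$, $M^{\mathbf C}_\lambda=\{z\in\mathbf T^d_{\mathbf C}:p(z,\lambda)=0\}$, $M^{\mathbf C}_{\lambda,reg}$ (resp. $M^{\mathbf C}_{\lambda,sng}$) the subset of $M^{\mathbf C}_\lambda$ where $\nabla_zp\ne0$ (resp. $=0$). Let $\lambda_1(x)\le\dots\le\lambda_s(x)$ be the eigenvalues of $H_0(x)$, $M_{\lambda,j}=\{x\in\mathbf T^d:\lambda_j(x)=\lambda\}$. Perturbed graph $\Gamma=\{\mathcal V,\mathcal E\}$: obtained from $\Gamma_0$ by removing and/or adding finitely many vertices and edges. For a large integer $a>0$ put $\mathcal V_{ext}=\{p_j+\mathbf v(n):\max_i|n_i|\ge a\}$, $\partial\mathcal V_{ext}=\{p_j+\mathbf v(n):\max_i|n_i|=a\}$, $\overset{\circ}{\mathcal V}_{ext}=\mathcal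 V_{ext}\setminus\partial\mathcal V_{ext}$, $\mathcal V_{int}=\mathcal V\setminus\overset{\circ}{\mathcal V}_{ext}$; $a$ is so large that $\mathcal V_{ext}\subset\mathcal V$ and each vertex of $\mathcal V_{ext}$ has the same adjacent vertices in $\Gamma$ as in $\Gamma_0$. $\mathcal V_{int}$ is finite. Put $\widehat H=-\widehat\Delta_\Gamma+\widehat V$ on $\ell^2(\mathcal V)$. $\sigma_e$ denotes essential spectrum. Assumptions: (A-1) There is $\mathcal T_1\subset\sigma(H_0)$ such that for $\lambda\in\sigma(H_0)\setminus\mathcal T_1$: $M^{\mathbf C}_{\lambda,sng}$ is discrete, and each connected component of $M^{\mathbf C}_{\lambda,reg}$ intersects $\mathbf T^d$, the intersection being a $(d-1)$-dimensional real analytic submanifold of $\mathbf T^d$. (A-2) There is a finite set $\mathcal T_0\subset\sigma(H_0)$ such that $M_{\lambda,i}\cap M_{\lambda,j}=\emptyset$ for $i\ne j$, $\lambda\in\sigma(H_0)\setminus\mathcal T_0$. (A-3) $\nabla_xp(x,\lambda)\ne0$ on $M_\lambda$ for $\lambda\in\sigma(H_0)\setminus\mathcal T_0$. (A-4) If $(\widehat H_0-\lambda)\widehat u=0$ on $\mathcal V_0$ for some $\lambda\in\mathbf C$ and $\widehat u(n)=0$ for $|n|>R_0$ for some $R_0>0$, then $\widehat u=0$ on $\mathcal V_0$. (A-5) $\widehat V$ is bounded self-adjoint on $\ell^2(\mathcal V)$ and $\widehat V\widehat u=0$ on $\mathcal V_{ext}$ for all $\widehat u\in\ell^2(\mathcal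 V)$. (A-6) If $(\widehat H_0-\lambda)\widehat u=0$ on $\mathcal V_{ext}$ for some $\lambda\in\mathbf C$ (this involves only the values of $\widehat u$ on $\mathcal V_{ext}$ and on vertices adjacent to it) and $\widehat u(n)=0$ for $|n|>R_0$ for some $R_0>0$, then $\widehat u=0$ on $\mathcal V_{ext}$. Unique continuation property of $\mathcal V_{int}$: if for some $\lambda\in\mathbf C$, $(-\widehat\Delta_\Gamma+\widehat V-\lambda)\widehat u=0$ on $\mathcal V$ and $\widehat u=0$ on $\overset{\circ}{\mathcal V}_{ext}$, then $\widehat u=0$ on the whole of $\mathcal V$. *)

(* Defs.v *)
From HB Require Import structures.
From mathcomp Require Import all_boot all_order all_algebra.
From mathcomp Require Import finmap complex ring.
From mathcomp Require Import all_classical all_reals all_analysis.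
Import numFieldNormedType.Exports.

Set Implicit Arguments.
Unset Strict Implicit.
Unset Printing Implicit Defensive.

Import Order.TTheory GRing.Theory Num.Theory.
Local Open Scope classical_set_scope.
Local Open Scope ring_scope.
Local Open Scope complex_scope.
Local Open Scope quotient_scope.

Section Sums.
Context {R : realType} {T : choiceType}.

(* Meaningful when f is absolutely summable on D. *)
Definition rsum (D : set T) (f : T -> R) : R :=
  fine (\esum_(x in D) (Num.max (f x) 0)%:E)
  - fine (\esum_(x in D) (Num.max (- f x) 0)%:E).

Definition csum (D : set T) (f : T -> R[i]) : R[i] :=
  rsum D (fun x => complex.Re (f x)) +i* rsum D (fun x => complex.Im (f x)).

End Sums.

Record graph (X : choiceType) := Graph {
  vset : set X;
  adj : rel X;
  adj_vset : forall x y, adj x y -> vset x /\ vset y;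
  adj_sym : symmetric adj;
  adj_irr : irreflexive adj;
  nbr_finite : forall x, finite_set [set y | adj x y];
  vset_infinite : infinite_set vset;
  graph_connected : forall x y, vset x -> vset y ->
    exists2 q : seq X, path adj x q & last x q = y }.

Section GraphOperators.
Context {R : realType} {X : choiceType} (G : graph X).
Implicit Types (f g : X -> R[i]) (T : (X -> R[i]) -> (X -> R[i])) (lam : R[i]).

Definition nbr (x : X) : set X := [set y | adj G x y].

Definition deg (x : X) : nat := #|` fset_set (nbr x)|%fset.

Definition lap f (x : X) : R[i] := (deg x)%:R^-1 * \sum_(y \in nbr x) f y.

Definition l2energy f : \bar R :=
  \esum_(x in vset G) ((deg x)%:R * ComplexField.Normc.normc (f x) ^+ 2)%:E.

(* A function on the vertex set is represented by its extension by zero to the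
   ambient type X; lap preserves this convention, nbr x being empty when x is
   not a vertex. *)
Definition l2 : set (X -> R[i]) :=
  [set f | (forall x, ~ vset G x -> f x = 0) /\ (l2energy f < +oo)%E].

Definition l2norm f : R := Num.sqrt (fine (l2energy f)).

Definition l2dot f g : R[i] :=
  csum (vset G) (fun x => f x * conjc (g x) * (deg x)%:R).

Definition bounded_op T : Prop :=
  [/\ forall f, l2 f -> l2 (T f),
      forall (a : R[i]) f g, l2 f -> l2 g ->
        T (fun x => a * f x + g x) = (fun x => a * T f x + T g x)
    & exists M : R, forall f, l2 f -> l2norm (T f) <= M * l2norm f].

Definition selfadjoint_op T : Prop :=
  bounded_op T /\ forall f g, l2 f -> l2 g -> l2dot (T f) g = l2dot f (T g).

Definition resolvent_set T : set R[i] :=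
  [set lam | exists2 S, bounded_op S & forall f, l2 f ->
    S (fun x => T f x - lam * f x) = f /\
    (fun x => T (S f) x - lam * S f x) = f].

Definition spectrum T : set R[i] := ~` resolvent_set T.

Definition l2_eigenspace T lam : set (X -> R[i]) :=
  [set f | l2 f /\ T f = (fun x => lam * f x)].

Definition l2_eigenvalue T lam : Prop :=
  exists2 f, l2_eigenspace T lam f & exists x, f x != 0.

Definition finite_multiplicity T lam : Prop :=
  exists (n : nat) (b : 'I_n -> X -> R[i]), forall f, l2_eigenspace T lam f ->
    exists c : 'I_n -> R[i], f = (fun x => \sum_(k < n) c k * b k x).

Definition discrete_spectrum T : set R[i] :=
  [set lam | [/\ spectrum T lam,
    ~ @limit_point R[i]^o (spectrum T) lam,
    l2_eigenvalue T lam & finite_multiplicity T lam]].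

(* For self-adjoint T. *)
Definition essential_spectrum T : set R[i] := spectrum T `\` discrete_spectrum T.

End GraphOperators.

(* v(n) = \sum_j n_j v_j, where v_j is the j-th row of B. *)
Definition lattice_pt (R : realType) (d : nat) (B : 'M[R]_d) (n : 'rV[int]_d) :
  'rV[R]_d := map_mx intr n *m B.

Record periodic_graph (R : realType) (d s : nat) := PeriodicGraph {
  pg_graph :> graph 'rV[R]_d;
  basis : 'M[R]_d;
  site : 'I_s -> 'rV[R]_d;
  basis_unit : basis \in unitmx;
  site_distinct : forall i j, i != j ->
    forall n, site i - site j <> lattice_pt basis n;
  vset_periodic : vset pg_graph =
    [set x | exists j n, x = site j + lattice_pt basis n];
  adj_periodic : forall (m : 'rV[int]_d) x y,
    vset pg_graph x -> vset pg_graph y ->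
    adj pg_graph (x + lattice_pt basis m) (y + lattice_pt basis m) =
    adj pg_graph x y }.

Section FreeHamiltonian.
Context {R : realType} {d s : nat} (G0 : periodic_graph R d s).
Implicit Types (z : 'rV[R[i]^o]_d) (x : 'rV[R]_d) (lam : R[i]).

(* The vertex p_j + v(n). *)
Definition vtx (j : 'I_s) (n : 'rV[int]_d) : 'rV[R]_d :=
  site G0 j + lattice_pt (basis G0) n.

Definition deg0 (j : 'I_s) : nat := deg G0 (vtx j 0).

Definition freeH (f : 'rV[R]_d -> R[i]) : 'rV[R]_d -> R[i] :=
  fun x => - lap G0 f x.

(* sigma(H_0) = sigma(H^_0), as the spectrum of the operator on l^2(V_0). *)
Definition spec0 : set R[i] := spectrum G0 freeH.

Definition cexp (w : R[i]) : R[i] :=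
  (expR (complex.Re w))%:C * (cos (complex.Im w) +i* sin (complex.Im w)).

Definition phase (n : 'rV[int]_d) z : R[i] :=
  cexp ('i * \sum_(l < d) (n 0 l)%:~R * z 0 l).

Definition realpt x : 'rV[R[i]^o]_d := map_mx (fun t : R => t%:C) x.

(* Conjugating by the Fourier transform U turns a translation
   f_k(n) |-> f_k(n + m) into multiplication by e^{- i m.x}. *)
Definition H0 z : 'M[R[i]]_s :=
  \matrix_(j, k) - (((Num.sqrt ((deg0 j * deg0 k)%:R : R))^-1)%:C *
    \sum_(m \in [set m | adj G0 (vtx j 0) (vtx k m)]) phase (- m) z).

(* U_{L_0} f at the point x, for f of finite support. *)
Definition fourier (f : 'rV[R]_d -> R[i]) x : 'cV[R[i]]_s :=
  \col_j (((2 * pi) `^ (- (d%:R / 2)) * Num.sqrt ((deg0 j)%:R : R))%:C *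
    \sum_(n \in setT) f (vtx j n) * phase n (realpt x)).

Definition charp lam z : R[i]^o := \det (H0 z - lam%:M).

Definition gradp lam z : 'rV[R[i]^o]_d :=
  \row_l 'D_(delta_mx 0 l) (charp lam) z.

(* The eigenvalues of a Hermitian matrix in increasing order, repeated
   according to multiplicity. *)
Definition eigenvals (A : 'M[R[i]]_s) : seq R :=
  sort <=%R (map (@complex.Re R) (sval (closed_field_poly_normal (char_poly A)))).

Definition band (j : 'I_s) x : R := (eigenvals (H0 (realpt x)))`_j.

Definition M_band lam (j : 'I_s) : set 'rV[R]_d :=
  [set x | (band j x)%:C = lam].

End FreeHamiltonian.

Section Floquet.
Context {R : realType} {d s : nat} (G0 : periodic_graph R d s).
Implicit Types (z : 'rV[R[i]^o]_d) (m n : 'rV[int]_d).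

Lemma cexpD (v w : R[i]) : cexp (v + w) = cexp v * cexp w.
Proof.
case: v w => [a b] [c e]; rewrite /cexp /= expRD cosD sinD.
by apply/eqP; rewrite eq_complex /=; apply/andP; split; apply/eqP; ring.
Qed.

Lemma phaseD m n z : phase (m + n) z = phase m z * phase n z.
Proof.
rewrite /phase -cexpD -mulrDr -big_split /=; congr (cexp (_ * _)).
by apply: eq_bigr => l _; rewrite mxE intrD mulrDl.
Qed.

Lemma lattice_ptD (B : 'M[R]_d) m n :
  lattice_pt B (m + n) = lattice_pt B m + lattice_pt B n.
Proof. by rewrite /lattice_pt map_mxD mulmxDl. Qed.

Lemma vtxD j m n : vtx G0 j (m + n) = vtx G0 j m + lattice_pt (basis G0) n.
Proof. by rewrite /vtx lattice_ptD addrA. Qed.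

Lemma vset_vtx j n : vset G0 (vtx G0 j n).
Proof. by rewrite vset_periodic; exists j, n. Qed.

Lemma adj_vtx j k m n l :
  adj G0 (vtx G0 j (m + l)) (vtx G0 k (n + l)) = adj G0 (vtx G0 j m) (vtx G0 k n).
Proof. by rewrite !vtxD adj_periodic//; exact: vset_vtx. Qed.

Lemma deg_vtx j n : deg G0 (vtx G0 j n) = deg0 G0 j.
Proof.
rewrite /deg0 /deg.
have -> : nbr G0 (vtx G0 j n) =
    (fun y => y + lattice_pt (basis G0) n) @` nbr G0 (vtx G0 j 0).
  apply/seteqP; split=> [y|_ [y + <-]]; rewrite /nbr /=.
    move=> jy; have [_] := adj_vset jy; rewrite vset_periodic => -[k [m ym]].
    exists (vtx G0 k (m - n)); last by rewrite -vtxD subrK.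
    by rewrite -(adj_vtx _ _ _ _ n) add0r subrK /vtx -ym.
  move=> jy; have [_] := adj_vset jy; rewrite vset_periodic => -[k [m ym]].
  move: jy; rewrite ym -!/(vtx G0 _ _) -vtxD.
  by rewrite -(adj_vtx _ _ _ _ n) add0r.
rewrite fset_set_image; last exact: nbr_finite.
by rewrite card_imfset//; exact: addIr.
Qed.

Lemma vtx_inj j : injective (vtx G0 j).
Proof.
move=> m n /addrI /(congr1 (mulmx^~ (invmx (basis G0)))).
rewrite /lattice_pt !mulmxK ?basis_unit// => /rowP mn; apply/rowP => l.
by have := mn l; rewrite !mxE => /eqP; rewrite eqr_int => /eqP.
Qed.

Lemma deg0_gt0 j : (0 < deg0 G0 j)%N.
Proof.
rewrite /deg0 /deg cardfs_gt0.
have x0 := vset_vtx j 0.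
have [y [Vy yx]] : exists y, vset G0 y /\ y != vtx G0 j 0.
  apply: contrapT => nex; apply: (@vset_infinite _ G0).
  apply: (@sub_finite_set _ _ [set vtx G0 j 0]) => // y Vy /=.
  by apply: contrapT => /eqP yx; apply: nex; exists y.
have [[|w q] /=] := graph_connected x0 Vy.
  by move=> _ e; rewrite e eqxx in yx.
move=> /andP[jw _] _; apply/fset0Pn; exists w.
by rewrite in_fset_set ?inE//; exact: nbr_finite.
Qed.

Lemma vtx_inj2 j k m n : vtx G0 j m = vtx G0 k n -> j = k /\ m = n.
Proof.
move=> jk; have [jke|/eqP jk'] := pselect (j = k).
  by split=> //; move: jk; rewrite jke => /vtx_inj.
case: (@site_distinct _ _ _ G0 _ _ jk' (n - m)).
apply/eqP; rewrite subr_eq -(inj_eq (addIr (lattice_pt (basis G0) m))).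
by rewrite addrAC -lattice_ptD subrK [eqbRHS]addrC; apply/eqP.
Qed.

(* The functions delta span a dense subspace of l2 G0, so this is the identity
   U H^_0 = H_0(x) U. *)
Lemma fourier_freeH k n0 x :
  let delta := fun y => (y == vtx G0 k n0)%:R in
  fourier G0 (freeH G0 delta) x = H0 G0 (realpt x) *m fourier G0 delta x.
Proof.
move=> delta; apply/colP => j; rewrite !mxE.
have fk l : \sum_(n \in setT) delta (vtx G0 l n) * phase n (realpt x) =
    (l == k)%:R * phase n0 (realpt x).
  rewrite (fsbigTE [fset n0]%fset) ?big_seq_fset1 /delta.
    have [->|lk] := eqVneq l k; first by rewrite eqxx.
    by case: eqP => [/vtx_inj2[/eqP]|//]; rewrite (negPf lk).
  move=> n; rewrite inE => nn0.
  case: eqP => [/vtx_inj2[_ /eqP]|]; last by rewrite mul0r.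
  by rewrite (negPf nn0).
rewrite [RHS](bigD1 k)//= [X in _ = _ + X]big1 ?addr0; last first.
  by move=> l lk; rewrite !mxE fk (negPf lk) mul0r !mulr0.
rewrite !mxE fk eqxx mul1r.
set A := [set m | adj G0 (vtx G0 j 0) (vtx G0 k m)].
have lapE n : freeH G0 delta (vtx G0 j n) =
    - ((deg0 G0 j)%:R^-1 * (adj G0 (vtx G0 j n) (vtx G0 k n0))%:R).
  rewrite /freeH /lap deg_vtx; congr (- (_ * _)).
  rewrite fsbig_mkcond (fsbigTE [fset vtx G0 k n0]%fset) ?big_seq_fset1.
    rewrite /patch /delta eqxx; case: ifPn.
      by rewrite inE /nbr /= => ->.
    by rewrite notin_setE /nbr /= => /negP/negPf ->.
  by move=> y; rewrite inE /patch /delta => /negPf ->; case: ifP.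
have -> : \sum_(n \in setT) freeH G0 delta (vtx G0 j n) * phase n (realpt x) =
    - (deg0 G0 j)%:R^-1 * (phase n0 (realpt x) * \sum_(m \in A) phase (- m) (realpt x)).
  rewrite (reindex_fsbigT (fun m => n0 - m)); last first.
    by exists (fun m => n0 - m) => m; rewrite opprB addrC subrK.
  rewrite [X in _ = _ * (_ * X)]fsbig_mkcond !mulr_fsumr; apply: eq_fsbigr => m _.
  have -> : freeH G0 delta (vtx G0 j (n0 - m)) = - ((deg0 G0 j)%:R^-1 * (m \in A)%:R).
    rewrite lapE; congr (- (_ * (nat_of_bool _)%:R)).
    have := adj_vtx j k 0 m (n0 - m); rewrite add0r [m + _]addrC subrK => ->.
    by apply/idP/idP; rewrite inE.
  rewrite phaseD /patch; case: ifP => _; last by rewrite ?(mulr0,mulr0n,oppr0,mul0r).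
  by rewrite mulr1 !mulNr.
set P := phase n0 _; set Sg := \sum_(m \in A) _.
set c := _ `^ _; have dj := deg0_gt0 j; have dk := deg0_gt0 k.
rewrite natrM sqrtrM// invfM.
set a := Num.sqrt _; set b := Num.sqrt _.
have a0 : a != 0 by rewrite gt_eqF// sqrtr_gt0 ltr0n.
have b0 : b != 0 by rewrite gt_eqF// sqrtr_gt0 ltr0n.
have -> : (deg0 G0 j)%:R = (a ^+ 2)%:C :> R[i].
  by rewrite sqr_sqrtr ?ler0n// rmorph_nat.
have a0' : a%:C != 0 by rewrite fmorph_eq0.
have b0' : b%:C != 0 by rewrite fmorph_eq0.
rewrite !rmorphM !fmorphV /=.
by field; rewrite a0' b0'.
Qed.
End Floquet.

Section Torus.
Context {R : realType} {d : nat}.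

Definition cong2pi (z w : 'rV[R[i]^o]_d) : bool :=
  `[< exists n : 'rV[int]_d, w = z + realpt (\row_l (2 * pi * (n 0 l)%:~R)) >].

Lemma cong2pi_refl : reflexive cong2pi.
Proof.
move=> z; apply/asboolP; exists 0; apply/rowP => l.
by rewrite !mxE mulr0 addr0.
Qed.

Lemma cong2pi_sym : symmetric cong2pi.
Proof.
suff H z w : cong2pi z w -> cong2pi w z by move=> z w; apply/idP/idP; exact: H.
move=> /asboolP[n ->]; apply/asboolP; exists (- n); apply/rowP => l.
by rewrite !mxE intrN mulrN rmorphN addrK.
Qed.

Lemma cong2pi_trans : transitive cong2pi.
Proof.
move=> w z u /asboolP[n ->] /asboolP[m ->]; apply/asboolP; exists (n + m).
by apply/rowP => l; rewrite !mxE intrD (mulrDr (2 * pi)) rmorphD addrA.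
Qed.

Canonical cong2pi_equiv :=
  EquivRel cong2pi cong2pi_refl cong2pi_sym cong2pi_trans.

(* T^d_C = C^d / (2 pi Z)^d with the quotient topology. *)
Definition torusC := quotient_topology {eq_quot cong2pi_equiv}.

Definition toTorus (z : 'rV[R[i]^o]_d) : torusC := \pi_torusC z.

(* T^d inside T^d_C. *)
Definition real_torus : set torusC := range (fun x => toTorus (realpt x)).

End Torus.

Arguments torusC R d : clear implicits.

Definition discrete_subset (T : topologicalType) (S : set T) : Prop :=
  forall x, S x -> ~ limit_point S x.

Section Analytic.
Context {R : realType}.

Definition monom m (al : {ffun 'I_m -> nat}) (x : 'rV[R]_m) : R :=
  \prod_(l < m) x 0 l ^+ al l.

Definition analytic_at m (f : 'rV[R]_m -> R) (a : 'rV[R]_m) : Prop :=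
  exists (c : {ffun 'I_m -> nat} -> R) (r : R), 0 < r /\
    forall y : 'rV[R]_m, (forall l, `|y 0 l - a 0 l| < r) ->
      summable setT (fun al => (c al * monom al (y - a))%:E) /\
      f y = rsum setT (fun al => c al * monom al (y - a)).

Definition analytic_on m k (U : set 'rV[R]_m) (f : 'rV[R]_m -> 'rV[R]_k) : Prop :=
  forall a, U a -> forall l, analytic_at (fun y => f y 0 l) a.

(* k-dimensional (embedded) real analytic submanifold of R^m: around each of its
   points, a real analytic diffeomorphism phi : U -> W with inverse psi flattens
   S onto R^k x {0}. *)
Definition analytic_submanifold m (k : nat) (S : set 'rV[R]_m) : Prop :=
  forall a, S a -> exists (U W : set 'rV[R]_m) (phi psi : 'rV[R]_m -> 'rV[R]_m),
    [/\ [/\ open U, open W & U a],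
        (forall x, U x -> W (phi x) /\ psi (phi x) = x) /\
        (forall y, W y -> U (psi y) /\ phi (psi y) = y),
        analytic_on U phi /\ analytic_on W psi
      & forall x, U x -> (S x <-> forall l : 'I_m, (k <= l)%N -> phi x 0 l = 0)].

(* R^d -> T^d is a local analytic diffeomorphism, so a subset of T^d is a
   submanifold iff its preimage in R^d is one. *)
Definition torus_submanifold d (k : nat) (S : set (torusC R d)) : Prop :=
  S `<=` real_torus /\
  analytic_submanifold k [set x : 'rV[R]_d | S (toTorus (realpt x))].

End Analytic.

Section FermiSurface.
Context {R : realType} {d s : nat} (G0 : periodic_graph R d s).

(* charp and gradp are 2 pi-periodic, so these are the subsets of T^d_C cut out
   by the indicated conditions. *)
Definition MC_reg (lam : R[i]) : set (torusC R d) :=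
  [set toTorus z | z in [set z | charp G0 lam z = 0 /\ gradp G0 lam z != 0]].

Definition MC_sng (lam : R[i]) : set (torusC R d) :=
  [set toTorus z | z in [set z | charp G0 lam z = 0 /\ gradp G0 lam z = 0]].

Definition A1 (T1 : set R[i]) : Prop :=
  T1 `<=` spec0 G0 /\
  forall lam, (spec0 G0 `\` T1) lam ->
    discrete_subset (MC_sng lam) /\
    forall t, MC_reg lam t ->
      let K := connected_component (MC_reg lam) t in
      K `&` real_torus !=set0 /\ torus_submanifold d.-1 (K `&` real_torus).

Definition A2 (T0 : set R[i]) : Prop :=
  [/\ finite_set T0, T0 `<=` spec0 G0
    & forall lam, (spec0 G0 `\` T0) lam ->
        forall i j : 'I_s, i != j -> M_band G0 lam i `&` M_band G0 lam j = set0].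

Definition A3 (T0 : set R[i]) : Prop :=
  forall lam, (spec0 G0 `\` T0) lam ->
    forall x : 'rV[R]_d, charp G0 lam (realpt x) = 0 ->
      gradp G0 lam (realpt x) != 0.

Definition znorm (n : 'rV[int]_d) : R := Num.sqrt (\sum_(l < d) (n 0 l)%:~R ^+ 2).

Definition zsup (n : 'rV[int]_d) : nat := (\max_(l < d) `|n ord0 l|)%N.

Definition vanishes_far (u : 'rV[R]_d -> R[i]) : Prop :=
  exists2 R0 : R, 0 < R0 & forall n, R0 < znorm n -> forall j, u (vtx G0 j n) = 0.

Definition Vext (a : nat) : set 'rV[R]_d :=
  [set x | exists j n, x = vtx G0 j n /\ (a <= zsup n)%N].

Definition Vext_bd (a : nat) : set 'rV[R]_d :=
  [set x | exists j n, x = vtx G0 j n /\ zsup n = a].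

Definition Vext_int (a : nat) : set 'rV[R]_d := Vext a `\` Vext_bd a.

Definition A4 : Prop :=
  forall (lam : R[i]) (u : 'rV[R]_d -> R[i]),
    (forall x, vset G0 x -> freeH G0 u x = lam * u x) -> vanishes_far u ->
    forall x, vset G0 x -> u x = 0.

Definition A6 (a : nat) : Prop :=
  forall (lam : R[i]) (u : 'rV[R]_d -> R[i]),
    (forall x, Vext a x -> freeH G0 u x = lam * u x) -> vanishes_far u ->
    forall x, Vext a x -> u x = 0.

End FermiSurface.

Section Perturbed.
Context {R : realType} {d s : nat} (G0 : periodic_graph R d s).
Context (G : graph 'rV[R]_d) (a : nat).
Variable V : ('rV[R]_d -> R[i]) -> ('rV[R]_d -> R[i]).

(* The vertices of G that are not vertices of G0 are also taken to be points of
   R^d; as they are finitely many, this is no restriction. *)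
Definition finite_perturbation : Prop :=
  [/\ finite_set (vset G `\` vset G0), finite_set (vset G0 `\` vset G)
    & finite_set [set e : 'rV[R]_d * 'rV[R]_d | adj G e.1 e.2 != adj G0 e.1 e.2]].

Definition unperturbed_outside : Prop :=
  [/\ (0 < a)%N, Vext G0 a `<=` vset G
    & forall x, Vext G0 a x -> nbr G x = nbr G0 x].

Definition A5 : Prop :=
  selfadjoint_op G V /\
  forall u, l2 G u -> forall x, Vext G0 a x -> V u x = 0.

Definition pertH (u : 'rV[R]_d -> R[i]) : 'rV[R]_d -> R[i] :=
  fun x => - lap G u x + V u x.

(* A function vanishing on Vext_int is finitely supported, hence in l2. *)
Definition unique_continuation : Prop :=
  forall (lam : R[i]) (u : 'rV[R]_d -> R[i]), l2 G u ->
    (forall x, vset G x -> pertH u x = lam * u x) ->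
    (forall x, Vext_int G0 a x -> u x = 0) ->
    forall x, vset G x -> u x = 0.

End Perturbed.

(* Main.v *)
Require Import Defs.
From HB Require Import structures.
From mathcomp Require Import all_boot all_order all_algebra.
From mathcomp Require Import finmap complex ring lra zify.
From mathcomp Require Import all_classical all_reals all_analysis.
Import numFieldNormedType.Exports.
Set Implicit Arguments.
Unset Strict Implicit.
Unset Printing Implicit Defensive.
Import Order.TTheory GRing.Theory Num.Theory.
Local Open Scope classical_set_scope.
Local Open Scope ring_scope.
Local Open Scope complex_scope.

(** The heart of the matter is that an eigenfunction for an eigenvalue [lam] in the essential
    spectrum outside [T1] vanishes on [Vext] ([eigenfunction_vanish]). It is then determined by its
    values on the finite set [region]: its eigenvalue is a root of the characteristic polynomial of
    one fixed matrix, eigenspaces have bounded dimension, and unique continuation leaves no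
    eigenfunction at all.

    Symmetry of [H] makes [lam] real. Weyl's theorem ([weyl]) puts it in the spectrum of the free
    operator: [H - lam] and the free [H_0 - lam], each extended by the identity off its vertex set,
    differ by an operator of finite rank, so in the resolvent set of the free operator the spectrum
    of [H] consists of isolated eigenvalues of finite multiplicity. Hence (A-1) applies to [lam].
    Cut off to [Vext], the eigenfunction solves the free equation up to finitely many vertices. In
    Bloch variables, and after multiplication by the adjugate of [H_0(z) - lam], each component [v]
    satisfies [q * v = g], where [q] is the symbol [det (H_0(z) - lam)] and [g] is a trigonometric
    polynomial. Once [v] is known to have finite support, (A-6) gives the vanishing.

    Finite support of [v] is a Rellich theorem for one real symbol ([rellich_l2]), with four
    ingredients. At a real regular zero of [q] the numerator [g] vanishes, because [g / q] is square
    integrable ([l2_vanish]). Integrals over the torus are replaced throughout by averages over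
    finite grids, which are exact on trigonometric polynomials of small degree. In suitable
    unimodular coordinates [q] is, up to a monomial, a monic polynomial [P] in the last variable
    ([normal_form]). Near a real regular point [g] is a multiple of the factor of [P] through that
    point ([min_divisor], [no_constraint]), and the zero set of a factor is open and closed in each
    component of the regular part ([component_factor]). Since every component has a real point, [g]
    vanishes on the whole complex regular part ([numerator_vanish]). If [P] did not divide [g], a
    factor of [P] of positive degree would have only singular zeros, infinitely many of them in a
    compact set, against discreteness ([singular_family]). So [g] is a trigonometric polynomial
    times [q]. Finally multiplication by [q] is injective on square-summable functions
    ([kernel_trivial], [small_set]), so [v] has the finitely many coefficients of the quotient. *)

Fixpoint tower (C : idomainType) (m : nat) : idomainType :=
  if m is m'.+1 then {poly (tower C m')} else C.

(** * Polynomials in several variables: evaluation, and divisibility from growth bounds *)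

Section Tower.
Variable C : numClosedFieldType.
Local Notation T := (tower C).
Implicit Types (m : nat) (y : nat -> C).

(** The variable adjoined in passing from [T m] to [T m.+1] takes the value [y m]; further entries
    of [y] are ignored, so one sequence serves all stages. *)
Fixpoint ev m y : {rmorphism T m -> C} :=
  match m return {rmorphism T m -> C} with
  | 0 => idfun
  | m'.+1 => horner_eval (y m') \o map_poly (ev m' y)
  end.

Lemma evS m y (f : T m.+1) : ev m.+1 y f = (map_poly (ev m y) f).[y m].
Proof. by []. Qed.

Lemma evX m y : ev m.+1 y ('X : {poly T m}) = y m.
Proof. by rewrite evS map_polyX hornerX. Qed.

Lemma evC m y (c : T m) : ev m.+1 y (c%:P : {poly T m}) = ev m y c.
Proof. by rewrite evS map_polyC hornerC. Qed.

Lemma evMXaddC m y (f : T m.+1) (c : T m) :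
  ev m.+1 y ((f : {poly T m}) * 'X + c%:P) = ev m.+1 y f * y m + ev m y c.
Proof. by rewrite rmorphD rmorphM evX evC. Qed.

Lemma ev_ext m y y' (f : T m) : (forall l, (l < m)%N -> y l = y' l) ->
  ev m y f = ev m y' f.
Proof.
elim: m f => // m IH f yy'; rewrite !evS yy'//; congr (_.[_]).
by apply: eq_map_poly => g; apply: IH => l /ltnW; apply: yy'.
Qed.

Fixpoint tconst m : {rmorphism C -> T m} :=
  match m return {rmorphism C -> T m} with
  | 0 => idfun
  | m'.+1 => polyC \o tconst m'
  end.

Lemma ev_const m y c : ev m y (tconst m c) = c.
Proof. by elim: m => //= m IH; rewrite /horner_eval map_polyC/= hornerC IH. Qed.

Definition upd y (l : nat) (t : C) : nat -> C := fun k => if k == l then t else y k.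

Lemma ev_upd m y l t (f : T m) : (m <= l)%N -> ev m (upd y l t) f = ev m y f.
Proof.
move=> ml; apply: ev_ext => k km; rewrite /upd ifN// ltn_eqF//.
exact: leq_trans ml.
Qed.

Definition infin (D : C -> Prop) := forall s : seq C, exists2 x, D x & x \notin s.

Lemma infin_inj (D : C -> Prop) (u : nat -> C) :
  injective u -> (forall n, D (u n)) -> infin D.
Proof.
move=> uI uD s.
have [/hasP[x xm xs]|] := boolP (has (fun x => x \notin s) (map u (iota 0 (size s).+1))).
  by move: xm xs => /mapP[n _ ->] xs; exists (u n).
rewrite -all_predC => /allP us.
have : (size (map u (iota 0 (size s).+1)) <= size s)%N.
  apply: uniq_leq_size; first by rewrite map_inj_uniq// iota_uniq.
  by move=> x /us /=; rewrite negbK.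
by rewrite size_map size_iota ltnn.
Qed.

Lemma infin_ball (a e : C) : 0 < e -> infin (fun x => `|x - a| <= e).
Proof.
move=> e0; apply: (@infin_inj _ (fun n => a + e / n.+1%:R)).
  move=> i j /addrI /(mulfI (lt0r_neq0 e0)) /invr_inj /eqP.
  by rewrite eqr_nat eqSS => /eqP.
move=> n; rewrite addrAC subrr add0r normrM normfV (gtr0_norm e0) ger0_norm//.
by rewrite ler_pdivrMr ?ltr0Sn// ler_peMr ?(ltW e0)// ler1n.
Qed.

Lemma roots_seq (p : {poly C}) : p != 0 -> exists s : seq C, forall x, root p x = (x \in s).
Proof.
move=> p0; have [s ps] := closed_field_poly_normal p.
exists s => x; rewrite ps rootZ ?lead_coef_eq0//.
by rewrite root_prod_XsubC.
Qed.

Lemma map_ev_neq0 m y (f : T m.+1) :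
  ev m y (lead_coef f) != 0 -> map_poly (ev m y) f != 0.
Proof.
move=> h; apply/eqP => /polyP /(_ (size f).-1).
by rewrite coef_map coef0 => /eqP; apply/negP.
Qed.

(** Induction on the variables: the lower ones are chosen to keep the leading coefficient nonzero,
    which leaves finitely many forbidden values for the last one. *)
Lemma ev_nonzero m (f : T m) (E : nat -> C -> Prop) : f != 0 ->
    (forall l, (l < m)%N -> infin (E l)) ->
  exists2 y, (forall l, (l < m)%N -> E l (y l)) & ev m y f != 0.
Proof.
elim: m f => [|m IH] f f0 iE; first by exists (fun=> 0).
have [||y yE yf] := IH (lead_coef f); first by rewrite lead_coef_eq0.
  by move=> l lm; apply/iE/ltnW.
have [s fs] := roots_seq (map_ev_neq0 yf).
have [x xE xs] := iE m (ltnSn m) s.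
exists (upd y m x) => [l|]; last first.
  rewrite evS (eq_map_poly (g := ev m y)) => [|g]; last exact: ev_upd.
  by move: xs; rewrite -fs /upd eqxx.
rewrite ltnS leq_eqVlt => /predU1P[->|lm]; rewrite /upd ?eqxx//.
by rewrite ltn_eqF//; apply: yE.
Qed.

Lemma ev_slice m y l (f : T m) : (l < m)%N ->
  exists q : {poly C}, forall t, ev m (upd y l t) f = q.[t].
Proof.
elim: m f => // m IH f; rewrite ltnS leq_eqVlt => /predU1P[->|lm].
  exists (map_poly (ev m y) f) => t; rewrite evS /upd eqxx.
  congr (_.[_]); apply: eq_map_poly => g; exact: ev_upd.
elim/poly_ind: f => [|f c [q fq]]; first by exists 0 => t; rewrite rmorph0 horner0.
have [qc cq] := IH c lm; exists (q * (y m)%:P + qc) => t.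
rewrite evMXaddC fq cq.
by rewrite hornerD hornerM !hornerC /upd gtn_eqF.
Qed.

Lemma ev_bounded m (f : T m) (r : C) : 0 <= r -> exists2 M : C, 0 <= M &
  forall y, (forall l, (l < m)%N -> `|y l| <= r) -> `|ev m y f| <= M.
Proof.
move=> r0; elim: m f => [f|m IH f]; first by exists `|f|.
elim/poly_ind: f => [|f c [Mf Mf0 fM]].
  by exists 0 => // y yr; rewrite rmorph0 normr0.
have [Mc Mc0 cM] := IH c; exists (Mf * r + Mc); first by rewrite addr_ge0// mulr_ge0.
move=> y yr; rewrite evMXaddC (le_trans (ler_normD _ _))// lerD//.
  by rewrite normrM ler_pM//; [apply: fM | apply: yr].
by apply: cM => l lm; apply/yr/ltnW.
Qed.

Lemma horner_bounded (f : {poly C}) (r : C) : 0 <= r -> exists2 M : C, 0 <= M &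
  forall x, `|x| <= r -> `|f.[x]| <= M.
Proof.
move=> r0; have [M M0 fM] := ev_bounded (m := 1) f r0; exists M => // x xr.
have := fM (fun=> x) (fun _ _ => xr).
by rewrite evS map_poly_id.
Qed.

(** Local boundedness of [f / a] off the roots of [b]. The exceptional set is kept as a parameter
    because it grows when common roots of [a] and [f] are cancelled. *)
Definition bounded_quotient (a b f : {poly C}) := forall r : C, 0 <= r ->
  exists2 M : C, 0 <= M &
    forall x, `|x| <= r -> ~~ root b x -> `|f.[x]| <= M * `|a.[x]|.

Lemma bounded_quotient_root (a b f : {poly C}) z : b != 0 ->
  bounded_quotient a b f -> root a z -> root f z.
Proof.
move=> b0 abf /factor_theorem[a1 def_a]; rewrite rootE; apply: contraT => fz.
have /factor_theorem[f1 def_f] : root (f - f.[z]%:P) z by rewrite /root !hornerE subrr.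
have r0 : 0 <= `|z| + 1 by rewrite addr_ge0.
have [Ma Ma0 aM] := horner_bounded a1 r0; have [Mf Mf0 fM] := horner_bounded f1 r0.
have [M M0 abM] := abf _ r0.
pose K := M * Ma + Mf; have K0 : 0 <= K by rewrite addr_ge0// mulr_ge0.
pose c := `|f.[z]|; have c0 : 0 < c by rewrite normr_gt0.
(* This radius satisfies [K * e < c], whereas a point within [e] of [z] and off the roots of [b]
   forces [c <= K * e]. *)
pose e := c / (K + c).
have Kc : 0 < K + c by rewrite ltr_wpDl.
have e0 : 0 < e by rewrite divr_gt0.
have e1 : e <= 1 by rewrite ler_pdivrMr// mul1r lerDr.
have [s bs] := roots_seq b0.
have [x xe xs] := infin_ball z e0 s.
have xr : `|x| <= `|z| + 1.
  by rewrite -[x](subrK z) addrC (le_trans (ler_normD _ _))// lerD2l (le_trans xe).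
have bx : ~~ root b x by rewrite bs.
have : c <= K * e.
  have -> : c = `|f.[x] - f1.[x] * (x - z)|.
    have -> : f1.[x] * (x - z) = (f - f.[z]%:P).[x] by rewrite def_f !hornerE.
    by rewrite !hornerE opprB addrC subrK.
  have ax : `|a.[x]| <= Ma * e.
    by rewrite def_a hornerM hornerXsubC normrM; apply: ler_pM => //; apply: aM.
  rewrite (le_trans (ler_normB _ _))// mulrDl lerD//.
    by rewrite (le_trans (abM _ xr bx))// -mulrA ler_wpM2l.
  by rewrite normrM; apply: ler_pM => //; apply: fM.
rewrite /e mulrA ler_pdivlMr// mulrDr [K * c]mulrC gerDl => cc.
by have := lt_le_trans (mulr_gt0 c0 c0) cc; rewrite ltxx.
Qed.

(** Roots of [a] are cancelled from [a] and [f] one at a time; the cancelled root joins the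
    exceptional set as a new factor of [b]. *)
Lemma dvdp_bounded_quotient (a b f : {poly C}) : a != 0 -> b != 0 ->
  bounded_quotient a b f -> a %| f.
Proof.
have [n] := ubnP (size a); elim: n a b f => // n IH a b f; rewrite ltnS => sa a0 b0 abf.
have [/eqP/size_poly1P[c c0 ->]|/closed_rootP[z az]] := eqVneq (size a) 1.
  by rewrite -alg_polyC dvdpZl// dvd1p.
have fz := bounded_quotient_root b0 abf az.
move: az fz (abf) => /factor_theorem[a1 def_a] /factor_theorem[f1 def_f] abf'.
have a10 : a1 != 0 by apply: contraNneq a0; rewrite def_a => ->; rewrite mul0r.
rewrite def_a def_f dvdp_mul2r ?polyXsubC_eq0//.
apply: (IH _ (b * ('X - z%:P))) => //.
- by rewrite (leq_trans _ sa)// def_a size_mul ?polyXsubC_eq0// size_XsubC addn2.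
- by rewrite mulf_neq0 ?polyXsubC_eq0.
move=> r r0; have [M M0 abM] := abf' r r0; exists M => // x xr.
rewrite rootM negb_or => /andP[bx]; rewrite root_XsubC => xz.
have := abM x xr bx; rewrite def_a def_f !hornerE !normrM mulrA ler_pM2r//.
by rewrite normr_gt0 subr_eq0.
Qed.


Lemma coef_dvd_poly (B : idomainType) (D : B) (e : {poly B}) :
  (forall i, exists h, e`_i = h * D) -> exists e' : {poly B}, e = D *: e'.
Proof.
elim/poly_ind: e => [_|e c IH eD]; first by exists 0; rewrite scaler0.
have [i|e' ->] := IH; first by have [h] := eD i.+1; rewrite coefD coefMX coefC addr0; exists h.
have [h] := eD 0; rewrite coefD coefMX coefC add0r => ->.
by exists (e' * 'X + h%:P); rewrite scalerDr -scalerAl [h * D]mulrC polyCM mul_polyC.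
Qed.

Lemma infin_notin (D : C -> Prop) (s : seq C) : infin D -> infin (fun x => D x /\ x \notin s).
Proof.
move=> iD t; have [x Dx] := iD (s ++ t).
by rewrite mem_cat negb_or => /andP[xs xt]; exists x.
Qed.

(** Divided differences: writing [q] as [q1 * (X - c0)] plus its value at [c0], the value of [q1] at
    another [c] is the difference of two multiples of [D] over the scalar [c - c0], and [q1] has
    smaller degree. *)
Lemma interpolate_dvd m (D : T m) (q : {poly T m}) (S : C -> Prop) : infin S ->
    (forall c, S c -> exists h, q.[tconst m c] = h * D) ->
  exists h : {poly T m}, q = D *: h.
Proof.
have [n] := ubnP (size q); elim: n q S => // n IH q S; rewrite ltnS => sq iS qD.
have [c0 Sc0 _] := iS [::]; have [h0 qc0] := qD _ Sc0.
have [q0|q0] := eqVneq q 0; first by exists 0; rewrite q0 scaler0.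
have /factor_theorem[q1 def_q1] : root (q - q.[tconst m c0]%:P) (tconst m c0).
  by rewrite /root !hornerE subrr.
have def_q : q = q1 * ('X - (tconst m c0)%:P) + (h0 * D)%:P.
  by rewrite -def_q1 qc0 subrK.
have [|c [Sc]|h1 def_h1] := IH q1 _ _ (infin_notin [:: c0] iS).
- have [->|q10] := eqVneq q1 0; first by rewrite size_poly0 (leq_trans _ sq)// size_poly_gt0.
  have s1 : size (q1 * ('X - (tconst m c0)%:P)) = (size q1).+1.
    by rewrite size_Mmonic ?monicXsubC// size_XsubC addn2.
  rewrite (leq_trans _ sq)// {1}def_q size_polyDl s1//.
  by rewrite (leq_ltn_trans (size_polyC_leq1 _))// ltnS size_poly_gt0.
- rewrite inE => cc0; have [h qc] := qD _ Sc.
  exists (tconst m (c - c0)^-1 * (h - h0)).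
  have : q.[tconst m c] - q.[tconst m c0] = q1.[tconst m c] * (tconst m c - tconst m c0).
    by rewrite qc0 {1}def_q !hornerE addrK.
  rewrite qc qc0 -mulrBl -rmorphB => e; rewrite -mulrA e mulrCA -rmorphM mulVf ?subr_eq0//.
  by rewrite rmorph1 mulr1.
by exists (h1 * ('X - (tconst m c0)%:P) + h0%:P); rewrite scalerDr scalerAl -def_h1 {1}def_q
   [h0 * D]mulrC polyCM mul_polyC.
Qed.

Lemma ev_horner m y c (f : {poly T m}) :
  ev m y f.[tconst m c] = ev m.+1 (upd y m c) f.
Proof.
rewrite evS /upd eqxx (eq_map_poly (g := ev m y)) => [|g]; last exact: ev_upd.
by rewrite -{2}(ev_const m y c) horner_map.
Qed.

Lemma horner_const_neq0 m (f : {poly T m}) : f != 0 ->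
  exists s : seq C, forall c, c \notin s -> f.[tconst m c] != 0.
Proof.
move=> f0; have [||y _ yf] := ev_nonzero (f := lead_coef f) (E := fun _ _ => True).
- by rewrite lead_coef_eq0.
- by move=> l lm s; have [x] := infin_ball 0 ltr01 s; exists x.
have [s fs] := roots_seq (map_ev_neq0 yf).
exists s => c; apply: contraNN => /eqP fc; rewrite -fs /root.
by rewrite -{1}(ev_const m y c) horner_map fc rmorph0.
Qed.

(** Pseudo-division by [a] in the last variable leaves no remainder, since at a generic choice of
    the other variables the one-variable case applies. The power of the leading coefficient
    introduced by pseudo-division is then removed: by induction it divides the quotient at
    infinitely many constant values of the last variable, hence everywhere by interpolation. *)
Lemma tower_dvd m (a b f : T m) : a != 0 -> b != 0 ->
    (forall r, 0 <= r -> exists2 M, 0 <= M & forall y, (forall l, (l < m)%N -> `|y l| <= r) ->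
      ev m y b != 0 -> `|ev m y f| <= M * `|ev m y a|) ->
  exists q, f = q * a.
Proof.
elim: m a b f => [|m IH] a b f a0 b0 abf.
  by exists (f / a); rewrite [LHS](_ : _ = f / a * a)// divfK.
pose at_ := lead_coef (a : {poly T m}); pose bt := lead_coef (b : {poly T m}).
have at0 : at_ != 0 by rewrite lead_coef_eq0.
have bt0 : bt != 0 by rewrite lead_coef_eq0.
have := Pdiv.Idomain.divp_eq (f : {poly T m}) a; rewrite -/at_.
set k := scalp _ _; set q := (_ %/ _)%R; set rr := (_ %% _)%R => def_f.
have rr0 : rr = 0.
  apply/eqP; apply: contraT => rr0.
  have [||y _] := ev_nonzero (f := at_ * bt * lead_coef rr) (E := fun _ _ => True).
  - by rewrite !mulf_neq0 ?lead_coef_eq0.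
  - by move=> l lm s; have [x] := infin_ball 0 ltr01 s; exists x.
  rewrite !rmorphM !mulf_eq0 !negb_or => /andP[/andP[ya yb] yr].
  have := map_ev_neq0 ya; have := map_ev_neq0 yb; have := map_ev_neq0 yr.
  set ry := map_poly _ _; set by_ := map_poly _ _; set ay := map_poly _ _ => ry0 by0 ay0.
  have ay_f : ay %| map_poly (ev m y) f.
    apply: dvdp_bounded_quotient ay0 by0 _ => r r0.
    (* The radius is enlarged so that the polydisc contains the chosen [y]. *)
    have [|M M0 abM] := abf (r + \sum_(l < m) `|y l|); first by rewrite addr_ge0// sumr_ge0.
    exists M => // x xr bx.
    have evx (g : T m.+1) : ev m.+1 (upd y m x) g = (map_poly (ev m y) g).[x].
      rewrite evS /upd eqxx; congr (_.[_]).
      by apply: eq_map_poly => h; apply: ev_upd.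
    have := abM (upd y m x); rewrite !evx; apply; last by [].
    move=> l; rewrite ltnS leq_eqVlt /upd => /predU1P[->|lm].
      by rewrite eqxx (le_trans xr)// lerDl sumr_ge0.
    rewrite ltn_eqF// (bigD1 (Ordinal lm))//= addrCA lerDl addr_ge0// sumr_ge0//.
  have : ay %| ry.
    have := congr1 (map_poly (ev m y)) def_f.
    rewrite rmorphD rmorphM /= map_polyZ /= => e.
    by rewrite -(dvdp_addr ry (dvdp_mull (map_poly (ev m y) q) (dvdpp ay))) -e dvdpZr// rmorphXn expf_neq0.
  move=> /(dvdp_leq ry0); rewrite leqNgt => /negP[].
  have -> : size ay = size (a : {poly T m}) by apply: size_map_poly_id0.
  by rewrite (leq_ltn_trans (size_poly _ _))// Pdiv.Idomain.ltn_modp.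
move: def_f; rewrite rr0 addr0 => def_f.
have [sa as_] := horner_const_neq0 a0; have [sb bs] := horner_const_neq0 b0.
have [||h def_h] := @interpolate_dvd m (at_ ^+ k) q (fun c => c \notin sa ++ sb).
- by move=> s; have [x [_]] := infin_notin (sa ++ sb) (infin_ball 0 ltr01) s; exists x.
- move=> c; rewrite mem_cat negb_or => /andP[/as_ ac /bs bc].
  (* The exceptional factor is the product of the values of [a] and [b]: off its zeros the value of
     [a] can be cancelled, which bounds that of [q] by a multiple of [at_ ^+ k]. *)
  apply: (IH _ ((a : {poly T m}).[tconst m c] * (b : {poly T m}).[tconst m c])).
  + by rewrite expf_neq0.
  + by rewrite mulf_neq0.
  move=> r r0; have [|M M0 abM] := abf (r + `|c|); first by rewrite addr_ge0.
  exists M => // y yr; rewrite rmorphM mulf_eq0 negb_or => /andP[yac ybc].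
  have := congr1 (fun p : {poly T m} => ev m y p.[tconst m c]) def_f.
  rewrite hornerZ hornerM !rmorphM => e.
  rewrite -(ler_pM2r (x := `|ev m y (a : {poly T m}).[tconst m c]|)) ?normr_gt0//.
  rewrite -normrM -e normrM mulrAC mulrC ler_wpM2r// !ev_horner; apply: abM; last first.
    by rewrite -ev_horner.
  move=> l; rewrite ltnS leq_eqVlt /upd => /predU1P[->|lm].
    by rewrite eqxx lerDr.
  by rewrite ltn_eqF// (le_trans (yr _ lm))// lerDl.
exists h; apply: (@mulfI (T m.+1) ((at_ ^+ k)%:P)); first by rewrite polyC_eq0 expf_neq0.
by rewrite mul_polyC def_f def_h mulrA mul_polyC.
Qed.

Lemma monic_root_bound (p : {poly C}) x : p \is monic -> root p x ->
  `|x| <= 1 + \sum_(c <- p) `|c|.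
Proof.
move=> pm /rootP px; rewrite (big_nth 0) big_mkord.
have [x1|x1] := real_leP (normr_real x) (real1 C).
  by rewrite (le_trans x1)// lerDl sumr_ge0.
have [k sp] : exists k, size p = k.+1.
  by exists (size p).-1; rewrite prednK// size_poly_gt0 monic_neq0.
have pl : p`_k = 1 by have := monicP pm; rewrite lead_coefE sp.
move: px; rewrite horner_coef sp !big_ord_recr/= pl mul1r normr1 => /eqP.
rewrite addrC addr_eq0 => /eqP xk.
have : `|x| ^+ k <= \sum_(i < k) `|p`_i| * `|x| ^+ k.-1.
  rewrite -normrX xk normrN (le_trans (ler_norm_sum _ _ _))// ler_sum// => i _.
  rewrite normrM normrX ler_wpM2l// ler_weXn2l ?(ltW x1)//.
  by rewrite -ltnS prednK ?ltn_ord// (leq_ltn_trans _ (ltn_ord i)).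
case: k {sp pl} xk => [|k _]; first by rewrite big_ord0 expr0 => /eqP; rewrite oppr0 oner_eq0.
rewrite -mulr_suml exprS ler_pM2r ?exprn_gt0 ?(lt_trans ltr01)// => h.
by rewrite (le_trans h)// addrCA lerDl addr_ge0.
Qed.

Lemma coef_prod_XsubC_bound (rs : seq C) B i : 0 <= B ->
  {in rs, forall z, `|z| <= B} -> `|(\prod_(z <- rs) ('X - z%:P))`_i| <= (1 + B) ^+ size rs.
Proof.
move=> B0; elim: rs i => [|z rs IH] i rsB.
  by rewrite big_nil coef1; case: (i == 0)%N; rewrite ?normr1 ?normr0.
have rsB' : {in rs, forall z, `|z| <= B} by move=> x xs; apply: rsB; rewrite inE xs orbT.
rewrite big_cons mulrBl coefB coefXM coefCM exprS mulrDl (le_trans (ler_normB _ _))//.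
apply: lerD; last by rewrite normrM; apply: ler_pM => //; [apply: rsB; rewrite mem_head | apply: IH].
rewrite mul1r; case: (i == 0)%N; last exact: IH.
by rewrite normr0 exprn_ge0// addr_ge0.
Qed.

Lemma sum_ev_bounded m (s : seq (T m)) (r : C) : 0 <= r -> exists2 M : C, 0 <= M &
  forall y, (forall l, (l < m)%N -> `|y l| <= r) -> \sum_(c <- s) `|ev m y c| <= M.
Proof.
move=> r0; elim: s => [|c s [M M0 IH]]; first by exists 0 => // y _; rewrite big_nil.
have [N N0 cN] := ev_bounded c r0; exists (N + M); first exact: addr_ge0.
by move=> y yr; rewrite big_cons lerD ?cN ?IH.
Qed.

(* Gauss's lemma: the coefficients of [e / lead_coef e] are polynomials in the
   roots of the monic [P], hence locally bounded. *)
Lemma gauss m (P e q : {poly T m}) (c : T m) : P \is monic -> c != 0 -> c *: P = q * e ->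
  exists2 e', e' \is monic & e = lead_coef e *: e'.
Proof.
move=> Pm c0 def_P.
have cP0 : c *: P != 0 by rewrite -mul_polyC mulf_neq0 ?polyC_eq0 ?monic_neq0.
have e0 : e != 0 by apply: contraNneq cP0 => e0; rewrite def_P e0 mulr0.
have le0 : lead_coef e != 0 by rewrite lead_coef_eq0.
have [i|e' def_e] := @coef_dvd_poly _ (lead_coef e) e; last first.
  exists e' => //; apply/monicP/(mulfI le0).
  by rewrite mulr1 -lead_coefZ -def_e.
apply: (tower_dvd le0 c0) => r r0; have [M M0 PM] := sum_ev_bounded P r0.
exists ((1 + (1 + M)) ^+ size e); first by rewrite exprn_ge0 ?addr_ge0.
move=> y yr cy.
have cE : ev m y c = ev m y (lead_coef q) * ev m y (lead_coef e).
  rewrite -rmorphM -lead_coefM -def_P lead_coefZ.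
  by rewrite (monicP Pm) mulr1.
have ye : ev m y (lead_coef e) != 0 by apply: contraNneq cy => ye; rewrite cE ye mulr0.
have se : size (map_poly (ev m y) e) = size e by apply: size_map_poly_id0.
have le : lead_coef (map_poly (ev m y) e) = ev m y (lead_coef e).
  by rewrite lead_coefE se coef_map.
have [rs def_ey] := closed_field_poly_normal (map_poly (ev m y) e).
have srs : size rs = (size e).-1.
  by rewrite -se def_ey size_scale ?lead_coef_eq0 ?map_ev_neq0// size_prod_XsubC.
have rsM : {in rs, forall z, `|z| <= 1 + M}.
  move=> z zs; rewrite (le_trans (monic_root_bound (p := map_poly (ev m y) P) _ _))//.
  - by rewrite monic_map.
  - have := congr1 (map_poly (ev m y)) def_P.
    rewrite rmorphM /= map_polyZ /= => /(congr1 (fun p => root p z)).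
    rewrite rootZ// => ->; rewrite rootM def_ey rootZ ?lead_coef_eq0 ?map_ev_neq0//.
    by rewrite root_prod_XsubC zs orbT.
  rewrite lerD2l (big_nth 0) (le_trans _ (PM y yr))// (big_nth 0 (r := P)).
  rewrite size_map_poly_id0; last by rewrite (monicP Pm) rmorph1 oner_eq0.
  by rewrite ler_sum// => j _; rewrite coef_map.
rewrite -coef_map def_ey coefZ le normrM mulrC ler_wpM2r//.
rewrite (le_trans (coef_prod_XsubC_bound i _ rsM)) ?addr_ge0// srs.
by rewrite ler_weXn2l ?leq_pred// lerDl addr_ge0.
Qed.

End Tower.

(** * Elements of least degree in an ideal *)

Section MinimalDivisor.
Variable (C : numClosedFieldType) (m : nat).
Local Notation T := (tower C).

Lemma min_size (R : nzSemiRingType) (Q : {poly R} -> Prop) f0 : Q f0 ->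
  exists2 f, Q f & forall g, Q g -> (size f <= size g)%N.
Proof.
move=> Qf0; pose A n := `[< exists2 f, Q f & size f = n >].
have exA : exists n, A n by exists (size f0); apply/asboolP; exists f0.
case: (ex_minnP exA) => n /asboolP[f Qf sf] fmin; exists f => // g Qg.
by rewrite sf; apply: fmin; apply/asboolP; exists g.
Qed.

Definition idealP (J : {poly T m} -> Prop) :=
  (forall f g, J f -> J g -> J (f - g)) /\ (forall f g, J g -> J (f * g)).

Lemma ideal_min_dvd (J : {poly T m} -> Prop) e P : idealP J -> J P -> J e -> e != 0 ->
    (forall g, J g -> g != 0 -> (size e <= size g)%N) ->
  exists2 k, True & lead_coef e ^+ k *: P = (P %/ e) * e.
Proof.
move=> [JB JM] JP Je e0 emin; have := Pdiv.Idomain.divp_eq P e; set k := scalp _ _.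
move=> def_P; exists k => //; rewrite {1}def_P.
suff -> : P %% e = 0 by rewrite addr0.
apply/eqP; apply: contraT => r0.
have : J (P %% e).
  have -> : P %% e = (lead_coef e ^+ k)%:P * P - (P %/ e) * e.
    by rewrite mul_polyC def_P addrAC subrr add0r.
  by apply: JB; exact: JM.
move=> /emin /(_ r0); rewrite leqNgt => /negP[].
exact: Pdiv.Idomain.ltn_modpN0.
Qed.

Lemma monic_dvd_gauss (P e q : {poly T m}) (c : T m) :
    P \is monic -> c != 0 -> c *: P = q * e ->
  exists e' q', [/\ P = q' * e', e' \is monic & e = lead_coef e *: e'].
Proof.
move=> Pm c0 def_P; have [e' e'm def_e] := gauss Pm c0 def_P.
have := Pdiv.RingMonic.rdivp_eq e'm P; set r := Pdiv.Ring.rmodp _ _; set q' := Pdiv.Ring.rdivp _ _.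
move=> def_P'; exists e', q'; split=> //.
rewrite {1}def_P'; suff -> : r = 0 by rewrite addr0.
apply/eqP; apply: contraT => r0.
have e'r : c *: r = (lead_coef e *: q - c *: q') * e'.
  rewrite mulrBl -!scalerAl scalerAr -def_e -def_P {1}def_P' scalerDr addrAC subrr add0r//.
have cr0 : c *: r != 0 by rewrite -mul_polyC mulf_neq0 ?polyC_eq0.
have : (size (c *: r) >= size e')%N.
  have w0 : lead_coef e *: q - c *: q' != 0.
    by apply: contraNneq cr0 => h; rewrite e'r h mul0r.
  rewrite e'r size_Mmonic//; move: w0; rewrite -size_poly_gt0.
  by case: (size _) => // k _; rewrite addSn leq_addl.
rewrite leqNgt => /negP[]; rewrite (leq_ltn_trans (size_scale_leq _ _))//.
by rewrite Pdiv.Ring.ltn_rmodpN0// monic_neq0.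
Qed.

(** In the application [J] consists of the polynomials vanishing on the real zero set near a regular
    point [y]. Let [P1] be a monic factor of [P] of least degree vanishing at [y], and [e] an
    element of least degree in [J]. By Gauss's lemma [e] is, up to its leading coefficient, a monic
    factor [e'] of [P1]. If the cofactor of [e'] vanishes at [y], minimality of [P1] forces
    [e' = 1], so [J] contains a nonzero polynomial free of the last variable. Otherwise [e']
    vanishes at [y], [P1] itself has least degree in [J], and division of [g] by the monic [P1]
    leaves no remainder. *)
Lemma min_divisor (P : {poly T m}) (J : {poly T m} -> Prop) (y : nat -> C) g :
    P \is monic -> idealP J -> ev m.+1 y P = 0 -> J g ->
    (forall f h, P = f * h -> ev m.+1 y h != 0 -> J f) ->
    (forall f h, P = f * h -> ev m.+1 y f = 0 -> ev m.+1 y h != 0) ->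
    (forall a : T m, J a%:P -> a = 0) ->
  exists P1 q1, [/\ P = P1 * q1, ev m.+1 y P1 = 0 & exists s, g = s * P1].
Proof.
move=> Pm [JB JM] Py Jg loc simple noa.
pose Q f := f \is monic /\ exists h, P = f * h /\ ev m.+1 y f = 0.
have [|P1 [P1m [q1 [def_P P1y]]] P1min] := @min_size _ Q P.
  by split=> //; exists 1; rewrite mulr1.
have JP1 : J P1 by apply: (loc _ q1) => //; apply: simple def_P P1y.
exists P1, q1; split=> //.
have [|e [Je e0] emin] := @min_size _ (fun f => J f /\ f != 0) P1.
  by rewrite monic_neq0.
have emin' f : J f -> f != 0 -> (size e <= size f)%N by move=> Jf f0; apply: emin.
have [k _ kP1] := ideal_min_dvd (conj JB JM) JP1 Je e0 emin'.
have [e' [q' [def_P1 e'm def_e]]] : exists e' q', [/\ P1 = q' * e', e' \is monic & e = lead_coef e *: e'].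
  by apply: monic_dvd_gauss P1m _ kP1; rewrite expf_neq0 ?lead_coef_eq0.
have q'm : q' \is monic by rewrite -(monicMr _ e'm) -def_P1.
have : ev m.+1 y (q' * e') = 0 by rewrite -def_P1.
rewrite rmorphM => /eqP; rewrite mulf_eq0 => /orP[/eqP q'y|/eqP e'y].
  have s1 : (size P1 <= size q')%N.
    by apply: P1min; split=> //; exists (e' * q1); split; rewrite // mulrA -def_P1.
  have e'1 : e' = 1.
    have e's : (size e' <= 1)%N.
      move: s1; rewrite {1}def_P1 size_monicM ?monic_neq0// -subn1 leq_subLR addnC.
      by rewrite leq_add2r.
    by move: e'm; rewrite (size1_polyC e's) monicE lead_coefC => /eqP ->.
  have : e = (lead_coef e)%:P by rewrite {1}def_e e'1 alg_polyC.
  move=> eC; move: Je; rewrite eC => /noa le0.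
  by move: e0; rewrite -lead_coef_eq0 le0 eqxx.
have s1 : (size P1 <= size e)%N.
  rewrite def_e size_scale ?lead_coef_eq0//.
  by apply: P1min; split=> //; exists (q' * q1); split; rewrite // mulrA [e' * _]mulrC -def_P1.
have := Pdiv.RingMonic.rdivp_eq P1m g; set r := Pdiv.Ring.rmodp _ _; set s := Pdiv.Ring.rdivp _ _.
move=> def_g; exists s; rewrite {1}def_g; suff -> : r = 0 by rewrite addr0.
apply/eqP; apply: contraT => r0.
have Jr : J r.
  have -> : r = g - s * P1 by rewrite {1}def_g addrC addKr.
  by apply: JB => //; apply: JM.
have := leq_trans s1 (emin' _ Jr r0); rewrite leqNgt => /negP[].
by rewrite Pdiv.Ring.ltn_rmodpN0// monic_neq0.
Qed.

End MinimalDivisor.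

(** * Taylor bounds for sine, cosine and the exponential *)

Section RealBounds.
Variable R : realType.
Implicit Types a b : R.

Lemma normr_sin_le b : `|sin b| <= `|b|.
Proof.
wlog b0 : b / 0 <= b.
  move=> H; have [b0|/ltW b0] := leP 0 b; first exact: H.
  by rewrite -normrN -sinN -[leRHS]normrN; apply: H; rewrite oppr_ge0.
have [|c _] := @MVT_segment R sin cos 0 b b0 (fun x _ => is_derive_sin x).
  exact/continuous_subspaceT/continuous_sin.
by rewrite sin0 !subr0 => ->; rewrite normrM ler_piMl// cos_max.
Qed.

Lemma cos_ge_sqr b : 1 - b ^+ 2 <= cos b.
Proof.
have -> : cos b = 1 - sin (b / 2) ^+ 2 *+ 2.
  by rewrite {1}[b](splitr b) cosD -!expr2 cos2sin2; ring.
rewrite lerD2l lerN2 -mulr_natr.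
have h : sin (b / 2) ^+ 2 <= (b / 2) ^+ 2.
  rewrite -[leLHS]real_normK ?num_real// -[leRHS]real_normK ?num_real//.
  by rewrite lerXn2r ?nnegrE// normr_sin_le.
by have := sqr_ge0 b; move: h; rewrite expr_div_n; nra.
Qed.

Lemma sin_taylor b : `|b| <= 1 -> `|sin b - b| <= b ^+ 2.
Proof.
wlog b0 : b / 0 <= b.
  move=> H; have [b0|/ltW b0] := leP 0 b; first exact: H.
  move=> b1; rewrite -normrN opprD -sinN -[b ^+ 2]sqrrN; apply: H.
    by rewrite oppr_ge0.
  by rewrite normrN.
rewrite ger0_norm// => b1.
have [|c] := @MVT_segment R sin cos 0 b b0 (fun x _ => is_derive_sin x).
  exact/continuous_subspaceT/continuous_sin.
rewrite in_itv/= => /andP[c0 cb]; rewrite sin0 !subr0 => ->.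
rewrite -[X in `|_ - X|]mul1r -mulrBl normrM expr2 [ `|b|]ger0_norm//.
rewrite ler_wpM2r// distrC ger0_norm ?subr_ge0 ?cos_le1//.
by have := cos_ge_sqr c; nra.
Qed.

Lemma expR_taylor a : `|a| <= 1 / 2 -> `|expR a - 1 - a| <= 2 * a ^+ 2.
Proof.
rewrite ler_norml => /andP[a1 a2].
have h1 := expR_ge1Dx a; have h2 := expR_ge1Dx (- a).
have h3 := expRxMexpNx_1 a; have h4 := expR_gt0 a.
rewrite ger0_norm; last by lra.
(* From [expR (- a) >= 1 - a]; the next inequality compares [1 / (1 - a)] with
   [1 + a + 2 * a ^+ 2]. *)
have h5 : expR a * (1 - a) <= 1 by rewrite -h3 ler_pM2l//; lra.
have h6 : (1 + a + 2 * a ^+ 2) * (1 - a) >= 1.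
  have := sqr_ge0 a; nra.
have h7 : 0 < 1 - a by lra.
have : expR a <= 1 + a + 2 * a ^+ 2 by rewrite -(ler_pM2r h7); exact: le_trans h6.
by lra.
Qed.

End RealBounds.

(** * The complex exponential and its logarithm *)

Section Cexp.
Variable R : realType.
Implicit Types (v w h : R[i]) (t : R).

Lemma cexp0 : cexp 0 = 1 :> R[i].
Proof. by rewrite /cexp /= expR0 cos0 sin0 mul1r. Qed.

Lemma cexp_neq0 w : cexp w != 0.
Proof.
apply/eqP => w0; have : cexp w * cexp (- w) = 1 by rewrite -cexpD subrr cexp0.
by move/eqP; rewrite w0 mul0r eq_sym oner_eq0.
Qed.

Lemma cexpN w : cexp (- w) = (cexp w)^-1.
Proof.
apply: (mulfI (cexp_neq0 w)).
by rewrite -cexpD subrr cexp0 divff// cexp_neq0.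
Qed.

Lemma normr_cexp w : `|cexp w| = (expR (complex.Re w))%:C.
Proof.
rewrite /cexp normrM normc_def /= expr0n addr0 sqrtr_sqr ger0_norm ?expR_ge0//.
by rewrite normc_def /= cos2Dsin2 sqrtr1 mulr1.
Qed.

Lemma cexp_i t : cexp ('i * t%:C) = cos t +i* sin t.
Proof. by rewrite /cexp /= !mul0r !mul1r subr0 add0r expR0 mul1r. Qed.

Lemma cexp_sum (I : Type) (r : seq I) (P : pred I) (F : I -> R[i]) :
  cexp (\sum_(i <- r | P i) F i) = \prod_(i <- r | P i) cexp (F i).
Proof. by apply: (big_morph (@cexp R) (@cexpD R) cexp0). Qed.

Lemma cexpMn w (n : nat) : cexp (n%:R * w) = cexp w ^+ n.
Proof.
elim: n => [|n IH]; first by rewrite mul0r cexp0 expr0.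
by rewrite -natr1 mulrDl mul1r cexpD IH exprSr.
Qed.

Lemma cexp_2pi (k : int) : cexp ('i * (2 * pi * k%:~R)%:C) = 1 :> R[i].
Proof.
have nat_case (n : nat) : cexp ('i * (2 * pi * n%:R)%:C) = 1 :> R[i].
  have -> : 'i * (2 * pi * n%:R)%:C = n%:R * ('i * (2 * pi)%:C) :> R[i].
    by rewrite (rmorphM _ (2 * pi)) rmorph_nat; ring.
  by rewrite cexpMn cexp_i mulr_natl cos2pi sin2pi expr1n.
case: k => n; first exact: nat_case.
by rewrite NegzE intrN mulrN rmorphN mulrN cexpN nat_case invr1.
Qed.

Lemma cexp_i_eq1 t : `|t| < 2 * pi -> cexp ('i * t%:C) = 1 -> t = 0.
Proof.
rewrite cexp_i => tpi /eqP; rewrite eq_complex /= => /andP[/eqP ct _].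
have : sin (`|t| / 2) = 0.
  apply/eqP; rewrite -sqrf_eq0 sin2cos2.
  have : cos `|t| = 1 by rewrite cos_norm.
  rewrite {1}[ `|t|](splitr `|t|) cosD -!expr2 sin2cos2 => h; apply/eqP; lra.
have [->//|t0 st] := eqVneq t 0.
have : 0 < sin (`|t| / 2).
  by apply: sin_gt0_pi; rewrite divr_gt0 ?normr_gt0//= ltr_pdivrMr// mulrC.
by rewrite st ltxx.
Qed.

(** A logarithm with imaginary part at most [pi] in absolute value; this bound later keeps the
    singular points of [singular_family] in a compact set. *)
Lemma cexp_surj w : w != 0 -> exists2 v, `|complex.Im v| <= pi & cexp v = w.
Proof.
move=> w0.
have nw : 0 < `|w| by rewrite normr_gt0.
set u := w / `|w|.
have nu : `|u| = 1 by rewrite /u normf_div normr_id divff ?gt_eqF.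
have [t tpi tu] : exists2 t, `|t| <= pi & cexp ('i * t%:C) = u.
  have : (complex.Re u) ^+ 2 + (complex.Im u) ^+ 2 = 1.
    apply: complexI; rewrite add_Re2_Im2 nu expr1n//.
  case: (u) => x y /= xy.
  have x1 : -1 <= x <= 1 by nra.
  have ys : sin (acos x) = `|y|.
    rewrite sin_acos// -sqrtr_sqr; congr Num.sqrt; lra.
  have ap : `|acos x| <= pi by rewrite ger0_norm ?acos_ge0// acos_lepi.
  have [y0|y0] := leP 0 y.
    by exists (acos x); rewrite // cexp_i acosK// ys ger0_norm.
  by exists (- acos x); rewrite ?normrN// cexp_i cosN sinN acosK// ys ltr0_norm// opprK.
have /complex_realP[r rw] : `|w| \is Num.real by [].
have r0 : 0 < r by rewrite -ltcR -rw.
exists ((ln r)%:C + 'i * t%:C); first by rewrite /= !mul0r mul1r !add0r.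
rewrite cexpD tu.
have -> : cexp (ln r)%:C = r%:C by rewrite /cexp/= cos0 sin0 mulr1 lnK.
by rewrite -rw /u mulrC divfK// gt_eqF.
Qed.

Lemma ler_normc_ReIm h : `|h| <= (`|complex.Re h| + `|complex.Im h|)%:C.
Proof.
rewrite normc_def lecR -[leRHS]ger0_norm ?addr_ge0// -sqrtr_sqr ler_wsqrtr//.
rewrite sqrrD !real_normK ?num_real// -addrA lerD2l lerDr.
by rewrite mulrn_wge0// mulr_ge0.
Qed.

Lemma Re_le_normc h : (`|complex.Re h|)%:C <= `|h|.
Proof. exact: normc_ge_Re. Qed.

Lemma Im_le_normc h : (`|complex.Im h|)%:C <= `|h|.
Proof.
by rewrite normc_def lecR -sqrtr_sqr ler_wsqrtr// lerDr sqr_ge0.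
Qed.


(** Only the quadratic order matters, for continuity and for the derivative; the constant 20 is not
    sharp. *)
Lemma cexp_taylor h : `|h| <= (1 / 2)%:C -> `|cexp h - 1 - h| <= 20%:R * `|h| ^+ 2.
Proof.
case: h => a b h2.
have ha : `|a| <= 1 / 2 by have := le_trans (Re_le_normc _) h2; rewrite lecR.
have hb : `|b| <= 1 / 2 by have := le_trans (Im_le_normc _) h2; rewrite lecR.
have hb1 : `|b| <= 1 by lra.
rewrite -add_Re2_Im2 /= -(rmorph_nat (real_complex R)) -rmorphM.
apply: le_trans (ler_normc_ReIm _) _; rewrite lecR /=.
have e1 : expR a * cos b - 0 * sin b - 1 - a = (expR a - 1 - a) * cos b + (1 + a) * (cos b - 1) by ring.
have e2 : expR a * sin b + 0 * cos b - 0 - b = (expR a - 1 - a) * sin b + (1 + a) * (sin b - b) + a * b by ring.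
rewrite e1 e2.
have ea := expR_taylor ha; have sb := sin_taylor hb1.
have cb : `|cos b - 1| <= b ^+ 2.
  by rewrite distrC ger0_norm ?subr_ge0 ?cos_le1//; have := cos_ge_sqr b; lra.
have a1 : `|1 + a| <= 3 / 2.
  by rewrite (le_trans (ler_normD _ _))// normr1; lra.
have ab : `|a * b| <= a ^+ 2 + b ^+ 2.
  rewrite normrM -[a ^+ 2]real_normK ?num_real// -[b ^+ 2]real_normK ?num_real//.
  by have := sqr_ge0 (`|a| - `|b|); have := sqr_ge0 `|a|; have := sqr_ge0 `|b|; nra.
have t1 : `|(expR a - 1 - a) * cos b| <= 2 * a ^+ 2.
  by rewrite normrM -[leRHS]mulr1; apply: ler_pM => //; exact: cos_max.
have t2 : `|(expR a - 1 - a) * sin b| <= 2 * a ^+ 2.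
  by rewrite normrM -[leRHS]mulr1; apply: ler_pM => //; exact: sin_max.
have t3 : `|(1 + a) * (cos b - 1)| <= 3 / 2 * b ^+ 2 by rewrite normrM; apply: ler_pM.
have t4 : `|(1 + a) * (sin b - b)| <= 3 / 2 * b ^+ 2 by rewrite normrM; apply: ler_pM.
have := ler_normD ((expR a - 1 - a) * cos b) ((1 + a) * (cos b - 1)).
have := ler_normD ((expR a - 1 - a) * sin b + (1 + a) * (sin b - b)) (a * b).
have := ler_normD ((expR a - 1 - a) * sin b) ((1 + a) * (sin b - b)).
have := sqr_ge0 a; have := sqr_ge0 b; lra.
Qed.

End Cexp.

(** * Characters of the lattice: continuity and derivatives *)

Section Phase.
Variable R : realType.
Local Notation C := (R[i]^o).

Lemma ltr0c (k : R) : (0 < k%:C) = (0 < k).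
Proof. by rewrite -(ltcR 0). Qed.

Lemma cexp_small (h : R[i]) : `|h| <= (1 / 2)%:C -> `|cexp h - 1| <= 11%:R * `|h|.
Proof.
move=> h2; have -> : cexp h - 1 = (cexp h - 1 - h) + h by rewrite subrK.
rewrite (le_trans (ler_normD _ _))//.
have -> : 11%:R * `|h| = 10%:R * `|h| + `|h| by rewrite -[11%N]/(10 + 1)%N natrD mulrDl mul1r.
rewrite lerD2r (le_trans (cexp_taylor h2))//.
have -> : 20%:R * `|h| ^+ 2 = 10%:R * `|h| * (2 * `|h|) by ring.
rewrite ler_piMr ?mulr_ge0//.
apply: le_trans (ler_wpM2l _ h2) _ => //.
by rewrite -(rmorph_nat (real_complex R)) -rmorphM mul1r mulfV// lexx.
Qed.

Lemma continuous_cexp : continuous (cexp : C -> C).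
Proof.
move=> z; apply/(@cvgrPdist_lt _ _ _ _ (nbhs_filter z)) => e e0; near=> w.
have -> : cexp w = cexp z * cexp (w - z) by rewrite -cexpD addrC subrK.
rewrite -[X in `|X - _|]mulr1 -mulrBr normrM distrC.
have wz : `|w - z| <= (1 / 2)%:C.
  near: w; apply: filterS (@nbhsx_ballx _ C z (1 / 2)%:C _); last by rewrite ltr0c.
  by move=> w /ltW; rewrite distrC.
apply: (le_lt_trans (ler_wpM2l (normr_ge0 _) (cexp_small wz))).
rewrite mulrA -ltr_pdivlMl ?mulr_gt0 ?normr_gt0 ?cexp_neq0//.
near: w; apply: filterS (@nbhsx_ballx _ C z ((`|cexp z| * 11%:R)^-1 * e) _).
  by move=> w; rewrite /ball/= distrC.
by rewrite mulr_gt0// invr_gt0 mulr_gt0 ?normr_gt0 ?cexp_neq0.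
Unshelve. all: by end_near. Qed.

Lemma cexp_derive (c : R[i]) : (h^-1 * (cexp (h * c) - 1) : C) @[h --> (0 : C)^'] --> (c : C).
Proof.
apply/cvgrPdist_lt => e e0; near=> h.
have h0 : h != 0 by near: h; exact: (@nbhs_dnbhs_neq C).
have -> : c - h^-1 * (cexp (h * c) - 1) = - (h^-1 * (cexp (h * c) - 1 - h * c)).
  by rewrite [in RHS]mulrBr mulKf// opprB.
rewrite normrN normrM normfV.
have hc : `|h * c| <= (1 / 2)%:C.
  have c1 : 0 < `|c| + 1 by rewrite ltr_wpDl.
  apply: (@le_trans _ _ (`|h| * (`|c| + 1))); first by rewrite normrM ler_wpM2l// lerDl.
  rewrite -ler_pdivlMr//; apply/ltW; near: h; apply: (@dnbhs0_lt _ C).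
  by rewrite divr_gt0// ltr0c.
have h0' : 0 < `|h| by rewrite normr_gt0.
rewrite mulrC ltr_pdivrMr//; apply: (le_lt_trans (cexp_taylor hc)).
rewrite normrM exprMn.
have -> : 20%:R * (`|h| ^+ 2 * `|c| ^+ 2) = (20%:R * `|c| ^+ 2 * `|h|) * `|h| by ring.
rewrite ltr_pM2r//.
have c1 : 0 < 20%:R * `|c| ^+ 2 + 1 by rewrite ltr_wpDl// mulr_ge0// exprn_ge0.
apply: (@le_lt_trans _ _ ((20%:R * `|c| ^+ 2 + 1) * `|h|)); first by rewrite ler_wpM2r// lerDl.
rewrite -ltr_pdivlMl//; near: h; apply: (@dnbhs0_lt _ C).
by rewrite mulr_gt0// invr_gt0.
Unshelve. all: by end_near. Qed.

Variable d : nat.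
Implicit Types (n : 'rV[int]_d) (z v : 'rV[C]_d).

Definition dotz n z : R[i] := \sum_(l < d) (n 0 l)%:~R * z 0 l.

Lemma phaseE n z : phase n z = cexp ('i * dotz n z).
Proof. by []. Qed.

Lemma dotzDr n z v : dotz n (z + v) = dotz n z + dotz n v.
Proof. by rewrite -big_split; apply: eq_bigr => l _; rewrite mxE mulrDr. Qed.

Lemma dotzZr n (h : R[i]) v : dotz n (h *: v : 'rV[C]_d) = h * dotz n v.
Proof. by rewrite mulr_sumr; apply: eq_bigr => l _; rewrite mxE mulrCA. Qed.

Lemma phase0 z : phase 0 z = 1.
Proof.
by rewrite phaseE /dotz big1 ?mulr0 ?cexp0// => l _; rewrite mxE mul0r.
Qed.

Lemma phase_neq0 n z : phase n z != 0.
Proof. exact: cexp_neq0. Qed.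

Lemma phaseN n z : phase (- n) z = (phase n z)^-1.
Proof.
by apply: (mulfI (phase_neq0 n z)); rewrite -phaseD subrr phase0 divff// phase_neq0.
Qed.

Lemma phaseDr n z v : phase n (z + v) = phase n z * phase n v.
Proof. by rewrite !phaseE dotzDr mulrDr cexpD. Qed.

Lemma continuous_sum (T : topologicalType) (I : Type) (r : seq I) (P : pred I) (F : I -> T -> C) :
  (forall i, continuous (F i)) -> continuous (fun x => \sum_(i <- r | P i) F i x : C).
Proof.
move=> Fc; elim: r => [|i r IH] x.
  by under eq_fun do rewrite big_nil; exact: cvg_cst.
under eq_fun do rewrite big_cons; case: (P i); last exact: IH.
by apply: (@continuousD _ C); [exact: Fc | exact: IH].
Qed.

Lemma continuous_dotz n : continuous (dotz n : 'rV[C]_d -> C).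
Proof.
apply: continuous_sum => l z.
apply: (@continuousM R[i] _ (fun=> (n 0 l)%:~R) (fun z : 'rV[C]_d => z 0 l)).
  exact: cst_continuous.
exact: coord_continuous.
Qed.

Lemma continuous_phase n : continuous (phase n : 'rV[C]_d -> C).
Proof.
move=> z; apply: (@continuous_comp _ C C (fun z : 'rV[C]_d => 'i * dotz n z)); last first.
  exact: continuous_cexp.
by apply: (@continuousM R[i] _ (fun=> 'i) (dotz n)); [exact: cst_continuous | exact: continuous_dotz].
Qed.

Lemma is_derive_phase n z v :
  is_derive z v (phase n : 'rV[C]_d -> C) (phase n z * ('i * dotz n v) : C).
Proof.
have cv : (h^-1 *: ((phase n \o shift z) (h *: v) - phase n z) : C) @[h --> (0 : C)^'] -->
    (phase n z * ('i * dotz n v) : C).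
  have ringE (h a E : R[i]) : h^-1 * (a * E - a) = a * (h^-1 * (E - 1)) by ring.
  have -> : (fun h : C => (h^-1 *: ((phase n \o shift z) (h *: v) - phase n z) : C)) =
      (fun h : C => phase n z * (h^-1 * (cexp (h * ('i * dotz n v)) - 1))).
    apply/funext => h /=.
    have -> : phase n (h *: v + z) = phase n z * cexp (h * ('i * dotz n v)).
      by rewrite addrC phaseDr; congr (_ * _); rewrite phaseE dotzZr mulrCA.
    exact: ringE.
  by apply: cvgM; [exact: cvg_cst | exact: cexp_derive].
apply: DeriveDef; last exact: cvg_lim.
by apply/cvg_ex; eexists; exact: cv.
Qed.

End Phase.

(** * Trigonometric polynomials and their action on lattice functions *)

Section Tpoly.
Variables (R : realType) (d : nat).
Local Notation C := (R[i]^o).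
Implicit Types (n : 'rV[int]_d) (z : 'rV[C]_d) (x : 'rV[R]_d).

(** Pairs of a coefficient and a frequency; a frequency may occur several times, and [tcoef] gives
    its total coefficient. *)
Definition tpoly := seq (R[i] * 'rV[int]_d).
Implicit Types (l : tpoly).

Definition tev l z : R[i] := \sum_(t <- l) t.1 * phase t.2 z.

Definition tmul l1 l2 : tpoly := [seq (s.1 * t.1, s.2 + t.2) | s <- l1, t <- l2].

Definition tconj l : tpoly := [seq (conjc t.1, - t.2) | t <- l].

Lemma tev_cat l1 l2 z : tev (l1 ++ l2) z = tev l1 z + tev l2 z.
Proof. by rewrite /tev big_cat. Qed.

Lemma tev_mul l1 l2 z : tev (tmul l1 l2) z = tev l1 z * tev l2 z.
Proof.
rewrite /tev /tmul big_allpairs_dep mulr_suml; apply: eq_bigr => s _.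
by rewrite mulr_sumr; apply: eq_bigr => t _ /=; rewrite phaseD mulrACA.
Qed.

Definition rdot n x : R := \sum_(l < d) (n 0 l)%:~R * x 0 l.

Lemma phase_real n x : phase n (realpt x) = cexp ('i * (rdot n x)%:C).
Proof.
rewrite phaseE; congr (cexp (_ * _)); rewrite rmorph_sum; apply: eq_bigr => l _.
by rewrite rmorphM rmorph_int !mxE.
Qed.

Lemma rdotN n x : rdot (- n) x = - rdot n x.
Proof. by rewrite -sumrN; apply: eq_bigr => l _; rewrite mxE intrN mulNr. Qed.

Lemma conj_phase n x : conjc (phase n (realpt x)) = phase (- n) (realpt x).
Proof. by rewrite !phase_real rdotN !cexp_i cosN sinN. Qed.

Lemma tev_conj l x : tev (tconj l) (realpt x) = conjc (tev l (realpt x)).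
Proof.
rewrite /tev big_map rmorph_sum; apply: eq_bigr => t _.
by rewrite rmorphM; congr (_ * _); rewrite -conj_phase.
Qed.

Lemma normr_phase_real n x : `|phase n (realpt x)| = 1.
Proof. by rewrite phase_real cexp_i normc_def /= cos2Dsin2 sqrtr1. Qed.

Definition istp (f : 'rV[C]_d -> R[i]) := exists l, f =1 tev l.

Lemma istp_const (c : R[i]) : istp (fun=> c).
Proof.
by exists [:: (c, 0)] => z; rewrite /tev big_seq1 phase0 mulr1.
Qed.

Lemma istp_phase n : istp (phase n).
Proof. by exists [:: (1, n)] => z; rewrite /tev big_seq1 mul1r. Qed.

Lemma istp_ext (f g : 'rV[C]_d -> R[i]) : f =1 g -> istp g -> istp f.
Proof. by move=> fg [l gl]; exists l => z; rewrite fg gl. Qed.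

Lemma istpD f g : istp f -> istp g -> istp (fun z => f z + g z).
Proof. by move=> [l fl] [k gk]; exists (l ++ k) => z; rewrite tev_cat fl gk. Qed.

Lemma istpM f g : istp f -> istp g -> istp (fun z => f z * g z).
Proof. by move=> [l fl] [k gk]; exists (tmul l k) => z; rewrite tev_mul fl gk. Qed.

Lemma istpN f : istp f -> istp (fun z => - f z).
Proof.
by move=> hf; apply: istp_ext (istpM (istp_const (-1)) hf) => z; rewrite mulN1r.
Qed.

Lemma istp_sum (I : Type) (r : seq I) (P : pred I) (F : I -> 'rV[C]_d -> R[i]) :
  (forall i, istp (F i)) -> istp (fun z => \sum_(i <- r | P i) F i z).
Proof.
move=> hF; elim: r => [|i r IH].
  by apply: istp_ext (istp_const 0) => z; rewrite big_nil.
have := IH; have [Pi|Pi] := boolP (P i) => hs.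
  by apply: istp_ext (istpD (hF i) hs) => z; rewrite big_cons Pi.
by apply: istp_ext hs => z; rewrite big_cons (negPf Pi).
Qed.

Lemma istp_prod (I : Type) (r : seq I) (F : I -> 'rV[C]_d -> R[i]) :
  (forall i, istp (F i)) -> istp (fun z => \prod_(i <- r) F i z).
Proof.
move=> hF; elim: r => [|i r IH].
  by apply: istp_ext (istp_const 1) => z; rewrite big_nil.
by apply: istp_ext (istpM (hF i) IH) => z; rewrite big_cons.
Qed.

Lemma istp_det k (A : 'rV[C]_d -> 'M[R[i]]_k) : (forall i j, istp (fun z => A z i j)) ->
  istp (fun z => \det (A z)).
Proof.
move=> hA; apply: istp_sum => s; apply: istpM; first exact: istp_const.
by apply: istp_prod => i; apply: hA.
Qed.

Lemma istp_adj k (A : 'rV[C]_d -> 'M[R[i]]_k) i j : (forall i j, istp (fun z => A z i j)) ->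
  istp (fun z => (\adj (A z)) i j).
Proof.
move=> hA; apply: istp_ext (istpM (istp_const ((-1) ^+ (j + i)))
  (istp_det (A := fun z => row' j (col' i (A z))) _)) => [z|k1 k2].
  by rewrite mxE.
by apply: istp_ext (hA (lift j k1) (lift i k2)) => z; rewrite !mxE.
Qed.

(** Convolution with the coefficients of [l]; on the Fourier side this is multiplication by
    [tev l]. *)
Definition tact l (v : 'rV[int]_d -> R[i]) n : R[i] := \sum_(t <- l) t.1 * v (n - t.2).

Lemma tact_cat l1 l2 v n : tact (l1 ++ l2) v n = tact l1 v n + tact l2 v n.
Proof. by rewrite /tact big_cat. Qed.

Lemma tact_mul l1 l2 v n : tact (tmul l1 l2) v n = tact l1 (tact l2 v) n.
Proof.
rewrite /tact /tmul big_allpairs_dep; apply: eq_bigr => s _.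
by rewrite mulr_sumr; apply: eq_bigr => t _ /=; rewrite mulrA opprD addrA.
Qed.

Definition finite_supp (v : 'rV[int]_d -> R[i]) := exists S : seq 'rV[int]_d, forall n, v n != 0 -> n \in S.

Lemma tact_finsupp l v : finite_supp v -> finite_supp (tact l v).
Proof.
move=> [S vS]; exists [seq s + t.2 | s <- S, t <- l] => n; apply: contraNT => nS.
rewrite /tact big_seq big1// => t tl.
have [/vS ntS|/negbNE/eqP ->] := boolP (v (n - t.2) != 0); last by rewrite mulr0.
case/negP: nS; apply/allpairsP; exists (n - t.2, t); split=> //=.
by rewrite subrK.
Qed.

Lemma finsuppD v w : finite_supp v -> finite_supp w -> finite_supp (fun n => v n + w n).
Proof.
move=> [S vS] [T wT]; exists (S ++ T) => n; rewrite mem_cat; apply: contraR.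
rewrite negb_or => /andP[nS nT].
have -> : v n = 0 by apply/eqP; apply: contraNT nS; exact: vS.
have -> : w n = 0 by apply/eqP; apply: contraNT nT; exact: wT.
by rewrite addr0.
Qed.

Lemma finsupp_sum (I : Type) (r : seq I) (F : I -> 'rV[int]_d -> R[i]) :
  (forall i, finite_supp (F i)) -> finite_supp (fun n => \sum_(i <- r) F i n).
Proof.
move=> hF; elim: r => [|i r IH].
  by exists [::] => n; rewrite big_nil eqxx.
have [S hS] := finsuppD (hF i) IH.
by exists S => n; rewrite big_cons; exact: hS.
Qed.

Definition tcoef l n : R[i] := \sum_(t <- l | t.2 == n) t.1.

Lemma big_group l (V : nmodType) (F : R[i] * 'rV[int]_d -> V) :
  \sum_(t <- l) F t = \sum_(m <- undup (map snd l)) \sum_(t <- l | t.2 == m) F t.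
Proof.
rewrite (exchange_big_dep xpredT)//=; apply: eq_big_seq => t tl.
rewrite (eq_bigl (pred1 t.2)); last by move=> m; rewrite /= eq_sym.
by rewrite -big_filter filter_pred1_uniq ?undup_uniq ?big_seq1// mem_undup map_f.
Qed.

Lemma tact_coef l v n : tact l v n = \sum_(m <- undup (map snd l)) tcoef l m * v (n - m).
Proof.
rewrite /tact big_group; apply: eq_bigr => m _; rewrite mulr_suml.
by apply: eq_bigr => t /eqP ->.
Qed.

Lemma tev_coef l z : tev l z = \sum_(m <- undup (map snd l)) tcoef l m * phase m z.
Proof.
rewrite /tev big_group; apply: eq_bigr => m _; rewrite mulr_suml.
by apply: eq_bigr => t /eqP ->.
Qed.

End Tpoly.

(** * Unimodular coordinates separating finitely many frequencies *)

Section Digits.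

(** Modulo [N] only the last digit survives, and it is smaller than [N] in absolute value, hence
    zero; the rest is divided by [N]. *)
Lemma digits0 (N : nat) k (dl : nat -> int) : (forall i, (i < k)%N -> (`|dl i| < N)%N) ->
  \sum_(i < k) dl i * (N ^ (k.-1 - i))%:Z = 0 -> forall i, (i < k)%N -> dl i = 0.
Proof.
elim: k => // k IH dlN; rewrite big_ord_recr/= subnn expn0 mulr1 => s0.
have e : \sum_(i < k) dl i * (N ^ (k - i))%:Z = N%:Z * \sum_(i < k) dl i * (N ^ (k.-1 - i))%:Z.
  rewrite mulr_sumr; apply: eq_bigr => i _; rewrite mulrCA -PoszM -expnS.
  by congr (_ * (_ ^ _)%N%:Z); case: k i {IH dlN s0} => [[//]|k] i /=; rewrite subSn// -ltnS.
rewrite e in s0.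
have dk : dl k = 0.
  have : (N%:Z %| dl k)%Z.
    have -> : dl k = - (N%:Z * \sum_(i < k) dl i * (N ^ (k.-1 - i))%:Z).
      by apply/eqP; rewrite -addr_eq0 addrC s0.
    by rewrite rpredN dvdz_mulr.
  rewrite dvdzE /= => /dvdn_leq h; apply/eqP; rewrite -absz_eq0; apply: contraT.
  rewrite -lt0n => /h; rewrite leqNgt dlN//.
move: s0; rewrite dk addr0 => /eqP; rewrite mulf_eq0 => /orP[/eqP [N0]|/eqP s0].
  by move=> i ik; have := dlN i ik; rewrite N0.
move=> i; rewrite ltnS leq_eqVlt => /predU1P[-> //|ik].
by apply: IH => // j jk; apply/dlN/ltnW.
Qed.

Lemma seq_argmax (T : eqType) (s : seq T) (f : T -> int) x0 : x0 \in s ->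
  exists2 x, x \in s & forall y, y \in s -> f y <= f x.
Proof.
elim: s x0 => // x s IH x0 _; case: s IH => [|x1 s] IH.
  by exists x; rewrite ?mem_head// => y; rewrite inE => /eqP ->.
have [y ys ymax] := IH x1 (mem_head _ _).
have [xy|yx] := leP (f x) (f y).
  exists y; first by rewrite inE ys orbT.
  by move=> z; rewrite inE => /predU1P[->//|/ymax].
exists x; first by rewrite mem_head.
move=> z; rewrite inE => /predU1P[->//|/ymax h]; exact: le_trans h (ltW yx).
Qed.

Variable m : nat.
Implicit Types n : 'rV[int]_m.+1.

Definition matK (N : nat) : 'M[int]_m.+1 :=
  \matrix_(i, j) if j == ord_max then (N ^ (m - i))%:Z else (i == j)%:Z.

Definition matS (M : nat) : 'M[int]_m.+1 :=
  \matrix_(i, j) if i == ord_max then (if j == ord_max then 1 else - M%:Z) else (i == j)%:Z.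

(* A Kronecker-type substitution: the new last coordinate separates the points
   of a finite set, and the other ones are sheared by it. *)
Definition coordB N M := matK N *m matS M.

Lemma coordB_unit N M : coordB N M \in unitmx.
Proof.
rewrite unitmx_mul; apply/andP; split; rewrite unitmxE.
  rewrite -det_tr det_trig; last first.
    apply/is_trig_mxP => i j ij; rewrite !mxE ifN.
      by rewrite [_ == _](gtn_eqF ij).
    by rewrite -val_eqE /= ltn_eqF// (leq_trans ij)// -ltnS.
  rewrite big1 ?unitr1// => i _; rewrite !mxE eqxx.
  by case: eqP => // ->; rewrite subnn.
rewrite det_trig; last first.
  apply/is_trig_mxP => i j ij; rewrite !mxE ifN.
    by rewrite [_ == _](ltn_eqF ij).
  by rewrite -val_eqE /= ltn_eqF// (leq_trans ij)// -ltnS.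
by rewrite big1 ?unitr1// => i _; rewrite !mxE eqxx; case: eqP.
Qed.

Definition phiN N n : int := \sum_(i < m.+1) n 0 i * (N ^ (m - i))%:Z.

Lemma mul_matK N n j : (n *m matK N) 0 j = if j == ord_max then phiN N n else n 0 j.
Proof.
rewrite mxE; case: eqP => [->|/eqP jm].
  by apply: eq_bigr => i _; rewrite mxE eqxx.
rewrite (bigD1 j)//= mxE (negPf jm) eqxx mulr1 big1 ?addr0// => i ij.
by rewrite mxE (negPf jm) (negPf ij) mulr0.
Qed.

Lemma coordBE N M n j : (n *m coordB N M) 0 j =
  if j == ord_max then phiN N n else n 0 j - M%:Z * phiN N n.
Proof.
rewrite /coordB mulmxA mxE; case: eqP => [->|/eqP jm].
  rewrite (bigD1 ord_max)//= mul_matK !mxE eqxx mulr1 big1 ?addr0// => i im.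
  by rewrite !mxE (negPf im) mulr0.
rewrite (bigD1 j)//= (bigD1 ord_max)/=; last by rewrite eq_sym.
rewrite big1 ?addr0; last first.
  by move=> i /andP[ij im]; rewrite [matS _ _ _]mxE (negPf im) (negPf ij) mulr0.
rewrite !mul_matK (negPf jm) eqxx !mxE eqxx (negPf jm) eqxx mulr1.
by rewrite mulrN mulrC.
Qed.

Lemma phiN_inj N n n' : (forall i, (`|(n - n')%R 0%R i| < N)%N) -> phiN N n = phiN N n' -> n = n'.
Proof.
move=> hN e; apply/rowP => i; apply/eqP; rewrite -subr_eq0.
pose dl (i : nat) := (n - n') 0 (inord i).
have -> : n 0 i - n' 0 i = dl i by rewrite /dl inord_val !mxE.
apply/eqP; apply: (@digits0 N m.+1 dl _ _ i (ltn_ord i)); first by move=> k km; apply: hN.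
move: e => /eqP; rewrite -subr_eq0 -sumrB => /eqP e; rewrite -[RHS]e; apply: eq_bigr => j _.
by rewrite /dl inord_val !mxE mulrBl.
Qed.

End Digits.

(** * Cauchy-Schwarz and Fourier analysis on finite grids *)

Section CauchySchwarz.
Variable R : realType.

(** Lagrange's identity for the absolute values: the gap is half a sum of squares. *)
Lemma cs_sum (I : Type) (r : seq I) (a b : I -> R[i]) :
  `|\sum_(i <- r) a i * b i| ^+ 2 <= (\sum_(i <- r) `|a i| ^+ 2) * (\sum_(i <- r) `|b i| ^+ 2).
Proof.
pose x i := `|a i|; pose y i := `|b i|.
have xy : `|\sum_(i <- r) a i * b i| <= \sum_(i <- r) x i * y i.
  by rewrite (le_trans (ler_norm_sum _ _ _))// ler_sum// => i _; rewrite normrM.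
have s0 : 0 <= \sum_(i <- r) x i * y i by rewrite sumr_ge0// => i _; rewrite mulr_ge0 ?normr_ge0.
apply: (@le_trans _ _ ((\sum_(i <- r) x i * y i) ^+ 2)).
  by apply: lerXn2r xy; rewrite nnegrE ?normr_ge0.
rewrite -[X in X ^+ 2 <= _]/(\sum_(i <- r) x i * y i) -subr_ge0.
have : 0 <= \sum_(i <- r) \sum_(j <- r) (x i * y j - x j * y i) ^+ 2.
  rewrite sumr_ge0// => i _; rewrite sumr_ge0// => j _.
  by rewrite real_exprn_even_ge0// rpredB ?rpredM ?normr_real.
have -> : \sum_(i <- r) \sum_(j <- r) (x i * y j - x j * y i) ^+ 2 =
  2%:R * ((\sum_(i <- r) x i ^+ 2) * (\sum_(i <- r) y i ^+ 2) - (\sum_(i <- r) x i * y i) ^+ 2).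
  rewrite mulr_natl mulr2n -[X in _ + X]opprK opprB -addrA; set S := _ ^+ 2.
  have -> : - S - (S - (\sum_(i <- r) x i ^+ 2) * (\sum_(i <- r) y i ^+ 2)) =
    (\sum_(i <- r) y i ^+ 2) * (\sum_(i <- r) x i ^+ 2) - (2%:R * S) by ring.
  rewrite /S expr2 !big_distrlr/= mulr_sumr -sumrB -big_split; apply: eq_bigr => i _ /=.
  rewrite mulr_sumr -sumrB -big_split; apply: eq_bigr => j _ /=.
  by ring.
by rewrite pmulr_rge0.
Qed.

End CauchySchwarz.

Section Grid.
Variables (R : realType) (d : nat).
Local Notation C := (R[i]^o).
Implicit Types (n : 'rV[int]_d) (z : 'rV[C]_d) (x b : 'rV[R]_d) (l : tpoly R d) (N : nat).

Definition gpt N b (k : {ffun 'I_d -> 'I_N}) : 'rV[R]_d :=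
  \row_l (b 0 l + 2 * pi * (k l)%:R / N%:R).

(** A Riemann sum in place of the integral over the torus; by [avg_phase] it is exact on characters
    with frequency entries below [N]. *)
Definition avg N b (f : 'rV[R]_d -> R[i]) : R[i] :=
  (N%:R ^- d) * \sum_(k : {ffun 'I_d -> 'I_N}) f (gpt b k).

Lemma geom_root N (j : int) : (`|j| < N)%N ->
  \sum_(t < N) cexp ('i * (2 * pi * j%:~R * t%:R / N%:R)%:C) = (N * (j == 0))%:R :> R[i].
Proof.
move=> jN; have N0 : (0 < N)%N by apply: leq_ltn_trans jN.
have [->|j0] := eqVneq j 0.
  rewrite muln1 (eq_bigr (fun=> 1)) => [|t _]; first by rewrite sumr_const card_ord.
  by rewrite mulr0 !mul0r mulr0 cexp0.
rewrite muln0; pose th : R := 2 * pi * j%:~R / N%:R; pose w := cexp ('i * th%:C).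
have -> : \sum_(t < N) cexp ('i * (2 * pi * j%:~R * t%:R / N%:R)%:C) = \sum_(t < N) w ^+ t.
  apply: eq_bigr => t _; rewrite -cexpMn; congr cexp.
  rewrite mulrCA -(rmorph_nat (real_complex R)) -rmorphM; congr (_ * _%:C).
  by rewrite /th; ring.
have wN : w ^+ N = 1.
  rewrite -cexpMn mulrCA -(rmorph_nat (real_complex R)) -rmorphM -(cexp_2pi R j).
  by congr (cexp (_ * _%:C)); rewrite /th mulrC divfK// pnatr_eq0 -lt0n.
have w1 : w - 1 != 0.
  rewrite subr_eq0; apply: contra_neq j0 => w1.
  have : th = 0.
    apply: cexp_i_eq1 => //; rewrite /th !normrM normfV ger0_norm// (ger0_norm (pi_ge0 R)) normr_nat.
    rewrite -[ltRHS]mulr1 -mulrA ltr_pM2l ?mulr_gt0 ?pi_gt0//.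
    by rewrite ltr_pdivrMr ?ltr0n// mul1r -intr_norm -[N%:R]/((N%:Z)%:~R) ltr_int -abszE ltz_nat.
  move/eqP; rewrite /th !mulf_eq0 invr_eq0 !pnatr_eq0 (gt_eqF (pi_gt0 R)) intr_eq0.
  by rewrite (gtn_eqF N0)/= orbF => /eqP.
by apply: (mulfI w1); rewrite -subrX1 wN subrr mulr0.
Qed.

Lemma avg_phase N b n : (0 < N)%N -> (forall j, (`|n 0%R j| < N)%N) ->
  avg N b (fun x => phase n (realpt x)) = (n == 0)%:R.
Proof.
move=> N0 nN; rewrite /avg.
pose W (l : 'I_d) (t : 'I_N) : R[i] := cexp ('i * (2 * pi * (n 0 l)%:~R * t%:R / N%:R)%:C).
have -> : \sum_(k : {ffun 'I_d -> 'I_N}) phase n (realpt (gpt b k)) =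
    phase n (realpt b) * \sum_(k : {ffun 'I_d -> 'I_N}) \prod_l W l (k l).
  rewrite mulr_sumr; apply: eq_bigr => k _.
  rewrite /W -cexp_sum !phase_real -cexpD -mulr_sumr -mulrDr -rmorph_sum -rmorphD.
  congr (cexp (_ * _%:C)); rewrite -big_split; apply: eq_bigr => l _ /=.
  by rewrite mxE; ring.
rewrite -(bigA_distr_bigA W).
under eq_bigr do rewrite geom_root//.
have [->|n0] := eqVneq n 0.
  rewrite phase0 mul1r (eq_bigr (fun=> N%:R)) => [|l _]; last by rewrite mxE eqxx muln1.
  by rewrite prodr_const card_ord mulVf// expf_neq0// pnatr_eq0 -lt0n.
have [j nj] : exists j, n 0 j != 0.
  apply/existsP; apply: contraNT n0; rewrite negb_exists => /forallP h.
  by apply/eqP/rowP => l; have := h l; rewrite negbK mxE => /eqP.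
by rewrite (bigD1 j)//= (negPf nj) muln0 mul0r !mulr0.
Qed.

Lemma avg_sum N b (I : Type) (r : seq I) (F : I -> 'rV[R]_d -> R[i]) :
  avg N b (fun x => \sum_(i <- r) F i x) = \sum_(i <- r) avg N b (F i).
Proof. by rewrite /avg exchange_big mulr_sumr. Qed.

Lemma avgZ N b c f : avg N b (fun x => c * f x) = c * avg N b f.
Proof. by rewrite /avg -mulr_sumr mulrCA. Qed.

Lemma eq_avg N b f g : f =1 g -> avg N b f = avg N b g.
Proof. by move=> fg; rewrite /avg (eq_bigr _ (fun k _ => fg (gpt b k))). Qed.

(** Two distinct frequencies of [l] then remain distinct modulo [N], so the grid does not confuse
    them. *)
Definition large N l := (0 < N)%N /\
  forall s t, s \in l -> t \in l -> forall j, (`|s.2 0%R j - t.2 0%R j| < N)%N.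

Lemma large_ex (l : tpoly R d) : exists N0, forall N, (N0 <= N)%N -> large N l.
Proof.
pose F (s t : R[i] * 'rV[int]_d) : nat := (\sum_(j < d) `|s.2 0%R j - t.2 0%R j|)%N.
exists (\sum_(s <- l) \sum_(t <- l) F s t).+1 => N hN; split; first exact: leq_trans hN.
move=> s t sl tl j; apply: leq_trans hN; rewrite ltnS.
rewrite (big_rem s)//= (leq_trans _ (leq_addr _ _))// (big_rem t)//=.
by rewrite (leq_trans _ (leq_addr _ _))// /F (bigD1 j)//= leq_addr.
Qed.

Lemma avg_tev N b l : (0 < N)%N -> (forall t, t \in l -> forall j, (`|t.2 0%R j| < N)%N) ->
  avg N b (fun x => tev l (realpt x)) = tcoef l 0.
Proof.
move=> N0 lN; rewrite /tev avg_sum /tcoef [RHS]big_mkcond/=; apply: eq_big_seq => t tl.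
rewrite avgZ avg_phase//; last exact: lN.
by case: eqP; rewrite ?mulr1 ?mulr0.
Qed.

Lemma parseval N b l : large N l ->
  avg N b (fun x => `|tev l (realpt x)| ^+ 2) = \sum_(m <- undup (map snd l)) `|tcoef l m| ^+ 2.
Proof.
move=> [N0 lN]; set E := undup _.
rewrite (@eq_avg N b _ (fun x => \sum_(m <- E) \sum_(m' <- E) (tcoef l m * conjc (tcoef l m')) * phase (m - m') (realpt x))).
  rewrite avg_sum; apply: eq_big_seq => m mE; rewrite avg_sum.
  rewrite (eq_big_seq (fun m' => if m' == m then `|tcoef l m| ^+ 2 else 0)).
    by rewrite -big_mkcond -big_filter filter_pred1_uniq ?undup_uniq ?big_seq1.
  move=> m' m'E; rewrite avgZ avg_phase//.
    by rewrite subr_eq0 eq_sym; case: eqP => [->|]; rewrite ?mulr1 ?mulr0// sqr_normc.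
  move=> j; move: mE m'E; rewrite !mem_undup => /mapP[s sl ->] /mapP[t tl ->].
  by rewrite !mxE; apply: lN.
move=> x; rewrite sqr_normc tev_coef -/E rmorph_sum mulr_suml; apply: eq_bigr => m _.
rewrite mulr_sumr; apply: eq_bigr => m' _.
by rewrite rmorphM phaseD mulrACA -conj_phase.
Qed.

Definition sqsummable (v : 'rV[int]_d -> R[i]) (M : R[i]) :=
  forall S, uniq S -> \sum_(n <- S) `|v n| ^+ 2 <= M.

(** Cauchy-Schwarz against the coefficients of [l], whose square sum is a grid average by
    [parseval]. This is how bounds for symbols on the real torus become bounds for [v]. *)
Lemma tact_bound N b l v M : large N l -> sqsummable v M ->
  `|tact l v 0| ^+ 2 <= M * avg N b (fun x => `|tev l (realpt x)| ^+ 2).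
Proof.
move=> lN vM; rewrite parseval// tact_coef mulrC; apply: le_trans (cs_sum _ _ _) _.
rewrite ler_wpM2l//; first by rewrite sumr_ge0// => m _; rewrite exprn_ge0.
under eq_bigr do rewrite sub0r.
rewrite -(big_map (fun n => - n) xpredT (fun n => `|v n| ^+ 2)); apply: vM.
by rewrite map_inj_uniq ?undup_uniq//; exact: oppr_inj.
Qed.

End Grid.

(** * Elementary power inequalities *)

Section Bernoulli.
Variable R : realFieldType.
Implicit Types a : R.

Lemma bernoulli_sub a K : 0 <= a -> a <= 1 -> 1 - K%:R * a <= (1 - a) ^+ K.
Proof.
move=> a0 a1; elim: K => [|K IH]; first by rewrite mul0r subr0.
rewrite exprS; apply: le_trans (ler_wpM2l _ IH); last by rewrite subr_ge0.
have K0 : 0 <= K%:R :> R by [].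
by rewrite -natr1; nra.
Qed.

Lemma bernoulli_add a K : 0 <= a -> 1 + K%:R * a <= (1 + a) ^+ K.
Proof.
move=> a0; elim: K => [|K IH]; first by rewrite mul0r addr0.
rewrite exprS; apply: le_trans (ler_wpM2l _ IH); last by rewrite addr_ge0.
have K0 : 0 <= K%:R :> R by [].
by rewrite -natr1; nra.
Qed.

End Bernoulli.

Lemma expr_small (R : realType) (a e : R) : 0 <= a -> a < 1 -> 0 < e -> exists K, a ^+ K <= e.
Proof.
move=> a0 a1 e0; have b0 : 0 < 1 - a by rewrite subr_gt0.
exists (Num.bound ((e * (1 - a))^-1)); set K := Num.bound _.
have Kb : (e * (1 - a))^-1 < K%:R.
  by have := archi_boundP (x := (e * (1 - a))^-1); apply; rewrite invr_ge0 mulr_ge0// ltW.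
have h1 : a ^+ K * (1 + K%:R * (1 - a)) <= 1.
  have h2 : a ^+ K * (1 + K%:R * (1 - a)) <= a ^+ K * (1 + (1 - a)) ^+ K.
    by rewrite ler_wpM2l ?exprn_ge0// bernoulli_add// ltW.
  apply: (le_trans h2); rewrite -exprMn exprn_ile1//; nra.
have h3 : 1 < K%:R * (e * (1 - a)).
  by rewrite -ltr_pdivrMr ?mulr_gt0// mul1r.
have h4 : 0 < 1 + K%:R * (1 - a) by rewrite addr_gt0//; nra.
rewrite -(ler_pM2r h4); apply: (le_trans h1); nra.
Qed.

(** * Square-summable functions tested against a real symbol *)

Section L2.
Variables (R : realType) (d : nat).
Local Notation C := (R[i]^o).
Implicit Types (n : 'rV[int]_d) (z : 'rV[C]_d) (x b : 'rV[R]_d) (N K : nat).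

Definition avgR N b (f : 'rV[R]_d -> R) : R :=
  (N%:R ^- d) * \sum_(k : {ffun 'I_d -> 'I_N}) f (gpt b k).

Lemma avgRE N b f : (avgR N b f)%:C = avg N b (fun x => (f x)%:C).
Proof.
by rewrite /avg /avgR rmorphM fmorphV rmorphXn rmorph_nat rmorph_sum.
Qed.

Lemma ler_avgR N b f g : (forall x, f x <= g x) -> avgR N b f <= avgR N b g.
Proof.
move=> fg; rewrite /avgR ler_wpM2l ?invr_ge0 ?exprn_ge0//.
by rewrite ler_sum.
Qed.

Lemma avgR_ge0 N b f : (forall x, 0 <= f x) -> 0 <= avgR N b f.
Proof. by move=> f0; rewrite mulr_ge0 ?invr_ge0 ?exprn_ge0// sumr_ge0. Qed.

Lemma avgRZ N b c f : avgR N b (fun x => c * f x) = c * avgR N b f.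
Proof. by rewrite /avgR -mulr_sumr mulrCA. Qed.

Lemma avgRD N b f g : avgR N b (fun x => f x + g x) = avgR N b f + avgR N b g.
Proof. by rewrite /avgR -mulrDr -big_split. Qed.

Lemma avgR_cst N b c : (0 < N)%N -> avgR N b (fun=> c) = c.
Proof.
move=> N0; rewrite /avgR sumr_const card_ffun !card_ord -[c *+ _]mulr_natl natrX mulrA mulVf ?mul1r//.
by rewrite expf_neq0// pnatr_eq0 -lt0n.
Qed.

Definition nsq (z : R[i]) : R := complex.Re z ^+ 2 + complex.Im z ^+ 2.

Lemma nsqE (z : R[i]) : (nsq z)%:C = `|z| ^+ 2.
Proof. exact: add_Re2_Im2. Qed.

Lemma nsq_ge0 (z : R[i]) : 0 <= nsq z.
Proof. by rewrite addr_ge0 ?sqr_ge0. Qed.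

Lemma nsqM (z w : R[i]) : nsq (z * w) = nsq z * nsq w.
Proof. by case: z => a b; case: w => e f; rewrite /nsq /=; ring. Qed.

Lemma nsqR (r : R) : nsq r%:C = r ^+ 2.
Proof. by rewrite /nsq /= expr0n addr0. Qed.

Lemma nsq_conj (z : R[i]) : nsq (conjc z) = nsq z.
Proof. by case: z => a b; rewrite /nsq /= sqrrN. Qed.

Variables (lq : tpoly R d) (v : 'rV[int]_d -> R[i]) (M : R).
Hypothesis lq_real : forall x, conjc (tev lq (realpt x)) = tev lq (realpt x).
Hypothesis vM : sqsummable v M%:C.

Definition qR x : R := complex.Re (tev lq (realpt x)).

Lemma qRE x : tev lq (realpt x) = (qR x)%:C.
Proof.
have := lq_real x; rewrite /qR; case: (tev _ _) => a b /= /eqP.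
by rewrite eq_complex/= eqxx => /eqP h; have -> : b = 0 by lra.
Qed.

(** An upper bound for the squared symbol, raised by 1 so that it is never below 1. *)
Definition Bq : R := (complex.Re (\sum_(t <- lq) `|t.1|)) ^+ 2 + 1.

Lemma Bq_gt0 : 0 < Bq.
Proof. by rewrite ltr_wpDl// sqr_ge0. Qed.

Lemma tev_le (l : tpoly R d) x : `|tev l (realpt x)| <= \sum_(t <- l) `|t.1|.
Proof.
rewrite (le_trans (ler_norm_sum _ _ _))// ler_sum// => t _.
by rewrite normrM normr_phase_real mulr1.
Qed.

Lemma qR_le x : qR x ^+ 2 <= Bq.
Proof.
rewrite /Bq; have := tev_le lq x.
have /complex_realP[r ->] : \sum_(t <- lq) `|t.1| \is Num.real.
  by apply: rpred_sum => t _; exact: normr_real.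
rewrite qRE normc_def /= expr0n addr0 sqrtr_sqr lecR => h.
rewrite ler_wpDr// -[leLHS]real_normK ?num_real//.
by apply: lerXn2r => //; rewrite nnegrE (le_trans _ h).
Qed.

(** Partial sum of the geometric series of [Bq / t]. On the interval from 0 to [Bq] the product
    [t * psi K t] stays below [Bq], while [psi K t] is of order [K] when [t] is of order [1 / K].
    Being polynomial in [t], it turns [q^2] into a trigonometric polynomial. *)
Definition psi K (t : R) : R := \sum_(k < K) (1 - t / Bq) ^+ k.

Lemma istpX (f : 'rV[C]_d -> R[i]) k : istp f -> istp (fun z => f z ^+ k).
Proof.
move=> hf; elim: k => [|k IH]; first exact: istp_const.
by apply: istp_ext (istpM hf IH) => z; rewrite exprS.
Qed.

Lemma psi_tp K : exists l : tpoly R d, forall x, tev l (realpt x) = (psi K (qR x ^+ 2))%:C.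
Proof.
have [l hl] : istp (fun z => \sum_(k < K) (1 - tev lq z ^+ 2 * (Bq^-1)%:C) ^+ k).
  apply: istp_sum => k; apply/istpX/istpD/istpN/istpM; [exact: istp_const| | exact: istp_const].
  by apply: istpX; exists lq.
exists l => x; rewrite -hl rmorph_sum; apply: eq_bigr => k _.
by rewrite qRE -rmorphXn -rmorphM -(rmorph1 (real_complex R)) -rmorphB -rmorphXn.
Qed.

Lemma psi_ge0 K t : 0 <= t -> t <= Bq -> 0 <= psi K t.
Proof.
move=> t0 tB; apply: sumr_ge0 => k _; apply: exprn_ge0.
by rewrite subr_ge0 ler_pdivrMr ?Bq_gt0// mul1r.
Qed.

Lemma psi_geom K t : t * psi K t = Bq * (1 - (1 - t / Bq) ^+ K).
Proof.
have := subrX1 (1 - t / Bq) K; rewrite -/(psi K t) => e.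
have -> : 1 - (1 - t / Bq) ^+ K = t / Bq * psi K t.
  by rewrite -opprB e -mulNr; congr (_ * _); ring.
by rewrite mulrA mulrCA divff ?mulr1// gt_eqF// Bq_gt0.
Qed.

Lemma psi_lower K t : 0 <= t -> t * (2 * K%:R) <= Bq -> K%:R / 2 <= psi K t.
Proof.
move=> t0 tK; have B0 := Bq_gt0.
have [->|K0] := posnP K; first by rewrite mul0r /psi big_ord0.
have K1 : 1 <= K%:R :> R by rewrite ler1n.
have a0 : 0 <= t / Bq by rewrite divr_ge0// ltW.
have aK : K%:R * (t / Bq) <= 1 / 2.
  by rewrite mulrA ler_pdivrMr//; lra.
have a1 : t / Bq <= 1 by nra.
have -> : K%:R / 2 = \sum_(k < K) (1 / 2 : R).
  by rewrite sumr_const card_ord -[RHS]mulr_natl mul1r.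
apply: ler_sum => k _; apply: le_trans (bernoulli_sub k a0 a1).
have kK : k%:R <= K%:R :> R by rewrite ler_nat ltnW.
by nra.
Qed.

(* [l = conj(g) * psi] is the test function: [q^2 psi <= Bq] by the geometric sum. *)
Lemma avg_psi_bound (gl : tpoly R d) : (forall n, tact lq v n = tcoef gl n) ->
  forall K, exists N0, forall N, (N0 <= N)%N -> forall b,
    avgR N b (fun x => nsq (tev gl (realpt x)) * psi K (qR x ^+ 2)) <= M * Bq.
Proof.
move=> hg K; have [ps hps] := psi_tp K.
pose l := tmul (tconj gl) ps.
have [N1 hN1] := large_ex ((0, 0) :: tmul l gl); have [N2 hN2] := large_ex (tmul l lq).
exists (maxn N1 N2) => N; rewrite geq_max => /andP[/hN1 [N0 lN1] /hN2 lN2] b.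
set G := fun x => nsq (tev gl (realpt x)); set A := avgR _ _ _.
have A0 : 0 <= A.
  by apply: avgR_ge0 => x; rewrite mulr_ge0 ?nsq_ge0// psi_ge0 ?sqr_ge0// qR_le.
have tl : tact (tmul l lq) v 0 = A%:C.
  rewrite tact_mul avgRE -(@eq_avg _ _ N b (fun x => tev (tmul l gl) (realpt x))); last first.
    move=> x; rewrite tev_mul tev_mul tev_conj hps mulrAC [X in X * _]mulrC.
    by rewrite -sqr_normc -nsqE -rmorphM.
  rewrite avg_tev//; last first.
    move=> t tl j; have := lN1 (0, 0) t (mem_head _ _).
    by rewrite inE tl orbT => /(_ isT j); rewrite mxE sub0r abszN.
  rewrite /tcoef /tmul big_mkcond big_allpairs_dep/=; apply: eq_bigr => s _.
  rewrite hg /tcoef sub0r mulr_sumr [LHS]big_mkcond; apply: eq_bigr => t _ /=.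
  by rewrite -addr_eq0 addrC.
have := tact_bound b lN2 vM; rewrite tl.
have -> : avg N b (fun x => `|tev (tmul l lq) (realpt x)| ^+ 2) =
    (avgR N b (fun x => G x * psi K (qR x ^+ 2) * (qR x ^+ 2 * psi K (qR x ^+ 2))))%:C.
  rewrite avgRE; apply: eq_avg => x; rewrite !tev_mul tev_conj hps qRE -nsqE !nsqM nsq_conj !nsqR.
  by congr (_%:C); rewrite /G; ring.
have -> : `|A%:C| ^+ 2 = (A ^+ 2)%:C by rewrite -nsqE nsqR.
rewrite -rmorphM lecR => h.
have h2 : avgR N b (fun x => G x * psi K (qR x ^+ 2) * (qR x ^+ 2 * psi K (qR x ^+ 2))) <= Bq * A.
  rewrite -avgRZ; apply: ler_avgR => x; rewrite mulrC ler_wpM2r//.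
    by rewrite mulr_ge0 ?nsq_ge0// psi_ge0 ?sqr_ge0// qR_le.
  rewrite psi_geom ger_pMr ?Bq_gt0// gerBl exprn_ge0//.
  by rewrite subr_ge0 ler_pdivrMr ?Bq_gt0// mul1r qR_le.
have M0 : 0 <= M by have := vM (isT : uniq [::]); rewrite big_nil lecR.
have h3 : A * A <= (M * Bq) * A.
  by rewrite -expr2 (le_trans h)// -mulrA ler_wpM2l.
have [A00|A00] := eqVneq A 0.
  by rewrite A00 mulr_ge0// ltW// Bq_gt0.
by move: h3; rewrite ler_pM2r// lt_neqAle eq_sym A00.
Qed.

(** As [q] annihilates [v], the value [v n] can be computed with the character at [- n] multiplied
    by [(1 - q^2 / Bq)^K], which changes it by a multiple of [q] only. The mean square of this
    symbol is at most the proportion of grid points with [q^2 <= eta] plus a power of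
    [1 - eta / Bq], and both are small. *)
Lemma kernel_trivial :
  (forall e : R, 0 < e -> exists2 eta : R, 0 < eta & exists N0, forall N, (N0 <= N)%N ->
     avgR N 0 (fun x => ((qR x ^+ 2 <= eta)%R)%:R) <= e) ->
  (forall n, tact lq v n = 0) -> forall n, v n = 0.
Proof.
move=> small hv n; have B0 := Bq_gt0.
have M0 : 0 <= M by have := vM (isT : uniq [::]); rewrite big_nil lecR.
suff H e : 0 < e -> nsq (v n) <= M * e.
  have vn : nsq (v n) <= 0.
    apply/ler_addgt0Pr => e e0; rewrite add0r.
    have M1 : 0 < M + 1 by rewrite ltr_wpDl.
    apply: le_trans (H (e / (M + 1)) _) _; first by rewrite divr_gt0.
    by rewrite mulrA ler_pdivrMr//; nra.
  apply/eqP; rewrite -normr_eq0 -sqrf_eq0 -nsqE; apply/eqP; congr (_%:C).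
  by apply/le_anti; rewrite vn nsq_ge0.
move=> e0; have e20 : 0 < e / 2 by rewrite divr_gt0.
have [eta eta0 [N1 hN1]] := small _ e20.
wlog etaB : eta eta0 hN1 / eta <= Bq.
  move=> W; have [/W|/ltW Be] := leP eta Bq; first exact.
  apply: (W Bq) => // N /hN1; apply: le_trans; apply: ler_avgR => x.
  by rewrite ler_nat; case: (leP _ Bq) => // h; rewrite (le_trans h).
have a0 : 0 <= 1 - eta / Bq by rewrite subr_ge0 ler_pdivrMr// mul1r.
have a1 : 1 - eta / Bq < 1 by rewrite gtrBl divr_gt0.
have [K hK] := expr_small a0 a1 e20.
have [ps hps] := psi_tp K.
(* [l0] is the cofactor of [q]: by the geometric sum, [phase (- n)] plus [l0] times [q] equals
   [phase (- n)] times [(1 - q^2 / Bq)^K]. *)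
have [l0 hl0] : exists l0 : tpoly R d, forall x, tev l0 (realpt x) =
    phase (- n) (realpt x) * (- (qR x / Bq * psi K (qR x ^+ 2)))%:C.
  have [l0 hl0] : istp (fun z => phase (- n) z * (- (tev lq z * (Bq^-1)%:C * tev ps z))).
    apply: istpM; first exact: istp_phase.
    apply/istpN/istpM; last by exists ps.
    by apply: istpM; [exists lq | exact: istp_const].
  by exists l0 => x; rewrite -hl0 hps qRE rmorphN !rmorphM.
pose l := (1, - n) :: tmul l0 lq.
have [N2 hN2] := large_ex l.
pose N := (maxn N1 N2).+1.
have lN : large N l by apply: hN2; rewrite ltnW// ltnS leq_maxr.
have N1N : (N1 <= N)%N by rewrite ltnW// ltnS leq_maxl.
have tl : tact l v 0 = v n.
  have h0 : tact l0 (tact lq v) 0 = 0 by apply: big1 => t _; rewrite hv mulr0.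
  by rewrite /tact big_cons -/(tact _ _ _) tact_mul h0 addr0 mul1r sub0r opprK.
have hl x : tev l (realpt x) = phase (- n) (realpt x) * ((1 - qR x ^+ 2 / Bq) ^+ K)%:C.
  rewrite /tev big_cons -/(tev _ _) tev_mul hl0 qRE mul1r -mulrA -[X in X + _]mulr1 -mulrDr -rmorphM.
  rewrite -(rmorph1 (real_complex R)) -rmorphD; congr (_ * _%:C).
  have -> : (1 - qR x ^+ 2 / Bq) ^+ K = 1 - qR x ^+ 2 * psi K (qR x ^+ 2) / Bq.
    by rewrite psi_geom [Bq * _]mulrC mulfK ?gt_eqF// subKr.
  by ring.
have := tact_bound 0 lN vM; rewrite tl -nsqE.
have -> : avg N 0 (fun x => `|tev l (realpt x)| ^+ 2) =
    (avgR N 0 (fun x => ((1 - qR x ^+ 2 / Bq) ^+ K) ^+ 2))%:C.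
  rewrite avgRE; apply: eq_avg => x; rewrite hl normrM normr_phase_real mul1r.
  by rewrite -nsqE nsqR.
rewrite -rmorphM lecR => h; apply: (le_trans h); rewrite ler_wpM2l//.
rewrite [leRHS](splitr e); apply: le_trans (lerD (hN1 N N1N) hK).
rewrite -[X in _ <= _ + X](@avgR_cst N 0)// -avgRD; apply: ler_avgR => x.
have b0 : 0 <= 1 - qR x ^+ 2 / Bq by rewrite subr_ge0 ler_pdivrMr// mul1r qR_le.
have b1 : 1 - qR x ^+ 2 / Bq <= 1 by rewrite gerBl divr_ge0 ?sqr_ge0// ltW.
case: (leP (qR x ^+ 2) eta) => hx.
  by rewrite ler_wpDr ?exprn_ge0// exprn_ile1// ?exprn_ge0// exprn_ile1.
rewrite add0r expr2 -[leRHS]mulr1; apply: ler_pM; rewrite ?exprn_ge0//; last by rewrite exprn_ile1.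
rewrite lerXn2r ?nnegrE// lerD2l lerN2 ler_wpM2r ?invr_ge0; [by []|exact: ltW|exact: ltW].
Qed.

End L2.

(** * Counting grid points and slicing the grid *)

Section Count.
Variable R : realType.

Lemma count_lt N (x : R) : 0 <= x -> x <= N%:R ->
  x - 1 <= \sum_(t < N) ((t%:R < x)%R)%:R <= x + 1.
Proof.
move=> x0 xN; have /andP[n1 n2] := truncn_itv x0; set n := Num.truncn x in n1 n2.
have cnt m : (m <= N)%N -> \sum_(t < N) ((t < m)%N)%:R = m%:R :> R.
  move=> mN; have -> : m%:R = \sum_(t < m) 1 :> R by rewrite sumr_const card_ord.
  rewrite (big_ord_widen N (fun=> 1)) // [RHS]big_mkcond/=.
  by apply: eq_bigr => t _; case: ifP.
have nN : (n <= N)%N by rewrite -(ler_nat R) (le_trans n1).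
apply/andP; split.
  apply: (@le_trans _ _ n%:R); first by rewrite lerBlDr natr1 ltW.
  rewrite -(cnt n)// ler_sum// => t _; rewrite ler_nat.
  case: (ltnP t n) => // tn; rewrite (lt_le_trans _ n1)// ltr_nat//.
have [nN'|Nn] := ltnP n N; last first.
  apply: (@le_trans _ _ N%:R); last by rewrite (le_trans _ (_ : n%:R <= _)) ?ler_nat// ler_wpDr.
  have -> : N%:R = \sum_(t < N) 1 :> R by rewrite sumr_const card_ord.
  by apply: ler_sum => t _; rewrite -[leRHS]/(1%:R) ler_nat leq_b1.
apply: (@le_trans _ _ n.+1%:R); last by rewrite -natr1 lerD2r.
rewrite -(cnt n.+1)// ler_sum// => t _; rewrite ler_nat.
case: ltP => // tx; rewrite -(ltr_nat R) (lt_trans tx)//.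
Qed.

(** Rounding costs at most one point at each end. *)
Lemma count_itv N (A B : R) : 0 <= A -> A <= B -> B <= N%:R ->
  B - A - 2 <= \sum_(t < N) ((A <= t%:R <= B)%R)%:R.
Proof.
move=> A0 AB BN; have B0 := le_trans A0 AB; have AN := le_trans AB BN.
have /andP[cB _] := count_lt B0 BN; have /andP[_ cA] := count_lt A0 AN.
apply: (@le_trans _ _ (\sum_(t < N) ((t%:R < B)%R)%:R - \sum_(t < N) ((t%:R < A)%R)%:R)); first by lra.
rewrite -sumrB ler_sum// => t _.
case: (ltP _ A) => tA /=; first by rewrite subr_le0 ler_nat leq_b1.
by rewrite subr0 ler_nat; case: ltP => // /ltW ->.
Qed.

Lemma count_arc N (s al be : R) : (0 < N)%N -> s <= al -> al <= be -> be <= s + 2 * pi ->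
  N%:R * (be - al) / (2 * pi) - 2 <= \sum_(t < N) ((al <= s + 2 * pi * t%:R / N%:R <= be)%R)%:R.
Proof.
move=> N0 sal albe bes; have pi0 := pi_gt0 R; have pi2 : 0 < 2 * pi :> R by lra.
have Nr : 0 < N%:R :> R by rewrite ltr0n.
pose A := (al - s) * N%:R / (2 * pi); pose B := (be - s) * N%:R / (2 * pi).
have A0 : 0 <= A by rewrite divr_ge0 ?mulr_ge0 ?subr_ge0// ltW.
have AB : A <= B by rewrite ler_pM2r ?invr_gt0// ler_pM2r// lerD2r.
have BN : B <= N%:R by rewrite ler_pdivrMr// mulrC ler_pM2l//; lra.
have -> : N%:R * (be - al) / (2 * pi) = B - A by rewrite /A /B; ring.
apply: le_trans (count_itv A0 AB BN) _; apply: ler_sum => t _; rewrite ler_nat.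
have -> : (A <= t%:R) = (al <= s + 2 * pi * t%:R / N%:R).
  by rewrite /A ler_pdivrMr// -lerBlDl ler_pdivlMr// [t%:R * _]mulrC.
have -> // : (t%:R <= B) = (s + 2 * pi * t%:R / N%:R <= be).
by rewrite /B ler_pdivlMr// -lerBrDl ler_pdivrMr// [t%:R * _]mulrC.
Qed.

End Count.

Section Slices.
Variables (R : realType) (d : nat).
Implicit Types (x b : 'rV[R]_d) (N K : nat).

Definition setc x (j : 'I_d) (s : R) : 'rV[R]_d := \row_i (if i == j then s else x 0 i).

Definition updf N (k : {ffun 'I_d -> 'I_N}) (j : 'I_d) (t : 'I_N) : {ffun 'I_d -> 'I_N} :=
  [ffun i => if i == j then t else k i].

Lemma gpt_updf N b (k : {ffun 'I_d -> 'I_N}) j t :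
  gpt b (updf k j t) = setc (gpt b k) j (b 0 j + 2 * pi * t%:R / N%:R).
Proof. by apply/rowP => i; rewrite !mxE ffunE; case: eqP => // ->. Qed.

(** Each grid point is reached [N] times, once for every former value of its [j]-th coordinate. *)
Lemma sum_updf (V : nmodType) N (F : {ffun 'I_d -> 'I_N} -> V) j :
  (\sum_k F k) *+ N = \sum_k \sum_t F (updf k j t).
Proof.
case: N F => [|N] F.
  rewrite mulr0n big1// => k _; apply: big1 => t; by case: t.
transitivity (\sum_(t : 'I_N.+1) \sum_k F k); first by rewrite sumr_const card_ord.
under [RHS]eq_bigr => k _.
  rewrite (reindex_inj (h := fun t => (t + k j)%R)); last by move=> s t /addIr.
  over.
rewrite [RHS]exchange_big/=; apply: eq_bigr => t _.
pose h (k : {ffun 'I_d -> 'I_N.+1}) := updf k j (t + k j)%R.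
rewrite (reindex_inj (h := h))// => k k' kk'.
apply/ffunP => i; have := congr1 (fun f : {ffun 'I_d -> 'I_N.+1} => f i) kk'.
by rewrite !ffunE; case: eqP => [->|//] /addrI.
Qed.

End Slices.

(** * Square integrability near a transverse real zero *)

Section Vanish.
Variables (R : realType) (d : nat) (lq gl : tpoly R d) (v : 'rV[int]_d -> R[i]) (M : R).
Hypothesis lq_real : forall x, conjc (tev lq (realpt x)) = tev lq (realpt x).
Hypothesis vM : sqsummable v M%:C.
Hypothesis hg : forall n, tact lq v n = tcoef gl n.
Local Notation q := (qR lq).
Implicit Types (x : 'rV[R]_d).

(** On each grid line in direction [j] through the box of radius [r'], at least a proportion
    [th / (2 * pi)] of the points lies within [th] of a zero of [q]. There [q^2] is at most
    [Bq / (2 * K)], so [psi] is at least [K / 2]. The product over the other coordinates bounds the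
    proportion of such lines from below. *)
Lemma avg_lower (x0 : 'rV[R]_d) (j : 'I_d) (eta r r' th L : R) K N :
  0 < eta -> 0 < r -> r <= 1 -> 0 < r' -> r' <= r -> 0 < th -> th <= r / 2 ->
  (forall x, (forall i, `|x 0 i - x0 0 i| <= r) -> eta <= nsq (tev gl (realpt x))) ->
  (forall x, (forall i, `|x 0 i - x0 0 i| <= r') ->
     exists2 rho, `|rho - x0 0 j| <= r / 2 & q (setc x j rho) = 0) ->
  (forall x s t, `|q (setc x j s) - q (setc x j t)| <= L * `|s - t|) ->
  (L * th) ^+ 2 * (2 * K%:R) <= Bq lq ->
  2 <= N%:R * th / (2 * pi) -> 2 <= N%:R * r' / (2 * pi) ->
  (\prod_(i < d) (if i == j then 1 else r' / (2 * pi))) * (th / (2 * pi)) * (eta * (K%:R / 2)) <=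
  avgR N (x0 - const_mx pi) (fun x => nsq (tev gl (realpt x)) * psi lq K (q x ^+ 2)).
Proof.
move=> eta0 r0 r1 r'0 r'r th0 thr hG hroot hL hK Nth Nr'.
set b := x0 - _; set F := fun x => _ * _; have pi0 := pi_gt0 R; have pi2 := pi_ge2 R.
have p20 : 0 < 2 * pi :> R by lra.
have N0 : (0 < N)%N by case: (N) Nth => //; rewrite !mul0r; lra.
have NR : 0 < N%:R :> R by rewrite ltr0n.
have Bq0 := Bq_gt0 lq.
have F0 x : 0 <= F x by rewrite mulr_ge0 ?nsq_ge0// psi_ge0 ?sqr_ge0// qR_le.
(* Indicator of the lines through the box: coordinate [j] is unconstrained. *)
pose g (i : 'I_d) (t : 'I_N) : R := if i == j then 1 else
  ((x0 0 i - r' <= b 0 i + 2 * pi * t%:R / N%:R <= x0 0 i + r')%R)%:R.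
have bE i : b 0 i = x0 0 i - pi by rewrite !mxE.
have g0 i t : 0 <= g i t by rewrite /g; case: ifP.
have slice (k : {ffun 'I_d -> 'I_N}) :
    (\prod_i g i (k i)) * (N%:R * (th / (2 * pi)) * (eta * (K%:R / 2))) <= \sum_t F (gpt b (updf k j t)).
  have S0 : 0 <= \sum_t F (gpt b (updf k j t)) by rewrite sumr_ge0.
  have [/forallP kg|] := boolP [forall i, (i == j) || (x0 0 i - r' <= gpt b k 0 i <= x0 0 i + r')]; last first.
    rewrite negb_forall => /existsP[i0]; rewrite negb_or => /andP[ij ki].
    rewrite (bigD1 i0)//= /g (negPf ij); move: ki; rewrite mxE => /negPf ->.
    by rewrite !mul0r.
  have -> : \prod_i g i (k i) = 1.
    apply: big1 => i _; rewrite /g; case: eqP => // /eqP ij; have := kg i.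
    by rewrite (negPf ij) mxE /= => ->.
  rewrite mul1r; pose y := setc (gpt b k) j (x0 0 j).
  have yr' i : `|y 0 i - x0 0 i| <= r'.
    rewrite mxE; case: eqP => [->|/eqP ij]; first by rewrite subrr normr0 ltW.
    have := kg i; rewrite (negPf ij) /= => /andP[k1 k2].
    by rewrite ler_norml; apply/andP; split; lra.
  have [rho rhor qrho] := hroot y yr'; move: rhor; rewrite ler_norml => /andP[rho1 rho2].
  have cnt : N%:R * (th / (2 * pi)) <= \sum_(t < N) ((rho - th <= b 0 j + 2 * pi * t%:R / N%:R <= rho + th)%R)%:R.
    apply: le_trans (count_arc N0 _ _ _); rewrite ?bE; lra.
  apply: (@le_trans _ _ (\sum_(t < N) (((rho - th <= b 0 j + 2 * pi * t%:R / N%:R <= rho + th)%R)%:R * (eta * (K%:R / 2))))).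
    by rewrite -mulr_suml ler_wpM2r// mulr_ge0 ?divr_ge0// ltW.
  apply: ler_sum => t _; case: (boolP (_ <= _ <= _)) => [/andP[t1 t2]|_]; last by rewrite mul0r.
  rewrite mul1r gpt_updf; set s := b 0 j + _ in t1 t2 *.
  have -> : setc (gpt b k) j s = setc y j s.
    by apply/rowP => i; rewrite !mxE; case: eqP.
  have sth : `|s - rho| <= th by rewrite ler_norml; apply/andP; split; lra.
  apply: ler_pM; rewrite ?divr_ge0//; first exact: ltW.
    apply: hG => i; rewrite mxE; case: eqP => [->|_].
      by rewrite ler_norml; apply/andP; split; lra.
    by rewrite (le_trans (yr' i)).
  apply: psi_lower; first exact: sqr_ge0.
  apply: le_trans hK; rewrite ler_wpM2r ?mulr_ge0//.
  have := hL y s rho; rewrite qrho subr0 => h.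
  have hh : `|q (setc y j s)| <= `|L * th|.
    rewrite (le_trans h)// normrM (gtr0_norm th0) (le_trans (ler_wpM2r _ (ler_norm L)))//.
    by rewrite ler_wpM2l.
  rewrite -[leLHS]real_normK ?num_real// -[leRHS]real_normK ?num_real//.
  by apply: lerXn2r.
have prodg : N%:R ^+ d * (\prod_(i < d) (if i == j then 1 else r' / (2 * pi))) <= \sum_(k : {ffun 'I_d -> 'I_N}) \prod_i g i (k i).
  rewrite -(bigA_distr_bigA g) -[d in N%:R ^+ d]card_ord -prodr_const -big_split/=.
  apply: ler_prod => i _; rewrite mulr_ge0 ?ler0n//=.
    rewrite /g; case: eqP => [_|/eqP ij].
      by rewrite mulr1 sumr_const card_ord lexx.
    apply: le_trans (count_arc N0 _ _ _); rewrite ?bE; lra.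
  by case: ifP => // _; rewrite divr_ge0// ltW.
rewrite /avgR -(ler_pM2l (x := N%:R ^+ d)) ?exprn_gt0// [leRHS]mulrA divff ?mul1r; last first.
  by rewrite expf_neq0// gt_eqF.
rewrite -(ler_pM2r NR) [leRHS]mulr_natr (sum_updf _ j).
apply: (@le_trans _ _ (\sum_(k : {ffun 'I_d -> 'I_N}) (\prod_i g i (k i)) * (N%:R * (th / (2 * pi)) * (eta * (K%:R / 2))))); last exact: ler_sum.
rewrite -mulr_suml; set P0 := \prod_(i < d) _.
have -> : N%:R ^+ d * (P0 * (th / (2 * pi)) * (eta * (K%:R / 2))) * N%:R =
  (N%:R ^+ d * P0) * (N%:R * (th / (2 * pi)) * (eta * (K%:R / 2))) by ring.
rewrite ler_wpM2r// !mulr_ge0 ?invr_ge0//; exact: ltW.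
Qed.

(** With [th = c1 / m] and [K = m ^ 2] the bound of [avg_lower] grows like [m], while that of
    [avg_psi_bound] does not depend on [K]. This is the divergence of the integral of [|g|^2 / q^2]
    across a hypersurface of zeros. *)
Lemma l2_vanish (x0 : 'rV[R]_d) (j : 'I_d) (eta r r' L : R) :
  0 < eta -> 0 < r -> r <= 1 -> 0 < r' -> r' <= r ->
  (forall x, (forall i, `|x 0 i - x0 0 i| <= r) -> eta <= nsq (tev gl (realpt x))) ->
  (forall x, (forall i, `|x 0 i - x0 0 i| <= r') ->
     exists2 rho, `|rho - x0 0 j| <= r / 2 & q (setc x j rho) = 0) ->
  (forall x s t, `|q (setc x j s) - q (setc x j t)| <= L * `|s - t|) -> False.
Proof.
move=> eta0 r0 r1 r'0 r'r hG hroot hL.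
have pi0 := pi_gt0 R; have p20 : 0 < 2 * pi :> R by lra.
pose L' := `|L| + 1; have L'0 : 0 < L' by rewrite ltr_wpDl.
have LL' : `|L| <= L' by rewrite lerDl.
(* The first entry keeps the arc in the box; the second makes [(L * th) ^+ 2 * (2 * m ^ 2)] at most
   1/2, hence at most [Bq]. *)
pose c1 := Num.min (r / 2) (1 / (2 * L')).
have c10 : 0 < c1 by rewrite lt_min !divr_gt0// mulr_gt0.
have c1r : c1 <= r / 2 by rewrite ge_min lexx.
have c1L : L' * c1 <= 1 / 2.
  have : c1 <= 1 / (2 * L') by rewrite ge_min lexx orbT.
  by rewrite ler_pdivlMr ?mulr_gt0//; lra.
set P0 := \prod_(i < d) (if i == j then 1 else r' / (2 * pi)).
have P00 : 0 < P0 by apply: prodr_gt0 => i _; case: ifP => // _; rewrite divr_gt0.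
pose c := P0 * (c1 / (2 * pi)) * (eta / 2).
have c0 : 0 < c by rewrite !mulr_gt0// ?invr_gt0.
have := archi_boundP (x := `|M * Bq lq| / c); rewrite divr_ge0 ?(ltW c0)// => /(_ isT).
set m := Num.bound _ => hm.
have m0 : (0 < m)%N by rewrite -(ltr_nat R) (le_lt_trans _ hm)// divr_ge0// ltW.
have mR : 0 < m%:R :> R by rewrite ltr0n.
have m1 : 1 <= m%:R :> R by rewrite ler1n.
pose th := c1 / m%:R; have th0 : 0 < th by rewrite divr_gt0.
have thc : th <= c1 by rewrite ler_pdivrMr// ler_peMr// ltW.
have [N1 hN1] := avg_psi_bound lq_real vM hg (m ^ 2).
have bound_ex (y : R) : 0 < y -> exists N2, forall N, (N2 <= N)%N -> 2 <= N%:R * y / (2 * pi).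
  move=> y0; have := archi_boundP (x := 2 * (2 * pi) / y); rewrite divr_ge0 ?mulr_ge0 ?(ltW y0) ?(ltW pi0)// => /(_ isT).
  set N2 := Num.bound _ => h; exists N2 => N hN.
  rewrite ler_pdivlMr// -ler_pdivrMr//; apply/ltW/(lt_le_trans h).
  by rewrite ler_nat.
have [N2 hN2] := bound_ex _ th0; have [N3 hN3] := bound_ex _ r'0.
pose N := (N1 + N2 + N3)%N.
have h1 := hN1 N (leq_trans (leq_addr _ _) (leq_addr _ _)) (x0 - const_mx pi).
have h2 : 2 <= N%:R * th / (2 * pi) by apply: hN2; rewrite /N addnAC addnC leq_addr.
have h3 : 2 <= N%:R * r' / (2 * pi) by apply: hN3; rewrite /N leq_addl.
have hK : (L * th) ^+ 2 * (2 * (m ^ 2)%:R) <= Bq lq.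
  have -> : (L * th) ^+ 2 * (2 * (m ^ 2)%:R) = 2 * (`|L| * c1) ^+ 2.
    by rewrite natrX /th !exprMn real_normK ?num_real// exprVn; field; rewrite gt_eqF.
  have h : `|L| * c1 <= 1 / 2 by rewrite (le_trans _ c1L)// ler_wpM2r// ltW.
  have h0 : 0 <= `|L| * c1 by rewrite mulr_ge0// ltW.
  have : (`|L| * c1) ^+ 2 <= 1 / 4 by nra.
  by rewrite /Bq; have := sqr_ge0 (complex.Re (\sum_(t <- lq) `|t.1|)); lra.
have := avg_lower eta0 r0 r1 r'0 r'r th0 (le_trans thc c1r) hG hroot hL hK h2 h3.
rewrite -/P0 => /le_trans /(_ h1).
have -> : P0 * (th / (2 * pi)) * (eta * ((m ^ 2)%:R / 2)) = c * m%:R.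
  have fieldE (p mm A B e : R) : p != 0 -> mm != 0 ->
      A * (B / mm / (2 * p)) * (e * (mm ^+ 2 / 2)) = A * (B / (2 * p)) * (e / 2) * mm.
    by move=> p0 mm0; field; rewrite p0 mm0.
  by rewrite natrX fieldE// lt0r_neq0.
by move: hm; rewrite ltr_pdivrMr// => hm h; have := ler_norm (M * Bq lq); lra.
Qed.

End Vanish.

(** * Derivatives and Lipschitz bounds of trigonometric polynomials *)

Section RealPoints.
Variables (R : realType) (d : nat).
Local Notation C := (R[i]^o).
Implicit Types (n : 'rV[int]_d) (z v : 'rV[C]_d) (x y : 'rV[R]_d) (l : tpoly R d).

Definition tder l v : tpoly R d := [seq (t.1 * ('i * dotz t.2 v), t.2) | t <- l].

Lemma tev_cons t l z : tev (t :: l) z = t.1 * phase t.2 z + tev l z.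
Proof. by rewrite /tev big_cons. Qed.

Lemma is_derive_tev l z v : is_derive z v (tev l : 'rV[C]_d -> C) (tev (tder l v) z : C).
Proof.
elim: l => [|t l IH].
  have -> : (tev [::] : 'rV[C]_d -> C) = cst 0 by apply/funext => w; rewrite /tev big_nil.
  exact: is_derive_cst.
have -> : (tev (t :: l) : 'rV[C]_d -> C) = (t.1 : C) *: (phase t.2 : 'rV[C]_d -> C) + tev l.
  by apply/funext => w; rewrite tev_cons.
have -> : tev (tder (t :: l) v) z = (t.1 : C) *: (phase t.2 z * ('i * dotz t.2 v) : C) + tev (tder l v) z :> C.
  by rewrite /= tev_cons /=; congr (_ + _); rewrite -mulrA [_ * phase _ _]mulrC.
apply: is_deriveD; apply: is_deriveZ; exact: is_derive_phase.
Qed.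

Lemma continuous_tev l : continuous (tev l : 'rV[C]_d -> C).
Proof.
apply: continuous_sum => t z.
by apply: (@continuousM R[i] _ (fun=> t.1) (phase t.2)); [exact: cst_continuous | exact: continuous_phase].
Qed.

Lemma cos_lip (s t : R) : `|cos s - cos t| <= `|s - t|.
Proof.
wlog st : s t / s <= t.
  by move=> H; have [/H|/ltW /H] := leP s t; rewrite // distrC [leRHS]distrC.
have [|c _] := @MVT_segment R cos (fun u => - sin u) s t st (fun u _ => is_derive_cos u).
  exact/continuous_subspaceT/continuous_cos.
by rewrite distrC [leRHS]distrC => ->; rewrite normrM normrN ler_piMl// sin_max.
Qed.

Lemma sin_lip (s t : R) : `|sin s - sin t| <= `|s - t|.
Proof.
wlog st : s t / s <= t.
  by move=> H; have [/H|/ltW /H] := leP s t; rewrite // distrC [leRHS]distrC.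
have [|c _] := @MVT_segment R sin cos s t st (fun u _ => is_derive_sin u).
  exact/continuous_subspaceT/continuous_sin.
by rewrite distrC [leRHS]distrC => ->; rewrite normrM ler_piMl// cos_max.
Qed.

Definition dist1 x y : R := \sum_(i < d) `|x 0 i - y 0 i|.

Lemma tev_lip l : exists2 L : R, 0 <= L & forall x y,
  `|tev l (realpt x) - tev l (realpt y)| <= (L * dist1 x y)%:C.
Proof.
elim: l => [|t l [L L0 IH]].
  by exists 0 => // x y; rewrite /tev !big_nil subrr normr0 mul0r.
have /complex_realP[c ct] : `|t.1| \is Num.real by exact: normr_real.
have c0 : 0 <= c by rewrite -ler0c -ct.
pose S : R := \sum_(i < d) `|(t.2 0 i)%:~R|.
have S0 : 0 <= S by apply: sumr_ge0.
exists (c * (2 * S) + L) => [|x y]; first by rewrite addr_ge0 ?mulr_ge0.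
rewrite !tev_cons opprD addrACA -mulrBr (le_trans (ler_normD _ _))//.
rewrite mulrDl rmorphD lerD// normrM ct -mulrA rmorphM ler_wpM2l//.
  by rewrite ler0c.
rewrite !phase_real !cexp_i; apply: le_trans (ler_normc_ReIm _) _; rewrite lecR /=.
have -> : 2 * S * dist1 x y = S * dist1 x y + S * dist1 x y by ring.
have h : `|rdot t.2 x - rdot t.2 y| <= S * dist1 x y.
  rewrite /rdot -sumrB (le_trans (ler_norm_sum _ _ _))// mulr_sumr ler_sum// => i _.
  rewrite -mulrBr normrM ler_wpM2r//.
  by rewrite /S (bigD1 i)//= lerDl sumr_ge0.
by apply: lerD; [apply: le_trans (cos_lip _ _) h | apply: le_trans (sin_lip _ _) h].
Qed.

Lemma lip_continuous (f : R -> R) (L : R) :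
  (forall s t, `|f s - f t| <= L * `|s - t|) -> continuous f.
Proof.
move=> fL x; apply/cvgrPdist_lt => e e0.
have L0 : 0 < `|L| + 1 by rewrite ltr_wpDl.
near=> y; apply: (le_lt_trans (fL x y)).
apply: (@le_lt_trans _ _ ((`|L| + 1) * `|x - y|)).
  by rewrite ler_wpM2r// (le_trans (ler_norm L))// lerDl.
rewrite -ltr_pdivlMl//; near: y; apply: filterS (@nbhsx_ballx _ R^o x ((`|L| + 1)^-1 * e) _) => //.
by rewrite mulr_gt0// invr_gt0.
Unshelve. all: by end_near. Qed.

End RealPoints.

(** * Zeros persist on nearby parallel lines *)

Section Cross.
Variables (R : realType) (d : nat) (lq : tpoly R d).
Local Notation C := (R[i]^o).
Hypothesis lq_real : forall x, conjc (tev lq (realpt x)) = tev lq (realpt x).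
Local Notation q := (qR lq).
Implicit Types (x y v : 'rV[R]_d).

Lemma q_lip : exists2 L : R, 0 <= L & forall x y, `|q x - q y| <= L * dist1 x y.
Proof.
have [L L0 hL] := tev_lip lq; exists L => // x y.
have := hL x y; rewrite !(qRE lq_real) -rmorphB normc_def /= expr0n addr0 sqrtr_sqr.
by rewrite lecR.
Qed.

(** The difference quotients at [t] and [- t] are real, larger than half of [|D|] in size and less
    than [|D|] apart, so they have the same sign and the two values of [q] have opposite signs. *)
Lemma sign_change x0 v : q x0 = 0 -> tev (tder lq (realpt v)) (realpt x0) != 0 ->
  forall e : R, 0 < e -> exists2 t : R, 0 < t < e & q (x0 + t *: v) * q (x0 - t *: v) < 0.
Proof.
move=> qx0 Dn0 e e0; set D := tev _ _ in Dn0.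
have D0 : 0 < `|D| / 2 by rewrite divr_gt0// normr_gt0.
have [dl] := is_derive_tev lq (realpt x0) (realpt v); rewrite -/D => dv.
have cv : (h^-1 *: ((tev lq \o shift (realpt x0)) (h *: realpt v) - tev lq (realpt x0)) : C) @[h --> (0 : C)^'] --> (D : C).
  by rewrite -dv; exact: dl.
move/(@cvgrPdist_lt _ _ _ _ (@dnbhs_filter C 0)): cv => /(_ _ D0).
move=> -[r /= r0 hr].
have /complex_realP[rr rE] : r \is Num.real by rewrite realE ltW.
have rr0 : 0 < rr by rewrite -ltr0c -rE.
have /complex_realP[dd ddE] : `|D| \is Num.real by exact: normr_real.
have hD : `|D| / 2 = (dd / 2)%:C.
  by rewrite ddE (rmorphM (real_complex R)) fmorphV rmorph_nat.
pose t := Num.min (e / 2) (rr / 2).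
have t0 : 0 < t by rewrite lt_min !divr_gt0.
have te : t < e by rewrite gt_min ltr_pdivrMr// mulrC ltr_pMl// ltr1n.
have tr : t < rr by rewrite gt_min orbC ltr_pdivrMr// mulrC ltr_pMl// ltr1n.
have quot (h : R) : `|h| < rr -> h != 0 -> `|D - (q (x0 + h *: v) / h)%:C| < (dd / 2)%:C.
  move=> hrr h0; have hh : ball_ [eta Num.Def.normr] (0 : C) r h%:C.
    by rewrite /ball_/= sub0r normrN normc_def /= expr0n addr0 sqrtr_sqr rE ltcR.
  have h0' : (h%:C : C) != 0 by rewrite fmorph_eq0.
  have := hr _ hh h0'; rewrite hD.
  have -> : (h%:C *: realpt v + realpt x0 : 'rV[C]_d) = realpt (x0 + h *: v).
    by apply/rowP => i; rewrite !mxE rmorphD rmorphM addrC.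
  rewrite !(qRE lq_real) qx0 subr0.
  have -> // : (h%:C : C)^-1 *: ((q (x0 + h *: v))%:C : C) = (q (x0 + h *: v) / h)%:C.
  by rewrite rmorphM fmorphV mulrC.
exists t; first by rewrite t0.
have q1 := quot t; have q2 := quot (- t).
rewrite normrN gtr0_norm// in q2; rewrite gtr0_norm// in q1.
have {q1} := q1 tr (lt0r_neq0 t0).
have {q2} : `|D - (q (x0 + - t *: v) / - t)%:C| < (dd / 2)%:C.
  by apply: q2 => //; rewrite oppr_eq0 lt0r_neq0.
rewrite scaleNr; set b := q _; set a := q _ => h2 h1.
have low (u : R) : `|D - u%:C| < (dd / 2)%:C -> dd / 2 < `|u|.
  move=> hu; have : `|D| <= `|D - u%:C| + `|u%:C|.
    by rewrite -{1}[D](subrK u%:C) ler_normD.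
  have -> : `|u%:C| = `|u|%:C by rewrite normc_def /= expr0n addr0 sqrtr_sqr.
  rewrite ddE => h; have := le_lt_trans h (ltr_leD hu (lexx _)).
  by rewrite -rmorphD ltcR; lra.
have uw : `|a / t - b / - t| < dd.
  rewrite -ltcR; have -> : `|a / t - b / - t|%:C = `|(a / t)%:C - (b / - t)%:C|.
    by rewrite -rmorphB [in RHS]normc_def /= expr0n addr0 sqrtr_sqr.
  have -> : (a / t)%:C - (b / - t)%:C = ((a / t)%:C - D) + (D - (b / - t)%:C) by rewrite addrA subrK.
  apply: le_lt_trans (ler_normD _ _) _; rewrite distrC.
  have -> : dd%:C = (dd / 2)%:C + (dd / 2)%:C by rewrite -rmorphD -splitr.
  exact: (ltrD h1 h2).
have dd0 : 0 < dd / 2 by rewrite -ltr0c -hD.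
have la := low _ h1; have lb := low _ h2.
have abE : a * b = - (t ^+ 2 * ((a / t) * (b / - t))) by field; rewrite lt0r_neq0.
rewrite abE oppr_lt0 mulr_gt0 ?exprn_gt0//.
move: la lb uw; set u := a / t; set w := b / - t.
have [u0|u0] := leP 0 u; have [w0|w0] := leP 0 w.
- by rewrite (ger0_norm u0) (ger0_norm w0) => *; rewrite mulr_gt0; lra.
- by rewrite (ger0_norm u0) (ltr0_norm w0) ltr_norml => ? ? /andP[]; lra.
- by rewrite (ltr0_norm u0) (ger0_norm w0) ltr_norml => ? ? /andP[]; lra.
- by move=> *; rewrite nmulr_rgt0.
Qed.

(** The sign change survives small shifts of the base point by the Lipschitz bound, and the
    intermediate value theorem gives the zero. This does the work of the implicit function
    theorem. *)
Lemma cross x0 v : q x0 = 0 -> tev (tder lq (realpt v)) (realpt x0) != 0 ->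
  forall e : R, 0 < e -> exists2 r : R, 0 < r &
    forall x, (forall i, `|x 0 i - x0 0 i| <= r) ->
      exists2 t : R, `|t| <= e & q (x + t *: v) = 0.
Proof.
move=> qx0 Dn0 e e0; have [t /andP[t0 te] qt] := sign_change qx0 Dn0 e0.
have [L L0 qL] := q_lip.
set a := q (x0 + t *: v) in qt; set b := q (x0 - t *: v) in qt.
have a0 : 0 < `|a| by rewrite normr_gt0; apply: contraTneq qt => ->; rewrite mul0r ltxx.
have b0 : 0 < `|b| by rewrite normr_gt0; apply: contraTneq qt => ->; rewrite mulr0 ltxx.
pose mn := Num.min `|a| `|b|; have mn0 : 0 < mn by rewrite lt_min a0.
pose r := mn / (2 * (L * d%:R + 1)).
have Ld : 0 < L * d%:R + 1 by rewrite ltr_wpDl// mulr_ge0.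
exists r => [|x xr]; first by rewrite divr_gt0// mulr_gt0.
have near (y : 'rV[R]_d) : `|q (x + y) - q (x0 + y)| <= mn / 2.
  apply: le_trans (qL _ _) _.
  apply: (@le_trans _ _ (L * (d%:R * r))).
    rewrite ler_wpM2l// /dist1 -[d in d%:R]card_ord -sumr_const mulr_suml ler_sum// => i _.
    by rewrite mul1r !mxE opprD addrACA subrr addr0 xr.
  have -> : L * (d%:R * r) = mn / 2 * (L * d%:R / (L * d%:R + 1)).
    by rewrite /r; field; rewrite lt0r_neq0.
  rewrite ler_piMr//; first by rewrite divr_ge0// ltW.
  by rewrite ler_pdivrMr// mul1r lerDl.
have ha := near (t *: v); have hb := near (- (t *: v)).
have mna : mn <= `|a| by rewrite ge_min lexx.
have mnb : mn <= `|b| by rewrite ge_min lexx orbT.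
pose f s := q (x + s *: v).
have fc : continuous f.
  apply: (@lip_continuous _ _ (L * \sum_(i < d) `|v 0 i|)) => s u.
  apply: le_trans (qL _ _) _; rewrite -mulrA ler_wpM2l// mulr_suml ler_sum// => i _.
  by rewrite !mxE opprD addrACA subrr add0r -mulrBl normrM mulrC.
have tt : - t <= t by lra.
have [|s] := @IVT R f (- t) t 0 tt (continuous_subspaceT fc).
  have -> : f (- t) = q (x - t *: v) by rewrite /f scaleNr.
  rewrite -/a -/b in ha hb; rewrite /f.
  move: ha hb qt mna mnb; set A := q (x + _); set B := q (x - _).
  rewrite !ler_norml => /andP[? ?] /andP[? ?] qt.
  have [a1|a1] := leP 0 a.
    have b1 : b < 0 by rewrite ltNge; apply/negP => b1; move: qt; rewrite ltNge mulr_ge0.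
    rewrite (ger0_norm a1) (ltr0_norm b1) => ? ?.
    by rewrite ge_min le_max; apply/andP; split; apply/orP; [left|right]; lra.
  have b1 : 0 < b by rewrite ltNge; apply/negP => b1; move: qt; rewrite ltNge mulr_le0// ltW.
  rewrite (ltr0_norm a1) (gtr0_norm b1) => ? ?.
  by rewrite ge_min le_max; apply/andP; split; apply/orP; [right|left]; lra.
rewrite in_itv/= => /andP[s1 s2] fs; exists s => //.
by rewrite ler_norml; apply/andP; split; lra.
Qed.

End Cross.

(** * Trigonometric polynomials as monic polynomials in monomial coordinates *)

Section Monomials.
Variable (C : numClosedFieldType).

Fixpoint mon k (a : nat -> nat) : tower C k :=
  match k return tower C k with
  | 0 => 1
  | k'.+1 => (mon k' a)%:P * 'X^(a k')
  end.

Lemma ev_mon k y a : ev k y (mon k a) = \prod_(l < k) y l ^+ a l.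
Proof.
elim: k => [|k IH]; first by rewrite big_ord0 rmorph1.
by rewrite [LHS]rmorphM rmorphXn evC evX IH big_ord_recr.
Qed.

Lemma mon0 k a : (forall l, (l < k)%N -> a l = 0%N) -> mon k a = 1.
Proof.
elim: k => //= k IH a0; rewrite a0// expr0 mulr1 IH// => l lk.
by apply/a0/ltnW.
Qed.

End Monomials.

Section Coordinates.
Variables (R : realType) (m : nat) (B : 'M[int]_m.+1).
Hypothesis Bu : B \in unitmx.
Local Notation C := (R[i]^o).
Local Notation T := (tower R[i]).
Implicit Types (n : 'rV[int]_m.+1) (z : 'rV[C]_m.+1) (x : 'rV[R]_m.+1).

Let A := invmx B.

(** Monomial coordinates of the complex torus attached to the unimodular [B]: the character of
    frequency [n] has exponents [n *m B] in them. *)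
Definition yz z (l : nat) : R[i] := phase (row (inord l) A) z.

Lemma yz_neq0 z l : yz z l != 0.
Proof. exact: phase_neq0. Qed.

Lemma phase_sum (I : Type) (r : seq I) (F : I -> 'rV[int]_m.+1) z :
  phase (\sum_(i <- r) F i) z = \prod_(i <- r) phase (F i) z.
Proof.
apply: (big_morph (fun n => phase n z) (id1 := 1)) => [n n'|]; first exact: phaseD.
exact: phase0.
Qed.

Lemma phaseZ n (k : nat) z : phase (k%:Z *: n) z = phase n z ^+ k.
Proof.
elim: k => [|k IH]; first by rewrite scale0r phase0.
by rewrite intS scalerDl scale1r phaseD IH exprS.
Qed.

Lemma ev_yz_mon (al : 'rV[int]_m.+1) z : (forall l, 0 <= al 0 l) ->
  ev m.+1 (yz z) (mon _ m.+1 (fun l => `|al 0%R (inord l)|%N)) = phase (al *m A) z.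
Proof.
move=> al0; rewrite ev_mon mulmx_sum_row phase_sum; apply: eq_bigr => i _.
by rewrite inord_val -{2}[al 0 i]gez0_abs// phaseZ /yz inord_val.
Qed.

(** One monomial factor clears all negative exponents. *)
Lemma tower_of_tpoly (l : tpoly R m.+1) : exists (k : 'rV[int]_m.+1) (g : T m.+1),
  forall z, ev m.+1 (yz z) g = phase k z * tev l z.
Proof.
pose be : 'rV[int]_m.+1 := \row_j - \sum_(t <- l) `|(t.2 *m B) 0 j|.
have be_le t j : t \in l -> 0 <= (t.2 *m B - be) 0 j.
  move=> tl; rewrite mxE [(- be) 0 j]mxE [be 0 j]mxE opprK.
  rewrite (big_rem t)//= addrA addr_ge0 ?sumr_ge0//.
  by have := ler_norm (- (t.2 *m B) 0 j); rewrite normrN; lia.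
exists (- (be *m A)), (\sum_(t <- l) tconst R[i] m.+1 t.1 * mon _ m.+1 (fun j => `|(t.2 *m B - be)%R 0%R (inord j)|%N)) => z.
rewrite rmorph_sum /tev mulr_sumr; apply: eq_big_seq => t tl.
rewrite rmorphM ev_const ev_yz_mon; last by move=> j; apply: be_le.
by rewrite mulmxBl mulmxK// phaseD; ring.
Qed.

Lemma tpoly_of_tower k (f : T k) : (k <= m.+1)%N -> istp (fun z => ev k (yz z) f).
Proof.
elim: k f => [|k IH] f km; first exact: istp_const.
elim/poly_ind: f => [|f c hf].
  by apply: istp_ext (@istp_const R m.+1 0) => z; rewrite rmorph0.
have hy : istp (fun z => yz z k) by exact: istp_phase.
have [l hl] := istpD (istpM hf hy) (IH c (ltnW km)).
by exists l => z; rewrite -hl evMXaddC.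
Qed.

Section Monic.
Variables (lq : tpoly R m.+1) (ntop nbot : 'rV[int]_m.+1) (E : seq 'rV[int]_m.+1).
Local Notation ph n := ((n *m B) 0 ord_max).
Hypotheses (Eu : uniq E) (Etop : ntop \in E) (Ebot : nbot \in E).
Hypothesis EE : forall z, tev lq z = \sum_(n <- E) tcoef lq n * phase n z.
Hypothesis Ec : forall n, n \in E -> tcoef lq n != 0.
Hypothesis top_max : forall n, n \in E -> n != ntop -> ph n < ph ntop.
Hypothesis bot_min : forall n, n \in E -> n != nbot -> ph nbot < ph n.
Hypothesis top_min : forall n j, n \in E -> j != ord_max -> (ntop *m B) 0 j <= (n *m B) 0 j.

(** Exponents to be subtracted: the lowest one in the last variable, those of the top term in the
    others. The top term becomes a pure power of the last variable and the bottom term lands in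
    degree zero. *)
Let be : 'rV[int]_m.+1 := \row_j if j == ord_max then ph nbot else (ntop *m B) 0 j.
Let al n := n *m B - be.

Let alE n j : al n 0 j = (n *m B) 0 j - (if j == ord_max then ph nbot else (ntop *m B) 0 j).
Proof. by rewrite mxE [(- be) 0 j]mxE [be 0 j]mxE. Qed.

Let al_ge0 n j : n \in E -> 0 <= al n 0 j.
Proof.
move=> nE; rewrite alE subr_ge0; case: eqP => [->|/eqP jm]; last exact: top_min.
by have [->//|nb] := eqVneq n nbot; rewrite ltW// bot_min.
Qed.

Let ex n (j : nat) : nat := `|al n 0%R (inord j)|%N.

Let inordm : inord m = ord_max :> 'I_m.+1.
Proof. by apply: val_inj; rewrite /= inordK. Qed.

Let P : {poly T m} := \sum_(n <- E)
  (tconst _ m (tcoef lq n / tcoef lq ntop) * mon _ m (ex n))%:P * 'X^(ex n m).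

(** The top and the bottom term are each alone in their degree in the last variable. Dividing by the
    top coefficient makes [P] monic, and the constant coefficient is a monomial; on the unit torus
    the latter has constant modulus, which keeps roots away from 0. *)
Lemma monicP_exists : exists (P : {poly T m}) (k : 'rV[int]_m.+1) (c : R[i]),
  [/\ P \is monic, c != 0, forall z, ev m.+1 (yz z) P = c * phase k z * tev lq z &
     exists c0 : R[i], c0 != 0 /\ exists ex : nat -> nat, forall y, ev m y P`_0 = c0 * \prod_(l < m) y l ^+ ex l].
Proof.
exists P, (- (be *m A)), (tcoef lq ntop)^-1; split.
- rewrite /P (big_rem ntop)//= divff ?Ec// rmorph1 mul1r mon0 ?mul1r; last first.
    move=> l lm; rewrite /ex alE -val_eqE /= inordK ?(ltn_eqF lm)//; last exact: ltnW.
    by rewrite subrr.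
  rewrite monicE lead_coefDl ?lead_coefXn// size_polyXn ltnS.
  apply: (leq_trans (size_sum _ _ _)); apply/bigmax_leqP_seq => n nE _.
  have /andP[nt nE'] : (n != ntop) && (n \in E) by move: nE; rewrite rem_filter// mem_filter.
  rewrite (leq_trans (size_polyMleq _ _))// size_polyXn addnS /=.
  rewrite (leq_trans (leq_add (size_polyC_leq1 _) (leqnn _)))// add1n.
  rewrite /ex inordm !alE eqxx -ltz_nat !gez0_abs ?ltrD2r ?top_max// subr_ge0.
    by have [<-//|nb] := eqVneq ntop nbot; rewrite ltW// bot_min.
  by have [->//|nb] := eqVneq n nbot; rewrite ltW// bot_min.
- by rewrite invr_eq0 Ec.
- move=> z; rewrite /P rmorph_sum EE mulr_sumr; apply: eq_big_seq => n nE.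
  have -> : (tconst _ m (tcoef lq n / tcoef lq ntop) * mon _ m (ex n))%:P * 'X^(ex n m) =
      (tconst _ m.+1 (tcoef lq n / tcoef lq ntop)) * mon _ m.+1 (ex n) :> T m.+1.
    by rewrite [RHS]mulrA -polyCM.
  rewrite rmorphM ev_const ev_yz_mon; last by move=> l; apply: al_ge0.
  rewrite mulmxBl mulmxK// phaseD; ring.
exists (tcoef lq nbot / tcoef lq ntop); split; first by rewrite mulf_neq0 ?invr_eq0 ?Ec.
exists (ex nbot) => y; rewrite coef_sum (big_rem nbot)//= big1_seq ?addr0; last first.
  move=> n /andP[_]; rewrite rem_filter// mem_filter /= => /andP[nb nE].
  rewrite coefCM coefXn /ex inordm alE eqxx eq_sym absz_eq0 subr_eq0.
  by rewrite (gt_eqF (bot_min nE nb)) mulr0.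
by rewrite coefCM coefXn /ex inordm alE eqxx subrr mulr1 rmorphM ev_const ev_mon.
Qed.

End Monic.
End Coordinates.

(** [D] bounds all differences of exponents. Base [D.+1] therefore separates the frequencies by
    their last coordinate, and subtracting [D] times it from the others gives the top frequency the
    least ones. *)
Lemma normal_form (R : realType) m (lq : tpoly R m.+1) : (exists z, tev lq z != 0) ->
  exists2 B : 'M[int]_m.+1, B \in unitmx &
  exists (P : {poly tower R[i] m}) (k : 'rV[int]_m.+1) (c : R[i]),
  [/\ P \is monic, c != 0, forall z, ev m.+1 (yz B z) P = c * phase k z * tev lq z &
     exists c0 : R[i], c0 != 0 /\ exists ex : nat -> nat, forall y, ev m y P`_0 = c0 * \prod_(l < m) y l ^+ ex l].
Proof.
move=> [z0 z00]; pose E := [seq n <- undup (map snd lq) | tcoef lq n != 0].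
have Eu : uniq E by rewrite filter_uniq ?undup_uniq.
have EE z : tev lq z = \sum_(n <- E) tcoef lq n * phase n z.
  rewrite tev_coef big_filter [RHS]big_mkcond/=; apply: eq_bigr => n _.
  by case: eqP => //= ->; rewrite mul0r.
have Ec n : n \in E -> tcoef lq n != 0 by rewrite mem_filter => /andP[].
have [n0 n0E] : exists n, n \in E.
  case: E EE {Eu Ec} => [EE|n s _]; last by exists n; rewrite mem_head.
  by move: z00; rewrite EE big_nil eqxx.
pose D := (\sum_(n <- E) \sum_(n' <- E) \sum_(i < m.+1) `|(n - n')%R 0%R i|)%N.
have hD n n' i : n \in E -> n' \in E -> (`|(n - n')%R 0%R i| <= D)%N.
  move=> nE nE'; rewrite /D (big_rem n)//= (leq_trans _ (leq_addr _ _))// (big_rem n')//=.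
  by rewrite (leq_trans _ (leq_addr _ _))// (bigD1 i)//= leq_addr.
pose B : 'M[int]_m.+1 := coordB m D.+1 D.
have phE n : (n *m B) 0 ord_max = phiN D.+1 n by rewrite coordBE eqxx.
have ph_inj n n' : n \in E -> n' \in E -> phiN D.+1 n = phiN D.+1 n' -> n = n'.
  by move=> nE nE'; apply: phiN_inj => i; rewrite ltnS hD.
have [nt ntE ntmax] := seq_argmax (phiN D.+1) n0E.
have [nb nbE nbmin] := seq_argmax (fun n => - phiN D.+1 n) n0E.
have top_max n : n \in E -> n != nt -> phiN D.+1 n < phiN D.+1 nt.
  by move=> nE nnt; rewrite lt_neqAle ntmax// andbT; apply: contraNneq nnt => /ph_inj ->.
exists B; first exact: coordB_unit.
apply: (@monicP_exists R m B (coordB_unit m D.+1 D) lq nt nb E) => //.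
- by move=> n nE nnt; rewrite !phE top_max.
- move=> n nE nnb; rewrite !phE lt_neqAle -lerN2 nbmin// andbT.
  by apply: contraNneq nnb => /ph_inj ->.
move=> n j nE jm; rewrite !coordBE (negPf jm).
have [->//|nnt] := eqVneq n nt.
have h1 := top_max n nE nnt; have := hD nt n j ntE nE; rewrite -lez_nat abszE !mxE => h2.
have := ler_norm (nt 0 j - n 0 j) => h3.
set a := nt 0 j in h2 h3 *; set b := n 0 j in h2 h3 *.
set u := phiN _ n in h1 *; set w := phiN _ nt in h1 *.
have : D%:Z * (w - u) >= D%:Z by rewrite ler_peMr// -[1]add0r lezD1 subr_gt0.
by rewrite mulrBr; lia.
Qed.

(** * The symbol is rarely small *)

Section GridShift.
Variables (R : realType) (d : nat).
Implicit Types (n k : 'rV[int]_d) (x b : 'rV[R]_d).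

Definition zvec n : 'rV[R]_d := map_mx intr n.

Definition periodic2pi (V : Type) (F : 'rV[R]_d -> V) :=
  forall x n, F (x + (2 * pi) *: zvec n) = F x.

(** The shift adds [t * kp] to the index vector, and modulo [N] this permutes the grid. *)
Lemma grid_shift (V : nmodType) N (F : 'rV[R]_d -> V) b (kp : 'rV[int]_d) t : periodic2pi F ->
  \sum_(k : {ffun 'I_d -> 'I_N}) F (gpt b k + (2 * pi * t%:R / N%:R) *: zvec kp) =
  \sum_(k : {ffun 'I_d -> 'I_N}) F (gpt b k).
Proof.
move=> Fp; case: N => [|N].
  by apply: eq_bigr => k _; congr F; rewrite invr0 mulr0 scale0r addr0.
pose hz j : int := ((t%:Z * kp 0%R j) %% N.+1%:Z)%Z.
pose h j : 'I_N.+1 := inord `|hz j|.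
have hE j : (h j : nat) = `|hz j|%N :> nat.
  by rewrite inordK// -ltz_nat gez0_abs ?modz_ge0// ltz_pmod.
pose g (k : {ffun 'I_d -> 'I_N.+1}) : {ffun 'I_d -> 'I_N.+1} := [ffun j => (k j + h j)%R].
rewrite [RHS](reindex_inj (h := g)); last first.
  move=> k k' kk'; apply/ffunP => i; have := congr1 (fun f : {ffun 'I_d -> 'I_N.+1} => f i) kk'.
  by rewrite !ffunE => /addIr.
apply: eq_bigr => k _.
(* The whole periods dropped when [t * kp], and then the sum of indices, are reduced modulo [N]. *)
pose w : 'rV[int]_d := \row_j (((t%:Z * kp 0%R j) %/ N.+1%:Z)%Z + ((k j + h j) %/ N.+1)%N%:Z).
rewrite -(Fp (gpt b (g k)) w); congr F; apply/rowP => j; rewrite !mxE ffunE /=.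
have e1 : t%:R * (kp 0 j)%:~R = ((t%:Z * kp 0%R j) %/ N.+1%:Z)%Z%:~R * N.+1%:R + (h j)%:R :> R.
  rewrite hE -[(`|hz j|)%:R]/((`|hz j|%N%:Z)%:~R) gez0_abs ?modz_ge0//.
  by rewrite -[N.+1%:R]/((N.+1%:Z)%:~R) -intrM -intrD -divz_eq intrM.
have e2 : (k j)%:R + (h j)%:R = ((k j + h j) %/ N.+1)%N%:R * N.+1%:R + ((k j + h j) %% N.+1)%N%:R :> R.
  by rewrite -natrD -natrM -natrD -divn_eq.
set r := ((k j + h j) %% N.+1)%N in e2 *; set Q := ((k j + h j) %/ N.+1)%N in e2 *.
set Q1 := (_ %/ _)%Z in e1 *.
have N0 : N.+1%:R != 0 :> R by [].
rewrite intrD -[(Q%:Z)%:~R]/(Q%:R) -!addrA; congr (_ + _).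
have -> : 2 * pi * t%:R / N.+1%:R * (kp 0 j)%:~R = 2 * pi * (t%:R * (kp 0 j)%:~R) / N.+1%:R :> R by ring.
rewrite e1.
have -> : (r%:R : R) = (k j)%:R + (h j)%:R - Q%:R * N.+1%:R by rewrite e2; ring.
by move: (pi : R) => p; field.
Qed.

Lemma rdotDr n x y : rdot n (x + y) = rdot n x + rdot n y.
Proof. by rewrite -big_split; apply: eq_bigr => i _; rewrite mxE mulrDr. Qed.

Lemma rdot_zvec n k c : rdot n (c *: zvec k) = c * (\sum_j n 0 j * k 0 j)%:~R.
Proof.
rewrite /rdot rmorph_sum mulr_sumr; apply: eq_bigr => j _.
by rewrite !mxE mulrCA rmorphM.
Qed.

Lemma phase_periodic n : periodic2pi (fun x => phase n (realpt x)).
Proof.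
move=> x k; rewrite !phase_real rdotDr rmorphD mulrDr cexpD rdot_zvec.
by rewrite cexp_2pi mulr1.
Qed.

Lemma tev_periodic (l : tpoly R d) : periodic2pi (fun x => tev l (realpt x)).
Proof.
by move=> x k; apply: eq_bigr => t _; rewrite phase_periodic.
Qed.

End GridShift.

Section ArcCount.
Variable R : realType.

(** All of [T] lies among the [b] indices starting at its least element or among the last [b]
    indices. *)
Lemma arc_count N b (T : {set 'I_N}) : (b <= N)%N ->
  (forall s t : 'I_N, s \in T -> t \in T -> (s <= t)%N -> (t - s < b)%N || (N - b < t - s)%N) ->
  (#|T| <= 2 * b)%N.
Proof.
move=> bN close; have [->|[t0 t0T]] := set_0Vmem T; first by rewrite cards0.
have [t tT tmin] : exists2 t, t \in T & forall s, s \in T -> (t <= s)%N.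
  by case: (arg_minnP (fun t : 'I_N => val t) t0T) => t tT tmin; exists t.
have TE s : s \in T -> (val s \in iota t b ++ iota (N - b) b).
  move=> sT; rewrite mem_cat !mem_iota; have := close _ _ tT sT (tmin _ sT).
  have := tmin _ sT; have := ltn_ord s.
  by move=> /= sN ts /orP h; apply/orP; case: h => h; [left|right]; apply/andP; split; lia.
have <- : size (iota t b ++ iota (N - b) b) = (2 * b)%N by rewrite size_cat !size_iota addnn mul2n.
rewrite cardE -(size_map val).
apply: uniq_leq_size; first by rewrite map_inj_uniq ?enum_uniq//; exact: val_inj.
by move=> x /mapP[s]; rewrite mem_enum => /TE ? ->.
Qed.

Lemma cexp_dist (s : R) : `|cexp ('i * s%:C) - 1| ^+ 2 = (2 - 2 * cos s)%:C.
Proof.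
rewrite cexp_i -add_Re2_Im2 /=; congr (_%:C).
by have := cos2Dsin2 s; rewrite !expr2; lra.
Qed.

(** Two rotations within [tau] of the same [r] are closer than the chord of the angle [2 * pi * e],
    so their indices are cyclically closer than [b] and [arc_count] applies. *)
Lemma arc_close (e : R) : 0 < e -> e <= 1 / 2 -> exists2 tau : R, 0 < tau &
  forall N (w r : R[i]) (b : nat), (0 < N)%N -> N%:R * e <= b%:R -> (b <= N)%N -> `|w| = 1 ->
    \sum_(t < N) ((`|w * cexp ('i * (2 * pi * t%:R / N%:R)%:C) - r| <= tau%:C)%R)%:R <= (2 * b)%:R :> R.
Proof.
move=> e0 e1; have pi0 := pi_gt0 R; have c1 : cos (2 * pi * e) < 1.
  rewrite -[ltRHS]cos0 ltr_cos ?in_itv/= ?lexx ?pi_ge0//; first by rewrite !mulr_gt0.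
  by apply/andP; split; [rewrite !mulr_ge0// ltW | nra].
pose dl := 2 - 2 * cos (2 * pi * e); have dl0 : 0 < dl by rewrite /dl; lra.
pose tau := Num.min 1 (dl / 8).
have tau0 : 0 < tau by rewrite lt_min ltr01 divr_gt0.
have tau_dl : (2 * tau) ^+ 2 < dl.
  have t1 : tau <= 1 by rewrite ge_min lexx.
  have t2 : tau <= dl / 8 by rewrite ge_min lexx orbT.
  by rewrite exprMn expr2; nra.
exists tau => // N w r b N0 eb bN w1; have NR : 0 < N%:R :> R by rewrite ltr0n.
pose T := [set t : 'I_N | (`|w * cexp ('i * (2 * pi * t%:R / N%:R)%:C) - r| <= tau%:C)%R]%SET.
have -> : \sum_(t < N) ((`|w * cexp ('i * (2 * pi * t%:R / N%:R)%:C) - r| <= tau%:C)%R)%:R = #|T|%:R :> R.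
  rewrite -natr_sum -sum1_card; congr (_%:R); rewrite [RHS]big_mkcond/=.
  by apply: eq_bigr => t _; rewrite inE; case: (_ <= _).
rewrite ler_nat; apply: arc_count => // s t; rewrite !inE => sT tT st.
apply: contraT; rewrite negb_or -!leqNgt => /andP[h1 h2].
pose th : R := 2 * pi * (t - s)%N%:R / N%:R.
have hth : `|cexp ('i * th%:C) - 1| <= (2 * tau)%:C.
  have -> : (2 * tau)%:C = tau%:C + tau%:C by rewrite mulr_natl mulr2n rmorphD.
  have tE : 2 * pi * t%:R / N%:R = 2 * pi * s%:R / N%:R + th.
    by rewrite /th natrB//; ring.
  set a := w * cexp ('i * (2 * pi * s%:R / N%:R)%:C) in sT.
  have a1 : `|a| = 1 by rewrite /a normrM w1 cexp_i normc_def /= cos2Dsin2 sqrtr1 mulr1.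
  have -> : `|cexp ('i * th%:C) - 1| = `|a * cexp ('i * th%:C) - a|.
    by rewrite -{2}[a]mulr1 -mulrBr normrM a1 mul1r.
  have -> : a * cexp ('i * th%:C) - a = (a * cexp ('i * th%:C) - r) - (a - r) by rewrite opprB addrA subrK.
  apply: le_trans (ler_normB _ _) _; apply: lerD => //.
  by rewrite /a -mulrA -cexpD -mulrDr -rmorphD -tE.
have : dl <= 2 - 2 * cos th.
  have bR : (N%:R * e) <= (t - s)%N%:R by rewrite (le_trans eb)// ler_nat.
  have bR2 : (t - s)%N%:R <= N%:R * (1 - e).
    by rewrite mulrBr mulr1 lerBrDr -lerBrDl (le_trans eb)// -natrB ?ler_nat; lia.
  have th1 : 2 * pi * e <= th by rewrite /th ler_pdivlMr//; nra.
  have th2 : th <= 2 * pi - 2 * pi * e by rewrite /th ler_pdivrMr//; nra.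
  have e2pi : 2 * pi * e <= pi by nra.
  have e2pi0 : 0 <= 2 * pi * e by rewrite !mulr_ge0// ltW.
  rewrite /dl lerD2l lerN2 ler_pM2l//.
  have le_cos (u : R) : 2 * pi * e <= u -> u <= pi -> cos u <= cos (2 * pi * e).
    move=> hu1 hu2; have [->//|ne] := eqVneq u (2 * pi * e).
    rewrite ltW// ltr_cos ?in_itv/= ?e2pi0 ?e2pi// ?lt_neqAle ?hu1 1?eq_sym ?ne//.
    by rewrite (le_trans e2pi0).
  have [thp|thp] := leP th pi; first exact: le_cos.
  have -> : cos th = cos (2 * pi - th).
    rewrite -[in RHS]cosN opprB -[in RHS](cosD2pi _); congr cos.
    by rewrite mulr_natl subrK.
  by apply: le_cos; lra.
rewrite -lecR -(cexp_dist th) => /le_trans h.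
have : dl%:C <= ((2 * tau)%:C) ^+ 2.
  by apply: h; apply: lerXn2r hth; rewrite nnegrE ?normr_ge0 ?ler0c ?mulr_ge0 ?(ltW tau0).
by rewrite -rmorphXn lecR leNgt tau_dl.
Qed.

End ArcCount.

Section DualBasis.
Variables (R : realType) (m : nat) (B : 'M[int]_m.+1).
Hypothesis Bu : B \in unitmx.

Definition dualv (l : 'I_m.+1) : 'rV[int]_m.+1 := \row_j B j l.

Lemma dual_sum (i l : 'I_m.+1) : \sum_j (row i (invmx B)) 0 j * dualv l 0 j = (i == l)%:Z.
Proof.
have := congr1 (fun M : 'M[int]_m.+1 => M i l) (mulVmx Bu).
rewrite [in RHS]mxE natz mxE => <-.
by apply: eq_bigr => j _; rewrite !mxE.
Qed.

Lemma rdot_dual (i l : 'I_m.+1) (s : R) :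
  rdot (row i (invmx B)) (s *: zvec R (dualv l)) = s * (i == l)%:R.
Proof. by rewrite rdot_zvec dual_sum. Qed.

Lemma yz_shift (x : 'rV[R]_m.+1) (l : 'I_m.+1) (s : R) k : (k < m.+1)%N ->
  yz B (realpt (x + s *: zvec R (dualv l))) k =
  if k == l then yz B (realpt x) k * cexp ('i * s%:C) else yz B (realpt x) k.
Proof.
move=> km; rewrite /yz !phase_real rdotDr rmorphD mulrDr cexpD rdot_dual.
have -> : (inord k == l) = (k == l :> nat) by rewrite -val_eqE /= inordK.
by case: eqP => _; rewrite ?mulr1// mulr0 mulr0 cexp0 mulr1.
Qed.

Lemma norm_yz_real (x : 'rV[R]_m.+1) k : `|yz B (realpt x) k| = 1.
Proof. exact: normr_phase_real. Qed.

Lemma ev_yz_last (P : {poly tower R[i] m}) (x : 'rV[R]_m.+1) (s : R) :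
  ev m.+1 (yz B (realpt (x + s *: zvec R (dualv ord_max)))) P =
  (map_poly (ev m (yz B (realpt x))) P).[yz B (realpt x) m * cexp ('i * s%:C)].
Proof.
rewrite evS yz_shift// eqxx; congr (_.[_]); apply: eq_map_poly => f.
by apply: ev_ext => l lm; rewrite yz_shift ?(ltn_eqF lm)// ltnW.
Qed.

End DualBasis.

Lemma half_lt (R : realFieldType) (a b t : R) : 0 < t -> a * (2 * b) <= t -> b * a < t.
Proof. by move=> t0 ab; lra. Qed.

(** Along the last dual direction only the last coordinate moves, on a circle, and [P] is there a
    monic polynomial of degree [D]. A small value forces the point near one of [D] roots, and each
    root accounts for at most [2 * b] of the [N] grid points. By [grid_shift] the average over the
    grid is an average over such lines. *)
Lemma small_set (R : realType) m (lq : tpoly R m.+1) :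
  (forall x, conjc (tev lq (realpt x)) = tev lq (realpt x)) -> (exists z, tev lq z != 0) ->
  forall e : R, 0 < e -> exists2 eta : R, 0 < eta & exists N0, forall N, (N0 <= N)%N ->
     avgR N 0 (fun x => ((qR lq x ^+ 2 <= eta)%R)%:R) <= e.
Proof.
move=> lq_real lq0 e e0.
have [B Bu [P [kk [c [Pm c0 hP _]]]]] := normal_form lq0.
pose D := (size P).-1.
have /complex_realP[cc ccE] : `|c| \is Num.real by exact: normr_real.
have cc0 : 0 < cc by rewrite -ltr0c -ccE normr_gt0.
pose ep := Num.min (1 / 2) (e / (4 * (D%:R + 1))).
have D1 : 0 < D%:R + 1 :> R by rewrite ltr_wpDl.
have ep0 : 0 < ep by rewrite lt_min !divr_gt0// mulr_gt0.
have ep2 : ep <= 1 / 2 by rewrite ge_min lexx.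
have epe : (D%:R + 1) * ep <= e / 4.
  have : ep <= e / (4 * (D%:R + 1)) by rewrite ge_min lexx orbT.
  by rewrite ler_pdivlMr ?mulr_gt0//; lra.
have [tau tau0 htau] := arc_close ep0 ep2.
(* [q^2 <= eta] gives [|P| <= tau ^+ D / 2], but away from all roots by more than [tau] one has
   [|P| >= tau ^+ D]. *)
pose eta := (tau ^+ D / (2 * cc)) ^+ 2.
exists eta; first by rewrite exprn_gt0// divr_gt0 ?exprn_gt0// mulr_gt0.
pose N1 := Num.bound (4 * D%:R / e).
have hN1 : 4 * D%:R / e < N1%:R by apply: archi_boundP; rewrite divr_ge0 ?mulr_ge0// ltW.
exists (maxn N1 2) => N; rewrite geq_max => /andP[N1N N2].
have NR : 0 < N%:R :> R by rewrite ltr0n (leq_trans _ N2).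
have N2R : 2 <= N%:R :> R by rewrite ler_nat.
pose F x := ((qR lq x ^+ 2 <= eta)%R)%:R : R.
pose b := (Num.truncn (N%:R * ep)).+1.
have Nep : 0 <= N%:R * ep by rewrite mulr_ge0// ltW.
have /andP[b1 b2] := truncn_itv Nep.
have bN : (b <= N)%N.
  rewrite -(ler_nat R) /b -natr1; nra.
have bb : b%:R <= N%:R * ep + 1 by rewrite /b -natr1 lerD2r.
have slice x : \sum_(t < N) F (x + (2 * pi * t%:R / N%:R) *: zvec R (dualv B ord_max)) <= D%:R * (2 * b)%:R.
  pose p := map_poly (ev m (yz B (realpt x))) P.
  have pm : p \is monic by rewrite monic_map.
  have sp : size p = size P by apply: size_map_poly_id0; rewrite (monicP Pm) rmorph1 oner_eq0.
  have [rs prs] := closed_field_poly_normal p.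
  rewrite (monicP pm) scale1r in prs.
  have srs : size rs = D by rewrite /D -sp prs size_prod_XsubC.
  pose w (t : 'I_N) := yz B (realpt x) m * cexp ('i * (2 * pi * t%:R / N%:R)%:C).
  apply: (@le_trans _ _ (\sum_(t < N) \sum_(r <- rs) ((`|w t - r| <= tau%:C)%R)%:R)).
    apply: ler_sum => t _; rewrite /F; case: (leP _ eta) => [qe|_]; last exact: sumr_ge0.
    have [/hasP[r rrs hr]|] := boolP (has (fun r => `|w t - r| <= tau%:C) rs).
      by rewrite (big_rem r)//= hr lerDl sumr_ge0.
    rewrite -all_predC => /allP hall; exfalso.
    have : (tau ^+ D)%:C <= `|p.[w t]|.
      rewrite prs horner_prod normr_prod -srs rmorphXn.
      have -> : tau%:C ^+ size rs = \prod_(r <- rs) tau%:C by rewrite big_const_seq count_predT iter_mulr mulr1.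
      rewrite !big_seq; apply: ler_prod => r rrs; rewrite ler0c ltW//= hornerXsubC.
      have := hall r rrs; rewrite /= -real_ltNge ?normr_real//; first exact: ltW.
      by rewrite realE ler0c ltW.
    have -> : p.[w t] = c * phase kk (realpt (x + (2 * pi * t%:R / N%:R) *: zvec R (dualv B ord_max))) *
       tev lq (realpt (x + (2 * pi * t%:R / N%:R) *: zvec R (dualv B ord_max))).
      by rewrite -hP ev_yz_last.
    rewrite (normrM (c * _)) (normrM c) normr_phase_real mulr1 (qRE lq_real) ccE.
    move: qe; set u := qR lq _ => qe.
    have -> : `|u%:C| = `|u|%:C by rewrite normc_def /= expr0n addr0 sqrtr_sqr.
    rewrite -rmorphM lecR leNgt => /negP; apply.
    have ul : `|u| <= tau ^+ D / (2 * cc).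
      rewrite -(@ler_pXn2r _ 2) ?nnegrE// ?real_normK ?num_real//.
      by rewrite divr_ge0 ?exprn_ge0 ?mulr_ge0// ltW.
    move: ul; rewrite ler_pdivlMr ?mulr_gt0// => ul.
    exact: half_lt (exprn_gt0 D tau0) ul.
  rewrite exchange_big /= -srs.
  have -> : (size rs)%:R * (2 * b)%:R = \sum_(r <- rs) (2 * b)%:R :> R.
    by rewrite big_const_seq count_predT iter_addr addr0 mulr_natl.
  apply: ler_sum => r _; apply: htau => //; [exact: leq_trans N2| |exact: norm_yz_real].
  by rewrite /b ltW.
have Fp : periodic2pi F.
  by move=> x n; rewrite /F /qR; have := tev_periodic lq x n => /= ->.
have sumF : N%:R * \sum_(k : {ffun 'I_m.+1 -> 'I_N}) F (gpt 0 k) <= N%:R ^+ m.+1 * (D%:R * (2 * b)%:R).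
  rewrite mulr_natl.
  have -> : (\sum_(k : {ffun 'I_m.+1 -> 'I_N}) F (gpt 0 k)) *+ N =
     \sum_(t < N) \sum_(k : {ffun 'I_m.+1 -> 'I_N}) F (gpt 0 k + (2 * pi * t%:R / N%:R) *: zvec R (dualv B ord_max)).
    rewrite [RHS](eq_bigr (fun=> \sum_(k : {ffun 'I_m.+1 -> 'I_N}) F (gpt 0 k))).
      by rewrite sumr_const card_ord.
    by move=> t _; exact: grid_shift.
  rewrite exchange_big/=.
  have -> : N%:R ^+ m.+1 * (D%:R * (2 * b)%:R) = \sum_(k : {ffun 'I_m.+1 -> 'I_N}) (D%:R * (2 * b)%:R) :> R.
    by rewrite sumr_const card_ffun !card_ord -[RHS]mulr_natl natrX.
  by apply: ler_sum => k _.
have Np : 0 < N%:R ^+ m.+1 :> R by rewrite exprn_gt0.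
rewrite /avgR -(ler_pM2l NR) mulrCA ler_pdivrMl//.
apply: le_trans sumF _; rewrite ler_wpM2l ?(ltW Np)//.
move: hN1; rewrite ltr_pdivrMr// => hN1.
have N1N' : N1%:R <= N%:R :> R by rewrite ler_nat.
have : D%:R * (2 * b)%:R <= D%:R * (2 * (N%:R * ep + 1)).
  by rewrite ler_wpM2l// natrM ler_wpM2l.
have : D%:R * ep <= e / 4 by nra.
have : N1%:R * e <= N%:R * e by rewrite ler_wpM2r// ltW.
nra.
Qed.

(** * Regular and singular parts of the zero set in the complex torus *)

Section Torus.
Local Open Scope quotient_scope.
Variables (R : realType) (d : nat).
Local Notation C := (R[i]^o).
Implicit Types (n : 'rV[int]_d) (z w v : 'rV[C]_d) (x y : 'rV[R]_d) (l F H U L : tpoly R d).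

Lemma closed_point (c : C) : closed [set c].
Proof. exact: accessible_closed_set1 (hausdorff_accessible (@norm_hausdorff R[i] C)) c. Qed.

Lemma toTorusP z w : toTorus z = toTorus w <-> exists n, w = z + realpt ((2 * pi) *: zvec R n).
Proof.
split.
  move=> e; have : z = w %[mod torusC R d] by [].
  move/eqmodP => /asboolP[n ->]; exists n; congr (_ + realpt _).
  by apply/rowP => j; rewrite !mxE.
move=> [n ->]; apply/eqmodP/asboolP; exists n; congr (_ + realpt _).
by apply/rowP => j; rewrite !mxE.
Qed.

Lemma tev_toTorus l z w : toTorus z = toTorus w -> tev l z = tev l w.
Proof.
move=> /toTorusP[n ->]; apply: eq_bigr => t _; rewrite phaseDr.
rewrite [X in _ * (_ * X)]phase_real rdot_zvec cexp_2pi mulr1//.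
Qed.

Lemma closed_zeros l : closed [set toTorus z | z in [set z | tev l z = 0]].
Proof.
set Z := [set _ | _ in _].
rewrite -[Z]setCK; apply: open_closedC.
have pre : (\pi_(torusC R d) : 'rV[C]_d -> torusC R d) @^-1` [set t | ~ Z t] = [set z | tev l z != 0].
  apply/seteqP; split=> z /=.
    by move=> hz; apply/eqP => lz; apply: hz; exists z.
  by move=> /eqP hz [w lw wz]; apply: hz; rewrite -(tev_toTorus l wz).
suff : open [set z : 'rV[C]_d | tev l z != 0] by rewrite -pre.
have -> : [set z : 'rV[C]_d | tev l z != 0] = (tev l : 'rV[C]_d -> C) @^-1` [set~ 0].
  by apply/seteqP; split=> z /= /eqP.
apply: open_comp; first by move=> z _; exact: continuous_tev.
exact/closed_openC/closed_point.
Qed.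

Lemma derive_tev l z v : 'D_v (tev l : 'rV[C]_d -> C) z = tev (tder l v) z.
Proof. by have [_] := is_derive_tev l z v. Qed.

Lemma tder_mul U L z v :
  tev (tder (tmul U L) v) z = tev (tder U v) z * tev L z + tev U z * tev (tder L v) z.
Proof.
rewrite /tev !big_map big_allpairs_dep !mulr_suml -big_split; apply: eq_bigr => s _ /=.
rewrite [X in _ = X + _]mulr_sumr [X in _ = _ + X]mulr_sumr -big_split; apply: eq_bigr => t _ /=.
have dE : dotz (s.2 + t.2) v = dotz s.2 v + dotz t.2 v.
  by rewrite -big_split; apply: eq_bigr => j _ /=; rewrite mxE intrD mulrDl.
rewrite phaseD dE; move: (phase s.2 z) (phase t.2 z) (dotz s.2 v) (dotz t.2 v) => p1 p2 d1 d2.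
have ringE (i a b : R[i]) : a * b * (i * (d1 + d2)) * (p1 * p2) =
  a * (i * d1) * p1 * (b * p2) + a * p1 * (b * (i * d2) * p2) by ring.
exact: ringE.
Qed.

(** Leibniz's rule on both sides: the derivative of [F * H] vanishes at a common zero, [L] vanishes
    there too, and [U] does not. *)
Lemma sing_of_product U L F H z v :
  (forall w, tev U w * tev L w = tev F w * tev H w) -> tev U z != 0 -> tev F z = 0 -> tev H z = 0 ->
  tev (tder L v) z = 0.
Proof.
move=> e U0 F0 H0; have L0 : tev L z = 0.
  by apply/eqP; have := e z; rewrite F0 mul0r => /eqP; rewrite mulf_eq0 (negPf U0).
have : tev (tder (tmul U L) v) z = tev (tder (tmul F H) v) z.
  have UF : (tev (tmul U L) : 'rV[C]_d -> C) = tev (tmul F H).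
    by apply/funext => w; rewrite !tev_mul.
  by rewrite -!derive_tev UF.
rewrite !tder_mul F0 H0 L0 !mulr0 !mul0r !add0r => /eqP.
by rewrite mulf_eq0 (negPf U0) => /eqP.
Qed.

Variable lq : tpoly R d.

Definition crit z := forall j, tev (tder lq (delta_mx 0 j)) z = 0.

Definition Reg : set (torusC R d) := [set toTorus z | z in [set z | tev lq z = 0 /\ ~ crit z]].
Definition Sng : set (torusC R d) := [set toTorus z | z in [set z | tev lq z = 0 /\ crit z]].

(** On the regular part the zero sets of [F] and [H] cover everything and are disjoint, a common
    zero being critical. Both are closed, so each is open and closed in the connected component. *)
Lemma component_factor t F H U :
  (forall w, tev U w * tev lq w = tev F w * tev H w) -> (forall w, tev U w != 0) ->
  let K := connected_component Reg t in
  forall z0, K (toTorus z0) -> tev F z0 = 0 -> forall z, K (toTorus z) -> tev F z = 0.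
Proof.
move=> e U0 K z0 Kz0 Fz0 z Kz.
have KReg s : K s -> Reg s by apply: connected_component_sub.
pose Zer l := [set toTorus z | z in [set z | tev l z = 0]].
have ZerE l w : Zer l (toTorus w) <-> tev l w = 0.
  by split=> [[w' lw' ww']|lw]; [rewrite -(tev_toTorus l ww') | exists w].
have disj s : K s -> Zer F s <-> ~ Zer H s.
  move=> /KReg[w [Lw nc] <-]; rewrite !ZerE; split=> [Fw Hw|/eqP Hw].
    by apply: nc => j; apply: (sing_of_product _ e) Fw Hw.
  apply/eqP; have /eqP := e w; rewrite Lw mulr0 eq_sym mulf_eq0 (negPf Hw) orbF//.
have : K `&` Zer F = K.
  apply: (@component_connected _ Reg t); first by exists (toTorus z0); split=> //; exact/ZerE.
    exists (~` Zer H); first exact/closed_openC/closed_zeros.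
    by apply/seteqP; split=> s [Ks h]; split=> //; exact/(disj s Ks).
  by exists (Zer F); [exact: closed_zeros|].
move=> KF; apply/ZerE; suff : (K `&` Zer F) (toTorus z) by case.
by rewrite KF.
Qed.

Lemma continuous_real_complex : continuous (real_complex R : R^o -> C).
Proof.
move=> p; apply/(@cvgrPdist_lt R[i] C _ _ (nbhs_filter p)) => e e0.
have /complex_realP[r rE] : e \is Num.real by rewrite realE ltW.
have r0 : 0 < r by rewrite -ltr0c -rE.
near=> q.
have -> : `|(p%:C : C) - q%:C| = (`|p - q|)%:C.
  by rewrite -rmorphB normc_def /= expr0n addr0 sqrtr_sqr.
rewrite rE ltcR; near: q; exact: (@nbhsx_ballx _ R^o).
Unshelve. all: by end_near. Qed.

Lemma continuous_Cplx : continuous (fun p : R^o * R^o => (p.1%:C + 'i * p.2%:C : C)).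
Proof.
move=> p; apply: (@continuousD _ C _ (fun p : R^o * R^o => p.1%:C : C) (fun p : R^o * R^o => 'i * p.2%:C : C)).
  by apply: (@continuous_comp _ R^o C fst (real_complex R)); [exact: cvg_fst | exact: continuous_real_complex].
apply: (@continuousM R[i] _ (fun=> 'i) (fun p : R^o * R^o => p.2%:C)); first exact: cst_continuous.
by apply: (@continuous_comp _ R^o C snd (real_complex R)); [exact: cvg_snd | exact: continuous_real_complex].
Qed.

Definition csquare (r : R) : set C := [set z | `|complex.Re z| <= r /\ `|complex.Im z| <= r].

Lemma compact_csquare r : compact (csquare r).
Proof.
have -> : csquare r = [set (p.1%:C + 'i * p.2%:C : C) | p in `[- r, r]%classic `*` `[- r, r]%classic].
  apply/seteqP; split=> [z [zr zi]|z [p [p1 p2] <-]].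
    exists (complex.Re z, complex.Im z); last by rewrite [RHS]complexE.
    by split; rewrite /= in_itv/= -ler_norml.
  move: p1 p2; rewrite /= !in_itv/= -!ler_norml => p1 p2; split.
    by rewrite /= mul0r mul1r subr0 addr0.
  by rewrite /= mul0r mul1r !add0r.
apply: continuous_compact; last by apply: compact_setX; exact: segment_compact.
exact/continuous_subspaceT/continuous_Cplx.
Qed.

(** A bounded sequence has a cluster point, singular by continuity of the symbol and its
    derivatives; distinct torus classes make it a limit point. *)
Lemma not_discrete (zs : nat -> 'rV[C]_d) (r : R) :
  (forall (n : nat) j, csquare r (zs n 0 j)) -> (forall n : nat, tev lq (zs n) = 0 /\ crit (zs n)) ->
  (forall n k : nat, toTorus (zs n) = toTorus (zs k) -> n = k) -> ~ discrete_subset Sng.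
Proof.
move=> zsr zsS zsI.
have := @rV_compact C d (fun=> csquare r) (fun=> @compact_csquare r).
move=> /(_ (zs @ \oo) _)[]; first by exists 0%N => // n _ j; exact: zsr.
move=> z [_ zcl].
have tail (n0 : nat) : (zs @ \oo) [set zs n | n in [set n : nat | (n0 < n)%N]].
  by exists n0.+1 => // n hn; exists n.
have zero l : (forall n : nat, tev l (zs n) = 0) -> tev l z = 0.
  move=> hl; apply/eqP; apply: contraT => lz.
  have U : nbhs z [set w | tev l w != 0].
    have : nbhs (tev l z : C) [set~ 0].
      by apply: open_nbhs_nbhs; split; [exact/closed_openC/closed_point | exact/eqP].
    move=> /(@continuous_tev _ _ l z _) h; apply: (@filterS _ (nbhs z) _ _ _ _ h) => w /= lw; exact/eqP.
  have [w2 [[n2 _ <-] /=]] := zcl _ _ (tail 0%N) U.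
  by rewrite hl eqxx.
have zS : Sng (toTorus z).
  by exists z => //; split; [apply: zero => n; case: (zsS n) | move=> j; apply: zero => n; case: (zsS n)].
move=> /(_ _ zS); apply => W Wz.
have piW : nbhs z ((\pi_(torusC R d) : 'rV[C]_d -> torusC R d) @^-1` W).
  exact: (@pi_continuous _ _ z).
have [w0 [[n0 _ <-] /= Wn0]] := zcl _ _ (tail 0%N) piW.
have [w1 [[n1 n1n0 <-] /= Wn1]] := zcl _ _ (tail n0) piW.
have inS (n : nat) : Sng (toTorus (zs n)) by exists (zs n).
(* Of two distinct points in the neighbourhood at least one differs from the cluster point. *)
have [e|ne] := eqVneq (toTorus (zs n0)) (toTorus z); last by exists (toTorus (zs n0)).
exists (toTorus (zs n1)); split => //.
rewrite -e; apply/eqP => /zsI e01; by rewrite e01 /= ltnn in n1n0.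
Qed.

End Torus.

(** * Independence of the first coordinates on the real zero set *)

Section NoConstraint.
Variables (R : realType) (m : nat) (lq : tpoly R m.+1) (B : 'M[int]_m.+1).
Hypothesis lq_real : forall x, conjc (tev lq (realpt x)) = tev lq (realpt x).
Hypothesis Bu : B \in unitmx.
Local Notation C := (R[i]^o).
Local Notation T := (tower R[i]).
Local Notation q := (qR lq).
Implicit Types (x : 'rV[R]_m.+1) (s : nat -> R).

Lemma arc_injective (c : R) : 0 < c -> c <= 1 ->
  injective (fun n : nat => cexp ('i * (c / n.+1%:R)%:C)).
Proof.
move=> c0 c1; have sE (n : nat) : 0 < c / n.+1%:R <= 1.
  by rewrite divr_gt0//= ler_pdivrMr// mul1r (@le_trans _ _ 1) ?ler1n.
move=> i j e; have /eqP : c / i.+1%:R - c / j.+1%:R = 0.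
  apply: cexp_i_eq1; last by rewrite rmorphB mulrBr cexpD e cexpN divff ?cexp_neq0.
  have /andP[i0 i1] := sE i; have /andP[j0 j1] := sE j; have := pi_ge2 R.
  by move: i0 i1 j0 j1; set a := _ / _; set b := _ / _ => *; rewrite ltr_norml; apply/andP; split; lra.
by rewrite subr_eq0 => /eqP /(mulfI (lt0r_neq0 c0)) /invr_inj /eqP; rewrite eqr_nat eqSS => /eqP.
Qed.

Lemma infin_arc (w : R[i]) (sg : R) : w != 0 -> 0 < sg ->
  infin (fun y => exists2 u : R, `|u| <= sg & y = w * cexp ('i * u%:C)).
Proof.
move=> w0 sg0; pose sg' := Num.min sg 1.
have s0 : 0 < sg' by rewrite lt_min sg0 ltr01.
have s1 : sg' <= 1 by rewrite ge_min lexx orbT.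
apply: (@infin_inj _ _ (fun n => w * cexp ('i * (sg' / n.+1%:R)%:C))) => [i j|n].
  by move=> /(mulfI w0) /(arc_injective s0 s1).
exists (sg' / n.+1%:R) => //; rewrite gtr0_norm ?divr_gt0// ler_pdivrMr//.
by rewrite (@le_trans _ _ sg) ?ge_min ?lexx// ler_peMr ?ler1n// ltW.
Qed.

Lemma tder_sum (I : finType) (a : I -> R[i]) (v : I -> 'rV[C]_m.+1) l z :
  tev (tder l (\sum_k a k *: v k)) z = \sum_k a k * tev (tder l (v k)) z.
Proof.
have dot_sum n : dotz n (\sum_k a k *: v k) = \sum_k a k * dotz n (v k).
  apply: (big_ind2 (fun (u : 'rV[C]_m.+1) (w : R[i]) => dotz n u = w)).
  - by apply: big1 => j _; rewrite mxE mulr0.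
  - by move=> u1 w1 u2 w2 e1 e2; rewrite dotzDr e1 e2.
  - by move=> k _; rewrite dotzZr.
rewrite /tev big_map.
have -> : \sum_k a k * (\sum_(t <- tder l (v k)) t.1 * phase t.2 z) =
  \sum_k \sum_(t <- l) a k * (t.1 * ('i * dotz t.2 (v k)) * phase t.2 z).
  by apply: eq_bigr => k _; rewrite big_map mulr_sumr.
rewrite exchange_big/=; apply: eq_bigr => t _; rewrite dot_sum.
rewrite mulr_sumr mulr_sumr mulr_suml; apply: eq_bigr => k _.
move: (dotz _ _) (phase _ _) => D p.
have ringE (i aa tt : R[i]) : tt * (i * (aa * D)) * p = aa * (tt * (i * D) * p) by ring.
exact: ringE.
Qed.

Lemma noncrit_dual z : ~ crit lq z ->
  exists l, tev (tder lq (realpt (zvec R (dualv B l)))) z != 0.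
Proof.
move=> nc; apply: contrapT => h; apply: nc => j.
have -> : delta_mx 0 j = \sum_l ((invmx B l j)%:~R : R[i]) *: realpt (zvec R (dualv B l)) :> 'rV[C]_m.+1.
  apply/rowP => i; rewrite summxE.
  have := congr1 (fun M : 'M[int]_m.+1 => (M i j)%:~R : R[i]) (mulmxV Bu).
  rewrite [in RHS]mxE natz => e; rewrite mxE eqxx /= -[LHS]/((i == j)%:Z%:~R) -e mxE rmorph_sum.
  by apply: eq_bigr => l _; rewrite !mxE rmorphM rmorph_int mulrC.
rewrite tder_sum big1// => l _.
have [->|ne] := eqVneq (tev (tder lq (realpt (zvec R (dualv B l)))) z) 0; first by rewrite mulr0.
by case: h; exists l.
Qed.

Variable x0 : 'rV[R]_m.+1.

(** Angular coordinates around [x0]: [s k] is the angle added to coordinate [k]. *)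
Definition xs s : 'rV[R]_m.+1 := x0 + \sum_(l < m.+1) s l *: zvec R (dualv B l).

Definition ys s (k : nat) : R[i] := yz B (realpt x0) k * cexp ('i * (s k)%:C).

Lemma yz_xs s k : (k < m.+1)%N -> yz B (realpt (xs s)) k = ys s k.
Proof.
move=> km; rewrite /ys /yz !phase_real rdotDr rmorphD mulrDr cexpD; congr (_ * cexp (_ * _%:C)).
have -> : rdot (row (inord k) (invmx B)) (\sum_(l < m.+1) s l *: zvec R (dualv B l)) =
    \sum_(l < m.+1) s l * (inord k == l)%:R.
  apply: (big_ind2 (fun (u : 'rV[R]_m.+1) (w : R) => rdot (row (inord k) (invmx B)) u = w)).
  - by apply: big1 => j _; rewrite [X in _ * X]mxE mulr0.
  - by move=> u1 w1 u2 w2 e1 e2; rewrite rdotDr e1 e2.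
  - by move=> l _; rewrite rdot_dual.
rewrite (bigD1 (inord k))//= eqxx mulr1 inordK// big1 ?addr0// => l ne.
by rewrite eq_sym (negPf ne) mulr0.
Qed.

Definition Kmax : R := \sum_(l < m.+1) \sum_(i < m.+1) `|(B i l)%:~R|.

Lemma xs_close s sg : (forall l, (l < m.+1)%N -> `|s l| <= sg) -> forall i, `|xs s 0 i - x0 0 i| <= sg * Kmax.
Proof.
move=> ssg i; rewrite /xs mxE addrAC subrr add0r summxE (le_trans (ler_norm_sum _ _ _))//.
rewrite mulr_sumr ler_sum// => l _; rewrite !mxE normrM.
apply: ler_pM => //; first exact: ssg.
by rewrite (bigD1 i)//= lerDl sumr_ge0.
Qed.

Lemma Kmax_ge0 : 0 <= Kmax.
Proof. by apply: sumr_ge0 => l _; apply: sumr_ge0. Qed.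

(** The real zero set has dimension one less than the torus: at a regular point some angle [l] is
    governed by the others, which are free. A nonzero [a] would impose a further condition. If [l]
    is the last angle, [a] vanishes on a product of arcs; otherwise [a] confines coordinate [l] to
    finitely many values, and then [P] confines the last coordinate to finitely many, though it
    ranges over an arc. *)
Lemma no_constraint (P : {poly T m}) (a : T m) (dl : R) : P \is monic ->
  (forall x, q x = 0 -> ev m.+1 (yz B (realpt x)) P = 0) ->
  q x0 = 0 -> ~ crit lq (realpt x0) -> 0 < dl ->
  (forall x, (forall i, `|x 0 i - x0 0 i| <= dl) -> q x = 0 -> ev m (yz B (realpt x)) a = 0) ->
  a = 0.
Proof.
move=> Pm qP qx0 nc dl0 ha; apply/eqP; apply: contraT => a0.
have [l Dl] := noncrit_dual nc.
have K0 := Kmax_ge0.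
(* Changing every angle by at most [e + e] stays within [dl] of [x0]. *)
pose e := dl / (2 * (Kmax + 1)); have K1 : 0 < Kmax + 1 by rewrite ltr_wpDl.
have e0 : 0 < e by rewrite divr_gt0// mulr_gt0.
have [r r0 hr] := cross lq_real qx0 Dl e0.
pose sg := Num.min e (r / (Kmax + 1)).
have sg0 : 0 < sg by rewrite lt_min e0 divr_gt0.
have sge : sg <= e by rewrite ge_min lexx.
have sgr : sg * Kmax <= r.
  have : sg <= r / (Kmax + 1) by rewrite ge_min lexx orbT.
  by rewrite ler_pdivlMr//; nra.
have e2 : (e + e) * Kmax <= dl.
  have -> : dl = (e + e) * (Kmax + 1) by rewrite /e; field; rewrite lt0r_neq0.
  by rewrite ler_wpM2l// ?addr_ge0 ?lerDl// ltW.
pose bump s t (k : nat) := if k == l :> nat then s k + t else s k.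
(* Small angles can be corrected in direction [l] so as to reach the zero set, where both [a] and
   [P] vanish. *)
have root s : (forall k, (k < m.+1)%N -> `|s k| <= sg) -> exists t,
    ev m (ys (bump s t)) a = 0 /\ ev m.+1 (ys (bump s t)) P = 0.
  move=> ssg; have [|t te qt] := hr (xs s).
    by move=> i; apply: le_trans (xs_close ssg i) sgr.
  exists t; have xE : xs s + t *: zvec R (dualv B l) = xs (bump s t).
    rewrite /xs -addrA; congr (_ + _).
    rewrite (bigD1 l)//= [in RHS](bigD1 l)//= /bump eqxx scalerDl addrAC; congr (_ + _).
    by apply: eq_bigr => k kl; rewrite ifN.
  rewrite xE in qt.
  have close i : `|xs (bump s t) 0 i - x0 0 i| <= dl.
    apply: le_trans (xs_close (sg := e + e) _ i) e2 => k km; rewrite /bump.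
    have sk : `|s k| <= e by apply: le_trans (ssg k km) sge.
    case: eqP => _; last by rewrite (le_trans sk)// lerDl ltW.
    by rewrite (le_trans (ler_normD _ _))// lerD.
  split.
    rewrite -(ha _ close qt); apply: ev_ext => k km; rewrite yz_xs//; exact: ltnW.
  by rewrite -(qP _ qt); apply: ev_ext => k km; rewrite yz_xs.
have [|y yE ya] := ev_nonzero (f := a)
    (E := fun k y => exists2 u : R, `|u| <= sg & y = yz B (realpt x0) k * cexp ('i * u%:C)) a0.
  by move=> k km; apply: infin_arc => //; exact: yz_neq0.
have [s hs] : exists s : nat -> R, forall k, (k < m)%N -> `|s k| <= sg /\ y k = ys s k.
  suff /choice[s hs] : forall k, exists u : R, (k < m)%N -> `|u| <= sg /\ y k = yz B (realpt x0) k * cexp ('i * u%:C).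
    by exists s.
  move=> k; case: (ltnP k m) => [/yE[u u1 u2]|mk]; first by exists u.
  by exists 0.
pose su u (k : nat) := if k == m then u else s k.
have susg u : `|u| <= sg -> forall k, (k < m.+1)%N -> `|su u k| <= sg.
  move=> usg k; rewrite ltnS leq_eqVlt /su => /predU1P[->|km]; first by rewrite eqxx.
  by rewrite ltn_eqF//; case: (hs k km).
have [lm|] := ltnP l m; last first.
  (* Here the correction is in the last coordinate, which [a] does not involve. *)
  move=> ml; have lE : l = m :> nat by apply/eqP; rewrite eqn_leq ml -ltnS ltn_ord.
  have [|t [at0 _]] := root (su 0); first by apply: susg; rewrite normr0 ltW.
  move: ya; rewrite -at0 (@ev_ext _ m y (ys (bump (su 0) t)))// ?at0 ?eqxx// => k km.
  rewrite /ys /bump lE (ltn_eqF km) /su (ltn_eqF km).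
  by have [_ ->] := hs k km.
(* With the other lower coordinates fixed, [a] is a nonzero polynomial in coordinate [l]; [PP]
   collects the polynomials that its roots leave for the last coordinate. *)
have [qp hqp] := ev_slice y a lm.
have qp0 : qp != 0.
  apply: contraNneq ya => qp0; have := hqp (y l); rewrite qp0 horner0 => <-.
  by apply/eqP/ev_ext => k km; rewrite /upd; case: eqP => // ->.
have [rs hrs] := roots_seq qp0.
pose PP := \prod_(rho <- rs) map_poly (ev m (upd y l rho)) P.
have PP0 : PP != 0.
  by rewrite prodf_seq_neq0; apply/allP => rho _ /=; rewrite monic_neq0// monic_map.
have [ss hss] := roots_seq PP0.
have [w [u usg ->]] := infin_arc (yz_neq0 B (realpt x0) m) sg0 ss.
rewrite -hss => /negP; case.
have [t [at0 Pt0]] := root (su u) (susg u usg).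
have ysE k : (k < m)%N -> ys (bump (su u) t) k = upd y l (ys (bump (su u) t) l) k.
  move=> km; rewrite /upd; case: eqP => [->//|/eqP kl].
  by rewrite /ys /bump (negPf kl) /su (ltn_eqF km); have [_ ->] := hs k km.
set rho := ys _ l in ysE.
have rho_rs : rho \in rs.
  by rewrite -hrs rootE -hqp -at0; apply/eqP/esym/ev_ext => k km; rewrite ysE.
rewrite /PP (big_rem rho)//= rootM; apply/orP; left; apply/rootP.
move: Pt0; rewrite evS => <-.
have -> : ys (bump (su u) t) m = yz B (realpt x0) m * cexp ('i * u%:C).
  by rewrite /ys /bump (gtn_eqF lm) /su eqxx.
by congr (_.[_]); apply: eq_map_poly => f; apply: ev_ext => k km; rewrite ysE.
Qed.

End NoConstraint.

Lemma avoid_tail (T : eqType) (u : nat -> T) (s : seq T) : injective u ->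
  exists N0, forall n, (N0 <= n)%N -> u n \notin s.
Proof.
move=> uI; elim: s => [|x s [N0 IH]]; first by exists 0%N.
have [[n0 e]|ne] := pselect (exists n, u n = x).
  exists (maxn N0 n0.+1) => n; rewrite geq_max => /andP[/IH ns nn0].
  rewrite inE negb_or ns andbT; apply: contraTneq nn0; rewrite -e => /uI ->.
  by rewrite ltnn.
exists N0 => n /IH ns; rewrite inE negb_or ns andbT; apply/eqP => e; apply: ne.
by exists n.
Qed.

(** * A cofactor of positive degree produces singular points *)

Section Singular.
Variables (R : realType) (m : nat) (lq : tpoly R m.+1) (B : 'M[int]_m.+1).
Hypothesis Bu : B \in unitmx.
Local Notation C := (R[i]^o).
Local Notation T := (tower R[i]).
Implicit Types (z w : 'rV[C]_m.+1).

Definition zmap (ze : nat -> R[i]) : 'rV[C]_m.+1 :=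
  \sum_(l < m.+1) ze l *: realpt (zvec R (dualv B l)).

Lemma yz_zmap ze k : (k < m.+1)%N -> yz B (zmap ze) k = cexp ('i * ze k).
Proof.
move=> km; rewrite /yz phaseE; congr (cexp (_ * _)).
have -> : dotz (row (inord k) (invmx B)) (zmap ze) = \sum_(l < m.+1) ze l * (inord k == l)%:R.
  apply: (big_ind2 (fun (u : 'rV[C]_m.+1) (w : R[i]) => dotz (row (inord k) (invmx B)) u = w)).
  - by apply: big1 => j _; rewrite [X in _ * X]mxE mulr0.
  - by move=> u1 w1 u2 w2 e1 e2; rewrite dotzDr e1 e2.
  - move=> l _; rewrite dotzZr; congr (_ * _).
    have := rdot_dual Bu (inord k) l (1 : R); rewrite scale1r mul1r => e.
    rewrite -[RHS](rmorph_nat (real_complex R)) -e rmorph_sum; apply: eq_bigr => j _.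
    by rewrite rmorphM rmorph_int !mxE.
rewrite (bigD1 (inord k))//= eqxx mulr1 inordK// big1 ?addr0// => l ne.
by rewrite eq_sym (negPf ne) mulr0.
Qed.

Lemma zmap_bound ze (r : R) : (forall l, (l < m.+1)%N -> `|ze l| <= r%:C) ->
  forall j, csquare (r * Kmax R B) (zmap ze 0 j).
Proof.
move=> hr j; have h : `|zmap ze 0 j| <= (r * Kmax R B)%:C.
  rewrite /zmap summxE (le_trans (ler_norm_sum _ _ _))// rmorphM rmorph_sum mulr_sumr.
  apply: ler_sum => l _; rewrite !mxE normrM; apply: ler_pM => //; first exact: hr.
  rewrite normc_def /= expr0n addr0 sqrtr_sqr lecR (bigD1 j)//= lerDl sumr_ge0//.
by split; rewrite -lecR; apply: le_trans h; [exact: Re_le_normc | exact: Im_le_normc].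
Qed.

Lemma yz_eq_torus z w k : toTorus z = toTorus w -> yz B z k = yz B w k.
Proof.
move=> e; have := tev_toTorus [:: (1, row (inord k) (invmx B))] e.
by rewrite /tev !big_seq1 !mul1r.
Qed.

(** A zero of [q] where [a] does not vanish is singular: at a regular point [e] would vanish as
    well, and a common zero of the two factors is critical. The lower coordinates are taken on the
    unit circle, the first one moving, which needs [m > 0]; a root of [q] in the last coordinate
    completes each point. *)
Lemma singular_family (P e q : {poly T m}) (a : T m) (c : R[i]) (kk : 'rV[int]_m.+1) (c0 : R[i]) (ex : nat -> nat) :
  (0 < m)%N -> P \is monic -> c != 0 ->
  (forall z, ev m.+1 (yz B z) P = c * phase kk z * tev lq z) ->
  c0 != 0 -> (forall y, ev m y P`_0 = c0 * \prod_(l < m) y l ^+ ex l) ->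
  a != 0 -> a *: P = q * e -> (1 < size q)%N ->
  (forall z, tev lq z = 0 -> ~ crit lq z -> ev m.+1 (yz B z) e = 0) ->
  discrete_subset (Sng lq) -> False.
Proof.
move=> m0 Pm cn0 hP c00 hP0 a0 aP sq eReg.
have q0 : q != 0 by rewrite -size_poly_gt0 ltnW.
have arc0 : (1 : R[i]) != 0 by rewrite oner_eq0.
have [||y yE ya] := ev_nonzero (f := a * lead_coef q)
    (E := fun k y => exists2 u : R, `|u| <= 1 & y = 1 * cexp ('i * u%:C)).
- by rewrite mulf_neq0 ?lead_coef_eq0.
- by move=> k km; apply: infin_arc.
have [s hs] : exists s : nat -> R, forall k, (k < m)%N -> `|s k| <= 1 /\ y k = cexp ('i * (s k)%:C).
  suff /choice[s hs] : forall k, exists u : R, (k < m)%N -> `|u| <= 1 /\ y k = cexp ('i * u%:C).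
    by exists s.
  move=> k; case: (ltnP k m) => [/yE[u u1 u2]|mk]; first by exists u => _; rewrite u2 mul1r.
  by exists 0.
have [qp hqp] := ev_slice y (a * lead_coef q) m0.
have qp0 : qp != 0.
  apply: contraNneq ya => qp0; have := hqp (y 0%N); rewrite qp0 horner0 => <-.
  by apply/eqP/ev_ext => k km; rewrite /upd; case: eqP => // ->.
have [rs hrs] := roots_seq qp0.
have arcI := @arc_injective R 1 ltr01 (lexx 1).
(* From [N0] on, the moving coordinate avoids the finitely many values where [a] or the leading
   coefficient of [q] vanishes. *)
have [N0 hN0] := avoid_tail rs arcI.
pose th n : R := 1 / (N0 + n).+1%:R.
have th1 n : `|th n| <= 1.
  by rewrite ger0_norm ?divr_ge0// ler_pdivrMr// mul1r ler1n.
pose yn n := upd y 0 (cexp ('i * (th n)%:C)).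
have yn_good n : ev m (yn n) (a * lead_coef q) != 0.
  by rewrite hqp; have := hN0 (N0 + n)%N (leq_addr _ _); rewrite -hrs.
have yn1 n k : (k < m)%N -> `|yn n k| = 1.
  move=> km; rewrite /yn /upd; case: eqP => _.
    by rewrite cexp_i normc_def /= cos2Dsin2 sqrtr1.
  by have [_ ->] := hs k km; rewrite cexp_i normc_def /= cos2Dsin2 sqrtr1.
have [M1 M10 PM1] := sum_ev_bounded P (ler01 : 0 <= 1 :> R[i]).
have /complex_realP[Mr MrE] : M1 \is Num.real by rewrite realE M10.
have Mr0 : 0 <= Mr by rewrite -ler0c -MrE.
have /complex_realP[cr crE] : `|c0| \is Num.real by exact: normr_real.
have cr0 : 0 < cr by rewrite -ltr0c -crE normr_gt0.
(* Inner radius of the annulus: the constant coefficient has modulus [cr], and at a root [w] it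
   equals [- w] times a sum bounded by this denominator. *)
pose lo := cr / ((1 + Mr) * (1 + Mr) ^+ size P).
have M1' : 0 < 1 + Mr by rewrite ltr_wpDr.
have lo0 : 0 < lo by rewrite divr_gt0// mulr_gt0// exprn_gt0.
(* The roots stay in an annulus, so the singular points accumulate. *)
have wn n : exists w : R[i], [/\ w != 0, ev m.+1 (upd (yn n) m w) P = 0, ev m.+1 (upd (yn n) m w) q = 0 &
     lo%:C <= `|w| <= (1 + Mr)%:C].
  pose p := map_poly (ev m (yn n)).
  have evw (w : R[i]) f : ev m.+1 (upd (yn n) m w) f = (p f).[w].
    rewrite evS /upd eqxx; congr (_.[_]); apply: eq_map_poly => g; exact: ev_upd.
  have := yn_good n; rewrite rmorphM mulf_eq0 negb_or => /andP[an qn].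
  have sp : size (p q) = size q by apply: size_map_poly_id0.
  have [w wq] : exists w : R[i], root (p q) w.
    by apply/closed_rootP; rewrite sp; case: (size q) sq => [|[]].
  have wP : root (p P) w.
    have := congr1 p aP; rewrite /p rmorphM /= map_polyZ /= => /(congr1 (fun f => root f w)).
    by rewrite rootZ// rootM wq.
  have pm : p P \is monic by rewrite monic_map.
  have yr l : (l < m)%N -> `|yn n l| <= 1 by move=> lm; rewrite yn1.
  have sP : size (p P) = size P by apply: size_map_poly_id0; rewrite (monicP Pm) rmorph1 oner_eq0.
  have sumP : \sum_(x <- p P) `|x| <= Mr%:C.
    rewrite -MrE (big_nth 0) (le_trans _ (PM1 _ yr))// (big_nth 0 (r := P)) sP.
    by rewrite ler_sum// => j _; rewrite coef_map.
  have whi : `|w| <= (1 + Mr)%:C.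
    by rewrite (le_trans (monic_root_bound pm wP))// rmorphD rmorph1 lerD2l.
  have p0 : `|(p P)`_0| = cr%:C.
    have -> : (p P)`_0 = ev m (yn n) P`_0 by rewrite coef_map.
    rewrite hP0 normrM crE normr_prod big1 ?mulr1// => l _.
    by rewrite normrX yn1// expr1n.
  have wlo : lo%:C <= `|w|.
    have : (p P)`_0 = - (w * \sum_(i < (size P).-1) (p P)`_i.+1 * w ^+ i).
      move/rootP: wP; rewrite horner_coef sP.
      have -> : size P = (size P).-1.+1 by rewrite prednK// size_poly_gt0 monic_neq0.
      rewrite big_ord_recl expr0 mulr1 => /eqP; rewrite addr_eq0 => /eqP ->; congr (- _).
      by rewrite mulr_sumr; apply: eq_bigr => i _; rewrite exprS mulrCA.
    move=> /(congr1 (fun x => `|x|)); rewrite p0 normrN normrM => e1.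
    have : cr%:C <= `|w| * ((1 + Mr) * (1 + Mr) ^+ size P)%:C.
      rewrite e1 ler_wpM2l// (le_trans (ler_norm_sum _ _ _))//.
      apply: (@le_trans _ _ (\sum_(i < (size P).-1) `|(p P)`_i.+1| * ((1 + Mr) ^+ size P)%:C)).
        apply: ler_sum => i _; rewrite normrM ler_wpM2l// normrX.
        apply: (@le_trans _ _ ((1 + Mr)%:C ^+ i)).
          by apply: lerXn2r whi; rewrite nnegrE ?normr_ge0 ?ler0c ?(ltW M1').
        rewrite rmorphXn ler_weXn2l//; first by rewrite -(rmorph1 (real_complex R)) lecR lerDl.
        by rewrite (leq_trans (ltnW (ltn_ord i)))// leq_pred.
      rewrite -mulr_suml rmorphM ler_wpM2r ?ler0c ?exprn_ge0 ?(ltW M1')//.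
      rewrite rmorphD; apply: ler_wpDl; first by rewrite ler0c.
      apply: le_trans sumP; rewrite (big_nth 0) sP big_mkord.
      have -> : size P = (size P).-1.+1 by rewrite prednK// size_poly_gt0 monic_neq0.
      by rewrite big_ord_recl lerDr.
    have Q0 : 0 < (1 + Mr) * (1 + Mr) ^+ size P by rewrite mulr_gt0// exprn_gt0.
    have -> : lo%:C = cr%:C / ((1 + Mr) * (1 + Mr) ^+ size P)%:C.
      by rewrite (rmorphM (real_complex R)) fmorphV.
    by rewrite ler_pdivrMr ?ltr0c.
  exists w; split; rewrite ?evw ?wlo ?whi//; [|exact/rootP|exact/rootP].
  by rewrite -normr_gt0 (lt_le_trans _ wlo)// ltr0c.
have [w hw] := choice wn.
have zt n : exists2 v, cexp ('i * v) = w n & `|v| <= (pi + `|ln lo| + `|ln (1 + Mr)|)%:C.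
  have [wn0 _ _ /andP[h1 h2]] := hw n; have [v v1 v2] := cexp_surj wn0.
  exists (- 'i * v); first by rewrite mulrA mulrN -expr2 sqr_i opprK mul1r.
  have -> : `|- 'i * v| = `|v|.
    have i1 : `|'i : R[i]| = 1 by rewrite normc_def /= expr0n expr1n add0r sqrtr1.
    by rewrite normrM normrN i1 mul1r.
  rewrite (le_trans (ler_normc_ReIm _))// lecR -addrA addrC lerD//.
  have e1 : expR (complex.Re v) <= 1 + Mr by rewrite -lecR -normr_cexp v2.
  have e2 : lo <= expR (complex.Re v) by rewrite -lecR -normr_cexp v2.
  have l1 : complex.Re v <= ln (1 + Mr) by rewrite -ler_expR lnK.
  have l2 : ln lo <= complex.Re v by rewrite -ler_expR lnK.
  have := ler_norm (ln (1 + Mr)); have := ler_norm (- ln lo); rewrite normrN.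
  have := normr_ge0 (ln (1 + Mr)); have := normr_ge0 (ln lo).
  by rewrite ler_norml => *; apply/andP; split; lra.
have /choice[v hv] : forall n, exists v, cexp ('i * v) = w n /\ `|v| <= (pi + `|ln lo| + `|ln (1 + Mr)|)%:C.
  by move=> n; have [v v1 v2] := zt n; exists v.
pose rr : R := pi + `|ln lo| + `|ln (1 + Mr)| + 1.
pose ze n (k : nat) : R[i] := if k == m then v n else if k == 0%N then (th n)%:C else (s k)%:C.
have zer n k : (k < m.+1)%N -> `|ze n k| <= rr%:C.
  have rr1 : 1 <= rr by rewrite /rr; have := pi_ge0 R; have := normr_ge0 (ln lo); have := normr_ge0 (ln (1 + Mr)); lra.
  rewrite ltnS leq_eqVlt /ze => /predU1P[->|km].
    by rewrite eqxx; have [_ h] := hv n; rewrite (le_trans h)// lecR lerDl.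
  have nR (u : R) : `|u%:C| = `|u|%:C by rewrite normc_def /= expr0n addr0 sqrtr_sqr.
  rewrite (ltn_eqF km); case: eqP => _; rewrite nR lecR (le_trans _ rr1)//.
  by case: (hs k km).
have yzE n k : (k < m.+1)%N -> yz B (zmap (ze n)) k = upd (yn n) m (w n) k.
  move=> km; rewrite yz_zmap// /ze /upd; case: eqP => [_|/eqP km']; first by case: (hv n).
  rewrite /yn /upd; case: eqP => // _.
  by have [|_ ->] := hs k; first by rewrite ltn_neqAle km' -ltnS.
have evE n (f : T m.+1) : ev m.+1 (yz B (zmap (ze n))) f = ev m.+1 (upd (yn n) m (w n)) f.
  by apply: ev_ext => k km; rewrite yzE.
apply: (@not_discrete R m.+1 lq (fun n => zmap (ze n)) (rr * Kmax R B)).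
- by move=> n j; apply: zmap_bound; exact: zer.
- move=> n; set z := zmap (ze n).
  have [_ Pz qz _] := hw n; rewrite -!evE -/z in Pz qz.
  have lz : tev lq z = 0.
    apply/eqP; move/eqP: Pz; rewrite hP mulf_eq0 mulf_eq0 (negPf cn0) (negPf (phase_neq0 _ _)) //.
  split=> //; apply: contrapT => nc; apply: (nc) => j.
  have ez := eReg z lz nc.
  have [lF hF] := tpoly_of_tower B (q : T m.+1) (leqnn _).
  have [lH hH] := tpoly_of_tower B (e : T m.+1) (leqnn _).
  have [lU hU] : istp (fun z => ev m (yz B z) a * (c * phase kk z)).
    apply: istpM; first by apply: tpoly_of_tower; exact: leqnSn.
    by apply: istpM; [exact: istp_const | exact: istp_phase].
  apply: (@sing_of_product _ _ lU lq lF lH).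
  + move=> u; rewrite -hU -hF -hH -mulrA -hP -rmorphM -aP -mul_polyC.
    by rewrite [RHS]rmorphM evC.
  + rewrite -hU; apply: mulf_neq0; last by apply: mulf_neq0 => //; exact: phase_neq0.
    have := yn_good n; rewrite rmorphM mulf_eq0 negb_or => /andP[an _].
    rewrite (@ev_ext _ m _ (yn n))// => k km.
    by rewrite yzE; [rewrite /upd (ltn_eqF km) | exact: ltnW].
  + by rewrite -hF.
  + by rewrite -hH.
move=> n k /(yz_eq_torus 0%N); rewrite !yzE// /upd (ltn_eqF m0) /yn /upd eqxx => e1.
by have /addnI := arcI _ _ e1.
Qed.

End Singular.

(** * Rellich's theorem for one real symbol *)

Section RellichL2.
Variables (R : realType) (m : nat) (lq : tpoly R m.+1) (v : 'rV[int]_m.+1 -> R[i]) (M : R).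
Local Notation C := (R[i]^o).
Local Notation T := (tower R[i]).
Local Notation q := (qR lq).
Implicit Types (z w : 'rV[C]_m.+1) (x : 'rV[R]_m.+1) (l : tpoly R m.+1).

Hypothesis m0 : (0 < m)%N.
Hypothesis lq_real : forall x, conjc (tev lq (realpt x)) = tev lq (realpt x).
Hypothesis vM : sqsummable v M%:C.
Hypothesis gfin : finite_supp (tact lq v).
Hypothesis sng : discrete_subset (Sng lq).
Hypothesis reg : forall t, Reg lq t -> connected_component (Reg lq) t `&` real_torus !=set0.

(** After moving the frequency to 0, the coefficient is a grid average over real points. *)
Lemma tcoef_eq l1 l2 : (forall x, tev l1 (realpt x) = tev l2 (realpt x)) -> tcoef l1 =1 tcoef l2.
Proof.
move=> e n.
have shift l : tcoef l n = tcoef (tmul [:: (1, - n)] l) 0.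
  rewrite /tcoef /tmul [RHS]big_mkcond big_allpairs_dep big_seq1 [LHS]big_mkcond/=.
  apply: eq_bigr => t _ /=; rewrite mul1r addrC subr_eq0 eq_sym.
  by rewrite [n == _]eq_sym.
rewrite !shift; set k1 := tmul _ l1; set k2 := tmul _ l2.
have [N1 h1] := large_ex ((0, 0) :: k1); have [N2 h2] := large_ex ((0, 0) :: k2).
have [N0 l1N] := h1 _ (leq_maxl N1 N2); have [_ l2N] := h2 _ (leq_maxr N1 N2).
rewrite -(@avg_tev _ _ (maxn N1 N2) 0 k1)//; last first.
  move=> t tl j; have := l1N (0, 0) t (mem_head _ _).
  by rewrite inE tl orbT => /(_ isT j); rewrite mxE sub0r abszN.
rewrite -(@avg_tev _ _ (maxn N1 N2) 0 k2)//; last first.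
  move=> t tl j; have := l2N (0, 0) t (mem_head _ _).
  by rewrite inE tl orbT => /(_ isT j); rewrite mxE sub0r abszN.
by apply: eq_avg => x; rewrite !tev_mul e.
Qed.

Lemma tact_tcoef l1 l2 n : tact l1 (tcoef l2) n = tcoef (tmul l1 l2) n.
Proof.
rewrite /tact /tcoef /tmul [RHS]big_mkcond big_allpairs_dep; apply: eq_bigr => s _.
rewrite mulr_sumr [LHS]big_mkcond; apply: eq_bigr => t _ /=.
by rewrite eq_sym subr_eq addrC eq_sym.
Qed.

Lemma tcoef_finite_supp l : finite_supp (tcoef l).
Proof.
exists (map snd l) => n; apply: contraNT => nl; rewrite /tcoef big_seq_cond big1//.
by move=> t /andP[tl /eqP e]; case/negP: nl; rewrite -e map_f.
Qed.

Lemma finite_supp_tcoef (g : 'rV[int]_m.+1 -> R[i]) : finite_supp g -> exists l, g =1 tcoef l.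
Proof.
move=> [S gS]; exists [seq (g n, n) | n <- undup S] => n; rewrite /tcoef big_map/=.
have [nS|nS] := boolP (n \in undup S).
  by rewrite -big_filter filter_pred1_uniq ?undup_uniq ?big_seq1.
rewrite big_seq_cond big1; first by apply/eqP; apply: contraNT nS => /gS; rewrite mem_undup.
by move=> k /andP[kS /eqP e]; rewrite e (negPf nS) in kS.
Qed.

Lemma sqsummable_finite_supp (g : 'rV[int]_m.+1 -> R[i]) : finite_supp g -> exists Mg : R, sqsummable g Mg%:C.
Proof.
move=> [S gS]; exists (\sum_(n <- undup S) nsq (g n)) => U Uu.
have -> : \sum_(n <- U) `|g n| ^+ 2 = \sum_(n <- [seq n <- U | n \in S]) `|g n| ^+ 2.
  rewrite big_filter [RHS]big_mkcond/=; apply: eq_bigr => n _; case: ifPn => // nS.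
  have -> : g n = 0 by apply/eqP; apply: contraNT nS => /gS.
  by rewrite normr0 expr0n.
rewrite rmorph_sum.
have -> : \sum_(n <- undup S) (nsq (g n))%:C = \sum_(n <- undup S) `|g n| ^+ 2.
  by apply: eq_bigr => n _; rewrite nsqE.
have sub : {subset [seq n <- U | n \in S] <= undup S} by move=> n; rewrite mem_filter mem_undup => /andP[].
have hp := permEl (perm_filterC (fun n => n \in [seq n <- U | n \in S]) (undup S)).
rewrite perm_sym in hp; rewrite [leRHS](perm_big _ hp).
rewrite big_cat/= [X in _ <= X + _](perm_big [seq n <- U | n \in S]).
  by rewrite lerDl; apply: sumr_ge0 => n _; rewrite exprn_ge0.
apply: uniq_perm; rewrite ?filter_uniq ?undup_uniq// => n.
rewrite [LHS]mem_filter; apply: andb_idr => nU; exact: sub.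
Qed.

Lemma sqsummableB (f g : 'rV[int]_m.+1 -> R[i]) Mf Mg : sqsummable f Mf%:C -> sqsummable g Mg%:C ->
  sqsummable (fun n => f n - g n) (2 * Mf + 2 * Mg)%:C.
Proof.
move=> fM gM S Su.
apply: (@le_trans _ _ (\sum_(n <- S) (2%:R * `|f n| ^+ 2 + 2%:R * `|g n| ^+ 2))).
  apply: ler_sum => n _; rewrite -!nsqE -!(rmorph_nat (real_complex R)) -!rmorphM -rmorphD lecR.
  case: (f n) (g n) => a b [a' b']; rewrite /nsq /=.
  by have := sqr_ge0 (a + a'); have := sqr_ge0 (b + b'); nra.
rewrite big_split -!mulr_sumr rmorphD !rmorphM !rmorph_nat.
by apply: lerD; rewrite ler_wpM2l ?fM ?gM.
Qed.

(** For a zero symbol every point of the torus would be singular. *)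
Lemma lq_neq0 : exists z, tev lq z != 0.
Proof.
apply: contrapT => h.
have l0 z : tev lq z = 0 by apply/eqP; apply: contraT => lz; case: h; exists z.
have d0 (a : 'rV[C]_m.+1) z : tev (tder lq a) z = 0.
  rewrite -derive_tev; have -> : (tev lq : 'rV[C]_m.+1 -> C) = cst 0 by apply/funext => w; exact: l0.
  by rewrite derive_cst.
pose B : 'M[int]_m.+1 := 1%:M.
have Bu : B \in unitmx by exact: unitmx1.
pose ze (n k : nat) : R[i] := (if k == 0%N then 1 / n.+1%:R else 0)%:C.
apply: (@not_discrete R m.+1 lq (fun n => zmap B (ze n)) (1 * Kmax R B)) => //.
  move=> n j; apply: zmap_bound => k km; rewrite /ze normc_def /= expr0n addr0 sqrtr_sqr lecR.
  case: eqP => _; last by rewrite normr0.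
  by rewrite ger0_norm ?divr_ge0// ler_pdivrMr// mul1r ler1n.
  by move=> n; split=> // j; rewrite d0.
move=> n k /(yz_eq_torus B 0%N); rewrite !(yz_zmap Bu)// /ze eqxx.
exact: (@arc_injective R 1 ltr01 (lexx 1)).
Qed.

Lemma near_lip l x0 (h : R) : 0 < h -> exists2 dl : R, 0 < dl &
  forall x, (forall i, `|x 0 i - x0 0 i| <= dl) -> `|tev l (realpt x) - tev l (realpt x0)| < h%:C.
Proof.
move=> h0; have [L L0 hL] := tev_lip l.
exists (h / (2 * (L * m.+1%:R + 1))) => [|x hx].
  by rewrite divr_gt0// mulr_gt0// ltr_wpDl// mulr_ge0.
apply: le_lt_trans (hL x x0) _; rewrite ltcR.
have D1 : 0 < L * m.+1%:R + 1 by rewrite ltr_wpDl// mulr_ge0.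
apply: (@le_lt_trans _ _ (L * (m.+1%:R * (h / (2 * (L * m.+1%:R + 1)))))).
  rewrite ler_wpM2l// /dist1 mulr_natl -[X in _ *+ X]card_ord -sumr_const.
  exact: ler_sum.
have -> : L * (m.+1%:R * (h / (2 * (L * m.+1%:R + 1)))) = h / 2 * (L * m.+1%:R / (L * m.+1%:R + 1)).
  have fD (D K : R) : D != 0 -> L * (K * (h / (2 * D))) = h / 2 * (L * K / D) by move=> ?; field.
  by apply: fD; rewrite lt0r_neq0.
have h1 : L * m.+1%:R / (L * m.+1%:R + 1) <= 1 by rewrite ler_pdivrMr// mul1r lerDl.
by apply: (@le_lt_trans _ _ (h / 2)); [rewrite ler_piMr// ltW// divr_gt0 | rewrite ltr_pdivrMr// ltr_pMr// ltr1n].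
Qed.

Lemma near_neq0 l x0 : tev l (realpt x0) != 0 -> exists2 dl : R, 0 < dl &
  forall x, (forall i, `|x 0 i - x0 0 i| <= dl) -> tev l (realpt x) != 0.
Proof.
move=> l0; have /complex_realP[c cE] : `|tev l (realpt x0)| \is Num.real by exact: normr_real.
have c0 : 0 < c by rewrite -ltr0c -cE normr_gt0.
have [dl dl0 h] := near_lip l x0 c0; exists dl => // x /h; rewrite -cE.
by apply: contraTneq => ->; rewrite sub0r normrN ltxx.
Qed.

(** Otherwise [g] is bounded below near [x0], while a nonzero partial derivative puts a zero of [q]
    on every nearby parallel line; [l2_vanish] excludes this. *)
Lemma g_vanish gl x0 : (forall n, tact lq v n = tcoef gl n) ->
  q x0 = 0 -> ~ crit lq (realpt x0) -> tev gl (realpt x0) = 0.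
Proof.
move=> hg qx0 nc; apply/eqP; apply: contraT => g0.
have [j Dj] : exists j, tev (tder lq (delta_mx 0 j)) (realpt x0) != 0.
  apply: contrapT => h; apply: nc => j; apply/eqP; apply: contraT => Dj.
  by case: h; exists j.
have deltaE : delta_mx 0 j = realpt (delta_mx 0 j : 'rV[R]_m.+1) :> 'rV[C]_m.+1.
  by apply/rowP => i; rewrite !mxE rmorph_nat.
rewrite deltaE in Dj.
have /complex_realP[c cE] : `|tev gl (realpt x0)| \is Num.real by exact: normr_real.
have c0 : 0 < c by rewrite -ltr0c -cE normr_gt0.
have [r1 r10 hr1] := near_lip gl x0 (divr_gt0 c0 (ltr0n _ 2 : 0 < 2%:R)).
pose r := Num.min 1 r1; have r0 : 0 < r by rewrite lt_min ltr01.
have r1' : r <= 1 by rewrite ge_min lexx.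
have r20 : 0 < r / 2 by rewrite divr_gt0.
have [r' r'0 hr'] := cross lq_real qx0 Dj r20.
have [L L0 hL] := q_lip lq_real.
apply: False_ind; apply: (@l2_vanish R m.+1 lq gl v M lq_real vM hg x0 j ((c / 2) ^+ 2) r (Num.min r r') L) => //.
- by rewrite exprn_gt0// divr_gt0.
- by rewrite lt_min r0.
- by rewrite ge_min lexx.
- move=> x hx; have := hr1 x; move=> /(_ _).
  have hx1 i : `|x 0 i - x0 0 i| <= r1 by rewrite (le_trans (hx i))// ge_min lexx orbT.
  move=> /(_ hx1) h; rewrite -lecR nsqE.
  have h2 : (c / 2)%:C <= `|tev gl (realpt x)|.
    have : `|tev gl (realpt x0)| <= `|tev gl (realpt x) - tev gl (realpt x0)| + `|tev gl (realpt x)|.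
      by rewrite distrC -{1}[tev gl (realpt x0)](subrK (tev gl (realpt x))) ler_normD.
    rewrite cE => h3; have /complex_realP[b bE] : `|tev gl (realpt x)| \is Num.real by exact: normr_real.
    have := le_lt_trans h3 (ltr_leD h (lexx _)).
    by rewrite bE -rmorphD ltcR lecR; lra.
  rewrite rmorphXn; apply: lerXn2r h2; rewrite nnegrE ?normr_ge0// ler0c.
  by rewrite divr_ge0// ltW.
- move=> x hx; have [|t te qt] := hr' (setc x j (x0 0 j)).
    move=> i; rewrite mxE; case: eqP => [->|_]; first by rewrite subrr normr0 ltW.
    by rewrite (le_trans (hx i))// ge_min lexx orbT.
  exists (x0 0 j + t); first by rewrite addrAC subrr add0r.
  rewrite -qt; congr q; apply/rowP => i; rewrite !mxE eqxx /=.
  by case: eqP => _; rewrite ?mulr1 ?mulr0 ?addr0.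
move=> x s t; apply: le_trans (hL _ _) _; rewrite ler_wpM2l// /dist1.
rewrite (bigD1 j)//= !mxE eqxx big1 ?addr0// => i ij.
by rewrite !mxE (negPf ij) subrr normr0.
Qed.

End RellichL2.

Section RellichL2.
Variables (R : realType) (m : nat) (lq : tpoly R m.+1) (v : 'rV[int]_m.+1 -> R[i]) (M : R).
Local Notation C := (R[i]^o).
Local Notation T := (tower R[i]).
Local Notation q := (qR lq).
Implicit Types (z w : 'rV[C]_m.+1) (x : 'rV[R]_m.+1) (l : tpoly R m.+1).

Hypothesis m0 : (0 < m)%N.
Hypothesis lq_real : forall x, conjc (tev lq (realpt x)) = tev lq (realpt x).
Hypothesis vM : sqsummable v M%:C.
Hypothesis gfin : finite_supp (tact lq v).
Hypothesis sng : discrete_subset (Sng lq).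
Hypothesis reg : forall t, Reg lq t -> connected_component (Reg lq) t `&` real_torus !=set0.

Lemma q_zero x : q x = 0 <-> tev lq (realpt x) = 0.
Proof.
rewrite /qR; split=> [h|->//]; apply/eqP; rewrite eq_complex h eqxx /=.
have := lq_real x; case: (tev lq (realpt x)) => a b /= [] /eqP.
by rewrite -subr_eq0 -opprD oppr_eq0 -mulr2n mulrn_eq0.
Qed.

Lemma crit_toTorus z w : toTorus z = toTorus w -> crit lq z -> crit lq w.
Proof. by move=> e h j; rewrite -(tev_toTorus _ e). Qed.

Variables (gl : tpoly R m.+1) (B : 'M[int]_m.+1) (P g : {poly T m}) (c : R[i]).
Variables (k kg : 'rV[int]_m.+1).
Hypothesis hg : forall n, tact lq v n = tcoef gl n.
Hypothesis Bu : B \in unitmx.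
Hypothesis Pm : P \is monic.
Hypothesis c0 : c != 0.
Hypothesis PE : forall z, ev m.+1 (yz B z) P = c * phase k z * tev lq z.
Hypothesis gE : forall z, ev m.+1 (yz B z) g = phase kg z * tev gl z.

(** The component of [z] contains a real regular point [x0]. Near [x0] the numerator vanishes on the
    real zero set, so by [min_divisor] it is a multiple of a factor [P1] of [P] vanishing at [x0],
    and [component_factor] carries the vanishing of [P1] to [z]. *)
Lemma numerator_vanish z : tev lq z = 0 -> ~ crit lq z -> tev gl z = 0.
Proof.
move=> lz nc.
have [t [Kt [x0 _ x0t]]] : connected_component (Reg lq) (toTorus z) `&` real_torus !=set0.
  by apply: reg; exists z.
have [w [lw ncw] wt] : Reg lq t by apply: connected_component_sub Kt.
have wx0 : toTorus w = toTorus (realpt x0) by rewrite wt x0t.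
have qx0 : q x0 = 0 by apply/q_zero; rewrite -(tev_toTorus _ wx0).
have ncx : ~ crit lq (realpt x0) by move=> h; apply: ncw; apply: crit_toTorus h; rewrite wx0.
have Pq x : q x = 0 -> ev m.+1 (yz B (realpt x)) P = 0.
  by move=> /q_zero h; rewrite PE h mulr0.
pose J (r : {poly T m}) := exists2 dl : R, 0 < dl & forall x,
  (forall i, `|x 0 i - x0 0 i| <= dl) -> q x = 0 -> ev m.+1 (yz B (realpt x)) r = 0.
have istp_ev (f : {poly T m}) : exists lf, forall z, ev m.+1 (yz B z) f = tev lf z.
  exact: (@tpoly_of_tower R m B m.+1 f (leqnn _)).
pose U : tpoly R m.+1 := [:: (c, k)].
have UE z1 : tev U z1 = c * phase k z1 by rewrite /tev big_seq1.
have U0 z1 : tev U z1 != 0 by rewrite UE (mulf_neq0 c0 (phase_neq0 k z1)).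
have JI : idealP J.
  split=> [f h [d1 d10 h1] [d2 d20 h2]|f h [d2 d20 h2]].
    exists (Num.min d1 d2); first by rewrite lt_min d10.
    move=> x hx qx; rewrite rmorphB h1 ?h2 ?subrr// => i; apply: le_trans (hx i) _.
      by rewrite ge_min lexx orbT.
    by rewrite ge_min lexx.
  by exists d2 => // x hx qx; rewrite rmorphM (h2 x hx qx) mulr0.
have Jg : J g.
  have [j Dj] : exists j, tev (tder lq (delta_mx 0 j)) (realpt x0) != 0.
    apply: contrapT => h; apply: ncx => j; apply/eqP; apply: contraT => Dj.
    by case: h; exists j.
  have [dl dl0 hdl] := near_neq0 Dj; exists dl => // x hx qx.
  rewrite gE (g_vanish lq_real vM hg qx) ?mulr0// => cx.
  by have := hdl x hx; rewrite cx eqxx.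
have loc f h : P = f * h -> ev m.+1 (yz B (realpt x0)) h != 0 -> J f.
  move=> def_P; have [lh lhE] := istp_ev h; rewrite lhE => /near_neq0[dl dl0 hdl].
  exists dl => // x hx qx; have := Pq x qx; rewrite def_P rmorphM => /eqP.
  by rewrite mulf_eq0 lhE (negPf (hdl x hx)) orbF => /eqP.
have prodE f h lf lh : P = f * h -> (forall z, ev m.+1 (yz B z) f = tev lf z) ->
    (forall z, ev m.+1 (yz B z) h = tev lh z) ->
    forall w, tev U w * tev lq w = tev lf w * tev lh w.
  by move=> def_P lfE lhE w1; rewrite UE -PE def_P rmorphM lfE lhE.
have simple f h : P = f * h -> ev m.+1 (yz B (realpt x0)) f = 0 ->
    ev m.+1 (yz B (realpt x0)) h != 0.
  move=> def_P fx; apply/eqP => hx; apply: ncx => j.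
  have [lf lfE] := istp_ev f; have [lh lhE] := istp_ev h.
  apply: (sing_of_product (delta_mx 0 j) (prodE _ _ _ _ def_P lfE lhE) (U0 _)).
    by rewrite -lfE.
  by rewrite -lhE.
have noa (b : T m) : J b%:P -> b = 0.
  move=> [dl dl0 h]; apply: (no_constraint lq_real Bu Pm Pq qx0 ncx dl0) => x hx qx.
  by have := h x hx qx; rewrite evC.
have [P1 [q1 [def_P P1x [s gs]]]] := min_divisor Pm JI (Pq x0 qx0) Jg loc simple noa.
have [l1 l1E] := istp_ev P1; have [l2 l2E] := istp_ev q1.
have := @component_factor R m.+1 lq (toTorus z) l1 l2 U (prodE _ _ _ _ def_P l1E l2E) U0.
move=> /(_ (realpt x0)); rewrite x0t => /(_ Kt); rewrite -l1E => /(_ P1x z).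
have Kz : connected_component (Reg lq) (toTorus z) (toTorus z).
  by apply: connected_component_refl; exists z.
move=> /(_ Kz) l1z.
have : ev m.+1 (yz B z) g = 0 by rewrite gs rmorphM l1E l1z mulr0.
by rewrite gE => /eqP; rewrite mulf_eq0 (negPf (phase_neq0 _ _)) => /eqP.
Qed.

End RellichL2.

(** If [P] did not divide [g], the remainder would belong to the ideal of polynomials vanishing on
    the regular part; an element of least degree there has a cofactor of positive degree in a
    multiple of [P], contradicting [singular_family]. So [g] is [q] times some [l'], and [v] minus
    the coefficients of [l'] is square-summable and annihilated by [q], hence zero. *)
Theorem rellich_l2 (R : realType) (m : nat) (lq : tpoly R m.+1) (v : 'rV[int]_m.+1 -> R[i]) (M : R) :
  (0 < m)%N -> (forall x, conjc (tev lq (realpt x)) = tev lq (realpt x)) ->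
  sqsummable v M%:C -> finite_supp (tact lq v) -> discrete_subset (Sng lq) ->
  (forall t, Reg lq t -> connected_component (Reg lq) t `&` real_torus !=set0) ->
  finite_supp v.
Proof.
move=> m0 lq_real vM gfin sng reg.
have nz := lq_neq0 sng.
have [B Bu [P [k [c [Pm c0 PE [c1 [c10 [ex exE]]]]]]]] := normal_form nz.
have [gl hg] := finite_supp_tcoef gfin.
have [kg [g gE]] := tower_of_tpoly Bu gl.
pose J (r : {poly tower R[i] m}) := forall z, tev lq z = 0 -> ~ crit lq z ->
  ev m.+1 (yz B z) r = 0.
have JI : idealP J.
  split=> [f h h1 h2|f h h2] z lz nc; first by rewrite rmorphB h1 ?h2 ?subrr.
  by rewrite rmorphM h2 ?mulr0.
have JP : J P by move=> z lz _; rewrite PE lz mulr0.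
have Jg : J g.
  move=> z lz nc; rewrite gE.
  by rewrite (numerator_vanish lq_real vM reg hg Bu Pm c0 PE gE lz nc) mulr0.
have gs : g = (g %/ P) * P.
  have gd := Pdiv.IdomainMonic.divp_eq Pm g; rewrite {1}gd.
  have Jr : J (g %% P).
    have -> : g %% P = g - (g %/ P) * P by rewrite {2}gd addrAC subrr add0r.
    by apply JI.1 => //; apply JI.2.
  have [-> |r0] := eqVneq (g %% P) 0; first by rewrite addr0.
  have [|e [Je e0] emin] := @min_size _ (fun f => J f /\ f != 0) (g %% P) => //.
  have [k' _ kP] := ideal_min_dvd JI JP Je e0 (fun f Jf f0 => emin f (conj Jf f0)).
  have a0 : lead_coef e ^+ k' != 0 by rewrite expf_neq0 ?lead_coef_eq0.
  have se : (size e < size P)%N.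
    apply: leq_ltn_trans (emin _ (conj Jr r0)) _.
    by rewrite ltn_modp monic_neq0.
  have sq : (1 < size (P %/ e)%R)%N.
    have P0 := monic_neq0 Pm.
    have d0 : P %/ e != 0.
      apply: contraNneq (P0) => h; move/eqP: kP; rewrite h mul0r -mul_polyC mulf_eq0 polyC_eq0.
      by rewrite (negPf a0).
    have := congr1 (fun p : {poly _} => size p) kP.
    rewrite /= -mul_polyC size_Cmul// size_mul// => h; move: se; rewrite h -subn1 ltn_subRL.
    by rewrite ltn_add2r.
  by case: (singular_family Bu m0 Pm c0 PE c10 exE a0 kP sq Je sng).
have [ls lsE] := @tpoly_of_tower R m B m.+1 (g %/ P) (leqnn _).
(* The factor in front undoes the monomials that relate [P] to [lq] and [g] to [gl]. *)
pose l' := tmul [:: (c, k - kg)] ls.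
have glE z : tev gl z = tev (tmul lq l') z.
  rewrite !tev_mul [tev [:: _] z]/tev big_seq1 phaseD /=.
  apply: (mulfI (phase_neq0 kg z)); rewrite -gE {1}gs rmorphM PE lsE phaseN.
  have fE (p1 p2 a b : R[i]) : p1 != 0 -> a * (c * p2 * b) = p1 * (b * (c * (p2 / p1) * a)).
    by move=> ?; field.
  exact: fE (phase_neq0 _ _).
pose v' n := v n - tcoef l' n.
have [Mt hMt] := sqsummable_finite_supp (tcoef_finite_supp l').
have v'M := sqsummableB vM hMt.
have v'0 : forall n, v' n = 0.
  apply: (kernel_trivial lq_real v'M); first exact: small_set.
  move=> n; rewrite /tact.
  transitivity (tact lq v n - tact lq (tcoef l') n).
    by rewrite /tact -sumrB; apply: eq_bigr => t _; rewrite -mulrBr.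
  by rewrite hg tact_tcoef (tcoef_eq (fun x => glE (realpt x))) subrr.
have [S hS] := tcoef_finite_supp l'; exists S => n vn; apply: hS.
by have /eqP := v'0 n; rewrite subr_eq0 => /eqP <-.
Qed.

(** * Square-summable functions and the graph Laplacian *)

Section FsetSum.
Variables (R : realType) (X : choiceType).
Implicit Types (A B S : {fset X}).

Lemma fsum_le A B (F : X -> R) : (forall x, 0 <= F x) -> (A `<=` B)%fset ->
  \sum_(x <- A) F x <= \sum_(x <- B) F x.
Proof.
move=> F0 AB; have -> : \sum_(x <- A) F x = \sum_(x <- B) (if x \in A then F x else 0).
  rewrite -(big_fset_incl _ AB); last by move=> x _ /negPf ->.
  by apply: eq_big_seq => x ->.
by apply: ler_sum => x _; case: ifP.
Qed.

Lemma fsumU (U : nmodType) A B (F : X -> U) : (forall x, x \in B -> x \notin A) ->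
  \sum_(x <- (A `|` B)%fset) F x = \sum_(x <- A) F x + \sum_(x <- B) F x.
Proof.
move=> AB; rewrite -big_cat; apply: perm_big; apply: uniq_perm; rewrite ?fset_uniq//.
  rewrite cat_uniq !fset_uniq andbT /=; apply/hasPn => x; exact: AB.
by move=> x; rewrite mem_cat in_fsetU.
Qed.

Lemma nsq_sum (I : Type) (r : seq I) (f : I -> R[i]) :
  nsq (\sum_(i <- r) f i) <= (size r)%:R * \sum_(i <- r) nsq (f i).
Proof.
rewrite -lecR rmorphM rmorph_sum nsqE rmorph_nat.
rewrite [X in _ <= _ * X](eq_bigr (fun i => `|f i| ^+ 2)) => [|i _]; last exact: nsqE.
have -> : \sum_(i <- r) f i = \sum_(i <- r) 1 * f i by apply: eq_bigr => i _; rewrite mul1r.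
apply: le_trans (cs_sum _ _ _) _.
by rewrite normr1 expr1n big_const_seq count_predT iter_addr_0.
Qed.

Lemma nsqD (z w : R[i]) : nsq (z + w) <= 2 * nsq z + 2 * nsq w.
Proof.
case: z w => a b [c e]; rewrite /nsq /=.
have := sqr_ge0 (a - c); have := sqr_ge0 (b - e); rewrite !sqrrB !sqrrD; lra.
Qed.

Lemma nsqN (z : R[i]) : nsq (- z) = nsq z.
Proof. by case: z => a b; rewrite /nsq /= !sqrrN. Qed.

Lemma nsq0 : nsq (0 : R[i]) = 0.
Proof. by rewrite /nsq /= expr0n addr0. Qed.

Lemma nsq_eq0 (z : R[i]) : nsq z = 0 -> z = 0.
Proof.
by move=> h; have := nsqE z; rewrite h => /esym/eqP; rewrite sqrf_eq0 normr_eq0 => /eqP.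
Qed.

(** A bound for the squared norm, expressed by finite partial sums and without the degree weight. *)
Definition sq (f : X -> R[i]) (M : R) := forall S, \sum_(x <- S) nsq (f x) <= M.

Lemma sq_ge0 f M : sq f M -> 0 <= M.
Proof. by move=> /(_ fset0); rewrite big_seq_fset0. Qed.

Lemma sq_pt f M x : sq f M -> nsq (f x) <= M.
Proof. by move=> /(_ [fset x]%fset); rewrite big_seq_fset1. Qed.

Lemma sq_mono f M N : M <= N -> sq f M -> sq f N.
Proof. by move=> MN h S; apply: le_trans (h S) MN. Qed.

Lemma sq_comb (c : R[i]) f g M N : sq f M -> sq g N ->
  sq (fun x => c * f x + g x) (2 * nsq c * M + 2 * N).
Proof.
move=> fM gN S; apply: (@le_trans _ _ (\sum_(x <- S) (2 * nsq c * nsq (f x) + 2 * nsq (g x)))).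
  by apply: ler_sum => x _; apply: le_trans (nsqD _ _) _; rewrite nsqM mulrA.
rewrite big_split -!mulr_sumr; by apply: lerD; rewrite ler_wpM2l ?fM ?gN ?mulr_ge0 ?nsq_ge0.
Qed.

Lemma sq_le f g M : (forall x, nsq (f x) <= nsq (g x)) -> sq g M -> sq f M.
Proof. by move=> fg gM S; apply: le_trans (gM S); apply: ler_sum => x _. Qed.

Lemma sq_scale (c : R[i]) f M : sq f M -> sq (fun x => c * f x) (nsq c * M).
Proof.
move=> fM S; under eq_bigr do rewrite nsqM.
by rewrite -mulr_sumr ler_wpM2l ?nsq_ge0.
Qed.

Lemma sq_zero f : sq f 0 -> forall x, f x = 0.
Proof.
by move=> h x; apply/nsq_eq0/eqP; rewrite eq_le nsq_ge0 (sq_pt x h).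
Qed.

Lemma sq_tail f M (e : R) : sq f M -> 0 < e ->
  exists S0 : {fset X}, forall Z : {fset X}, (forall x, x \in Z -> x \notin S0) -> \sum_(x <- Z) nsq (f x) <= e.
Proof.
move=> fM e0; pose E := [set \sum_(x <- S) nsq (f x) | S in @setT {fset X}].
have hE : has_sup E.
  split; first by exists (\sum_(x <- fset0) nsq (f x)), fset0.
  by exists M => _ [S _ <-]; exact: fM.
have [_ [S0 _ <-] hS0] := sup_adherent e0 hE.
exists S0 => Z dis.
have := @sup_upper_bound _ _ hE (\sum_(x <- (S0 `|` Z)%fset) nsq (f x)) (ex_intro2 _ _ _ I erefl).
by rewrite fsumU//; move: hS0; lra.
Qed.

End FsetSum.

Section GraphL2.
Variables (R : realType) (X : choiceType) (G : graph X) (D : nat).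
Hypothesis degD : forall x, (deg G x <= D)%N.
Implicit Types (f g : X -> R[i]) (S : {fset X}).

Definition nbs (x : X) : {fset X} := fset_set (nbr G x).

Lemma mem_nbs x y : (y \in nbs x) = adj G x y.
Proof. by rewrite in_fset_set; [apply/idP/idP; rewrite inE | exact: nbr_finite]. Qed.

Definition vsupp f := forall x, ~ vset G x -> f x = 0.

Lemma lapE f x : lap G f x = (deg G x)%:R^-1 * \sum_(y <- nbs x) f y.
Proof. by rewrite /lap fsbig_finite//; exact: nbr_finite. Qed.

Lemma deg_gt0 x : vset G x -> (0 < deg G x)%N.
Proof.
move=> x0; rewrite /deg cardfs_gt0.
have [y [Vy yx]] : exists y, vset G y /\ y != x.
  apply: contrapT => nex; apply: (@vset_infinite _ G).
  apply: (@sub_finite_set _ _ [set x]) => // y Vy /=.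
  by apply: contrapT => /eqP yx; apply: nex; exists y.
have [[|w p] /=] := graph_connected x0 Vy.
  by move=> _ e; rewrite e eqxx in yx.
by move=> /andP[jw _] _; apply/fset0Pn; exists w; rewrite mem_nbs.
Qed.

Lemma nbs_novert x : ~ vset G x -> nbs x = fset0.
Proof.
move=> nx; apply/fsetP => y; rewrite mem_nbs in_fset0; by apply/negP => /adj_vset[/nx].
Qed.

Lemma vsupp_lap f : vsupp (lap G f).
Proof. by move=> x /nbs_novert h; rewrite lapE h big_seq_fset0 mulr0. Qed.

Lemma nsq_normc (z : R[i]) : ComplexField.Normc.normc z ^+ 2 = nsq z.
Proof. by case: z => a b; rewrite /nsq sqr_sqrtr// addr_ge0 ?sqr_ge0. Qed.

Lemma l2energy_ge0 f : (0 <= l2energy G f)%E.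
Proof. by apply: esum_ge0 => x _; rewrite lee_fin mulr_ge0 ?sqr_ge0. Qed.

Lemma l2norm_sqr f : l2norm G f ^+ 2 = fine (l2energy G f).
Proof. by rewrite sqr_sqrtr// fine_ge0// l2energy_ge0. Qed.

Lemma l2_sq f : l2 G f -> sq f (l2norm G f ^+ 2).
Proof.
move=> [f0 fE] S; rewrite l2norm_sqr.
have fin : l2energy G f \is a fin_num by rewrite ge0_fin_numE ?l2energy_ge0.
rewrite -lee_fin fineK//.
pose S' := [fset x in S | `[< vset G x >]]%fset.
have S'S : (S' `<=` S)%fset by apply/fsubsetP => x; rewrite !inE => /andP[].
rewrite -(big_fset_incl _ S'S); last first.
  move=> x xS; rewrite !inE xS /= => /negP xV; rewrite f0 ?nsq0// => Vx.
  by apply: xV; apply/asboolP.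
have : (\sum_(x \in [set` S']) ((deg G x)%:R * ComplexField.Normc.normc (f x) ^+ 2)%:E <= l2energy G f)%E.
  apply: ereal_sup_ubound; exists [set` S'] => //; split; first exact: finite_fset.
  by move=> x /=; rewrite !inE => /andP[_ /asboolP].
rewrite fsbig_finite ?set_fsetK; last exact: finite_fset.
apply: le_trans; rewrite sumEFin lee_fin [leLHS]big_seq [leRHS]big_seq.
apply: ler_sum => x; rewrite !inE => /andP[_ /asboolP Vx].
by rewrite nsq_normc ler_peMl ?nsq_ge0// ler1n deg_gt0.
Qed.

(** Degrees are at most [D]; together with [l2_sq], which uses that they are at least 1 on vertices,
    this makes the weighted and unweighted norms equivalent. *)
Lemma sq_l2 f M : vsupp f -> sq f M -> l2 G f /\ l2norm G f ^+ 2 <= D%:R * M.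
Proof.
move=> f0 fM.
have h : (l2energy G f <= (D%:R * M)%:E)%E.
  apply: ge_ereal_sup => _ [A [Af AV] <-]; rewrite fsbig_finite// sumEFin lee_fin.
  apply: (@le_trans _ _ (D%:R * \sum_(x <- fset_set A) nsq (f x))).
    rewrite mulr_sumr; apply: ler_sum => x _; rewrite nsq_normc ler_wpM2r ?nsq_ge0//.
    by rewrite ler_nat.
  by rewrite ler_wpM2l.
have fin : l2energy G f \is a fin_num.
  by rewrite ge0_fin_numE ?l2energy_ge0// (le_lt_trans h) ?ltry.
split; first by split=> //; rewrite -ge0_fin_numE ?l2energy_ge0.
by rewrite l2norm_sqr -lee_fin fineK.
Qed.

Lemma nsq_lap f x : nsq (lap G f x) <= \sum_(y <- nbs x) nsq (f y).
Proof.
rewrite lapE; have [Vx|/nbs_novert nV] := pselect (vset G x); last first.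
  by rewrite nV !big_seq_fset0 mulr0 nsq0.
have d0 : (0 : R) < (deg G x)%:R by rewrite ltr0n deg_gt0.
rewrite -(rmorph_nat (real_complex R)) -fmorphV nsqM nsqR exprVn ler_pdivrMl ?exprn_gt0//.
apply: le_trans (nsq_sum _ _) _.
rewrite -[size _]/(deg G x) ler_wpM2r ?sumr_ge0// ?expr2 ?ler_peMl ?ler1n ?deg_gt0 ?ltW//.
by move=> y _; exact: nsq_ge0.
Qed.

(* Double counting: each vertex lies in at most D neighbourhoods. *)
Lemma sum_nbs S (P : {fset X}) (w : X -> R) : (forall x, 0 <= w x) ->
  (forall x y, x \in S -> y \in nbs x -> y \in P) ->
  \sum_(x <- S) \sum_(y <- nbs x) w y <= D%:R * \sum_(y <- P) w y.
Proof.
move=> w0 SP.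
have -> : \sum_(x <- S) \sum_(y <- nbs x) w y = \sum_(x <- S) \sum_(y <- P) (adj G x y)%:R * w y.
  apply: eq_big_seq => x xS.
  have NP : (nbs x `<=` P)%fset by apply/fsubsetP => y; exact: SP.
  rewrite -[RHS](big_fset_incl _ NP) => [|y _]; last by rewrite mem_nbs => /negPf ->; rewrite mul0r.
  by apply: eq_big_seq => y; rewrite mem_nbs => ->; rewrite mul1r.
rewrite exchange_big mulr_sumr; apply: ler_sum => y _; rewrite -mulr_suml ler_wpM2r//.
have -> : \sum_(x <- S) (adj G x y)%:R = (#|` [fset x in S | adj G x y]|%fset)%:R :> R.
  have SS : ([fset x in S | adj G x y] `<=` S)%fset by apply/fsubsetP => x; rewrite !inE => /andP[].
  rewrite -(big_fset_incl _ SS) => [|x xS]; last by rewrite !inE xS /= => /negPf ->.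
  rewrite (eq_big_seq (fun=> 1)) => [|x]; last by rewrite !inE => /andP[_ ->].
  by rewrite big_const_seq count_predT iter_addr_0 cardfE -cardfE.
rewrite ler_nat (leq_trans _ (degD y))//; apply: fsubset_leq_card; apply/fsubsetP => x.
by rewrite !inE => /andP[_]; rewrite adj_sym -mem_nbs.
Qed.

Lemma sq_lap f M : sq f M -> sq (lap G f) (D%:R * M).
Proof.
move=> fM S; pose P := (\big[fsetU/fset0]_(x <- S) nbs x)%fset.
apply: (@le_trans _ _ (\sum_(x <- S) \sum_(y <- nbs x) nsq (f y))).
  by apply: ler_sum => x _; exact: nsq_lap.
apply: le_trans (@sum_nbs S P _ (fun x => nsq_ge0 (f x)) _) _.
  by move=> x y xS yx; apply/bigfcupP; exists x; rewrite ?xS.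
by rewrite ler_wpM2l.
Qed.
End GraphL2.

(** * Pointwise limits of bounded sequences *)

Section PointwiseLimits.
Variable R : realType.
Implicit Types (s t : nat -> R[i]) (z w : R[i]).

Definition pcv s z := forall e : R, 0 < e ->
  exists N0 : nat, forall n, (N0 <= n)%N -> nsq (s n - z) <= e.

Lemma pcv_ext s t z : s =1 t -> pcv s z -> pcv t z.
Proof. by move=> st h e /h[N0 hN]; exists N0 => n /hN; rewrite st. Qed.

Lemma pcv_cst z : pcv (fun=> z) z.
Proof. by move=> e e0; exists 0%N => n _; rewrite subrr nsq0 ltW. Qed.

Lemma pcv_scale (c : R[i]) s z : pcv s z -> pcv (fun n => c * s n) (c * z).
Proof.
move=> h e e0; have c1 : 0 < nsq c + 1 by rewrite ltr_wpDl ?nsq_ge0.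
have [|N0 hN] := h (e / (nsq c + 1)); first by rewrite divr_gt0.
exists N0 => n /hN hn; rewrite -mulrBr nsqM.
apply: (@le_trans _ _ (nsq c * (e / (nsq c + 1)))); first by rewrite ler_wpM2l ?nsq_ge0.
by rewrite mulrCA ger_pMr// ler_pdivrMr// mul1r lerDl.
Qed.

Lemma pcvD s t z w : pcv s z -> pcv t w -> pcv (fun n => s n + t n) (z + w).
Proof.
move=> hs ht e e0; have e4 : 0 < e / 4 by rewrite divr_gt0.
have [N1 h1] := hs _ e4; have [N2 h2] := ht _ e4; exists (maxn N1 N2) => n.
rewrite geq_max => /andP[/h1 {}h1 /h2 {}h2]; rewrite opprD addrACA.
by apply: le_trans (nsqD _ _) _; move: h1 h2; lra.
Qed.

Lemma pcv_sum (I : Type) (r : seq I) (F : I -> nat -> R[i]) (z : I -> R[i]) :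
  (forall i, pcv (F i) (z i)) -> pcv (fun n => \sum_(i <- r) F i n) (\sum_(i <- r) z i).
Proof.
move=> h; elim: r => [|i r IH].
  by rewrite big_nil; apply: pcv_ext (pcv_cst 0) => n; rewrite big_nil.
by rewrite big_cons; apply: pcv_ext (pcvD (h i) IH) => n; rewrite big_cons.
Qed.

Lemma pcv_shift s z : pcv s z -> pcv (fun n => s n.+1) z.
Proof. by move=> h e /h[N0 hN]; exists N0 => n nN; apply: hN; rewrite leqW. Qed.

Lemma pcv_unique s z w : pcv s z -> pcv s w -> z = w.
Proof.
move=> hz hw; apply/eqP; rewrite -subr_eq0; apply/eqP/nsq_eq0/eqP; rewrite eq_le nsq_ge0 andbT.
apply/ler_addgt0Pr => e e0; rewrite add0r; have e4 : 0 < e / 4 by rewrite divr_gt0.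
have [N1 h1] := hz _ e4; have [N2 h2] := hw _ e4.
have {}h1 := h1 _ (leq_maxl N1 N2); have {}h2 := h2 _ (leq_maxr N1 N2).
have -> : z - w = - (s (maxn N1 N2) - z) + (s (maxn N1 N2) - w).
  by rewrite opprB addrA subrK.
by apply: le_trans (nsqD _ _) _; rewrite nsqN; move: h1 h2; lra.
Qed.

Lemma real_geometric_series (a : nat -> R) (K : R) : 0 <= K ->
  (forall k, a k ^+ 2 <= K * (1 / 4) ^+ k) -> exists b : R, forall e : R, 0 < e ->
  exists N0 : nat, forall n, (N0 <= n)%N -> `|\sum_(k < n) a k - b| <= e.
Proof.
move=> K0 aK.
have ab k : `|a k| <= (K + 1) * (1 / 2) ^+ k.
  have g0 : 0 <= (1 / 2 : R) ^+ k by rewrite exprn_ge0// divr_ge0.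
  rewrite -ler_sqr ?nnegrE ?normr_ge0 ?mulr_ge0 ?addr_ge0// real_normK ?num_real//.
  apply: le_trans (aK k) _.
  rewrite [leRHS]exprMn -[X in _ <= _ * X]exprM mulnC exprM.
  have -> : (1 / 2 : R) ^+ 2 = 1 / 4 by field.
  rewrite ler_wpM2r ?exprn_ge0 ?divr_ge0//; nra.
have cv : cvgn (series a).
  apply: normed_cvg; apply: (@series_le_cvg _ _ (geometric (K + 1) (1 / 2))) => //=.
  - by move=> n; rewrite mulr_ge0 ?addr_ge0 ?exprn_ge0 ?divr_ge0.
  - by apply: is_cvg_geometric_series; rewrite ger0_norm ?divr_ge0// ltr_pdivrMr// mul1r ltr1n.
exists (limn (series a)) => e e0.
have /cvgrPdist_le /(_ e e0) [N0 _ hN] := cv; exists N0 => n nN.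
by have := hN n nN; rewrite distrC /series /= big_mkord.
Qed.

Lemma half_sum n : \sum_(k < n) (1 / 2 : R) ^+ k = 2 - 2 * (1 / 2) ^+ n.
Proof.
elim: n => [|n IH]; first by rewrite big_ord0 expr0 mulr1 subrr.
by rewrite big_ord_recr /= IH exprS; field.
Qed.

(** Iteration of [nsqD]; the geometric weights stand in for Minkowski's inequality. *)
Lemma nsq_sum_weighted n (a : nat -> R[i]) :
  nsq (\sum_(k < n) a k) <= 2 * \sum_(k < n) 2 ^+ k * nsq (a k).
Proof.
elim: n a => [|n IH] a; first by rewrite !big_ord0 nsq0 mulr0.
rewrite !big_ord_recl expr0 mul1r mulrDr; apply: le_trans (nsqD _ _) _.
rewrite lerD2l ler_wpM2l//; apply: le_trans (IH (fun k => a k.+1)) _.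
by rewrite mulr_sumr; apply: ler_sum => k _; rewrite lift0 exprS mulrA.
Qed.

Lemma pcv_geometric_series (a : nat -> R[i]) (K : R) :
  (forall k, nsq (a k) <= K * (1 / 4) ^+ k) ->
  exists z, pcv (fun n => \sum_(k < n) a k) z.
Proof.
move=> aK; have K0 : 0 <= K.
  by have := le_trans (nsq_ge0 _) (aK 0%N); rewrite expr0 mulr1.
have [k|b hb] := @real_geometric_series (fun k => complex.Re (a k)) K K0.
  by apply: le_trans (aK k); rewrite lerDl sqr_ge0.
have [k|c hc] := @real_geometric_series (fun k => complex.Im (a k)) K K0.
  by apply: le_trans (aK k); rewrite lerDr sqr_ge0.
exists (b +i* c) => e e0; pose e' := Num.min 1 (e / 2).
have e'0 : 0 < e' by rewrite lt_min ltr01 divr_gt0.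
have [N1 h1] := hb _ e'0; have [N2 h2] := hc _ e'0; exists (maxn N1 N2) => n.
rewrite geq_max => /andP[/h1 {}h1 /h2 {}h2].
have sq1 (x : R) : `|x| <= e' -> x ^+ 2 <= e / 2.
  move=> hx; rewrite -real_normK ?num_real//.
  apply: (@le_trans _ _ (`|x| * 1)); last by rewrite mulr1 (le_trans hx)// ge_min lexx orbT.
  by rewrite expr2 ler_wpM2l// (le_trans hx)// ge_min lexx.
have -> : e = e / 2 + e / 2 by field.
rewrite /nsq (raddfB (@complex.Re R)) (raddfB (@complex.Im R)) !raddf_sum /=.
by apply: lerD; apply: sq1.
Qed.

(** A crude Fatou lemma: on a finite set [h] is close to some [s n], and [nsqD] costs the factor
    2. *)
Lemma pcv_sq (X : choiceType) (s : nat -> X -> R[i]) (h : X -> R[i]) M :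
  (forall n, sq (s n) M) -> (forall x, pcv (fun n => s n x) (h x)) -> sq h (2 * M).
Proof.
move=> sM sh S; apply/ler_addgt0Pr => e e0.
have [N0 hN] : exists N0 : nat, forall n, (N0 <= n)%N ->
    \sum_(x <- S) nsq (h x - s n x) <= e / 2.
  elim: (S : seq X) (e / 2) (divr_gt0 e0 (ltr0n _ 2 : 0 < 2%:R)) => [|x r IH] e' e'0.
    by exists 0%N => n _; rewrite big_nil ltW.
  have e2 : 0 < e' / 2 by rewrite divr_gt0.
  have [N1 h1] := IH _ e2; have [N2 h2] := sh x _ e2; exists (maxn N1 N2) => n.
  rewrite geq_max big_cons => /andP[/h1 {}h1 /h2 {}h2].
  have {}h2 : nsq (h x - s n x) <= e' / 2 by rewrite -opprB nsqN.
  by rewrite [e']splitr; apply: lerD.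
have := hN N0 (leqnn _); have := sM N0 S => hs hd.
apply: (@le_trans _ _ (\sum_(x <- S) (2 * nsq (s N0 x) + 2 * nsq (h x - s N0 x)))).
  apply: ler_sum => x _; have := nsqD (s N0 x) (h x - s N0 x).
  by rewrite addrC subrK.
by rewrite big_split /= -!mulr_sumr; move: hs hd; lra.
Qed.

Lemma sq_best (X : choiceType) (f : X -> R[i]) M : sq f M ->
  exists M', sq f M' /\ forall N, sq f N -> M' <= N.
Proof.
move=> fM; pose E := [set \sum_(x <- S) nsq (f x) | S in @setT {fset X}].
have hE : has_sup E.
  split; first by exists (\sum_(x <- fset0) nsq (f x)), fset0.
  by exists M => _ [S _ <-]; exact: fM.
exists (sup E); split=> [S|N fN]; first by apply: sup_upper_bound => //; exists S.
by apply: ge_sup; [exact: hE.1 | move=> _ [S _ <-]; exact: fN].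
Qed.

End PointwiseLimits.

(** * Resolvent sets through solvability and injectivity *)

Section Resolvent.
Variables (R : realType) (X : choiceType) (G : graph X) (D : nat).
Hypothesis degD : forall x, (deg G x <= D)%N.
Implicit Types (f g h : X -> R[i]) (lam mu : R[i]) (T : (X -> R[i]) -> X -> R[i]).

(** With [no_kernel] this amounts to bounded invertibility of [T - lam], without naming an
    inverse. *)
Definition solvable T lam (C : R) := forall f N, vsupp G f -> sq f N ->
  exists g, [/\ vsupp G g, forall x, T g x - lam * g x = f x & sq g (C * N)].

Definition no_kernel T lam := forall h M, vsupp G h -> sq h M ->
  (forall x, T h x = lam * h x) -> forall x, h x = 0.

Definition lin_on_l2 T := forall (a : R[i]) f g, l2 G f -> l2 G g ->
  T (fun x => a * f x + g x) = (fun x => a * T f x + T g x).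

Lemma lap_comb (c : R[i]) f g x :
  lap G (fun y => c * f y + g y) x = c * lap G f x + lap G g x.
Proof. by rewrite !lapE big_split -mulr_sumr /=; ring. Qed.

Lemma resolvent_inv T lam : resolvent_set G T lam ->
  (exists C, 0 <= C /\ solvable T lam C) /\ no_kernel T lam.
Proof.
move=> [S [Sl2 Slin [M SM]] hS]; split.
  exists (M ^+ 2 * D%:R); split; first by rewrite mulr_ge0 ?sqr_ge0.
  move=> f N f0 fN; have [fl2 fn] := sq_l2 degD f0 fN.
  exists (S f); split; first by case: (Sl2 f fl2).
    by move=> x; rewrite -[RHS](congr1 (fun F => F x) (hS f fl2).2).
  apply: sq_mono (l2_sq (Sl2 f fl2)).
  apply: (@le_trans _ _ ((M * l2norm G f) ^+ 2)).
    have n0 : 0 <= l2norm G (S f) by exact: sqrtr_ge0.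
    by rewrite ler_sqr ?nnegrE// ?SM// (le_trans n0)// SM.
  by rewrite exprMn -mulrA ler_wpM2l ?sqr_ge0.
move=> h K h0 hK Th; have [hl2 _] := sq_l2 degD h0 hK.
have [e _] := hS h hl2.
have z0 : l2 G (fun=> 0 : R[i]).
  have v0 : vsupp G (fun=> 0 : R[i]) by [].
  have s0 : sq (fun _ : X => 0 : R[i]) 0 by move=> A; rewrite big1// => x _; exact: nsq0.
  by have [] := sq_l2 degD v0 s0.
have e0 : (fun x => T h x - lam * h x) = (fun=> 0) by apply/funext => x; rewrite Th subrr.
have S0 : S (fun=> 0) = (fun=> 0).
  have e1 : (fun x : X => 1 * (0 : R[i]) + 0) = (fun=> 0) by apply/funext => x; rewrite mulr0 addr0.
  have := Slin 1 (fun=> 0) (fun=> 0) z0 z0; rewrite e1 => e2; apply/funext => x.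
  have := congr1 (fun F => F x) e2; rewrite mul1r => /eqP.
  by rewrite -subr_eq0 opprD addrA subrr sub0r oppr_eq0 => /eqP.
by move=> x; rewrite -e e0 S0.
Qed.

Lemma inv_resolvent T lam C : (forall f, l2 G f -> l2 G (T f)) -> lin_on_l2 T -> 0 <= C ->
  solvable T lam C -> no_kernel T lam -> resolvent_set G T lam.
Proof.
move=> Tl2 Tlin C0 sol nk.
have [S hS] : {S & forall f, l2 G f -> [/\ vsupp G (S f), (fun x => T (S f) x - lam * S f x) = f
    & sq (S f) (C * l2norm G f ^+ 2)]}.
  apply: (@choice _ _ (fun f g => l2 G f -> [/\ vsupp G g, (fun x => T g x - lam * g x) = f
    & sq g (C * l2norm G f ^+ 2)])) => f.
  have [fl2|nf] := pselect (l2 G f); last by exists f.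
  have [g [g0 Tg gs]] := sol f _ fl2.1 (l2_sq fl2).
  by exists g => _; split=> //; apply/funext.
have Sl2 f : l2 G f -> l2 G (S f) by move=> /hS[a _ b]; have [] := sq_l2 degD a b.
have uniq g1 g2 : l2 G g1 -> l2 G g2 ->
    (fun x => T g1 x - lam * g1 x) = (fun x => T g2 x - lam * g2 x) -> g1 = g2.
  move=> l1 l2' e; apply/funext => x; apply/eqP; rewrite -subr_eq0.
  have hz : vsupp G (fun y => (-1) * g2 y + g1 y).
    by move=> y Vy; rewrite l1.1 ?l2'.1// mulr0 addr0.
  have Tz y : T (fun y => (-1) * g2 y + g1 y) y = lam * ((-1) * g2 y + g1 y).
    rewrite (Tlin (-1) _ _ l2' l1); have := congr1 (fun F => F y) e => /= ey.
    have -> : T g1 y = T g2 y - lam * g2 y + lam * g1 y by rewrite -ey subrK.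
    by ring.
  have := nk _ _ hz (sq_comb (-1) (l2_sq l2') (l2_sq l1)) Tz x.
  by rewrite mulN1r addrC => ->.
have comb a f g : l2 G f -> l2 G g -> l2 G (fun x => a * f x + g x).
  move=> fl gl; have := sq_comb a (l2_sq fl) (l2_sq gl) => h.
  have [] // := sq_l2 degD _ h.
  by move=> y Vy; rewrite fl.1 ?gl.1// mulr0 addr0.
exists S.
  split=> //.
    move=> a f g fl gl; have fgl := comb a f g fl gl.
    have [_ e _] := hS _ fgl; have [_ e1 _] := hS _ fl; have [_ e2 _] := hS _ gl.
    apply: uniq; [exact: Sl2|apply: comb; exact: Sl2|].
    rewrite e (Tlin a _ _ (Sl2 _ fl) (Sl2 _ gl)); apply/funext => x.
    by rewrite -{1}e1 -{1}e2; ring.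
  exists (Num.sqrt (D%:R * C)) => f fl.
  have [s0 _ ss] := hS _ fl; have [_ b] := sq_l2 degD s0 ss.
  have n0 : 0 <= l2norm G f by exact: sqrtr_ge0.
  have DC : 0 <= D%:R * C by rewrite mulr_ge0.
  rewrite -ler_sqr ?nnegrE ?mulr_ge0 ?sqrtr_ge0//.
  by rewrite [leRHS]exprMn (sqr_sqrtr DC) -[leRHS]mulrA.
move=> f fl; split; last by have [] := hS _ fl.
have Tfl : l2 G (fun x => T f x - lam * f x).
  have -> : (fun x => T f x - lam * f x) = (fun x => (- lam) * f x + T f x).
    by apply/funext => x; ring.
  exact: comb fl (Tl2 _ fl).
by apply: uniq => //; [exact: Sl2 | have [] := hS _ Tfl].
Qed.

(* Neumann series, with pointwise sums; the factor 2 ^+ k in the Cauchy-Schwarz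
   estimate is paid by the convergence factor. *)
Lemma neumann lam C : 0 <= C -> solvable (fun f x => - lap G f x) lam C ->
  no_kernel (fun f x => - lap G f x) lam ->
  forall mu, nsq (mu - lam) * C <= 1 / 4 ->
  solvable (fun f x => - lap G f x) mu (8 * C) /\ no_kernel (fun f x => - lap G f x) mu.
Proof.
move=> C0 sol nk mu; set t := mu - lam => tC; have t0 := nsq_ge0 t; split; last first.
  move=> h M h0 hM Th.
  (* For the least bound [M'] of [h]: since [T h - lam * h = t * h], the bound contracts to a
     quarter of [M'], so [M' = 0]. *)
  have [M' [hM' best]] := sq_best hM.
  have [|g [g0 Tg gM]] := sol (fun x => t * h x) _ _ (sq_scale t hM').
    by move=> x /h0 ->; rewrite mulr0.
  have gh x : h x = g x.
    apply/eqP; rewrite -subr_eq0; apply/eqP; rewrite addrC -mulN1r.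
    have hz : vsupp G (fun y => (-1) * g y + h y).
      by move=> y Vy; rewrite g0 ?h0// mulr0 addr0.
    apply: (nk _ _ hz (sq_comb (-1) gM hM)) => y; have e1 := Tg y; have e2 := Th y.
    rewrite lap_comb.
    have e3 : - lap G h y = t * h y + lam * h y by rewrite e2 /t; ring.
    have -> : - (-1 * lap G g y + lap G h y) = lap G g y - lap G h y by ring.
    by rewrite e3 -e1; ring.
  have hg : sq h (C * (nsq t * M')) by apply: sq_le gM => x; rewrite gh.
  have := best _ hg; have M0 := sq_ge0 hM'.
  have : C * (nsq t * M') <= 1 / 4 * M' by rewrite mulrA [C * _]mulrC ler_wpM2r.
  move=> b1 b2; have M'0 : M' = 0 by apply/eqP; rewrite eq_le M0 andbT; move: b1 b2 M0; lra.
  by apply: sq_zero; rewrite -M'0.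
move=> f N f0 fN; have N0 := sq_ge0 fN.
have [S hS] : {S : (X -> R[i]) * R -> X -> R[i] & forall p, vsupp G p.1 -> sq p.1 p.2 ->
    [/\ vsupp G (S p), forall x, - lap G (S p) x - lam * S p x = p.1 x & sq (S p) (C * p.2)]}.
  apply: (@choice _ _ (fun p g => vsupp G p.1 -> sq p.1 p.2 -> [/\ vsupp G g,
    forall x, - lap G g x - lam * g x = p.1 x & sq g (C * p.2)])) => -[f1 N1].
  have [a|na] := pselect (vsupp G f1); last by exists f1.
  have [b|nb] := pselect (sq f1 N1); last by exists f1.
  by have [g gh] := sol _ _ a b; exists g.
(* [g k] is the inverse of [- lap - lam] applied [k.+1] times to [f]. *)
pose g := fix g k := if k is k'.+1 then S (g k', C ^+ k * N) else S (f, N).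
have gP k : [/\ vsupp G (g k), forall x, - lap G (g k) x - lam * g k x = (if k is k'.+1 then g k' x else f x)
    & sq (g k) (C ^+ k.+1 * N)].
  elim: k => [|k [a _ b]]; first by have := hS (f, N) f0 fN; rewrite expr1.
  by have := hS (g k, C ^+ k.+1 * N) a b; rewrite /= mulrA -exprS.
have gs k : sq (fun x => t ^+ k * g k x) (C * N * (1 / 4) ^+ k).
  have [_ _ b] := gP k; apply: sq_mono (sq_scale _ b).
  have -> : nsq (t ^+ k) = nsq t ^+ k.
    by elim: (k) => [|n IH]; rewrite ?expr0 ?(nsqR 1) ?expr1n// !exprS nsqM IH.
  have -> : nsq t ^+ k * (C ^+ k.+1 * N) = C * N * (nsq t * C) ^+ k.
    by rewrite exprS exprMn; ring.
  by rewrite ler_wpM2l ?mulr_ge0// lerXn2r ?nnegrE ?mulr_ge0 ?divr_ge0.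
pose s n x := \sum_(k < n) t ^+ k * g k x.
have [h hcv] : {h : X -> R[i] & forall x, pcv (fun n => s n x) (h x)}.
  apply: (@choice _ _ (fun x z => pcv (fun n => s n x) z)) => x.
  by apply: (@pcv_geometric_series _ (fun k => t ^+ k * g k x) (C * N)) => k; exact: sq_pt (gs k).
have sM n : sq (s n) (4 * (C * N)).
  move=> A; apply: (@le_trans _ _ (\sum_(x <- A) 2 * \sum_(k < n) 2 ^+ k * nsq (t ^+ k * g k x))).
    by apply: ler_sum => x _; exact: (nsq_sum_weighted n (fun k => t ^+ k * g k x)).
  rewrite -mulr_sumr exchange_big /=.
  apply: (@le_trans _ _ (2 * \sum_(k < n) (C * N) * (1 / 2) ^+ k)).
    rewrite ler_wpM2l//; apply: ler_sum => k _; rewrite -mulr_sumr.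
    have -> : C * N * (1 / 2) ^+ k = 2 ^+ k * (C * N * (1 / 4) ^+ k).
      have -> : (1 / 2 : R) = 2 * (1 / 4) by field.
      by rewrite exprMn; ring.
    by rewrite ler_wpM2l ?exprn_ge0//; exact: gs.
  rewrite -mulr_sumr half_sum.
  have : 0 <= C * N * (1 / 2) ^+ n by rewrite !mulr_ge0 ?exprn_ge0 ?divr_ge0.
  by move=> p; nra.
exists h; split.
- move=> x Vx; apply: pcv_unique (hcv x) _; apply: pcv_ext (pcv_cst 0) => n.
  by rewrite /s big1// => k _; have [a _ _] := gP k; rewrite a// mulr0.
- move=> x.
  have eqn n : - lap G (s n.+1) x - lam * s n.+1 x = f x + t * s n x.
    elim: n => [|n IH].
      have -> : s 1%N = g 0%N by apply/funext => y; rewrite /s big_ord1 expr0 mul1r.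
      by have [_ -> _] := gP 0%N; rewrite /s big_ord0 mulr0 addr0.
    have sE k : s k.+1 = (fun y => t ^+ k * g k y + s k y).
      by apply/funext => y; rewrite /s big_ord_recr addrC.
    have e1 : s n.+1 x = t ^+ n * g n x + s n x by rewrite (sE n).
    rewrite (sE n.+1) lap_comb.
    have [_ gn _] := gP n.+1.
    have -> : - (t ^+ n.+1 * lap G (g n.+1) x + lap G (s n.+1) x) -
      lam * (t ^+ n.+1 * g n.+1 x + s n.+1 x) =
      t ^+ n.+1 * (- lap G (g n.+1) x - lam * g n.+1 x) + (- lap G (s n.+1) x - lam * s n.+1 x) by ring.
    by rewrite gn IH e1 exprS; ring.
  have c1 : pcv (fun n => - lap G (s n.+1) x - lam * s n.+1 x) (- lap G h x - lam * h x).
    apply: (@pcv_ext _ (fun n => (-1) * lap G (s n.+1) x + (- lam) * s n.+1 x)).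
      by move=> n; ring.
    have -> : - lap G h x - lam * h x = (-1) * lap G h x + (- lam) * h x by ring.
    apply: pcvD; apply: pcv_scale; last exact: pcv_shift (hcv x).
    rewrite lapE; apply: (@pcv_ext _ (fun n => (deg G x)%:R^-1 * \sum_(y <- nbs G x) s n.+1 y)).
      by move=> n; rewrite lapE.
    by apply: pcv_scale; apply: pcv_sum => y; exact: pcv_shift (hcv y).
  have c2 : pcv (fun n => - lap G (s n.+1) x - lam * s n.+1 x) (f x + t * h x).
    apply: (@pcv_ext _ (fun n => f x + t * s n x)); first by move=> n; rewrite eqn.
    by apply: pcvD; [exact: pcv_cst | exact: pcv_scale].
  have -> : mu = lam + t by rewrite /t addrC subrK.
  rewrite mulrDl opprD addrA (pcv_unique c1 c2).
  by rewrite addrK.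
have -> : 8 * C * N = 2 * (4 * (C * N)) by ring.
exact: pcv_sq sM hcv.
Qed.

End Resolvent.

(** * Finite-rank perturbations of an invertible operator *)

Section FiniteRank.
Variables (R : realType) (X : choiceType).
Implicit Types (f g : X -> R[i]) (T : (X -> R[i]) -> X -> R[i]).

Definition ell2 f := exists N, sq f N.

Definition linear_ell2 T := forall (a : R[i]) f g, ell2 f -> ell2 g ->
  forall x, T (fun y => a * f y + g y) x = a * T f x + T g x.

Lemma ell2_0 : ell2 (fun=> 0).
Proof. by exists 0 => S; rewrite big1// => x _; exact: nsq0. Qed.

Lemma ell2_comb (a : R[i]) f g : ell2 f -> ell2 g -> ell2 (fun y => a * f y + g y).
Proof. by move=> [M fM] [N gN]; eexists; exact: sq_comb fM gN. Qed.

Lemma ell2_sum (I : Type) (r : seq I) (c : I -> R[i]) (u : I -> X -> R[i]) :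
  (forall i, ell2 (u i)) -> ell2 (fun x => \sum_(i <- r) c i * u i x).
Proof.
move=> uL; elim: r => [|i r IH].
  have -> : (fun x => \sum_(i <- [::]) c i * u i x) = (fun=> 0).
    by apply/funext => x; rewrite big_nil.
  exact: ell2_0.
have -> : (fun x => \sum_(j <- i :: r) c j * u j x) =
    (fun x => c i * u i x + \sum_(j <- r) c j * u j x) by apply/funext => x; rewrite big_cons.
exact: ell2_comb.
Qed.

Lemma ell2_linear0 T x : linear_ell2 T -> T (fun=> 0) x = 0.
Proof.
move=> Tl; have := Tl 1 _ _ ell2_0 ell2_0 x.
have -> : (fun _ : X => 1 * (0 : R[i]) + 0) = (fun=> 0) by apply/funext => y; rewrite mulr0 addr0.
by rewrite mul1r => /eqP; rewrite -subr_eq0 opprD addrA subrr sub0r oppr_eq0 => /eqP.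
Qed.

Lemma ell2_linear_sum T (I : Type) (r : seq I) (c : I -> R[i]) (u : I -> X -> R[i]) x :
  linear_ell2 T -> (forall i, ell2 (u i)) ->
  T (fun y => \sum_(i <- r) c i * u i y) x = \sum_(i <- r) c i * T (u i) x.
Proof.
move=> Tl uL; elim: r => [|i r IH].
  have -> : (fun y => \sum_(i <- [::]) c i * u i y) = (fun=> 0) by apply/funext => y; rewrite big_nil.
  by rewrite big_nil ell2_linear0.
have -> : (fun y => \sum_(j <- i :: r) c j * u j y) =
    (fun y => c i * u i y + \sum_(j <- r) c j * u j y) by apply/funext => y; rewrite big_cons.
by rewrite Tl//; [rewrite IH big_cons | exact: ell2_sum].
Qed.

Variables (A0 K : (X -> R[i]) -> X -> R[i]) (C CK : R) (n : nat) (ys : 'I_n -> X).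
Hypothesis C0 : 0 <= C.
Hypothesis CK0 : 0 <= CK.
Hypothesis A0lin : linear_ell2 A0.
Hypothesis A0inj : forall f, ell2 f -> (forall x, A0 f x = 0) -> forall x, f x = 0.
Hypothesis A0sol : forall f N, sq f N -> exists g, (forall x, A0 g x = f x) /\ sq g (C * N).
Hypothesis Klin : linear_ell2 K.
Hypothesis KB : forall f N, sq f N -> forall x, nsq (K f x) <= CK * N.
Hypothesis ys_inj : injective ys.
Hypothesis Ksupp : forall f x, ell2 f -> (forall i, ys i <> x) -> K f x = 0.

Definition delta (i : 'I_n) (x : X) : R[i] := (x == ys i)%:R.

Lemma sum_delta (c : 'I_n -> R[i]) i : \sum_j c j * delta j (ys i) = c i.
Proof.
rewrite (bigD1 i)//= /delta eqxx mulr1 big1 ?addr0// => j ji.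
by rewrite (inj_eq ys_inj) eq_sym (negPf ji) mulr0.
Qed.

Lemma sq_delta (c : 'I_n -> R[i]) N : (forall i, nsq (c i) <= N) ->
  sq (fun x => \sum_j c j * delta j x) (n%:R * N).
Proof.
move=> cN S; pose F := [fset ys i | i in 'I_n]%fset.
have F0 x : x \notin F -> \sum_j c j * delta j x = 0.
  move=> xF; rewrite big1// => j _; rewrite /delta; case: eqP => [e|]; last by rewrite mulr0.
  by case/negP: xF; rewrite e; apply/imfsetP; exists j.
apply: (@le_trans _ _ (\sum_(x <- (F `|` S)%fset) nsq (\sum_j c j * delta j x))).
  by apply: fsum_le; [move=> x; exact: nsq_ge0 | exact: fsubsetUr].
rewrite -(big_fset_incl _ (fsubsetUl F S)); last by move=> x _ /F0 ->; exact: nsq0.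
rewrite (perm_big [seq ys i | i <- index_enum 'I_n])/=; last first.
  apply: uniq_perm; [exact: fset_uniq | by rewrite map_inj_uniq ?index_enum_uniq|] => x.
  by apply/imfsetP/mapP => [[i _ ->]|[i _ ->]]; exists i => //; rewrite mem_index_enum.
rewrite big_map; under eq_bigr do rewrite sum_delta.
by apply: le_trans (ler_sum _ (fun i _ => cN i)) _; rewrite sumr_const card_ord mulr_natl.
Qed.

Lemma ell2_delta i : ell2 (delta i).
Proof.
exists (n%:R * 1) => S.
have := @sq_delta (fun j => (j == i)%:R) 1 _ S; under eq_bigr => x _.
  rewrite (bigD1 i)//= eqxx mul1r big1 ?addr0; last by move=> j /negPf ->; rewrite mul0r.
  over.
apply => j; case: (j == i); first by rewrite (nsqR 1) expr1n.
by rewrite nsq0.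
Qed.

(** Solving with the least bound of [f] gives one solution that satisfies the estimate for every
    [N]. *)
Lemma inverse_op : exists S : (X -> R[i]) -> X -> R[i], forall f, ell2 f ->
  (forall x, A0 (S f) x = f x) /\ forall N, sq f N -> sq (S f) (C * N).
Proof.
pose P f g := ell2 f -> (forall x, A0 g x = f x) /\ forall N, sq f N -> sq g (C * N).
suff /choice[S hS] : forall f, exists g, P f g by exists S.
move=> f; rewrite /P; have [[N fN]|nf] := pselect (ell2 f); last by exists f.
have [M [fM best]] := sq_best fN; have [g [gf gM]] := A0sol fM.
by exists g => _; split=> // N' /best h; apply: sq_mono gM; rewrite ler_wpM2l.
Qed.

Lemma finite_rank_kernel (k : nat) (u : 'I_k -> X -> R[i]) : (n < k)%N -> (forall i, ell2 (u i)) ->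
  exists c : 'I_k -> R[i], (exists i, c i != 0) /\
    forall x, K (fun y => \sum_i c i * u i y) x = 0.
Proof.
move=> nk uL; pose U : 'M[R[i]]_(k, n) := \matrix_(i, j) K (u i) (ys j).
have : kermx U != 0 by rewrite -mxrank_eq0 mxrank_ker -lt0n subn_gt0 (leq_ltn_trans (rank_leq_col _)).
move=> k0; pose v := nz_row (kermx U).
have v0 : v != 0 by rewrite nz_row_eq0.
have vU : v *m U = 0 by apply/sub_kermxP; exact: nz_row_sub.
exists (fun i => v 0 i); split; first by move/rV0Pn: v0.
move=> x; have [[j <-]|nx] := pselect (exists j, ys j = x).
  rewrite (ell2_linear_sum _ _ _ Klin uL).
  transitivity ((v *m U) 0 j); last by rewrite vU mxE.
  by rewrite mxE; apply: eq_bigr => i _; rewrite [U _ _]mxE.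
by apply: Ksupp; [exact: ell2_sum | move=> j e; apply: nx; exists j].
Qed.

Local Notation A := (fun f x => A0 f x + K f x).

(** A kernel element satisfies [A0 g = - K g], and [K g] is a combination of the [delta i]; so [g]
    is that combination, negated, of their preimages under [A0]. *)
Lemma finite_rank_span : exists b : 'I_n -> X -> R[i], forall g, ell2 g ->
  (forall x, A0 g x + K g x = 0) -> exists c : 'I_n -> R[i], g = (fun x => \sum_i c i * b i x).
Proof.
have [S hS] := inverse_op.
have SL i : ell2 (S (delta i)).
  have [_ h] := hS _ (ell2_delta i); have [N dN] := ell2_delta i.
  by exists (C * N); exact: h.
exists (fun i => S (delta i)) => g gL gA; exists (fun i => - K g (ys i)).
pose w y := (-1) * (\sum_i (- K g (ys i)) * S (delta i) y) + g y.
have wL : ell2 w by apply: ell2_comb => //; exact: ell2_sum.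
apply/funext => x; have := A0inj wL _ x; rewrite /w mulN1r addrC => h.
apply/eqP; rewrite -subr_eq0; apply/eqP; apply: h => {}x.
rewrite A0lin//; last exact: ell2_sum.
rewrite (ell2_linear_sum _ _ _ A0lin SL).
have -> : \sum_i (- K g (ys i)) * A0 (S (delta i)) x = - K g x.
  under eq_bigr => i _ do rewrite (hS _ (ell2_delta i)).1.
  have [[j <-]|nx] := pselect (exists j, ys j = x); first by rewrite (sum_delta (fun i => - K g (ys i))).
  rewrite (Ksupp gL) => [|j e]; last by apply: nx; exists j.
  rewrite oppr0 big1// => j _; rewrite /delta; case: eqP => [e|]; last by rewrite mulr0.
  by case: nx; exists j.
by rewrite mulN1r opprK addrC gA.
Qed.

(** The Fredholm alternative. With [S] inverse to [A0], the ansatz [g = S (f - ph c)] reduces the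
    equation to the finite system [c *m Mx = b], and a vector [c] killed by [Mx] would give the
    kernel element [S (ph c)] of [A0 + K]. *)
Lemma finite_rank_solve :
  (forall g, ell2 g -> (forall x, A0 g x + K g x = 0) -> forall x, g x = 0) ->
  exists2 C', 0 <= C' & forall f N, sq f N ->
    exists g, (forall x, A0 g x + K g x = f x) /\ sq g (C' * N).
Proof.
move=> Ainj; have [S hS] := inverse_op.
have SL f : ell2 f -> ell2 (S f).
  by move=> fL; have [_ h] := hS _ fL; have [N fN] := fL; exists (C * N); exact: h.
have Slin : linear_ell2 S.
  move=> a f g fL gL x; apply/eqP; rewrite -subr_eq0; apply/eqP.
  pose w y := (-1) * (a * S f y + S g y) + S (fun z => a * f z + g z) y.
  have fgL := ell2_comb a fL gL.
  have wL : ell2 w by apply: ell2_comb; [apply: ell2_comb; exact: SL | exact: SL].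
  rewrite addrC -mulN1r; apply: (A0inj wL) => y.
  rewrite A0lin ?A0lin ?(hS _ _).1//; try exact: SL; last by apply: ell2_comb; exact: SL.
  by rewrite mulN1r addrC subrr.
pose Mx : 'M[R[i]]_n := \matrix_(j, i) ((j == i)%:R + K (S (delta j)) (ys i)).
pose ph (c : 'rV[R[i]]_n) x := \sum_j c 0 j * delta j x.
have phL c : ell2 (ph c) by apply: ell2_sum => i; exact: ell2_delta.
have phi c i : ph c (ys i) = c 0 i by exact: sum_delta.
have ph0 c x : (forall i, ys i <> x) -> ph c x = 0.
  move=> nx; rewrite /ph big1// => j _; rewrite /delta; case: eqP => [e|]; last by rewrite mulr0.
  by case: (nx j).
have KS c i : K (S (ph c)) (ys i) = \sum_j c 0 j * K (S (delta j)) (ys i).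
  have -> : S (ph c) = (fun x => \sum_j c 0 j * S (delta j) x).
    by apply/funext => x; rewrite (ell2_linear_sum _ _ _ Slin)// => j; exact: ell2_delta.
  by rewrite (ell2_linear_sum _ _ _ Klin)// => j; apply: SL; exact: ell2_delta.
have MxE c i : (c *m Mx) 0 i = c 0 i + K (S (ph c)) (ys i).
  rewrite KS mxE -(phi c i) /ph -big_split; apply: eq_bigr => j _ /=.
  by rewrite mxE mulrDr /delta (inj_eq ys_inj) [i == j]eq_sym.
have Mxu : Mx \in unitmx.
  rewrite unitmxE unitfE; apply/det0P => -[c c0 cM].
  have z x : A0 (S (ph c)) x + K (S (ph c)) x = 0.
    rewrite (hS _ (phL c)).1; have [[i <-]|nx] := pselect (exists i, ys i = x).
      by rewrite phi -MxE cM mxE.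
    have nx' i : ys i <> x by move=> e; apply: nx; exists i.
    by rewrite ph0// Ksupp ?addr0//; exact: SL.
  have Sz := Ainj _ (SL _ (phL c)) z.
  have S0 : S (ph c) = (fun=> 0) by apply/funext.
  case/eqP: c0; apply/rowP => i; rewrite mxE -phi -(hS _ (phL c)).1 S0.
  exact: ell2_linear0 A0lin.
pose Q := \sum_i \sum_j nsq (invmx Mx j i).
pose C1 := n%:R * (CK * C * Q).
have Q0 : 0 <= Q by apply: sumr_ge0 => i _; apply: sumr_ge0 => j _; exact: nsq_ge0.
have C10 : 0 <= C1 by rewrite !mulr_ge0.
exists (C * (2 * nsq (-1 : R[i]) * (n%:R * C1) + 2)).
  by rewrite mulr_ge0// addr_ge0// !mulr_ge0// nsq_ge0.
move=> f N fN; have N0 := sq_ge0 fN; have fL : ell2 f by exists N.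
pose b : 'rV[R[i]]_n := \row_i K (S f) (ys i).
pose c := b *m invmx Mx.
have cb : c *m Mx = b by rewrite mulmxKV.
have bN i : nsq (b 0 i) <= CK * (C * N) by rewrite mxE; apply: KB; exact: (hS _ fL).2.
have cN i : nsq (c 0 i) <= C1 * N.
  rewrite mxE; apply: le_trans (nsq_sum _ _) _.
  have -> : size (index_enum 'I_n) = n by rewrite -[RHS]card_ord cardE enumT.
  rewrite /C1 -[leRHS]mulrA ler_wpM2l//.
  apply: (@le_trans _ _ (\sum_j CK * (C * N) * nsq (invmx Mx j i))).
    by apply: ler_sum => j _; rewrite nsqM ler_wpM2r ?nsq_ge0.
  rewrite -mulr_sumr.
  have -> : CK * C * Q * N = CK * (C * N) * Q by ring.
  rewrite ler_wpM2l ?mulr_ge0// /Q [leRHS](bigD1 i)//= lerDl.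
  by apply: sumr_ge0 => k _; apply: sumr_ge0 => j _; exact: nsq_ge0.
have phN := sq_delta cN.
pose psi x := (-1) * ph c x + f x.
have psiN : sq psi ((2 * nsq (-1 : R[i]) * (n%:R * C1) + 2) * N).
  by have := sq_comb (-1) phN fN; congr (sq _ _); ring.
have psiL : ell2 psi by eexists; exact: psiN.
exists (S psi); split; last by rewrite -[X in sq _ X]mulrA; apply: (hS _ psiL).2 psiN.
move=> x; rewrite (hS _ psiL).1 /psi.
have Ke : K (S psi) x = (-1) * K (S (ph c)) x + K (S f) x.
  have -> : S psi = (fun x => (-1) * S (ph c) x + S f x) by apply/funext => y; rewrite Slin.
  by rewrite Klin//; exact: SL.
rewrite Ke; have [[i <-]|nx] := pselect (exists i, ys i = x).
  have := MxE c i; rewrite cb mxE phi => ->; ring.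
have nx' i : ys i <> x by move=> e; apply: nx; exists i.
rewrite ph0// (Ksupp _ nx'); last exact: SL.
by rewrite (Ksupp _ nx'); [ring | exact: SL].
Qed.

End FiniteRank.

(** * Symmetry, real eigenvalues and orthogonality of eigenfunctions *)

Lemma conjc_natM (R : realType) (n : nat) (z : R[i]) : conjc (n%:R * z) = n%:R * conjc z.
Proof.
rewrite -(rmorph_nat (real_complex R)); case: z => a b.
by apply/eqP; rewrite eq_complex /= !mul0r !subr0 !addr0 mulrN !eqxx.
Qed.

Lemma conjc_sum (R : realType) (I : Type) (r : seq I) (F : I -> R[i]) :
  conjc (\sum_(i <- r) F i) = \sum_(i <- r) conjc (F i).
Proof. exact: rmorph_sum. Qed.

Section Boundary.
Variables (R : realType) (X : choiceType) (G : graph X) (D : nat).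
Hypothesis degD : forall x, (deg G x <= D)%N.
Implicit Types (f g u w : X -> R[i]) (S : {fset X}).

Definition bil S f g : R[i] := \sum_(x <- S) (deg G x)%:R * (f x * conjc (g x)).

(** Limits along the directed family of finite sets, so that inner products are handled through
    partial sums. *)
Definition eventually_fset (P : {fset X} -> Prop) :=
  exists S0 : {fset X}, forall S : {fset X}, (S0 `<=` S)%fset -> P S.

Lemma eventually_fset_all (I : finType) (P : I -> {fset X} -> Prop) :
  (forall i, eventually_fset (P i)) -> eventually_fset (fun S => forall i, P i S).
Proof.
move=> /choice[F hF]; exists (\bigcup_(i <- index_enum I) F i)%fset => S FS i.
apply: hF; apply: fsubset_trans FS; apply/fsubsetP => x xF.
by apply/bigfcupP; exists i; rewrite ?mem_index_enum.
Qed.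

Lemma deg_lap u x : (deg G x)%:R * lap G u x = \sum_(y <- nbs G x) u y.
Proof.
rewrite lapE; have [d0|d0] := eqVneq (deg G x) 0%N.
  rewrite d0 mul0r; have /eqP -> : nbs G x == fset0 by rewrite -cardfs_eq0 -/(deg G x) d0.
  by rewrite big_seq_fset0.
by rewrite mulrA divff ?mul1r// pnatr_eq0.
Qed.

Lemma norm_conj_prod (a b : R[i]) : `|a * conjc b| <= (nsq a + nsq b)%:C.
Proof.
have -> : (nsq a + nsq b)%:C = `|a| ^+ 2 + `|b| ^+ 2 by rewrite -!nsqE -rmorphD.
have -> : `|a * conjc b| = `|a| * `|b| by rewrite normrM (norm_conjC b).
have /complex_realP[s ->] : `|a| \is Num.real by exact: normr_real.
have /complex_realP[t ->] : `|b| \is Num.real by exact: normr_real.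
rewrite -!rmorphXn -rmorphM -rmorphD lecR.
by have := sqr_ge0 (s - t); have := sqr_ge0 (s + t); nra.
Qed.

(* The edges inside S cancel; only edges leaving S contribute. *)
Lemma boundary u w (e : R) : ell2 u -> ell2 w -> 0 < e ->
  eventually_fset (fun S => `|bil S (lap G u) w - bil S u (lap G w)| <= e%:C).
Proof.
move=> [M uM] [N wN] e0; pose e1 := e / (4 * D%:R + 1).
have D1 : 0 < 4 * D%:R + 1 :> R by rewrite ltr_wpDl// mulr_ge0.
have e10 : 0 < e1 by rewrite divr_gt0.
have [Su hu] := sq_tail uM e10; have [Sw hw] := sq_tail wN e10.
pose S0 := (Su `|` Sw)%fset.
(* A vertex outside such an [S] has no neighbour in [S0], so an edge leaving [S] only sees the tails
   of [u] and [w]. *)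
exists (S0 `|` \bigcup_(x <- S0) nbs G x)%fset => S S0S.
pose nu x := if x \in S0 then 0 else nsq (u x) + nsq (w x).
have nu0 x : 0 <= nu x by rewrite /nu; case: ifP => // _; rewrite addr_ge0 ?nsq_ge0.
have tail (Z : {fset X}) : \sum_(x <- Z) nu x <= 2 * e1.
  have ZS : ((Z `\` S0) `<=` Z)%fset by exact: fsubsetDl.
  rewrite -(big_fset_incl _ ZS) => [|x xZ]; last first.
    by rewrite in_fsetD xZ andbT negbK /nu => ->.
  rewrite (eq_big_seq (fun x => nsq (u x) + nsq (w x))) => [|x]; last first.
    by rewrite in_fsetD /nu => /andP[/negPf ->].
  rewrite big_split /= mulr_natl mulr2n; apply: lerD; [apply: hu|apply: hw] => x;
    by rewrite in_fsetD in_fsetU negb_or => /andP[/andP[]].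
pose P := (S `|` \bigcup_(x <- S) nbs G x)%fset.
have SP : (S `<=` P)%fset by exact: fsubsetUl.
have nP x y : x \in S -> y \in nbs G x -> y \in P.
  by move=> xS yx; rewrite in_fsetU; apply/orP; right; apply/bigfcupP; exists x; rewrite ?xS.
pose a x y := (adj G x y)%:R * (u y * conjc (w x) - u x * conjc (w y)).
have diffE : bil S (lap G u) w - bil S u (lap G w) = \sum_(x <- S) \sum_(y <- P) a x y.
  rewrite /bil -sumrB; apply: eq_big_seq => x xS.
  have NP : (nbs G x `<=` P)%fset by apply/fsubsetP => y; exact: nP.
  rewrite -(big_fset_incl _ NP) => [|y _]; last by rewrite mem_nbs /a => /negPf ->; rewrite mul0r.
  have -> : (deg G x)%:R * (u x * conjc (lap G w x)) = u x * conjc ((deg G x)%:R * lap G w x).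
    by rewrite conjc_natM mulrCA.
  rewrite mulrA !deg_lap mulr_suml conjc_sum mulr_sumr -sumrB.
  by apply: eq_big_seq => y; rewrite mem_nbs /a => ->; rewrite mul1r.
have inner : \sum_(x <- S) \sum_(y <- S) a x y = 0.
  have : \sum_(x <- S) \sum_(y <- S) a x y = - \sum_(x <- S) \sum_(y <- S) a x y.
    rewrite {1}exchange_big -sumrN; apply: eq_bigr => x _; rewrite -sumrN; apply: eq_bigr => y _.
    by rewrite /a [adj G y x]adj_sym; ring.
  by move/eqP; rewrite -addr_eq0 -mulr2n mulrn_eq0 => /eqP.
have split_sum x : \sum_(y <- P) a x y = \sum_(y <- S) a x y + \sum_(y <- (P `\` S)%fset) a x y.
  rewrite -fsumU => [|y]; last by rewrite in_fsetD => /andP[].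
  congr (\sum_(y <- enum_fset _) _); apply/fsetP => y; rewrite in_fsetU in_fsetD.
  by have := fsubsetP SP y; case: (y \in S) => //= ->.
rewrite diffE; under eq_bigr do rewrite split_sum.
rewrite big_split /= inner add0r.
apply: (@le_trans _ _ (\sum_(x <- S) \sum_(y <- nbs G x) (nu y + nu x))%:C).
  rewrite rmorph_sum; apply: le_trans (ler_norm_sum _ _ _) _.
  rewrite [leLHS]big_seq [leRHS]big_seq; apply: ler_sum => x xS.
  apply: le_trans (ler_norm_sum _ _ _) _.
  have NP : (nbs G x `<=` P)%fset by apply/fsubsetP => y; exact: nP.
  apply: (@le_trans _ _ (\sum_(y <- (P `\` S)%fset) ((adj G x y)%:R * (nu y + nu x)))%:C).
    rewrite rmorph_sum [leLHS]big_seq [leRHS]big_seq; apply: ler_sum => y.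
    rewrite in_fsetD => /andP[yS _]; rewrite /a; have [xy|_] := boolP (adj G x y); last first.
      by rewrite !mul0r normr0.
    have xS0 : x \notin S0.
      apply: contra yS => xS0; apply: (fsubsetP S0S); rewrite in_fsetU; apply/orP; right.
      by apply/bigfcupP; exists x; rewrite ?xS0 ?mem_nbs.
    have yS0 : y \notin S0.
      by apply: contra yS => yS0; apply: (fsubsetP S0S); rewrite in_fsetU yS0.
    rewrite !mul1r /nu (negPf xS0) (negPf yS0).
    rewrite -[leRHS]/((nsq (u y) + nsq (w y) + (nsq (u x) + nsq (w x)))%:C).
    have -> : (nsq (u y) + nsq (w y) + (nsq (u x) + nsq (w x)))%:C =
      (nsq (u y) + nsq (w x))%:C + (nsq (u x) + nsq (w y))%:C by rewrite -rmorphD; congr (_%:C); ring.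
    apply: le_trans (ler_normB _ _) _; apply: lerD; exact: norm_conj_prod.
  rewrite -[leRHS]/((\sum_(y <- nbs G x) (nu y + nu x))%:C).
  rewrite lecR; apply: (@le_trans _ _ (\sum_(y <- P) (adj G x y)%:R * (nu y + nu x))).
    by apply: fsum_le; [move=> y; rewrite mulr_ge0 ?addr_ge0 | exact: fsubsetDl].
  rewrite -(big_fset_incl _ NP) => [|y _]; last by rewrite mem_nbs => /negPf ->; rewrite mul0r.
  by rewrite le_eqVlt; apply/orP; left; apply/eqP; apply: eq_big_seq => y; rewrite mem_nbs => ->; rewrite mul1r.
rewrite lecR; under eq_bigr do rewrite big_split.
rewrite big_split /=; apply: (@le_trans _ _ (D%:R * (2 * e1) + D%:R * (2 * e1))).
  apply: lerD.
    by apply: le_trans (sum_nbs degD nu0 nP) _; rewrite ler_wpM2l// tail.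
  apply: (@le_trans _ _ (D%:R * \sum_(x <- S) nu x)); last by rewrite ler_wpM2l// tail.
  rewrite mulr_sumr; apply: ler_sum => x _.
  by rewrite big_const_seq count_predT iter_addr_0 -[nu x *+ _]mulr_natl ler_wpM2r// ler_nat; exact: degD.
have -> : D%:R * (2 * e1) + D%:R * (2 * e1) = 4 * D%:R * e1 by ring.
rewrite /e1 mulrCA ger_pMr// ler_pdivrMr// mul1r lerDl.
by [].
Qed.

Variable T : (X -> R[i]) -> X -> R[i].
Hypothesis symT : forall u w (e : R), ell2 u -> ell2 w -> vsupp G u -> vsupp G w -> 0 < e ->
  eventually_fset (fun S => `|bil S (T u) w - bil S u (T w)| <= e%:C).

Definition eigf lam u := [/\ ell2 u, vsupp G u & forall x, T u x = lam * u x].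

Lemma eigf_bil lam mu u w (e : R) : eigf lam u -> eigf mu w -> 0 < e ->
  eventually_fset (fun S => `|(lam - conjc mu) * bil S u w| <= e%:C).
Proof.
move=> [uL us Tu] [wL ws Tw] e0; have [S0 h] := symT uL wL us ws e0; exists S0 => S /h.
congr (_ <= _); congr `|_|; rewrite /bil -sumrB mulr_sumr; apply: eq_bigr => x _.
by rewrite Tu Tw rmorphM; ring.
Qed.

Lemma bil_diag S u : bil S u u = (\sum_(x <- S) (deg G x)%:R * nsq (u x))%:C.
Proof.
rewrite rmorph_sum; apply: eq_bigr => x _.
have -> : u x * conjc (u x) = (nsq (u x))%:C by rewrite nsqE sqr_normc.
by rewrite rmorphM rmorph_nat.
Qed.

Lemma wsum_ge S u : vsupp G u -> \sum_(x <- S) nsq (u x) <= \sum_(x <- S) (deg G x)%:R * nsq (u x).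
Proof.
move=> us; apply: ler_sum => x _; have [Vx|nV] := pselect (vset G x).
  by rewrite ler_peMl ?nsq_ge0// ler1n deg_gt0.
by rewrite us// nsq0 mulr0.
Qed.

Lemma wsum_le S u M : sq u M -> \sum_(x <- S) (deg G x)%:R * nsq (u x) <= D%:R * M.
Proof.
move=> uM; apply: (@le_trans _ _ (D%:R * \sum_(x <- S) nsq (u x))); last by rewrite ler_wpM2l.
by rewrite mulr_sumr; apply: ler_sum => x _; rewrite ler_wpM2r ?nsq_ge0 ?ler_nat.
Qed.

Lemma small_norm_eq0 (z : R[i]) : (forall e : R, 0 < e -> `|z| <= e%:C) -> z = 0.
Proof.
move=> h; have /complex_realP[s sE] : `|z| \is Num.real by exact: normr_real.
apply/eqP; rewrite -normr_eq0 sE; apply: contraT => s0.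
have s1 : 0 < s by rewrite -ltr0c -sE normr_gt0 -normr_eq0 sE.
have := h (s / 2) (divr_gt0 s1 (ltr0n _ 2 : 0 < 2%:R)); rewrite sE lecR.
by move: s1; lra.
Qed.

Lemma eigf_real lam u : eigf lam u -> (exists x, u x != 0) -> conjc lam = lam.
Proof.
move=> hu [x0 ux0]; apply/eqP; rewrite eq_sym -subr_eq0; apply/eqP.
have n0 : 0 < nsq (u x0).
  by rewrite lt_neqAle nsq_ge0 andbT eq_sym; apply: contraNneq ux0 => /nsq_eq0 ->.
apply: small_norm_eq0 => e e0.
have [S0 h] := eigf_bil hu hu (mulr_gt0 e0 n0).
have := h (x0 |` S0)%fset (fsubsetUr _ _); rewrite normrM bil_diag rmorphM.
set b := \sum_(x <- _) _ => hb.
have nb : nsq (u x0) <= b.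
  have [_ us _] := hu; apply: le_trans (wsum_ge _ us).
  rewrite -[leLHS](big_seq_fset1 +%R x0 (fun x => nsq (u x))).
  by apply: fsum_le; [move=> x; exact: nsq_ge0 | exact: fsubsetUl].
have b0 := lt_le_trans n0 nb.
have /complex_realP[s sE] : `|lam - conjc lam| \is Num.real by exact: normr_real.
have s0 : 0 <= s by rewrite -ler0c -sE normr_ge0.
have nbC : `|b%:C| = b%:C by rewrite ger0_norm// ler0c ltW.
move: hb; rewrite nbC sE -!rmorphM !lecR => hb.
rewrite -(ler_pM2r n0); apply: le_trans hb; rewrite ler_wpM2l//.
Qed.

Lemma eigf_orth lam mu u w (e : R) : eigf lam u -> eigf mu w -> conjc mu = mu -> lam != mu -> 0 < e ->
  eventually_fset (fun S => `|bil S u w| <= e%:C).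
Proof.
move=> hu hw mur lm e0.
have /complex_realP[s sE] : `|lam - mu| \is Num.real by exact: normr_real.
have s0 : 0 < s by rewrite -ltr0c -sE normr_gt0 subr_eq0.
have [S0 h] := eigf_bil hu hw (mulr_gt0 e0 s0); exists S0 => S /h.
have /complex_realP[t tE] : `|bil S u w| \is Num.real by exact: normr_real.
by rewrite mur normrM tE sE -rmorphM !lecR mulrC ler_pM2r.
Qed.

Lemma eigf_scale lam (c : R[i]) u : linear_ell2 T -> eigf lam u -> eigf lam (fun x => c * u x).
Proof.
move=> Tl [uL us Tu]; have z0 := @ell2_0 R X.
have e : (fun x => c * u x) = (fun x => c * u x + (fun=> 0) x) by apply/funext => x; rewrite addr0.
split; first by rewrite e; exact: ell2_comb.
  by move=> x /us ->; rewrite mulr0.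
by move=> x; rewrite e Tl// Tu (ell2_linear0 _ Tl) !addr0 mulrCA.
Qed.

Lemma asym_pythagoras (k : nat) (la : 'I_k -> R[i]) (v : 'I_k -> X -> R[i]) (e : R) :
  (forall i, eigf (la i) (v i)) -> (forall i, conjc (la i) = la i) -> injective la -> 0 < e ->
  eventually_fset (fun S => `|\sum_(x <- S) (deg G x)%:R * nsq (\sum_i v i x) -
    \sum_i \sum_(x <- S) (deg G x)%:R * nsq (v i x)| <= e).
Proof.
move=> hv lar la_inj e0; pose e1 := e / (k%:R * k%:R + 1).
have k1 : 0 < k%:R * k%:R + 1 :> R by rewrite ltr_wpDl// mulr_ge0.
have e10 : 0 < e1 by rewrite divr_gt0.
have [|S0 h] := @eventually_fset_all ('I_k * 'I_k)%type
    (fun p S => p.1 != p.2 -> `|bil S (v p.1) (v p.2)| <= e1%:C).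
  move=> [i j] /=; have [->|ij] := eqVneq i j; first by exists fset0.
  have [|S0 h] := eigf_orth (hv i) (hv j) (lar j) _ e10; first by rewrite (inj_eq la_inj).
  by exists S0 => S /h.
exists S0 => S /h {}h; rewrite -lecR.
have nE (r : R) : (`|r|)%:C = `|r%:C| by rewrite normc_def /= expr0n addr0 sqrtr_sqr.
rewrite nE rmorphB.
rewrite [X in `|X - _|](_ : _ = bil S (fun x => \sum_i v i x) (fun x => \sum_i v i x)); last first.
  by rewrite bil_diag.
rewrite [X in `|_ - X|](_ : _ = \sum_i bil S (v i) (v i)); last first.
  by rewrite rmorph_sum; apply: eq_bigr => i _; rewrite bil_diag.
have -> : bil S (fun x => \sum_i v i x) (fun x => \sum_i v i x) = \sum_i \sum_j bil S (v i) (v j).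
  rewrite /bil; under eq_bigr => x _ do rewrite conjc_sum mulr_suml mulr_sumr.
  rewrite exchange_big; apply: eq_bigr => i _.
  under eq_bigr => x _ do rewrite !mulr_sumr.
  by rewrite exchange_big.
rewrite -sumrB.
apply: (@le_trans _ _ (\sum_(i < k) \sum_(j < k) e1%:C)).
  apply: le_trans (ler_norm_sum _ _ _) _; apply: ler_sum => i _.
  rewrite (bigD1 i)//= addrAC subrr add0r.
  apply: (@le_trans _ _ (\sum_(j < k | j != i) e1%:C)).
    apply: le_trans (ler_norm_sum _ _ _) _; apply: ler_sum => j ji.
    by apply: (h (i, j)); rewrite /= eq_sym.
  by rewrite [leRHS](bigD1 i)//= lerDr ler0c ltW.
rewrite !sumr_const !card_ord -mulrnA -[_ *+ _]mulr_natl.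
rewrite -[(k * k)%:R](rmorph_nat (real_complex R)) -!rmorphM lecR /e1 mulrCA ger_pMr//.
by rewrite ler_pdivrMr// mul1r -[(k * k)%:R]/((k * k)%:R : R) natrM lerDl.
Qed.

(** Let [w] be the combination with coefficients [c i] and [w'] the one with [c i * (la i - lam)].
    By orthogonality the squared norm of [w'] is at most [de] times that of [w], here [sup E]; the
    hypothesis on solutions and the degree weight bound that of [w] by [D * C] times that of [w'].
    As [D * C * de < 1], this forces [sup E = 0], against a nonzero coefficient. *)
Lemma eigf_packing (k : nat) (la : 'I_k -> R[i]) (u : 'I_k -> X -> R[i]) (lam : R[i])
    (c : 'I_k -> R[i]) (de C : R) : linear_ell2 T ->
  (forall i, eigf (la i) (u i)) -> (forall i, exists x, u i x != 0) ->
  (forall i, conjc (la i) = la i) -> injective la ->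
  (exists i, c i != 0) -> 0 <= de -> (forall i, nsq (la i - lam) <= de) -> D%:R * C * de < 1 ->
  (forall N, sq (fun x => \sum_i (c i * (la i - lam)) * u i x) N ->
     sq (fun x => \sum_i c i * u i x) (C * N)) -> False.
Proof.
move=> Tl hu unz lar la_inj [i0 ci0] de0 hde Cde sol.
pose n i (S : {fset X}) := \sum_(x <- S) (deg G x)%:R * nsq (c i * u i x).
have n0 i S : 0 <= n i S by apply: sumr_ge0 => x _; rewrite mulr_ge0 ?nsq_ge0.
pose q S := \sum_i n i S.
have nmono i (S S' : {fset X}) : (S `<=` S')%fset -> n i S <= n i S'.
  by move=> SS; apply: fsum_le => // x; rewrite mulr_ge0 ?nsq_ge0.
have qmono (S S' : {fset X}) : (S `<=` S')%fset -> q S <= q S'.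
  by move=> SS; apply: ler_sum => i _; exact: nmono.
have [M hM] : exists M : 'I_k -> R, forall i, sq (fun x => c i * u i x) (M i).
  suff /choice[F hF] : forall i, exists N, sq (fun x => c i * u i x) N by exists F.
  move=> i; by have [[N h] _ _] := eigf_scale (c i) Tl (hu i); exists N.
pose E := [set q S | S in @setT {fset X}].
have hE : has_sup E.
  split; first by exists (q fset0), fset0.
  exists (\sum_i D%:R * M i) => _ [S _ <-]; apply: ler_sum => i _; exact: wsum_le.
have qE S : q S <= sup E by apply: sup_upper_bound => //; exists S.
have q0 : 0 < sup E.
  have [x ux] := unz i0; apply: lt_le_trans (qE [fset x]%fset).
  apply: (@lt_le_trans _ _ (n i0 [fset x]%fset)); last first.
    by rewrite /q (bigD1 i0)//= lerDl; apply: sumr_ge0.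
  rewrite /n big_seq_fset1 mulr_gt0//.
    rewrite ltr0n deg_gt0//; apply: contrapT => nV; have [_ us _] := hu i0.
    by move: ux; rewrite us ?eqxx.
  rewrite lt_neqAle nsq_ge0 andbT eq_sym.
  by apply: contraNneq (mulf_neq0 ci0 ux) => /nsq_eq0 ->.
have ev (d : 'I_k -> R[i]) e : 0 < e ->
    eventually_fset (fun S => `|\sum_(x <- S) (deg G x)%:R * nsq (\sum_i d i * u i x) -
      \sum_i \sum_(x <- S) (deg G x)%:R * nsq (d i * u i x)| <= e).
  move=> e0; apply: (asym_pythagoras (la := la) (v := fun i x => d i * u i x)) => // i.
  exact: eigf_scale.
pose w x := \sum_i c i * u i x.
pose w' x := \sum_i (c i * (la i - lam)) * u i x.
have usupp d : vsupp G (fun x => \sum_(i < k) d i * u i x).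
  by move=> x nV; rewrite big1// => i _; have [_ us _] := hu i; rewrite us// mulr0.
have w'S : sq w' (de * sup E).
  move=> S1; apply/ler_addgt0Pr => e e0.
  have [S0 h] := ev (fun i => c i * (la i - lam)) e e0.
  have := h (S0 `|` S1)%fset (fsubsetUl _ _); set S := (S0 `|` S1)%fset => hS.
  apply: (@le_trans _ _ (\sum_(x <- S) (deg G x)%:R * nsq (w' x))).
    apply: le_trans (wsum_ge _ (usupp _)).
    by apply: fsum_le; [move=> x; exact: nsq_ge0 | exact: fsubsetUr].
  have h2 : \sum_i \sum_(x <- S) (deg G x)%:R * nsq (c i * (la i - lam) * u i x) <= de * q S.
    rewrite mulr_sumr; apply: ler_sum => i _; rewrite mulr_sumr; apply: ler_sum => x _.
    have -> : c i * (la i - lam) * u i x = (la i - lam) * (c i * u i x) by ring.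
    by rewrite nsqM mulrCA ler_wpM2r ?hde// mulr_ge0 ?nsq_ge0.
  have h3 : de * q S <= de * sup E by rewrite ler_wpM2l.
  have := le_trans (ler_norm _) hS; move: h2 h3.
  by set a := \sum_(i < k) _; set b := \sum_(x <- S) _; lra.
have wS := sol _ w'S.
have fin S1 : q S1 <= D%:R * (C * (de * sup E)).
  apply/ler_addgt0Pr => e e0; have [S0 h] := ev c e e0.
  have := h (S0 `|` S1)%fset (fsubsetUl _ _); set S := (S0 `|` S1)%fset => hS.
  apply: le_trans (qmono _ S (fsubsetUr _ _)) _.
  have h1 := wsum_le S wS; rewrite distrC in hS.
  have h2 := le_trans (ler_norm _) hS; rewrite lerBlDl in h2.
  by apply: le_trans h2 _; rewrite lerD2r.
have : sup E <= D%:R * (C * (de * sup E)).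
  by apply: ge_sup; [exact: hE.1 | move=> _ [S _ <-]].
have -> : D%:R * (C * (de * sup E)) = (D%:R * C * de) * sup E by ring.
by rewrite leNgt gtr_pMl// Cde.
Qed.

End Boundary.

Lemma finite_csum (R : realType) (X : choiceType) (D : set X) (S : {fset X}) (f : X -> R[i]) :
  (forall x, x \in S -> D x) -> (forall x, D x -> x \notin S -> f x = 0) ->
  csum D f = \sum_(x <- S) f x.
Proof.
move=> SD f0.
have rE (g : X -> R) : (forall x, D x -> x \notin S -> g x = 0) -> rsum D g = \sum_(x <- S) g x.
  move=> g0.
  have eE (h : X -> R) : (forall x, 0 <= h x) -> (forall x, D x -> x \notin S -> h x = 0) ->
      (\esum_(x in D) (h x)%:E)%E = (\sum_(x <- S) h x)%:E.
    move=> h0 hz; rewrite esum_mkcond.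
    transitivity (\esum_(x in [set` S]) (h x)%:E)%E; last first.
      rewrite esum_fset; [|exact: finite_fset|by move=> x _; rewrite lee_fin].
      by rewrite fsbig_finite ?set_fsetK ?sumEFin//; exact: finite_fset.
    rewrite [RHS]esum_mkcond; apply: eq_esum => x _; rewrite !mem_setE.
    have [xS|xS] := boolP (x \in S); first by rewrite mem_set//; exact: SD.
    by case: ifPn => //; rewrite inE => Dx; rewrite hz.
  have e1 : (\esum_(x in D) (Num.max (g x) 0)%:E)%E = (\sum_(x <- S) Num.max (g x) 0)%:E.
    by apply: eE => [x|x Dx xS]; [rewrite le_max lexx orbT | rewrite g0// maxxx].
  have e2 : (\esum_(x in D) (Num.max (- g x) 0)%:E)%E = (\sum_(x <- S) Num.max (- g x) 0)%:E.
    by apply: eE => [x|x Dx xS]; [rewrite le_max lexx orbT | rewrite g0// oppr0 maxxx].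
  rewrite /rsum e1 e2 /=.
  rewrite -sumrB; apply: eq_bigr => x _.
  by case: (ltP (g x) 0) => h; case: (ltP (- g x) 0) => h'; move: h h'; lra.
rewrite /csum !rE; [|by move=> x Dx xS; rewrite f0..].
by apply/eqP; rewrite eq_complex /= !raddf_sum /= !eqxx.
Qed.

(** * Restriction to vertices and the finite region where the operators differ *)

Section Restriction.
Variables (R : realType) (X : choiceType) (G : graph X) (D : nat).
Hypothesis degD : forall x, (deg G x <= D)%N.
Implicit Types (f g : X -> R[i]).

Definition restr f x : R[i] := if `[< vset G x >] then f x else 0.

Lemma restr_in f x : vset G x -> restr f x = f x.
Proof. by move=> h; rewrite /restr asboolT. Qed.

Lemma vsupp_restr f : vsupp G (restr f).
Proof. by move=> x h; rewrite /restr asboolF. Qed.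

Lemma restr_id f : vsupp G f -> restr f = f.
Proof. by move=> h; apply/funext => x; rewrite /restr; case: asboolP => // /h ->. Qed.

Lemma restr_comb (c : R[i]) f g :
  restr (fun y => c * f y + g y) = (fun y => c * restr f y + restr g y).
Proof. by apply/funext => x; rewrite /restr; case: ifP => // _; rewrite mulr0 addr0. Qed.

Lemma sq_restr f N : sq f N -> sq (restr f) N.
Proof. by apply: sq_le => x; rewrite /restr; case: ifP => // _; rewrite nsq0 nsq_ge0. Qed.

Lemma l2_restr f : ell2 f -> l2 G (restr f).
Proof. by move=> [N fN]; have [] := sq_l2 degD (vsupp_restr f) (sq_restr fN). Qed.

End Restriction.

Section FiniteRegion.
Variables (R : realType) (d s : nat) (G0 : periodic_graph R d s) (G : graph 'rV[R]_d) (a : nat).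
Hypothesis hG : finite_perturbation G0 G.
Hypothesis ha : unperturbed_outside G0 G a.

Lemma finite_zsup : finite_set [set n : 'rV[int]_d | (zsup n < a)%N].
Proof.
pose F (f : {ffun 'I_d -> 'I_(2 * a)}) : 'rV[int]_d := \row_l ((f l : nat)%:Z - a%:Z).
apply: (@sub_finite_set _ _ (F @` setT)); last by apply: finite_image; exact: finite_finset.
move=> n /= na.
have nl l : (`|n ord0 l| < a)%N by apply: leq_ltn_trans na; exact: (leq_bigmax l).
have h l : (`|(n ord0 l + a%:Z)%R| < 2 * a)%N by have := nl l; lia.
exists [ffun l => Ordinal (h l)] => //; apply/rowP => l; rewrite !mxE ffunE /=.
by have := nl l; rewrite -[n 0 l]/(n ord0 l); lia.
Qed.

Lemma Vext_vset0 x : Vext G0 a x -> vset G0 x.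
Proof. by move=> [j [n [-> _]]]; exact: vset_vtx. Qed.

Lemma Vext_vset x : Vext G0 a x -> vset G x.
Proof. by have [_ h _] := ha; exact: h. Qed.

Lemma finite_region : finite_set ((vset G `|` vset G0) `\` Vext G0 a).
Proof.
have [f1 _ _] := hG.
have f2 : finite_set [set x | exists j n, x = vtx G0 j n /\ (zsup n < a)%N].
  apply: (@sub_finite_set _ _ (\bigcup_(j in @setT 'I_s) (vtx G0 j @` [set n | (zsup n < a)%N]))).
    by move=> _ [j [n [-> na]]]; exists j => //; exists n.
  apply: bigcup_finite; first exact: finite_finset.
  by move=> j _; apply: finite_image; exact: finite_zsup.
apply: (@sub_finite_set _ _ ((vset G `\` vset G0) `|` [set x | exists j n, x = vtx G0 j n /\ (zsup n < a)%N])).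
  move=> x [xV nx]; have [V0|nV0] := pselect (vset G0 x); last by left; case: xV.
  right; move: V0; rewrite vset_periodic => -[j [n e]]; exists j, n; split=> //.
  by rewrite ltnNge; apply/negP => an; apply: nx; exists j, n; split.
by rewrite finite_setU.
Qed.

(** Everything that distinguishes the perturbed operator from the free one is supported here. *)
Definition region : {fset 'rV[R]_d} := fset_set ((vset G `|` vset G0) `\` Vext G0 a).

Lemma mem_region x : x \in region <-> (vset G x \/ vset G0 x) /\ ~ Vext G0 a x.
Proof. by rewrite in_fset_set ?inE//; exact: finite_region. Qed.

Lemma not_region x : x \notin region -> Vext G0 a x \/ (~ vset G x /\ ~ vset G0 x).
Proof.
move=> xr; have [xE|nE] := pselect (Vext G0 a x); [by left | right].
by split=> h; case/negP: xr; apply/mem_region; split=> //; [left|right].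
Qed.

Definition degbound := (\sum_j deg0 G0 j + \sum_(x <- region) deg G x)%N.

Lemma deg0_bound x : (deg G0 x <= degbound)%N.
Proof.
have [|nV] := pselect (vset G0 x); last first.
  by have := nbs_novert nV => e; rewrite /deg -/(nbs G0 x) e cardfs0.
rewrite vset_periodic => -[j [n ->]]; rewrite -/(vtx G0 j n) deg_vtx /degbound (bigD1 j)//=.
by rewrite -!addnA leq_addr.
Qed.

Lemma nbs_Vext x : Vext G0 a x -> nbs G x = nbs G0 x.
Proof. by have [_ _ h] := ha; move=> /h e; rewrite /nbs e. Qed.

Lemma deg_bound x : (deg G x <= degbound)%N.
Proof.
have [xr|/not_region[xE|[nV _]]] := boolP (x \in region).
- by rewrite /degbound (big_fsetD1 x)//= addnCA leq_addr.
- by rewrite /deg -/(nbs G x) nbs_Vext//; exact: deg0_bound.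
- by have := nbs_novert nV => e; rewrite /deg -/(nbs G x) e cardfs0.
Qed.

End FiniteRegion.

(** * The perturbed operator as a finite-rank perturbation of the free one *)

Section Weyl.
Variables (R : realType) (d s : nat) (G0 : periodic_graph R d s) (G : graph 'rV[R]_d) (a : nat).
Variable V : ('rV[R]_d -> R[i]) -> 'rV[R]_d -> R[i].
Hypothesis hG : finite_perturbation G0 G.
Hypothesis ha : unperturbed_outside G0 G a.
Hypothesis hA5 : A5 G0 G a V.
Local Notation X := ('rV[R]_d).
Local Notation H := (pertH G V).
Local Notation D := (degbound G0 G a).
Implicit Types (f g u w : X -> R[i]) (lam mu : R[i]).

Let dG := deg_bound hG ha.
Let dG0 := deg0_bound G0 G a.

Lemma V_supp u x : l2 G u -> x \notin region G0 G a -> V u x = 0.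
Proof.
move=> ul /(not_region hG)[xE|[nV _]]; first by have [_ h] := hA5; exact: h.
by have [[[Vl _ _] _] _] := hA5; have [h _] := Vl u ul; exact: h.
Qed.

Lemma V_bound : exists2 M, 0 <= M & forall u N, vsupp G u -> sq u N -> sq (V u) (M * N).
Proof.
have [[[Vl _ [M hM]] _] _] := hA5; exists (M ^+ 2 * D%:R); first by rewrite mulr_ge0 ?sqr_ge0.
move=> u N us uN; have [ul un] := sq_l2 dG us uN.
apply: sq_mono (l2_sq (Vl u ul)).
apply: (@le_trans _ _ ((M * l2norm G u) ^+ 2)).
  have n0 : 0 <= l2norm G (V u) by exact: sqrtr_ge0.
  by rewrite ler_sqr ?nnegrE// ?hM// (le_trans n0)// hM.
by rewrite [leLHS]exprMn -[leRHS]mulrA ler_wpM2l ?sqr_ge0.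
Qed.

Definition Hr f := H (restr G f).

Lemma Hr_lin : linear_ell2 Hr.
Proof.
move=> c f g fL gL x; rewrite /Hr restr_comb /pertH lap_comb.
have [[[_ Vlin _] _] _] := hA5.
by rewrite (Vlin c _ _ (l2_restr dG fL) (l2_restr dG gL)); ring.
Qed.

Lemma Hr_bound : exists2 M, 0 <= M & forall f N, sq f N -> sq (Hr f) (M * N).
Proof.
have [M M0 hM] := V_bound.
exists (2 * nsq (-1 : R[i]) * D%:R + 2 * M).
  by rewrite addr_ge0 ?mulr_ge0 ?nsq_ge0.
move=> f N fN; have rN := sq_restr G fN.
have := sq_comb (-1) (sq_lap dG rN) (hM _ _ (@vsupp_restr R X G f) rN).
have -> : (fun x => (-1) * lap G (restr G f) x + V (restr G f) x) = Hr f.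
  by apply/funext => x; rewrite mulN1r.
by congr (sq _ _); ring.
Qed.

Lemma vsupp_Hr f : ell2 f -> vsupp G (Hr f).
Proof.
move=> fL x nV; rewrite /Hr /pertH (vsupp_lap _ nV) oppr0 add0r.
by have [[[Vl _ _] _] _] := hA5; have [h _] := Vl _ (l2_restr dG fL); exact: h.
Qed.

(** Acting as the identity off the vertices, [Aop] and [A0op] operate on one common space although
    the two graphs have different vertices, and their difference [Kop] is supported in the
    region. *)
Definition Aop lam f x : R[i] := if `[< vset G x >] then Hr f x - lam * f x else f x.

Definition A0op lam f x : R[i] :=
  if `[< vset G0 x >] then - lap G0 (restr G0 f) x - lam * f x else f x.

Definition Kop lam f x : R[i] := Aop lam f x - A0op lam f x.

Lemma A0op_lin lam : linear_ell2 (A0op lam).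
Proof.
move=> c f g _ _ x; rewrite /A0op; case: ifP => // _; rewrite restr_comb lap_comb; ring.
Qed.

Lemma Aop_lin lam : linear_ell2 (Aop lam).
Proof.
move=> c f g fL gL x; rewrite /Aop; case: ifP => // _; rewrite Hr_lin//; ring.
Qed.

Lemma Kop_lin lam : linear_ell2 (Kop lam).
Proof. by move=> c f g fL gL x; rewrite /Kop Aop_lin// A0op_lin//; ring. Qed.

Lemma Kop_supp lam f x : ell2 f -> x \notin region G0 G a -> Kop lam f x = 0.
Proof.
move=> fL xr; have Vx := V_supp (l2_restr dG fL) xr.
case/(not_region hG): xr => [xE|[nV nV0]]; rewrite /Kop /Aop /A0op; last first.
  by rewrite !asboolF// subrr.
have x0 := Vext_vset0 xE; have x1 := Vext_vset ha xE.
rewrite !asboolT// /Hr /pertH Vx addr0.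
have -> : lap G (restr G f) x = lap G0 (restr G0 f) x; last by rewrite subrr.
rewrite !lapE /deg -/(nbs G x) -/(nbs G0 x) (nbs_Vext ha xE); congr (_ * _).
apply: eq_big_seq => y y0; have y1 : y \in nbs G x by rewrite (nbs_Vext ha xE).
move: y0 y1; rewrite !mem_nbs => /adj_vset[_ y0] /adj_vset[_ y1].
by rewrite !restr_in.
Qed.

Lemma Kop_bound lam : exists2 CK, 0 <= CK & forall f N, sq f N -> forall x, nsq (Kop lam f x) <= CK * N.
Proof.
have [M M0 hM] := Hr_bound; pose L := nsq (- lam).
have L0 : 0 <= L by exact: nsq_ge0.
pose N1 := nsq (-1 : R[i]).
have N10 : 0 <= N1 by exact: nsq_ge0.
pose E := 2 * (2 * L + 2 * M) + 2 * (2 * L + 2 * (N1 * D%:R)) + 4.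
exists E; first by rewrite !addr_ge0// !mulr_ge0// !addr_ge0// !mulr_ge0.
move=> f N fN x; have NN := sq_ge0 fN.
have fx := sq_pt x fN; have Hx := sq_pt x (hM _ _ fN).
have Lx := sq_pt x (sq_lap dG0 (sq_restr G0 fN)).
have b1 : nsq (Aop lam f x) <= (2 * L + 2 * M + 1) * N.
  rewrite /Aop; case: ifP => _.
    have -> : Hr f x - lam * f x = (- lam) * f x + Hr f x by ring.
    apply: le_trans (nsqD _ _) _; rewrite nsqM -/L.
    have : L * nsq (f x) <= L * N by rewrite ler_wpM2l.
    by move: Hx NN; nra.
  have : 0 <= (2 * L + 2 * M) * N by rewrite mulr_ge0// addr_ge0// mulr_ge0.
  by move: fx; lra.
have b2 : nsq (A0op lam f x) <= (2 * L + 2 * (N1 * D%:R) + 1) * N.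
  rewrite /A0op; case: ifP => _.
    have -> : - lap G0 (restr G0 f) x - lam * f x = (- lam) * f x + (-1) * lap G0 (restr G0 f) x by ring.
    apply: le_trans (nsqD _ _) _; rewrite (nsqM (- lam)) (nsqM (-1)) -/L -/N1.
    have h1 : L * nsq (f x) <= L * N by rewrite ler_wpM2l.
    have h2 : N1 * nsq (lap G0 (restr G0 f) x) <= N1 * (D%:R * N) by rewrite ler_wpM2l.
    rewrite mulrA in h2; move: (N1 * D%:R) h1 h2 NN => ND h1 h2 NN.
    have -> : (2 * L + 2 * ND + 1) * N = 2 * (L * N) + 2 * (ND * N) + N by ring.
    by move: h1 h2 NN; lra.
  have : 0 <= (2 * L + 2 * (N1 * D%:R)) * N by rewrite mulr_ge0// addr_ge0// !mulr_ge0.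
  by move: fx; lra.
rewrite /Kop; apply: le_trans (nsqD _ _) _; rewrite nsqN /E.
by move: b1 b2; lra.
Qed.

Local Notation n := (size (enum_fset (region G0 G a))).

Definition region_pt (i : 'I_n) : X := tnth (in_tuple (enum_fset (region G0 G a))) i.

Lemma region_pt_inj : injective region_pt.
Proof. by apply/tuple_uniqP; exact: fset_uniq. Qed.

Lemma Kop_region_pt lam f x : ell2 f -> (forall i, region_pt i <> x) -> Kop lam f x = 0.
Proof.
move=> fL nx; apply: Kop_supp => //; apply/negP => /seq_tnthP[i e].
by apply: (nx i).
Qed.

Section Free.
Variables (lam : R[i]) (C : R).
Hypothesis C0 : 0 <= C.
Hypothesis sol : solvable G0 (freeH G0) lam C.
Hypothesis nk : no_kernel G0 (freeH G0) lam.

Lemma A0op_inj f : ell2 f -> (forall x, A0op lam f x = 0) -> forall x, f x = 0.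
Proof.
move=> [N fN] h; have fs : vsupp G0 f by move=> x nV; have := h x; rewrite /A0op asboolF.
apply: (nk fs fN) => x; have [Vx|nV] := pselect (vset G0 x).
  have := h x; rewrite /A0op asboolT// restr_id// => /eqP.
  by rewrite subr_eq0 => /eqP.
by rewrite /freeH (vsupp_lap _ nV) fs// mulr0 oppr0.
Qed.

(** The extra 1 in the constant pays for the identity part off the vertices. *)
Lemma A0op_sol f N : sq f N -> exists g, (forall x, A0op lam g x = f x) /\ sq g ((C + 1) * N).
Proof.
move=> fN; have [g0 [gs Tg gN]] := sol (@vsupp_restr R X G0 f) (sq_restr G0 fN).
pose g x := if `[< vset G0 x >] then g0 x else f x.
have rg : restr G0 g = g0.
  by apply/funext => x; rewrite /restr /g; case: asboolP => // /gs ->.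
exists g; split=> [x|S].
  rewrite /A0op rg /g; case: asboolP => // Vx.
  by have := Tg x; rewrite restr_in.
apply: (@le_trans _ _ (\sum_(x <- S) (nsq (g0 x) + nsq (f x)))).
  apply: ler_sum => x _; rewrite /g; case: ifP => _; first by rewrite lerDl nsq_ge0.
  by rewrite lerDr nsq_ge0.
by rewrite big_split /= mulrDl mul1r lerD// gN.
Qed.

Lemma AopE f x : Aop lam f x = A0op lam f x + Kop lam f x.
Proof. by rewrite /Kop addrC subrK. Qed.

Lemma eigenspace_finite : finite_multiplicity G H lam.
Proof.
have [CK CK0 hCK] := Kop_bound lam.
have C1 : 0 <= C + 1 by rewrite addr_ge0.
have [b hb] := finite_rank_span C1 (A0op_lin lam) A0op_inj A0op_sol region_pt_inj (@Kop_region_pt lam).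
exists n, b => f [fl Hf]; apply: hb; first by exists (l2norm G f ^+ 2); exact: l2_sq.
move=> x; rewrite -AopE /Aop /Hr restr_id; last exact: fl.1.
case: asboolP => [Vx|nV]; last by rewrite fl.1.
by rewrite Hf subrr.
Qed.

Lemma pertH_l2 f : l2 G f -> l2 G (H f).
Proof.
move=> fl; have fL : ell2 f by exists (l2norm G f ^+ 2); exact: l2_sq.
have e : Hr f = H f by rewrite /Hr restr_id//; exact: fl.1.
have [M _ hM] := Hr_bound; rewrite -e.
by have [N fN] := fL; have [] := sq_l2 dG (vsupp_Hr fL) (hM _ _ fN).
Qed.

Lemma pertH_lin : lin_on_l2 G H.
Proof.
move=> c f g fl gl; have [[[_ Vlin _] _] _] := hA5.
by apply/funext => x; rewrite /pertH lap_comb Vlin//; ring.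
Qed.

(** [finite_rank_solve] for [Aop = A0op + Kop], whose injectivity is the absence of an
    eigenfunction. *)
Lemma resolvent_or_eigenvalue : l2_eigenvalue G H lam \/ resolvent_set G H lam.
Proof.
have [ev|nev] := pselect (l2_eigenvalue G H lam); [by left | right].
have nk' : no_kernel G H lam.
  move=> h M hs hM Hh x; apply/eqP; apply: contraT => hx; case: nev.
  exists h; last by exists x.
  by split; [have [] := sq_l2 dG hs hM | apply/funext].
have [CK CK0 hCK] := Kop_bound lam.
have C1 : 0 <= C + 1 by rewrite addr_ge0.
have [|C' C'0 hC'] := finite_rank_solve C1 CK0 (A0op_lin lam) A0op_inj A0op_sol
  (Kop_lin lam) hCK region_pt_inj (@Kop_region_pt lam).
  move=> g [N gN] Ag.
  have gs : vsupp G g by move=> x nV; have := Ag x; rewrite -AopE /Aop asboolF.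
  apply: (nk' _ _ gs gN) => x; have := Ag x; rewrite -AopE /Aop /Hr restr_id//.
  case: asboolP => [_ /eqP|nV _]; first by rewrite subr_eq0 => /eqP.
  have := vsupp_Hr (ex_intro _ N gN) nV; rewrite /Hr restr_id// => ->.
  by rewrite gs// mulr0.
apply: (inv_resolvent dG pertH_l2 pertH_lin C'0) => // f N fs fN.
have [g [Ag gN]] := hC' f N fN.
have gs : vsupp G g by move=> x nV; have := Ag x; rewrite -AopE /Aop asboolF// => ->; exact: fs.
exists g; split=> // x; have := Ag x; rewrite -AopE /Aop /Hr restr_id//.
case: asboolP => // nV _.
have := vsupp_Hr (ex_intro _ _ gN) nV; rewrite /Hr restr_id// => ->.
by rewrite gs// fs// mulr0 subr0.
Qed.

End Free.

End Weyl.

(** * Weyl's theorem: isolated eigenvalues off the free spectrum *)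

Section WeylTheorem.
Variables (R : realType) (d s : nat) (G0 : periodic_graph R d s) (G : graph 'rV[R]_d) (a : nat).
Variable V : ('rV[R]_d -> R[i]) -> 'rV[R]_d -> R[i].
Hypothesis hG : finite_perturbation G0 G.
Hypothesis ha : unperturbed_outside G0 G a.
Hypothesis hA5 : A5 G0 G a V.
Local Notation X := ('rV[R]_d).
Local Notation H := (pertH G V).
Local Notation D := (degbound G0 G a).
Implicit Types (f g u w : X -> R[i]) (lam mu : R[i]).

Let dG := deg_bound hG ha.
Let dG0 := deg0_bound G0 G a.

Lemma bil_vset (S : {fset X}) f g : vsupp G f \/ vsupp G g ->
  bil G S f g = \sum_(x <- [fset x in S | `[< vset G x >]]%fset) (deg G x)%:R * (f x * conjc (g x)).
Proof.
move=> h; have SS : ([fset x in S | `[< vset G x >]] `<=` S)%fset.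
  by apply/fsubsetP => x; rewrite !inE => /andP[].
rewrite /bil -(big_fset_incl _ SS)// => x xS; rewrite !inE xS /= => /asboolP nV.
by case: h => h; rewrite (h x nV) ?conjc0 ?mul0r ?mulr0.
Qed.

(** [V u] and [V w] are supported in the region, so the sums in [l2dot] reduce to sums over the
    vertices in [S]. *)
Lemma V_bil u w (S : {fset X}) : l2 G u -> l2 G w -> (region G0 G a `<=` S)%fset ->
  bil G S (V u) w = bil G S u (V w).
Proof.
move=> ul wl rS; have [[[Vl _ _] Vsym] _] := hA5.
rewrite !bil_vset; [|left; exact: ul.1|left; exact: (Vl u ul).1].
set S' := [fset x in S | _]%fset.
have S'V x : x \in S' -> vset G x by rewrite !inE => /andP[_ /asboolP].
have S'n x : vset G x -> x \notin S' -> x \notin region G0 G a.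
  by move=> Vx; apply: contra => /(fsubsetP rS) xS; rewrite !inE xS /=; apply/asboolP.
have e1 := @finite_csum _ _ _ S' (fun x => V u x * conjc (w x) * (deg G x)%:R) S'V.
have e2 := @finite_csum _ _ _ S' (fun x => u x * conjc (V w x) * (deg G x)%:R) S'V.
have := Vsym u w ul wl; rewrite /l2dot e1 ?e2.
- move=> e; under eq_bigr do rewrite mulrC; rewrite e.
  by under [RHS]eq_bigr do rewrite mulrC.
- by move=> x Vx /(S'n _ Vx) xr; rewrite (V_supp hG hA5 wl xr) conjc0 mulr0 mul0r.
- by move=> x Vx /(S'n _ Vx) xr; rewrite (V_supp hG hA5 ul xr) !mul0r.
Qed.

Lemma Hr_symmetric u w (e : R) : ell2 u -> ell2 w -> vsupp G u -> vsupp G w -> 0 < e ->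
  eventually_fset (fun S => `|bil G S (Hr G V u) w - bil G S u (Hr G V w)| <= e%:C).
Proof.
move=> uL wL us ws e0; have [S0 h] := boundary dG uL wL e0.
exists (S0 `|` region G0 G a)%fset => S; rewrite fsubUset => /andP[/h + rS].
have ul : l2 G u by rewrite -(restr_id us); exact: l2_restr.
have wl : l2 G w by rewrite -(restr_id ws); exact: l2_restr.
rewrite /Hr !restr_id//.
suff -> : bil G S (H u) w - bil G S u (H w) = - (bil G S (lap G u) w - bil G S u (lap G w)).
  by rewrite normrN.
have -> : bil G S (H u) w = - bil G S (lap G u) w + bil G S (V u) w.
  by rewrite /bil -sumrN -big_split; apply: eq_bigr => x _ /=; rewrite /pertH; ring.
have -> : bil G S u (H w) = - bil G S u (lap G w) + bil G S u (V w).
  rewrite /bil -sumrN -big_split; apply: eq_bigr => x _ /=.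
  have -> : conjc (H w x) = - conjc (lap G w x) + conjc (V w x) by rewrite -rmorphN -rmorphD.
  by ring.
by rewrite (V_bil ul wl rS); ring.
Qed.

Lemma eigf_of lam f : l2_eigenspace G H lam f -> eigf G (Hr G V) lam f.
Proof.
move=> [fl Hf]; split; [by exists (l2norm G f ^+ 2); exact: l2_sq|exact: fl.1|].
by move=> x; rewrite /Hr restr_id ?Hf//; exact: fl.1.
Qed.

Lemma eigenvalue_real lam : l2_eigenvalue G H lam -> conjc lam = lam.
Proof.
move=> [f /eigf_of hf f0]; exact (eigf_real (G := G) (T := Hr G V) Hr_symmetric hf f0).
Qed.

Lemma away_from (l : seq R[i]) lam : lam \notin l ->
  exists2 e : R, 0 < e & forall mu, mu \in l -> e%:C <= `|lam - mu|.
Proof.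
elim: l => [|mu l IH]; first by exists 1.
rewrite inE negb_or => /andP[lm /IH[e e0 he]].
have /complex_realP[t tE] : `|lam - mu| \is Num.real by exact: normr_real.
have t0 : 0 < t by rewrite -ltr0c -tE normr_gt0 subr_eq0.
exists (Num.min e t); first by rewrite lt_min e0.
move=> nu; rewrite inE => /orP[/eqP ->|/he h].
  by rewrite tE lecR ge_min lexx orbT.
by apply: le_trans h; rewrite lecR ge_min lexx.
Qed.

(** Each new point is taken closer to [lam] than all earlier ones. *)
Lemma many_near (P : set R[i]) lam (de : R) (k : nat) : 0 < de -> @limit_point R[i]^o P lam ->
  exists l : seq R[i], [/\ uniq l, size l = k, lam \notin l &
    forall mu, mu \in l -> P mu /\ nsq (mu - lam) <= de].
Proof.
move=> de0 lp; elim: k => [|k [l [lu ls lamn lP]]]; first by exists [::].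
have [e e0 he] := away_from lamn.
pose e' := Num.min e (Num.min 1 de).
have e'0 : 0 < e' by rewrite !lt_min e0 ltr01.
have e'C : 0 < e'%:C by rewrite ltr0c.
have [mu [mulam Pmu]] := lp _ (nbhsx_ballx (lam : R[i]^o) e'%:C e'C).
rewrite -ball_normE /= => hmu.
exists (mu :: l); split=> //=.
- rewrite lu andbT; apply/negP => /he h; have := le_lt_trans h hmu.
  by rewrite ltcR lt_min ltxx.
- by rewrite ls.
- by rewrite inE negb_or eq_sym mulam.
move=> nu; rewrite inE => /orP[/eqP ->|/lP//]; split=> //.
rewrite -lecR nsqE distrC; have /complex_realP[t tE] : `|lam - mu| \is Num.real by exact: normr_real.
have t0 : 0 <= t by rewrite -ler0c -tE normr_ge0.
move: hmu; rewrite tE ltcR !lt_min -rmorphXn lecR => /andP[_ /andP[t1 td]].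
by apply: le_trans (ltW td); rewrite expr2 ler_piMr// ltW.
Qed.

(** Spectral points near [lam] are eigenvalues, by [neumann] and [resolvent_or_eigenvalue]. Among
    more eigenfunctions than the region has points, a nontrivial combination [w] is annihilated by
    [Kop lam]. Then [A0op lam w] equals [Aop lam w], the combination with coefficients multiplied by
    [la i - lam], and invertibility of [A0op lam] contradicts [eigf_packing]. *)
Lemma isolated lam : resolvent_set G0 (freeH G0) lam -> ~ @limit_point R[i]^o (spectrum G H) lam.
Proof.
move=> /(resolvent_inv dG0)[[C [C0 sol]] nk] lp.
have C1 : 0 <= C + 1 by rewrite addr_ge0.
(* Small enough both for the Neumann series around [lam] and for the packing estimate. *)
pose de : R := (4 * (D%:R + 1) * (C + 1))^-1.
have DC0 : 0 < 4 * (D%:R + 1) * (C + 1) by rewrite !mulr_gt0// ltr_wpDl.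
have de0 : 0 < de by rewrite invr_gt0.
have deC : de * C <= 1 / 4.
  rewrite /de mulrC ler_pdivrMr//; have : 0 <= D%:R * (C + 1) by rewrite mulr_ge0.
  by rewrite -!mulrA mulrDl; move: C0; lra.
have Cde : D%:R * (C + 1) * de < 1.
  rewrite /de ltr_pdivrMr// mul1r; have : 0 <= D%:R * (C + 1) by rewrite mulr_ge0.
  by rewrite -!mulrA [(D%:R + 1) * _]mulrDl; move: C0; lra.
pose n := size (enum_fset (region G0 G a)).
have [l [lu ls lamn lP]] := many_near n.+1 de0 lp.
have ev mu : mu \in l -> l2_eigenvalue G H mu.
  move=> /lP[sp hmu]; have hC : nsq (mu - lam) * C <= 1 / 4.
    by apply: le_trans deC; rewrite ler_wpM2r.
  have [solm nkm] := neumann C0 sol nk hC.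
  have C8 : 0 <= 8 * C by rewrite mulr_ge0.
  by case: (resolvent_or_eigenvalue hG ha hA5 C8 solm nkm) => // /sp.
pose la (i : 'I_n.+1) := nth 0 l i.
have lal i : la i \in l by rewrite mem_nth// ls.
have la_inj : injective la.
  by move=> i j /eqP; rewrite nth_uniq ?ls// => /eqP /val_inj.
have [u hu] : exists u : 'I_n.+1 -> X -> R[i], forall i,
    l2_eigenspace G H (la i) (u i) /\ exists x, u i x != 0.
  suff /choice[u hu] : forall i, exists f, l2_eigenspace G H (la i) f /\ exists x, f x != 0 by exists u.
  by move=> i; have [f f1 f2] := ev _ (lal i); exists f.
have hue i := eigf_of (hu i).1.
have uL i : ell2 (u i) by have [] := hue i.
have [c [c0 Kw]] := finite_rank_kernel (Kop_lin hG ha hA5 lam) (Kop_region_pt hG ha hA5 lam) (ltnSn n) uL.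
apply: (eigf_packing (lam := lam) dG Hr_symmetric (Hr_lin hG ha hA5) hue (fun i => (hu i).2) _ la_inj c0 (ltW de0) _ Cde).
- by move=> i; apply: eigenvalue_real; exact: ev.
- by move=> i; have [_] := lP _ (lal i).
move=> N wN; set w := fun x => \sum_i c i * u i x.
have [g [Ag gN]] := A0op_sol sol wN.
have wL : ell2 w by exact: ell2_sum.
suff -> : w = g by [].
apply/funext => x; apply/eqP; rewrite eq_sym -subr_eq0; apply/eqP.
have gL : ell2 g by exists ((C + 1) * N).
rewrite addrC -mulN1r.
apply: (A0op_inj nk (ell2_comb (-1) wL gL)) => {}x.
rewrite (A0op_lin G0 lam)// Ag.
have -> : A0op G0 lam w x = \sum_i c i * (la i - lam) * u i x; last by rewrite mulN1r addNr.
have := AopE G0 G V lam w x; rewrite Kw addr0 => <-.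
rewrite /Aop; have ws : vsupp G w.
  by move=> y nV; rewrite /w big1// => i _; have [_ us _] := hue i; rewrite us// mulr0.
case: asboolP => [Vx|nV]; last first.
  by rewrite ws// big1// => i _; have [_ us _] := hue i; rewrite us// mulr0.
rewrite (ell2_linear_sum _ _ _ (Hr_lin hG ha hA5) uL) /w mulr_sumr -sumrB; apply: eq_bigr => i _.
by have [_ _ ->] := hue i; ring.
Qed.

Theorem weyl lam : l2_eigenvalue G H lam -> resolvent_set G0 (freeH G0) lam ->
  spectrum G H lam -> discrete_spectrum G H lam.
Proof.
move=> ev re sp; split=> //; first exact: isolated.
have [[C [C0 sol]] nk] := resolvent_inv dG0 re.
exact: (eigenspace_finite hG ha hA5 C0 sol nk).
Qed.

End WeylTheorem.

(** * Reducing a matrix symbol to its determinant *)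

Section ActEq.
Variables (R : realType) (m : nat).
Implicit Types (l : tpoly R m.+1) (v : 'rV[int]_m.+1 -> R[i]).

Lemma tact_eq l1 l2 v n : (forall x, tev l1 (realpt x) = tev l2 (realpt x)) ->
  tact l1 v n = tact l2 v n.
Proof.
move=> e; pose l := l1 ++ tmul [:: (-1, 0)] l2.
have lE x : tev l (realpt x) = tev [::] (realpt x).
  rewrite tev_cat tev_mul /tev big_seq1 big_nil phase0 mulr1 mulN1r -/(tev l2 _) -/(tev l1 _) e.
  by rewrite subrr.
have : tact l v n = 0.
  rewrite tact_coef big1// => k _; rewrite (tcoef_eq lE) /tcoef big_nil mul0r//.
rewrite tact_cat tact_mul {2}/tact big_seq1 /= subr0 mulN1r => /eqP.
by rewrite subr_eq0 => /eqP.
Qed.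

Lemma tev_flatten (I : Type) (r : seq I) (F : I -> tpoly R m.+1) z :
  tev (flatten [seq F i | i <- r]) z = \sum_(i <- r) tev (F i) z.
Proof. by elim: r => [|i r IH]; rewrite ?big_nil ?big_cons /= ?tev_cat ?IH// /tev big_nil. Qed.

Lemma tact_flatten (I : Type) (r : seq I) (F : I -> tpoly R m.+1) v n :
  tact (flatten [seq F i | i <- r]) v n = \sum_(i <- r) tact (F i) v n.
Proof. by elim: r => [|i r IH]; rewrite ?big_nil ?big_cons /= ?tact_cat ?IH// /tact big_nil. Qed.

Lemma tact_sum (I : Type) (r : seq I) l (F : I -> 'rV[int]_m.+1 -> R[i]) n :
  tact l (fun k => \sum_(i <- r) F i k) n = \sum_(i <- r) tact l (F i) n.
Proof. by rewrite /tact exchange_big; apply: eq_bigr => t _; rewrite mulr_sumr. Qed.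

(** Cramer's rule: the adjugate turns the system into the determinant acting on each component
    separately. *)
Lemma adjugate_finite_supp (s : nat) (L Adj : 'I_s -> 'I_s -> tpoly R m.+1)
    (M : 'rV[R[i]^o]_m.+1 -> 'M[R[i]]_s) (lq : tpoly R m.+1)
    (v : 'I_s -> 'rV[int]_m.+1 -> R[i]) i :
  (forall j k z, tev (L j k) z = M z j k) -> (forall j k z, tev (Adj j k) z = (\adj (M z)) j k) ->
  (forall z, tev lq z = \det (M z)) ->
  (forall j, finite_supp (fun n => \sum_k tact (L j k) (v k) n)) ->
  finite_supp (tact lq (v i)).
Proof.
move=> LE AE qE fin.
have [S hS] : finite_supp (fun n => \sum_j tact (Adj i j) (fun n => \sum_k tact (L j k) (v k) n) n).
  by apply: finsupp_sum => j; apply: tact_finsupp.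
exists S => n; have -> : tact lq (v i) n =
    \sum_j tact (Adj i j) (fun n => \sum_k tact (L j k) (v k) n) n; last exact: hS.
pose T k := flatten [seq tmul (Adj i j) (L j k) | j <- index_enum 'I_s].
transitivity (\sum_k tact (T k) (v k) n); last first.
  under [RHS]eq_bigr do rewrite tact_sum.
  rewrite exchange_big; apply: eq_bigr => k _; rewrite tact_flatten.
  by apply: eq_bigr => j _; rewrite tact_mul.
have TE k z : tev (T k) z = \det (M z) *+ (i == k).
  rewrite tev_flatten; transitivity ((\adj (M z) *m M z) i k).
    by rewrite mxE; apply: eq_bigr => j _; rewrite tev_mul AE LE.
  by rewrite mul_adj_mx mxE.
rewrite (bigD1 i)//= [X in _ + X]big1 ?addr0 => [|k ki].
  by apply: tact_eq => x; rewrite TE eqxx qE.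
rewrite (@tact_eq _ [::]) => [|x]; first by rewrite /tact big_nil.
by rewrite TE eq_sym (negPf ki) /tev big_nil.
Qed.

End ActEq.

(** * The free equation in Bloch variables *)

Section Bloch.
Variables (R : realType) (m s : nat) (G0 : periodic_graph R m.+1 s) (lam : R[i]).
Local Notation d := m.+1.
Local Notation X := ('rV[R]_d).
Hypothesis lam_real : conjc lam = lam.

Definition shifts j k : {fset 'rV[int]_d} := fset_set [set n | adj G0 (vtx G0 j 0) (vtx G0 k n)].

Lemma finite_shifts j k : finite_set [set n | adj G0 (vtx G0 j 0) (vtx G0 k n)].
Proof.
apply: (@finite_preimage _ _ (nbr G0 (vtx G0 j 0)) (vtx G0 k)); last exact: nbr_finite.
by move=> n1 n2 _ _; exact: vtx_inj.
Qed.

Lemma mem_shifts j k n : (n \in shifts j k) = adj G0 (vtx G0 j 0) (vtx G0 k n).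
Proof. by rewrite in_fset_set; [apply/idP/idP; rewrite inE | exact: finite_shifts]. Qed.

Definition H0coef j k : R[i] := (Num.sqrt ((deg0 G0 j * deg0 G0 k)%:R : R))^-1%:C.

Definition H0list j k : tpoly R d :=
  [seq (- H0coef j k, - n) | n <- shifts j k] ++ [:: (- (lam *+ (j == k)), 0)].

Lemma H0listE j k z : tev (H0list j k) z = (H0 G0 z - lam%:M) j k.
Proof.
rewrite tev_cat /tev big_map big_seq1 /= phase0 mulr1 !mxE fsbig_finite; last exact: finite_shifts.
by rewrite -mulr_sumr mulNr.
Qed.

Lemma shiftsN j k : [seq - n | n <- shifts j k] =i shifts k j.
Proof.
move=> n; rewrite mem_shifts; apply/mapP/idP => [[n' + ->]|h].
  by rewrite mem_shifts -(adj_vtx G0 j k 0 n' (- n')) add0r subrr adj_sym.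
exists (- n); last by rewrite opprK.
by rewrite mem_shifts -(adj_vtx G0 j k 0 (- n) n) add0r addNr adj_sym.
Qed.

Lemma H0_hermitian x : map_mx (@conjc R) (H0 G0 (realpt x) - lam%:M) = (H0 G0 (realpt x) - lam%:M)^T.
Proof.
apply/matrixP => j k; rewrite [LHS]mxE [RHS]mxE -!H0listE !tev_cat /tev !big_map !big_seq1 /=.
rewrite phase0 !mulr1 rmorphD rmorph_sum rmorphN; congr (_ + _); last first.
  by rewrite [k == j]eq_sym; congr (- _); case: eqP => _; [exact: lam_real | exact: conjc0].
transitivity (\sum_(n <- [seq - n | n <- shifts j k]) (- H0coef k j) * phase (- n) (realpt x)).
  rewrite big_map; apply: eq_bigr => n _.
  have cM (b c : R[i]) : conjc (b * c) = conjc b * conjc c by exact: rmorphM.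
  rewrite -[LHS]/(conjc _) cM conj_phase; congr (_ * _).
  by rewrite /H0coef mulnC; apply/eqP; rewrite eq_complex /= !oppr0 !eqxx.
apply: perm_big; apply: uniq_perm; [|exact: fset_uniq|exact: shiftsN].
by rewrite map_inj_uniq ?fset_uniq//; exact: oppr_inj.
Qed.

(** At real points the matrix is Hermitian because [lam] is real, so its determinant is real. *)
Lemma charp_tpoly : exists lq : tpoly R d, (forall z, tev lq z = charp G0 lam z) /\
  forall x, conjc (tev lq (realpt x)) = tev lq (realpt x).
Proof.
have [lq lqE] : istp (fun z => \det (H0 G0 z - lam%:M)).
  by apply: istp_det => j k; exists (H0list j k) => z; rewrite H0listE.
exists lq; split=> [z|x]; first by rewrite -lqE.
by rewrite -!lqE -[LHS](det_map_mx (@conjc R)) H0_hermitian det_tr.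
Qed.

Variable lq : tpoly R d.
Hypothesis lqE : forall z, tev lq z = charp G0 lam z.

Lemma gradp_crit z : gradp G0 lam z = 0 <-> crit lq z.
Proof.
have e : charp G0 lam = (tev lq : 'rV[R[i]^o]_d -> R[i]^o) by apply/funext => w; rewrite lqE.
split=> [h j|h]; first by rewrite -derive_tev -e; have := congr1 (fun M : 'rV__ => M 0 j) h; rewrite !mxE.
by apply/rowP => j; rewrite !mxE e derive_tev h.
Qed.

Lemma MC_regE : MC_reg G0 lam = Reg lq.
Proof.
apply/seteqP; split=> [_ [z [z1 /eqP z2] <-]|_ [z [z1 z2] <-]]; exists z => //; split.
- by rewrite lqE.
- by move=> /gradp_crit.
- by rewrite -lqE.
- by apply/eqP => /gradp_crit.
Qed.

Lemma MC_sngE : MC_sng G0 lam = Sng lq.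
Proof.
apply/seteqP; split=> [_ [z [z1 z2] <-]|_ [z [z1 z2] <-]]; exists z => //; split.
- by rewrite lqE.
- exact/gradp_crit.
- by rewrite -lqE.
- exact/gradp_crit.
Qed.

Variables (f : X -> R[i]) (F : {fset X}) (N : R).
Hypothesis fN : sq f N.
Hypothesis eqF : forall x, vset G0 x -> x \notin F -> freeH G0 f x = lam * f x.

(** The weight is the one in the unitary transform that makes the symbol Hermitian. *)
Definition bloch j (n : 'rV[int]_d) : R[i] := (Num.sqrt ((deg0 G0 j)%:R : R))%:C * f (vtx G0 j n).

Lemma nbs_vtx (g : X -> R[i]) j n :
  \sum_(y <- nbs G0 (vtx G0 j n)) g y = \sum_k \sum_(l <- shifts j k) g (vtx G0 k (n + l)).
Proof.
transitivity (\sum_(y <- [seq vtx G0 k (n + l) | k <- index_enum 'I_s, l <- shifts j k]) g y).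
  apply: perm_big; apply: uniq_perm; first exact: fset_uniq.
    apply: allpairs_uniq_dep; [exact: index_enum_uniq|by move=> k _; exact: fset_uniq|].
    move=> [k1 l1] [k2 l2] _ _ /= /vtx_inj2[ek]; move: l1; rewrite ek => l1 /addrI /= -> //.
  move=> y; rewrite mem_nbs; apply/idP/allpairsPdep => [h|[k [l [_ + ->]]]]; last first.
    by rewrite mem_shifts -(adj_vtx G0 j k 0 l n) add0r addrC.
  have [_] := adj_vset h; rewrite vset_periodic => -[k [l yE]].
  exists k, (l - n); rewrite mem_index_enum; split=> //; last by rewrite addrC subrK.
  by rewrite mem_shifts -(adj_vtx G0 j k 0 (l - n) n) add0r subrK /vtx -yE.
by rewrite big_allpairs_dep.
Qed.

Lemma bloch_equation j n : \sum_k tact (H0list j k) (bloch k) n =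
  (Num.sqrt ((deg0 G0 j)%:R : R))%:C * (freeH G0 f (vtx G0 j n) - lam * f (vtx G0 j n)).
Proof.
pose sd k := Num.sqrt ((deg0 G0 k)%:R : R).
have sd0 k : sd k != 0 by rewrite gt_eqF// sqrtr_gt0 ltr0n deg0_gt0.
have sdC k : (sd k)%:C != 0 by rewrite fmorph_eq0.
have degE : (deg G0 (vtx G0 j n))%:R = (sd j)%:C * (sd j)%:C :> R[i].
  by rewrite deg_vtx -rmorphM -expr2 sqr_sqrtr ?ler0n// rmorph_nat.
have cE k : H0coef j k = ((sd j)%:C * (sd k)%:C)^-1.
  by rewrite /H0coef natrM sqrtrM ?ler0n// -rmorphM -fmorphV.
have tE k : tact (H0list j k) (bloch k) n =
    - (sd j)%:C^-1 * \sum_(l <- shifts j k) f (vtx G0 k (n + l)) - lam *+ (j == k) * ((sd j)%:C * f (vtx G0 j n)).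
  rewrite tact_cat /tact big_map big_seq1 /= subr0 mulNr; congr (_ + _).
    rewrite mulr_sumr; apply: eq_bigr => l _; rewrite opprK cE /bloch -/(sd k).
    move: (f _) (sd0 j) (sd0 k) (sdC j) (sdC k) => y _ _.
    by move: (sd j)%:C (sd k)%:C => p q p0 q0; field; rewrite p0 q0.
  by case: eqP => [->//|_]; rewrite mulr0n !mul0r.
rewrite (eq_bigr _ (fun k _ => tE k)) sumrB -mulr_sumr -nbs_vtx.
have -> : \sum_i lam *+ (j == i) * ((sd j)%:C * f (vtx G0 j n)) = lam * ((sd j)%:C * f (vtx G0 j n)).
  rewrite (bigD1 j)//= eqxx mulr1n big1 ?addr0// => k kj.
  by rewrite eq_sym (negPf kj) mulr0n mul0r.
rewrite /freeH lapE degE -/(sd j).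
move: (\sum_(y <- _) _) (f _) (sdC j) => y z.
by move: (sd j)%:C => p p0; field.
Qed.

Lemma sqsummable_bloch j : sqsummable (bloch j) ((deg0 G0 j)%:R * N)%:C.
Proof.
move=> S Su; have -> : \sum_(n <- S) `|bloch j n| ^+ 2 =
    ((deg0 G0 j)%:R * \sum_(n <- S) nsq (f (vtx G0 j n)))%:C.
  rewrite rmorphM rmorph_sum mulr_sumr; apply: eq_bigr => n _.
  by rewrite -nsqE /bloch nsqM nsqR sqr_sqrtr ?ler0n// rmorphM.
rewrite lecR ler_wpM2l//; apply: le_trans (fN [fset vtx G0 j n | n in S]%fset).
rewrite big_imfset /=; last by move=> n1 n2 _ _; exact: vtx_inj.
rewrite le_eqVlt; apply/orP; left; apply/eqP; apply: perm_big.
by apply: uniq_perm; rewrite ?undup_uniq// => n; rewrite ?mem_undup.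
Qed.

(** By [bloch_equation] the Bloch system has a finitely supported right side; after
    [adjugate_finite_supp] each component satisfies a scalar equation with symbol [charp], and
    [rellich_l2] applies. *)
Theorem rellich_graph : (0 < m)%N -> discrete_subset (MC_sng G0 lam) ->
  (forall t, MC_reg G0 lam t -> connected_component (MC_reg G0 lam) t `&` real_torus !=set0) ->
  forall j, finite_supp (fun n => f (vtx G0 j n)).
Proof.
move=> m0; rewrite MC_sngE MC_regE => sng reg j.
have lqr x : conjc (tev lq (realpt x)) = tev lq (realpt x).
  have [lq' [e h]] := charp_tpoly; by rewrite lqE -e h.
have [Adj AdjE] : exists Adj : 'I_s -> 'I_s -> tpoly R d,
    forall i k z, tev (Adj i k) z = (\adj (H0 G0 z - lam%:M)) i k.
  have h i k : exists l : tpoly R d, forall z, tev l z = (\adj (H0 G0 z - lam%:M)) i k.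
    have [l lE] : istp (fun z => (\adj (H0 G0 z - lam%:M)) i k).
      by apply: istp_adj => i' k'; exists (H0list i' k') => z; rewrite H0listE.
    by exists l => z; rewrite -lE.
  have /choice[A hA] : forall p : 'I_s * 'I_s, exists l : tpoly R d,
      forall z, tev l z = (\adj (H0 G0 z - lam%:M)) p.1 p.2 by move=> [i k]; exact: h.
  by exists (fun i k => A (i, k)) => i k z; rewrite hA.
have fin i : finite_supp (fun n => \sum_k tact (H0list i k) (bloch k) n).
  have fF : finite_set (vtx G0 i @^-1` [set` F]).
    apply: finite_preimage; last exact: finite_fset.
    by move=> n1 n2 _ _; exact: vtx_inj.
  exists (fset_set (vtx G0 i @^-1` [set` F])) => n; rewrite bloch_equation in_fset_set//.
  apply: contraNT => nF; rewrite eqF ?subrr ?mulr0//; first exact: vset_vtx.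
  by apply: contra nF => nF; rewrite inE.
have gfin := @adjugate_finite_supp R m s H0list Adj (fun z => H0 G0 z - lam%:M) lq bloch j
  H0listE AdjE lqE fin.
have [S hS] := rellich_l2 m0 lqr (sqsummable_bloch j) gfin sng reg.
exists S => n fn; apply: hS; rewrite /bloch mulf_neq0// fmorph_eq0.
by rewrite gt_eqF// sqrtr_gt0 ltr0n deg0_gt0.
Qed.

End Bloch.

(** * Embedded eigenvalues *)

Section EmbeddedEigenvalues.
Variables (R : realType) (m s : nat) (G0 : periodic_graph R m.+1 s) (G : graph 'rV[R]_m.+1) (a : nat).
Variable V : ('rV[R]_m.+1 -> R[i]) -> 'rV[R]_m.+1 -> R[i].
Variable T1 : set R[i].
Hypothesis m0 : (0 < m)%N.
Hypothesis hG : finite_perturbation G0 G.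
Hypothesis ha : unperturbed_outside G0 G a.
Hypothesis hA1 : A1 G0 T1.
Hypothesis hA5 : A5 G0 G a V.
Hypothesis hA6 : A6 G0 a.
Local Notation X := ('rV[R]_m.+1).
Local Notation H := (pertH G V).
Implicit Types (f g : X -> R[i]) (lam : R[i]).

Lemma eigenvalue_spec0 lam : essential_spectrum G H lam -> l2_eigenvalue G H lam -> spec0 G0 lam.
Proof.
by move=> [sp nd] ev re; apply: nd; exact: (weyl hG ha hA5 ev re sp).
Qed.

Lemma freeH_Vext f lam x : l2_eigenspace G H lam f -> Vext G0 a x -> freeH G0 f x = lam * f x.
Proof.
move=> [fl Hf] xE; rewrite -[RHS](congr1 (fun F => F x) Hf) /pertH.
have [_ hV] := hA5; rewrite (hV f fl x xE) addr0 /freeH !lapE.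
by rewrite /deg -/(nbs G x) -/(nbs G0 x) (nbs_Vext ha xE).
Qed.

Lemma vanishes_far_supp f : (forall j, finite_supp (fun n => if `[< Vext G0 a (vtx G0 j n) >]
  then f (vtx G0 j n) else 0)) -> vanishes_far G0 f.
Proof.
move=> /choice[S hS]; pose Z := fset_set [set n : 'rV[int]_m.+1 | (zsup n < a)%N].
pose zn := znorm (R := R) (d := m.+1).
have zn0 n : 0 <= zn n by exact: sqrtr_ge0.
have le_sum (r : seq 'rV[int]_m.+1) n : n \in r -> zn n <= \sum_(k <- r) zn k.
  elim: r => [//|k r IH]; rewrite inE big_cons => /orP[/eqP ->|/IH h].
    by rewrite lerDl sumr_ge0.
  by rewrite (le_trans h)// lerDr.
(* This radius exceeds the norm of every index inside the box or in one of the finite supports. *)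
exists (1 + \sum_(n <- Z) zn n + \sum_j \sum_(n <- S j) zn n).
  rewrite -addrA ltr_pwDl//; apply: addr_ge0; first exact: sumr_ge0.
  by apply: sumr_ge0 => j _; exact: sumr_ge0.
move=> n hn j; have s1 : 0 <= \sum_j \sum_(n <- S j) zn n.
  by apply: sumr_ge0 => k _; exact: sumr_ge0.
have s2 : 0 <= \sum_(n <- Z) zn n by exact: sumr_ge0.
have nZ : (a <= zsup n)%N.
  rewrite leqNgt; apply/negP => h; have : n \in Z.
    by rewrite in_fset_set ?inE//; exact: finite_zsup.
  by move=> /le_sum h2; move: hn h2 s1; rewrite -/(zn n); lra.
have xE : Vext G0 a (vtx G0 j n) by exists j, n.
have := hS j n; rewrite asboolT// => h; apply/eqP; apply: contraT => /h /le_sum h2.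
have h3 : \sum_(k <- S j) zn k <= \sum_j \sum_(n <- S j) zn n.
  rewrite [leRHS](bigD1 j)//= lerDl; apply: sumr_ge0 => k _; exact: sumr_ge0.
by move: hn h2 s2 h3; rewrite -/(zn n); lra.
Qed.

(** Cut off to [Vext], the function still solves the free equation at every vertex of [Vext] with
    all neighbours in [Vext], that is, off a finite set. [rellich_graph] makes it finitely
    supported, and (A-6) makes it zero. *)
Lemma eigenfunction_vanish lam f : (essential_spectrum G H `\` T1) lam ->
  l2_eigenvalue G H lam -> l2_eigenspace G H lam f -> forall x, Vext G0 a x -> f x = 0.
Proof.
move=> [ess nT1] ev hf; have lr := eigenvalue_real hG ha hA5 ev.
have [_ /(_ lam (conj (eigenvalue_spec0 ess ev) nT1))[sng reg]] := hA1.
apply: (hA6 (lam := lam)) => [x|]; first exact: freeH_Vext.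
pose g x := if `[< Vext G0 a x >] then f x else 0.
have gN : sq g (l2norm G f ^+ 2).
  apply: sq_le (l2_sq hf.1) => x; rewrite /g; case: ifP => // _.
  by rewrite nsq0 nsq_ge0.
pose rg := region G0 G a.
pose F := (rg `|` \bigcup_(x <- rg) nbs G0 x)%fset.
have gF x : vset G0 x -> x \notin F -> freeH G0 g x = lam * g x.
  move=> Vx; rewrite in_fsetU negb_or => /andP[xr /bigfcupP xn].
  have inE' y : vset G0 y -> y \notin rg -> Vext G0 a y.
    by move=> Vy /(not_region hG)[//|[_ /(_ Vy)]].
  have xE := inE' x Vx xr.
  rewrite {2}/g asboolT// -(freeH_Vext hf xE) /freeH !lapE; congr (- (_ * _)).
  apply: eq_big_seq => y; rewrite mem_nbs => xy; rewrite /g asboolT//.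
  apply: inE'; first by have [] := adj_vset xy.
  by apply/negP => yr; apply: xn; exists y; rewrite ?yr// mem_nbs adj_sym.
have [lq [lqE _]] := charp_tpoly G0 lr.
apply: vanishes_far_supp => j.
by apply: (rellich_graph lr lqE gN gF m0 sng) => t /reg[].
Qed.

Local Notation n := (size (enum_fset (region G0 G a))).
Local Notation pt := (region_pt (G0 := G0) (G := G) (a := a)).

Lemma eigenfunction_delta lam f : (essential_spectrum G H `\` T1) lam ->
  l2_eigenvalue G H lam -> l2_eigenspace G H lam f ->
  f = (fun x => \sum_(i < n) f (pt i) * delta R pt i x).
Proof.
move=> ess ev hf; apply/funext => x; have [[i <-]|nx] := pselect (exists i, pt i = x).
  by rewrite (sum_delta (@region_pt_inj _ _ _ _ _ _) (fun i => f (pt i))).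
rewrite [RHS]big1 => [|i _].
  have [xr|/(not_region hG)[xE|[nV _]]] := boolP (x \in region G0 G a).
  - by have [i e] := seq_tnthP xr; case: nx; exists i.
  - exact: (eigenfunction_vanish ess ev hf).
  - exact: hf.1.1.
by rewrite /delta; case: eqP => [e|_]; [case: nx; exists i | rewrite mulr0].
Qed.

(** The operator compressed to functions on the region. It does not depend on [lam], and the values
    of an eigenfunction on the region form a row eigenvector, which bounds the number of
    eigenvalues. *)
Definition compression : 'M[R[i]]_n := \matrix_(j, i) Hr G V (delta R pt j) (pt i).

Lemma eigenvalue_compression lam : (essential_spectrum G H `\` T1) lam ->
  l2_eigenvalue G H lam -> root (char_poly compression) lam.
Proof.
move=> ess ev; have [f hf [x fx]] := ev; have fE := eigenfunction_delta ess ev hf.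
rewrite -eigenvalue_root_char; apply/eigenvalueP; exists (\row_j f (pt j)).
  apply/rowP => i; rewrite mxE [RHS]mxE [in RHS]mxE.
  have := congr1 (fun F => F (pt i)) hf.2 => /= <-.
  have <- : Hr G V f (pt i) = H f (pt i) by rewrite /Hr restr_id//; exact: hf.1.1.
  rewrite [in RHS]fE (ell2_linear_sum _ _ _ (Hr_lin hG ha hA5)); last first.
    by move=> j; exact: ell2_delta (@region_pt_inj _ _ _ _ _ _) j.
  by apply: eq_bigr => j _; rewrite !mxE.
apply: contra_neq fx => /rowP c0; rewrite fE big1// => i _.
by have := c0 i; rewrite !mxE => ->; rewrite mul0r.
Qed.

Lemma finite_eigenvalues :
  finite_set [set lam | (essential_spectrum G H `\` T1) lam /\ l2_eigenvalue G H lam].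
Proof.
have [r hr] := closed_field_poly_normal (char_poly compression).
apply: (@sub_finite_set _ _ [set` r]); last exact: finite_seq.
move=> lam [ess ev]; have := eigenvalue_compression ess ev.
by rewrite hr (monicP (char_poly_monic _)) scale1r root_prod_XsubC.
Qed.

Lemma finite_multiplicities lam : (essential_spectrum G H `\` T1) lam ->
  l2_eigenvalue G H lam -> finite_multiplicity G H lam.
Proof.
move=> ess ev; exists n, (delta R pt) => f hf; exists (fun i => f (pt i)).
exact: eigenfunction_delta ess ev hf.
Qed.

Lemma no_eigenvalue : unique_continuation G0 G a V ->
  forall lam, (essential_spectrum G H `\` T1) lam -> ~ l2_eigenvalue G H lam.
Proof.
move=> ucp lam ess ev; have [f hf [x fx]] := ev; have [fl Hf] := hf.
have f0 := ucp lam f fl (fun x _ => congr1 (fun F => F x) Hf) _.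
have [Vx|nV] := pselect (vset G x); last by move: fx; rewrite fl.1// eqxx.
move: fx; rewrite f0 ?eqxx// => y [yE _]; exact: eigenfunction_vanish ess ev hf y yE.
Qed.

End EmbeddedEigenvalues.

Theorem lemma7p2 (R : realType) (d s : nat) (hd : (2 <= d)%N)
    (G0 : periodic_graph R d s) (G : graph 'rV[R]_d) (a : nat)
    (hG : finite_perturbation G0 G) (ha : unperturbed_outside G0 G a)
    (V : ('rV[R]_d -> R[i]) -> ('rV[R]_d -> R[i]))
    (T1 T0 : set R[i])
    (hA1 : A1 G0 T1) (hA2 : A2 G0 T0) (hA3 : A3 G0 T0) (hA4 : A4 G0)
    (hA5 : A5 G0 G a V) (hA6 : A6 G0 a) :
  let H := pertH G V in
  (finite_set [set lam | (essential_spectrum G H `\` T1) lam /\ l2_eigenvalue G H lam]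
   /\ forall lam, (essential_spectrum G H `\` T1) lam -> l2_eigenvalue G H lam ->
        finite_multiplicity G H lam)
  /\ (unique_continuation G0 G a V ->
      forall lam, (essential_spectrum G H `\` T1) lam -> ~ l2_eigenvalue G H lam).
Proof.
case: d hd G0 G V hG ha hA1 hA2 hA3 hA4 hA5 hA6 => [//|m] hd G0 G V hG ha hA1 _ _ _ hA5 hA6 H.
split; last exact: (no_eigenvalue hd hG ha hA1 hA5 hA6).
split; first exact: (finite_eigenvalues hd hG ha hA1 hA5 hA6).
exact: (finite_multiplicities hd hG ha hA1 hA5 hA6).
Qed.
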